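(* Let $\ell\geq5$ be prime and let $Q$ be a squarefree positive integer with $\gcd(Q,6\ell)=1$ and prime factorization $Q=Q_1\cdots Q_t$. Let $\beta_0\in\mathbb Z$ with $\gcd(Q,24\beta_0-1)=1$, and suppose $p(\ell Qn+\beta_0)\equiv0\pmod\ell$ for all integers $n$. Let $\delta:=\left(\frac{1-24\beta_0}{\ell}\right)$, which lies in $\{0,-1\}$, and for $d\mid Q$ let $\lambda_d:=d^{-1}\left(\frac{-12}{d}\right)\left(\frac{24\beta_0-1}{d}\right)$. Then $$f_{\ell,\delta}\,|\,(U_{Q_1}+\lambda_{Q_1}V_{Q_1})\cdots(U_{Q_t}+\lambda_{Q_t}V_{Q_t})\equiv0\pmod\ell.$$
   Context: $p(n)$ is the partition function ($p(0)=1$, $p(x)=0$ if $x$ is not a nonnegative integer). Symbols $\left(\frac{\cdot}{d}\right)$ are Jacobi symbols; $d^{-1}$ is the inverse in the ring $\mathcal O_\ell$ of algebraic numbers integral at primes above $\ell$. Let $q=e^{2\pi i\tau}$, $\eta(\tau)=q^{1/24}\prod_{n\ge1}(1-q^n)$, $\nu_\eta$ the multiplier with $\eta(\gamma\tau)=\nu_\eta(\gamma)(c\tau+d)^{1/2}\eta(\tau)$ on $\mathrm{SL}_2(\mathbb Z)$; $S_k(1,\nu_\eta^{-1})$ the cusp forms of weight $k$ with $f(\gamma\tau)=\nu_\eta(\gamma)^{-1}(c\tau+d)^kf(\tau)$ and coefficients in $\mathcal O_\ell$, expanded as $\sum a(n)q^{n/24}$. For $f=\sum a(n)q^{n/24}$: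 $f|U_m=\sum a(mn)q^{n/24}$, $f|V_m=\sum a(n)q^{mn/24}$; operators are applied successively left to right. Congruence mod $\ell$ is coefficientwise in $\mathcal O_\ell$. $f_{\ell,\delta}=\sum a_{\ell,\delta}(n)q^{n/24}$ lies in $S_{(\ell^2-2\ell)/2}(1,\nu_\eta^{-1})$ if $\delta=0$, in $S_{(\ell^2-2)/2}(1,\nu_\eta^{-1})$ if $\delta=-1$, with $a_{\ell,\delta}(n)\equiv p\left(\frac{n+1}{24}\right)\pmod\ell$ when $\left(\frac{-n}\ell\right)=\delta$ and $\equiv0$ otherwise. *)

(* Defs.v *)
From HB Require Import structures.
From mathcomp Require Import all_boot all_order all_algebra all_field.
Set Implicit Arguments. Unset Strict Implicit. Unset Printing Implicit Defensive.
Import Order.TTheory GRing.Theory Num.Theory.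

(* Partition function p(n) on nat: number of partitions of n, counted via the
   multiplicity representation: m i = number of parts equal to i+1. *)
Definition partition_count (n : nat) : nat :=
  #|[set m : {ffun 'I_n -> 'I_n.+1} | (\sum_(i < n) i.+1 * m i)%N == n]|.

Definition p_int (x : int) : nat :=
  match x with Posz k => partition_count k | Negz _ => 0%N end.

Definition p_shift (n : nat) : nat :=
  if (24 %| n.+1)%N then partition_count (n.+1 %/ 24) else 0%N.

Definition legendre (a : int) (p : nat) : int :=
  if (p%:Z %| a)%Z then 0%R
  else if [exists x : 'I_p, (p%:Z %| (x%:Z ^+ 2 - a)%R)%Z] then 1%R else (-1)%R.

Definition jacobi (a : int) (d : nat) : int :=
  (\prod_(q <- primes d) legendre a q ^+ logn q d)%R.

Definition squarefree (n : nat) : Prop :=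
  forall q : nat, prime q -> ~~ (q ^ 2 %| n)%N.

Local Open Scope ring_scope.

(* O_ell : algebraic numbers integral at all primes above ell
   (equivalently: m * x is an algebraic integer for some integer m prime to ell). *)
Definition in_Oell (ell : nat) (x : algC) : Prop :=
  exists m : nat, coprime m ell /\ (m%:R * x) \in Aint.

Definition cong_mod (ell : nat) (x y : algC) : Prop :=
  in_Oell ell ((x - y) / ell%:R).

(* a q-series sum_n a(n) q^{n/24}, n >= 0 (cusp form: a(0) irrelevant, coefficients
   at non-positive exponents vanish) is represented by its coefficient sequence. *)
Definition opU (m : nat) (a : nat -> algC) : nat -> algC := fun n => a (m * n)%N.
Definition opV (m : nat) (a : nat -> algC) : nat -> algC :=
  fun n => if (m %| n)%N then a (n %/ m)%N else 0.

Definition opUV (m : nat) (lam : algC) (a : nat -> algC) : nat -> algC :=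
  fun n => opU m a n + lam * opV m a n.

Definition lambda_coef (beta0 : int) (d : nat) : algC :=
  (d%:R)^-1 * (jacobi (-12) d)%:~R * (jacobi (24 * beta0 - 1) d)%:~R.

Definition apply_ops (beta0 : int) (Q : nat) (a : nat -> algC) : nat -> algC :=
  foldl (fun b q => opUV q (lambda_coef beta0 q) b) a (primes Q).

Definition is_f_coeffs (ell : nat) (delta : int) (a : nat -> algC) : Prop :=
  forall n : nat, in_Oell ell (a n) /\
    cong_mod ell (a n)
      (if jacobi (- n%:Z) ell == delta then (p_shift n)%:R else 0).

(* Main.v *)
Require Import Defs.
From HB Require Import structures.
From mathcomp Require Import all_boot all_order all_fingroup all_algebra all_solvable all_field.
From mathcomp Require Import boolp zify ring.
From mathcomp Require generic_quotient.

(** The statement is proved with q-expansions in characteristic ell only; no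
    complex analysis is used.  Let k be a finite field of characteristic ell
    with enough roots of unity.  Theta series in k[[S]], with q a power of S,
    give the Tate curve Y^2 = 4 X (X - al) (X - be) and the coordinates X_v,
    Y_v of its N-torsion points, indexed by v in (Z/N)^2.  Evaluating the
    ell-division polynomial near the origin shows that 1 is homogeneous of
    degree (ell - 1)/2 in al and be (the Hasse invariant), so the relations
    between al, be, X_v, Y_v are those between modular forms modulo ell.

    The maps v |-> f v that preserve all these relations are linear and contain
    the shear S |-> xi S.  If they all preserved the line of multiplicative
    p-torsion, the sum of X over it would be integral and homogeneous, hence a
    linear form in al and be, which its q-expansion excludes.  So conjugating
    the shear yields the Weyl element at each prime p dividing N.

    The products YY_v of Y_w / (X_w - X_2w) over half of the multiples w of v
    are, up to factors that are harmless modulo ell-th powers, the series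
    1 / E(zeta^j q^(1/N)) with E(t) the Euler product, at v = (j, 1).  Hence
    the generating function of p(n), cut to one class modulo ell by a
    polynomial in the derivation S d/dS, is transformed by the Weyl elements
    as a uniform rational function of the torsion coordinates.  The sum that
    expresses vanishing on one class modulo p is thereby turned into U_p plus a
    multiple of V_p; the multiple is a quotient of Gauss sums, computed from
    the pentagonal number expansion of 1 / YY_v.

    Taking N = Q p for an auxiliary prime p, the same argument moves the
    vanishing from the class of M = 24 n - 1 to the classes multiplied by
    squares, so it only depends on the Legendre symbol at ell.  Taking N = Q
    then gives the theorem, and the coefficient p(0) = 1 excludes delta = 1. *)

(** The obstacle is that, without the upper half plane, nothing says which substitutions of torsion
    points are legitimate. They are found indirectly: sums over all maps [V -> V] are symmetric
    functions of the torsion coordinates, hence homogeneous in [al] and [be], and independence of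
    characters then isolates the maps that preserve relations. Since the Hasse invariant is 1,
    degrees only make sense modulo (ell - 1)/2, so the grading is carried by the (ell - 1)-th roots
    of unity. The other point is that cutting a series to a class modulo ell must be an operation on
    rational functions of the torsion coordinates. It is, because the derivation acts on these
    functions and because a power of the discriminant, chosen so that ell divides N + 12 n, turns
    the leftover power of the Euler product into a constant for the derivation. As Q is squarefree,
    Z/N splits by idempotents and operators at distinct primes commute. The forms f are never
    constructed: any coefficient sequence with the required residues is treated. *)

Set Implicit Arguments. Unset Strict Implicit. Unset Printing Implicit Defensive.
Import Order.TTheory GRing.Theory Num.Theory.
Local Open Scope ring_scope.

(** * Formal power series: ring structure, units, derivation, scaling of the variable *)

Module PowerSeries.

(* The variable of these series is written [S] in the comments. *)
Record fps (R : Type) := Fps { fcoef : nat -> R }.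

HB.instance Definition _ (R : Type) := gen_eqMixin (fps R).
HB.instance Definition _ (R : Type) := gen_choiceMixin (fps R).

Lemma fpsP (R : Type) (f g : fps R) : (forall n, fcoef f n = fcoef g n) -> f = g.
Proof. by case: f => f; case: g => g /= H; congr Fps; apply: funext. Qed.

Section FpsRing.
Variable R : comNzRingType.
Implicit Types f g h : fps R.

Definition fps_add f g := Fps (fun n => fcoef f n + fcoef g n).
Definition fps_opp f := Fps (fun n => - fcoef f n).
Definition fps_zero : fps R := Fps (fun=> 0).
Definition fps_trunc n f : {poly R} := \poly_(i < n) fcoef f i.
(** Delegating to truncated polynomials lets commutativity and associativity be inherited from
    [{poly R}]. *)
Definition fps_mul f g :=
  Fps (fun n => (fps_trunc n.+1 f * fps_trunc n.+1 g)`_n).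
Definition fps_one : fps R := Fps (fun n => (n == 0)%:R).

Lemma fps_addA : associative fps_add.
Proof. by move=> f g h; apply: fpsP => n /=; rewrite addrA. Qed.
Lemma fps_addC : commutative fps_add.
Proof. by move=> f g; apply: fpsP => n /=; rewrite addrC. Qed.
Lemma fps_add0 : left_id fps_zero fps_add.
Proof. by move=> f; apply: fpsP => n /=; rewrite add0r. Qed.
Lemma fps_addN : left_inverse fps_zero fps_opp fps_add.
Proof. by move=> f; apply: fpsP => n /=; rewrite addNr. Qed.
HB.instance Definition _ :=
  GRing.isZmodule.Build (fps R) fps_addA fps_addC fps_add0 fps_addN.

Lemma fps_mulE f g n :
  fcoef (fps_mul f g) n = \sum_(i < n.+1) fcoef f i * fcoef g (n - i)%N.
Proof.
rewrite /= coefM; apply: eq_bigr => i _.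
by rewrite !coef_poly ltn_ord ltnS leq_subr.
Qed.

(** The truncation order is irrelevant beyond the index read, so associativity can be checked inside
    one triple product of polynomials truncated at a common order. *)
Lemma fps_mul_trunc f g n N : (n < N)%N ->
  fcoef (fps_mul f g) n = (fps_trunc N f * fps_trunc N g)`_n.
Proof.
move=> ltnN; rewrite fps_mulE coefM; apply: eq_bigr => i _.
by rewrite !coef_poly (leq_ltn_trans _ ltnN) ?(leq_ltn_trans _ ltnN) ?leq_subr // -ltnS.
Qed.

Lemma fps_mulC : commutative fps_mul.
Proof. by move=> f g; apply: fpsP => n /=; rewrite mulrC. Qed.

Lemma fps_mulA : associative fps_mul.
Proof.
move=> f g h; apply: fpsP => n.
rewrite fps_mulE [RHS]fps_mulE.
transitivity ((fps_trunc n.+1 f * (fps_trunc n.+1 g * fps_trunc n.+1 h))`_n).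
  rewrite coefM; apply: eq_bigr => i _.
  by rewrite coef_poly ltn_ord (@fps_mul_trunc g h _ n.+1) // ltnS leq_subr.
rewrite mulrA coefM; apply: eq_bigr => i _.
by rewrite [in RHS](@fps_mul_trunc f g _ n.+1) // [X in _ * X]coef_poly ltnS leq_subr.
Qed.

Lemma fps_mul1 : left_id fps_one fps_mul.
Proof.
move=> f; apply: fpsP => n; rewrite fps_mulE big_ord_recl /= mul1r subn0.
by rewrite big1 ?addr0 // => i _; rewrite mul0r.
Qed.

Lemma fps_mulDl : left_distributive fps_mul fps_add.
Proof.
move=> f g h; apply: fpsP => n; rewrite fps_mulE /=.
rewrite -[X in _ = X + _]/(fcoef (fps_mul f h) n) -[X in _ = _ + X]/(fcoef (fps_mul g h) n).
by rewrite !fps_mulE -big_split; apply: eq_bigr => i _; rewrite mulrDl.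
Qed.

Lemma fps_one_neq0 : fps_one != fps_zero.
Proof.
by apply/eqP => /(congr1 (fun f => fcoef f 0)) /= /eqP; rewrite oner_eq0.
Qed.

HB.instance Definition _ := GRing.Zmodule_isComNzRing.Build (fps R)
  fps_mulA fps_mulC fps_mul1 fps_mulDl fps_one_neq0.

Lemma fcoef0 n : fcoef (0 : fps R) n = 0. Proof. by []. Qed.
Lemma fcoef1 n : fcoef (1 : fps R) n = (n == 0)%:R. Proof. by []. Qed.
Lemma fcoefD f g n : fcoef (f + g) n = fcoef f n + fcoef g n. Proof. by []. Qed.
Lemma fcoefN f n : fcoef (- f) n = - fcoef f n. Proof. by []. Qed.
Lemma fcoefB f g n : fcoef (f - g) n = fcoef f n - fcoef g n. Proof. by []. Qed.
Lemma fcoefM f g n :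
  fcoef (f * g) n = \sum_(i < n.+1) fcoef f i * fcoef g (n - i)%N.
Proof. exact: fps_mulE. Qed.
Lemma fcoef_sum (I : Type) (r : seq I) (P : pred I) (F : I -> fps R) n :
  fcoef (\sum_(i <- r | P i) F i) n = \sum_(i <- r | P i) fcoef (F i) n.
Proof. by elim/big_rec2: _ => // i x y _ <-. Qed.

Definition fpsC (c : R) : fps R := Fps (fun n => if n == 0 then c else 0).
Definition fpsX (e : nat) : fps R := Fps (fun n => (n == e)%:R).

Lemma fcoefCM c f n : fcoef (fpsC c * f) n = c * fcoef f n.
Proof.
rewrite fcoefM big_ord_recl /= subn0 big1 ?addr0 // => i _.
by rewrite mul0r.
Qed.

Lemma fcoefXM e f n : fcoef (fpsX e * f) n = if (n < e)%N then 0 else fcoef f (n - e).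
Proof.
rewrite fcoefM; case: ltnP => [lt_ne | le_en].
  rewrite big1 // => i _ /=; case: eqP => [Ei|_]; last by rewrite mul0r.
  by have := ltn_ord i; rewrite Ei ltnS leqNgt lt_ne.
rewrite (bigD1 (Ordinal (n:=n.+1) (m:=e) le_en)) //= eqxx mul1r big1 ?addr0 //.
move=> i; rewrite -val_eqE /= => /negPf->; exact: mul0r.
Qed.

Lemma fpsC_zmod : zmod_morphism fpsC.
Proof.
by move=> a b; apply: fpsP => n; rewrite fcoefB /=; case: eqP => // _; rewrite subr0.
Qed.
Lemma fpsC_monoid : monoid_morphism fpsC.
Proof.
split; first by apply: fpsP => n /=; case: eqP.
by move=> a b; apply: fpsP => n; rewrite fcoefCM /=; case: eqP => // _; rewrite mulr0.
Qed.
HB.instance Definition _ := GRing.isZmodMorphism.Build R (fps R) fpsC fpsC_zmod.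
HB.instance Definition _ := GRing.isMonoidMorphism.Build R (fps R) fpsC fpsC_monoid.

Lemma fpsX0 : fpsX 0 = 1. Proof. exact: fpsP. Qed.
Lemma fpsXD a b : fpsX (a + b) = fpsX a * fpsX b.
Proof.
apply: fpsP => n; rewrite fcoefXM /=.
case: ltnP => Hn; last by congr (_%:R); lia.
by case: eqP => // ?; lia.
Qed.
Lemma fpsXM a n : fpsX (a * n) = fpsX a ^+ n.
Proof. by elim: n => [|n IH]; rewrite ?muln0 ?fpsX0 ?expr0 // mulnS fpsXD IH exprS. Qed.

Definition fderiv f : fps R := Fps (fun n => fcoef f n *+ n).
Lemma fderivD f g : fderiv (f + g) = fderiv f + fderiv g.
Proof. by apply: fpsP => n /=; rewrite mulrnDl. Qed.
Lemma fderivM f g : fderiv (f * g) = fderiv f * g + f * fderiv g.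
Proof.
apply: fpsP => n; rewrite [LHS]/= -[X in X *+ n]/(fcoef (f * g) n) fcoefD !fcoefM -big_split -sumrMnl.
apply: eq_bigr => i _ /=.
rewrite mulrnAl mulrnAr -mulrnDr subnKC //.
by rewrite -ltnS.
Qed.

(* The substitution [S |-> c S]. *)
Definition fscale (c : R) f : fps R := Fps (fun n => c ^+ n * fcoef f n).
Lemma fscale_zmod c : zmod_morphism (fscale c).
Proof. by move=> f g; apply: fpsP => n; rewrite fcoefB /= mulrBr. Qed.
Lemma fscale_monoid c : monoid_morphism (fscale c).
Proof.
split; first by apply: fpsP => -[|n] /=; rewrite ?mulr0 ?expr0 ?mul1r.
move=> f g; apply: fpsP => n; rewrite fcoefM [LHS]/= -[X in _ * X]/(fcoef (f * g) n) fcoefM mulr_sumr.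
apply: eq_bigr => i _; rewrite /= mulrACA -exprD subnKC // -ltnS.
exact: ltn_ord.
Qed.
HB.instance Definition _ c := GRing.isZmodMorphism.Build (fps R) (fps R) (fscale c) (fscale_zmod c).
HB.instance Definition _ c := GRing.isMonoidMorphism.Build (fps R) (fps R) (fscale c) (fscale_monoid c).

(** Congruence modulo S^n. It plays the part of the S-adic topology: infinite sums and products are
    compared by their truncations for every n. *)
Definition feqm n f g := forall i, (i < n)%N -> fcoef f i = fcoef g i.

Lemma feqm_refl n f : feqm n f f. Proof. by []. Qed.
Lemma feqm_sym n f g : feqm n f g -> feqm n g f.
Proof. by move=> H i /H. Qed.
Lemma feqm_trans n f g h : feqm n f g -> feqm n g h -> feqm n f h.
Proof. by move=> H1 H2 i lt; rewrite H1 ?H2. Qed.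
Lemma feqm_le n m f g : (n <= m)%N -> feqm m f g -> feqm n f g.
Proof. by move=> le H i lt; apply: H; apply: leq_trans le. Qed.
Lemma feqmD n f f' g g' : feqm n f f' -> feqm n g g' -> feqm n (f + g) (f' + g').
Proof. by move=> H1 H2 i lt; rewrite !fcoefD H1 ?H2. Qed.
Lemma feqmN n f f' : feqm n f f' -> feqm n (- f) (- f').
Proof. by move=> H1 i lt; rewrite !fcoefN H1. Qed.
Lemma feqmM n f f' g g' : feqm n f f' -> feqm n g g' -> feqm n (f * g) (f' * g').
Proof.
move=> H1 H2 i lt; rewrite !fcoefM; apply: eq_bigr => j _.
by rewrite H1 ?H2 //; apply: leq_ltn_trans lt; rewrite ?leq_subr // -ltnS.
Qed.
Lemma feqmX n f f' m : feqm n f f' -> feqm n (f ^+ m) (f' ^+ m).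
Proof. by move=> H; elim: m => [|m IH]; rewrite ?expr0 // !exprS; apply: feqmM. Qed.
Lemma feqm_eq f g : (forall n, feqm n f g) -> f = g.
Proof. by move=> H; apply: fpsP => n; apply: (H n.+1). Qed.
Lemma feqm_sum n (I : Type) (r : seq I) (P : pred I) (F G : I -> fps R) :
  (forall i, P i -> feqm n (F i) (G i)) ->
  feqm n (\sum_(i <- r | P i) F i) (\sum_(i <- r | P i) G i).
Proof.
by move=> H; elim/big_rec2: _ => // i x y Pi Hxy; apply: feqmD => //; apply: H.
Qed.

Lemma fcoefX0 f n : fcoef (f ^+ n) 0 = fcoef f 0 ^+ n.
Proof.
elim: n => [|n IH]; first by [].
by rewrite !exprS fcoefM big_ord_recl big_ord0 addr0 IH.
Qed.

Lemma fps_lowpow h n i : fcoef h 0 = 0 -> (i < n)%N -> fcoef (h ^+ n) i = 0.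
Proof.
move=> h0; elim: n i => // n IH i; rewrite ltnS => le_in.
rewrite exprS fcoefM big_ord_recl h0 mul0r add0r big1 // => j _.
rewrite IH ?mulr0 //.
by rewrite lift0; have := ltn_ord j; lia.
Qed.

(** Geometric series: the coefficient of index i only sees the powers h^n with n <= i, because h has
    no constant term. *)
Lemma fps_inv1 h : fcoef h 0 = 0 -> exists g, g * (1 - h) = 1.
Proof.
move=> h0; exists (Fps (fun i => fcoef (\sum_(n < i.+1) h ^+ n) i)).
have E N : feqm N (Fps (fun i => fcoef (\sum_(n < i.+1) h ^+ n) i)) (\sum_(n < N) h ^+ n).
  move=> i lt_iN /=; rewrite !fcoef_sum.
  rewrite -(subnKC lt_iN) big_split_ord /= [X in _ = _ + X]big1 ?addr0 // => j _.
  by rewrite fps_lowpow // ltn_addr.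
apply: feqm_eq => N.
apply: (feqm_trans (feqmM (E N) (@feqm_refl N (1 - h)))).
rewrite mulrC -opprB mulNr -subrX1 opprB => i lt.
by rewrite fcoefB fps_lowpow // subr0.
Qed.

End FpsRing.

Arguments fpsX {R} e.

Section FpsUnit.
Variable R : comUnitRingType.
Implicit Types f g h : fps R.

Definition fps_unit : pred (fps R) := fun f => `[< exists g, g * f = 1 >].
Definition fps_inv f : fps R :=
  if pselect (exists g, g * f = 1) is left H then projT1 (cid H) else f.
Lemma fps_mulVr : {in fps_unit, left_inverse 1 fps_inv *%R}.
Proof.
move=> f; rewrite /fps_inv => Hf; case: pselect => [H|]; last first.
  by case; apply/asboolP.
exact: (projT2 (cid H)).
Qed.
Lemma fps_unitP f g : g * f = 1 -> fps_unit f.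
Proof. by move=> H; apply/asboolP; exists g. Qed.
Lemma fps_inv_out : {in [predC fps_unit], fps_inv =1 id}.
Proof.
move=> f; rewrite inE /= /fps_inv; case: pselect => // H.
by move/negP; case; apply/asboolP.
Qed.
HB.instance Definition _ := GRing.ComNzRing_hasMulInverse.Build (fps R)
  fps_mulVr fps_unitP fps_inv_out.

Lemma fps_unitE f : fcoef f 0 \is a GRing.unit -> f \is a GRing.unit.
Proof.
move=> Uf; have [|g Hg] := @fps_inv1 R (1 - fpsC (fcoef f 0)^-1 * f).
  by rewrite fcoefB fcoefCM mulVr // fcoef1 subrr.
apply/unitrPr; exists (g * fpsC (fcoef f 0)^-1).
by rewrite -{}Hg opprB addrC subrK mulrC -mulrA.
Qed.
End FpsUnit.

Section FpsIdomain.
Variable R : idomainType.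
Implicit Types f g h : fps R.

Lemma fps_lead f : f != 0 ->
  exists2 n, fcoef f n != 0 & forall i, (i < n)%N -> fcoef f i = 0.
Proof.
move=> nz; have ex : exists n, fcoef f n != 0.
  apply: contrapT => H; case/eqP: nz; apply: fpsP => n.
  by apply/eqP/negPn/negP => nzn; apply: H; exists n.
case: (ex_minnP ex) => n nzn Hmin; exists n => // i lt.
by apply/eqP/negPn/negP => /Hmin; rewrite leqNgt lt.
Qed.

Lemma fps_idomain f g : f * g = 0 -> (f == 0) || (g == 0).
Proof.
move=> fg0; apply/norP => -[/fps_lead [m nzm Hm] /fps_lead [n nzn Hn]].
have: fcoef (f * g) (m + n) = fcoef f m * fcoef g n.
  rewrite fcoefM (bigD1 (Ordinal (leq_addr n m : (m < (m + n).+1)%N))) //=.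
  rewrite addKn big1 ?addr0 // => i; rewrite -val_eqE /= => ne.
  have [lt|ge] := ltnP i m; first by rewrite Hm ?mul0r.
  rewrite [fcoef g _]Hn ?mulr0 //.
  have := ltn_ord i; move: ne ge; lia.
by rewrite fg0 fcoef0 => /esym/eqP; rewrite mulf_eq0 (negPf nzm) (negPf nzn).
Qed.
HB.instance Definition _ := GRing.ComUnitRing_isIntegral.Build (fps R) fps_idomain.

Lemma fpsX_neq0 e : fpsX e != 0 :> fps R.
Proof.
by apply/eqP => /(congr1 (fun f => fcoef f e)) /= /eqP; rewrite eqxx oner_eq0.
Qed.
Lemma fpsC_inj : injective (@fpsC R).
Proof. by move=> a b /(congr1 (fun f => fcoef f 0)). Qed.
End FpsIdomain.

Section FpsMap.
Variables (R R' : comNzRingType) (phi : {rmorphism R -> R'}).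
Definition fmap (f : fps R) : fps R' := Fps (fun n => phi (fcoef f n)).
Lemma fmap_zmod : zmod_morphism fmap.
Proof. by move=> f g; apply: fpsP => n; rewrite fcoefB /= rmorphB. Qed.
Lemma fmap_monoid : monoid_morphism fmap.
Proof.
split; first by apply: fpsP => n /=; rewrite rmorph_nat.
move=> f g; apply: fpsP => n; rewrite fcoefM [LHS]/= -[X in phi X]/(fcoef (f * g) n) fcoefM rmorph_sum.
by apply: eq_bigr => i _; rewrite rmorphM.
Qed.
HB.instance Definition _ := GRing.isZmodMorphism.Build (fps R) (fps R') fmap fmap_zmod.
HB.instance Definition _ := GRing.isMonoidMorphism.Build (fps R) (fps R') fmap fmap_monoid.
End FpsMap.

End PowerSeries.

(** * Infinite sums of monomials over arbitrary index types *)

Module FormalSums.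
Import PowerSeries.

(** Finite fibres are the whole summability condition, as exponents are natural numbers. No order on
    the index set is involved, so sums over Z or Z x Z can be reindexed by any bijection. *)
Definition proper (I : eqType) (x : I -> nat) :=
  forall e, exists s : seq I, forall i, x i = e -> i \in s.

Lemma proper_le (I : eqType) (x : I -> nat) : proper x ->
  forall e, exists2 s : seq I, uniq s & forall i, (x i <= e)%N -> i \in s.
Proof.
move=> px e; suff [s Hs] : exists s : seq I, forall i, (x i <= e)%N -> i \in s.
  by exists (undup s); rewrite ?undup_uniq // => i /Hs; rewrite mem_undup.
elim: e => [|e [s Hs]].
  by have [s Hs] := px 0; exists s => i; rewrite leqn0 => /eqP/Hs.
have [t Ht] := px e.+1; exists (s ++ t) => i; rewrite mem_cat leq_eqVlt.
by case/orP => [/eqP/Ht -> | /Hs ->]; rewrite ?orbT.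
Qed.

Lemma proper_can (I J : eqType) (x : I -> nat) (h : J -> I) (g : I -> J) :
  cancel h g -> proper x -> proper (x \o h).
Proof.
move=> hK px e; have [s Hs] := px e; exists (map g s) => j /= /Hs hs.
by rewrite -(hK j) map_f.
Qed.

Lemma proper_add (I J : eqType) (x : I -> nat) (y : J -> nat) :
  proper x -> proper y -> proper (fun p : I * J => x p.1 + y p.2)%N.
Proof.
move=> /proper_le px /proper_le py e.
have [s _ Hs] := px e; have [t _ Ht] := py e.
exists [seq (a, b) | a <- s, b <- t] => -[a b] /= E.
by apply: allpairs_f; [apply: Hs | apply: Ht]; lia.
Qed.

Section Gs.
Variable R : comNzRingType.

(* The sum of [w i * S ^ (x i)] over all [i]; junk unless the fibres of [x] are finite. *)
Definition gs (I : eqType) (w : I -> R) (x : I -> nat) : fps R :=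
  Fps (fun e =>
    if pselect (exists s : seq I, forall i, x i = e -> i \in s) is left H
    then \sum_(i <- undup (projT1 (cid H)) | x i == e) w i else 0).

Lemma gsE (I : eqType) (w : I -> R) (x : I -> nat) e (s : seq I) :
  uniq s -> (forall i, x i = e -> i \in s) ->
  fcoef (gs w x) e = \sum_(i <- s | x i == e) w i.
Proof.
move=> us Hs /=; case: pselect => [H|]; last by case; exists s.
case: (cid H) => t Ht /=; rewrite -big_filter -[RHS]big_filter; apply: perm_big.
apply: uniq_perm; rewrite ?filter_uniq ?undup_uniq // => i.
by rewrite !mem_filter mem_undup; case: eqP => //= E; rewrite Ht ?Hs.
Qed.

Lemma eq_gs (I : eqType) (w w' : I -> R) (x x' : I -> nat) :
  w =1 w' -> x =1 x' -> gs w x = gs w' x'.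
Proof. by move=> /funext -> /funext ->. Qed.

Lemma gs_eq0 (I : eqType) (w : I -> R) (x : I -> nat) :
  (forall i, w i = 0) -> gs w x = 0.
Proof.
move=> w0; apply: fpsP => e /=; case: pselect => // H.
by rewrite big1 // => i _; rewrite w0.
Qed.

Lemma gs_mul (I J : eqType) (w : I -> R) (x : I -> nat) (v : J -> R) (y : J -> nat) :
  proper x -> proper y ->
  gs w x * gs v y = gs (fun p => w p.1 * v p.2) (fun p => x p.1 + y p.2)%N.
Proof.
move=> /proper_le px /proper_le py; apply: fpsP => e.
have [s us Hs] := px e; have [t ut Ht] := py e.
rewrite fcoefM (@gsE _ _ _ _ [seq (a, b) | a <- s, b <- t]); first last.
- by move=> [a b] /= E; apply: allpairs_f; [apply: Hs | apply: Ht]; lia.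
- by apply: allpairs_uniq => // -[a b] [a' b'].
rewrite [RHS]big_mkcond [RHS]big_allpairs_dep.
transitivity (\sum_(i < e.+1) \sum_(a <- s | x a == i) w a * \sum_(b <- t | y b == (e - i)%N) v b).
  apply: eq_bigr => i _; have := ltn_ord i; rewrite ltnS => le_ie.
  rewrite (@gsE _ w x _ s) ?(@gsE _ v y _ t) ?mulr_suml //.
    by move=> b E; apply: Ht; rewrite E leq_subr.
  by move=> a E; apply: Hs; rewrite E.
rewrite (exchange_big_dep xpredT) //=; apply: eq_big_seq => a a_s.
have [le_xe | lt_ex] := leqP (x a) e.
  rewrite (bigD1 (Ordinal (n:=e.+1) (m:=x a) le_xe)) //= [X in _ + X]big1 ?addr0; last first.
    move=> i /andP[/eqP E]; rewrite -val_eqE /= -E eqxx //.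
  rewrite mulr_sumr big_mkcond /=; apply: eq_bigr => b _.
  by congr (if _ then _ else _); apply/eqP/eqP; lia.
rewrite big1 => [|i /eqP E]; last by have := ltn_ord i; lia.
by rewrite big1 // => b _; case: eqP => // ?; lia.
Qed.

Lemma gs_reindex (I J : eqType) (h : J -> I) (w : I -> R) (x : I -> nat) :
  bijective h -> proper x -> gs w x = gs (w \o h) (x \o h).
Proof.
case=> g hK gK px; apply: fpsP => e; have [s us Hs] := proper_le px e.
rewrite (@gsE _ w x e s) //; last by move=> i E; apply: Hs; rewrite E.
rewrite (@gsE _ _ _ e (map g s)); first last.
- by move=> j /= E; rewrite -(hK j) map_f // Hs // E.
- by rewrite map_inj_uniq //; apply: can_inj gK.
by rewrite big_map; apply: eq_big => i /=; rewrite gK.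
Qed.

(** Needed to split a sum over pairs of integers by the parity of their difference, the two cases
    becoming the two summands of the index type. *)
Lemma gs_sum (I J : eqType) (w : I + J -> R) (x : I + J -> nat) : proper x ->
  gs w x = gs (w \o inl) (x \o inl) + gs (w \o inr) (x \o inr).
Proof.
move=> px; apply: fpsP => e; have [s us Hs] := proper_le px e.
rewrite fcoefD (@gsE _ w x e s) //; last by move=> i E; apply: Hs; rewrite E.
pose sl := pmap (fun z : I + J => if z is inl a then Some a else None) s.
pose sr := pmap (fun z : I + J => if z is inr a then Some a else None) s.
have Msl a : (a \in sl) = (inl a \in s).
  rewrite mem_pmap; apply/mapP/idP => [[[b|b] // Hb [->]] //|Ha].
  by exists (inl a).
have Msr a : (a \in sr) = (inr a \in s).
  rewrite mem_pmap; apply/mapP/idP => [[[b|b] // Hb [->]] //|Ha].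
  by exists (inr a).
have usl : uniq sl.
  apply: (@pmap_uniq _ _ (fun z : I + J => if z is inl a then Some a else None) inl) => //.
  by case.
have usr : uniq sr.
  apply: (@pmap_uniq _ _ (fun z : I + J => if z is inr a then Some a else None) inr) => //.
  by case.
rewrite (@gsE _ _ _ e sl) //; last by move=> a /= E; rewrite Msl Hs // E.
rewrite (@gsE _ _ _ e sr) //; last by move=> a /= E; rewrite Msr Hs // E.
have -> : \sum_(i <- s | x i == e) w i = \sum_(i <- map inl sl ++ map inr sr | x i == e) w i.
  apply: perm_big; apply: uniq_perm => //.
    rewrite cat_uniq !map_inj_uniq ?usl ?usr //=; try by move=> ? ? [].
    by rewrite andbT; apply/hasPn => z /mapP[b _ ->]; apply/mapP => -[].
  move=> [a|b]; rewrite mem_cat.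
    rewrite mem_map ?Msl => [|? ? [] //]; case: (inl a \in s) => //=.
    by apply/esym/negbTE/mapP => -[].
  rewrite [X in _ = _ || X]mem_map ?Msr => [|? ? [] //]; case: (inr b \in s); rewrite ?orbT //.
  by rewrite orbF; apply/esym/negbTE/mapP => -[].
by rewrite big_cat !big_map.
Qed.

Lemma gsZ (I : eqType) (c : R) (w : I -> R) (x : I -> nat) :
  gs (fun i => c * w i) x = fpsC c * gs w x.
Proof.
apply: fpsP => e; rewrite fcoefCM /=; case: pselect => [H|_]; last by rewrite mulr0.
by rewrite mulr_sumr.
Qed.

Lemma gsN (I : eqType) (w : I -> R) (x : I -> nat) :
  gs (fun i => - w i) x = - gs w x.
Proof.
apply: fpsP => e; rewrite fcoefN /=; case: pselect => [H|_]; last by rewrite oppr0.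
by rewrite sumrN.
Qed.

Lemma fscale_gs (I : eqType) c (w : I -> R) (x : I -> nat) :
  fscale c (gs w x) = gs (fun i => c ^+ x i * w i) x.
Proof.
apply: fpsP => e /=; case: pselect => [H|_]; last by rewrite mulr0.
by rewrite mulr_sumr; apply: eq_bigr => i /eqP->.
Qed.

Lemma fderiv_gs (I : eqType) (w : I -> R) (x : I -> nat) :
  fderiv (gs w x) = gs (fun i => w i *+ x i) x.
Proof.
apply: fpsP => e /=; case: pselect => [H|_]; last by rewrite mul0rn.
by rewrite -sumrMnl; apply: eq_bigr => i /eqP->.
Qed.

Lemma fpsX_gs (I : eqType) a (w : I -> R) (x : I -> nat) : proper x ->
  fpsX a * gs w x = gs w (fun i => a + x i)%N.
Proof.
move=> px; apply: fpsP => e; rewrite fcoefXM.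
have [s us Hs] := proper_le px e.
rewrite (@gsE _ w (fun i => a + x i)%N e s) //; last by move=> i E; apply: Hs; lia.
case: ltnP => [lt|le]; first by rewrite big1 // => i /eqP E; lia.
rewrite (@gsE _ w x _ s) //; last by move=> i E; apply: Hs; lia.
by apply: eq_bigl => i; apply/eqP/eqP; lia.
Qed.

Lemma gs_coef_out (I : eqType) (w : I -> R) (x : I -> nat) e :
  (forall i, x i <> e) -> fcoef (gs w x) e = 0.
Proof.
by move=> H; rewrite (@gsE _ _ _ e [::]) ?big_nil // => i /H.
Qed.

Lemma gs_coef_one (I : eqType) (w : I -> R) (x : I -> nat) i0 :
  (forall i, x i = x i0 -> i = i0) -> fcoef (gs w x) (x i0) = w i0.
Proof.
move=> H; rewrite (@gsE _ _ _ _ [:: i0]) // ?big_cons ?big_nil ?eqxx ?addr0 //.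
by move=> i /H ->; rewrite inE.
Qed.

Lemma gs_coef_two (I : eqType) (w : I -> R) (x : I -> nat) i0 i1 : i0 != i1 ->
  x i0 = x i1 -> (forall i, x i = x i0 -> (i == i0) || (i == i1)) ->
  fcoef (gs w x) (x i0) = w i0 + w i1.
Proof.
move=> ne E H; rewrite (@gsE _ _ _ _ [:: i0; i1]) /=.
- by rewrite !big_cons big_nil E eqxx addr0.
- by rewrite inE ne.
by move=> i /H; rewrite !inE.
Qed.
End Gs.

Lemma fmap_gs (R R' : comNzRingType) (phi : {rmorphism R -> R'}) (I : eqType)
  (w : I -> R) (x : I -> nat) : fmap phi (gs w x) = gs (phi \o w) x.
Proof.
apply: fpsP => e /=; case: pselect => [H|_]; last by rewrite rmorph0.
by rewrite rmorph_sum.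
Qed.

(** Reindexing by h shows that the sum equals its opposite. *)
Lemma gs_odd (R : idomainType) (I : eqType) (h : I -> I) (w : I -> R) (x : I -> nat) :
  (2%:R : R) != 0 -> bijective h -> proper x -> (forall i, w (h i) = - w i) ->
  (forall i, x (h i) = x i) -> gs w x = 0.
Proof.
move=> nz2 bh px wh xh; have := gs_reindex w bh px.
rewrite (@eq_gs _ _ (w \o h) (fun i => - w i) (x \o h) x) // gsN => E.
apply: fpsP => e; have /(congr1 (fun f => fcoef f e)) := E; rewrite fcoefN fcoef0.
move=> H; apply/eqP; move/eqP: H; rewrite -addr_eq0 -mulr2n -mulr_natr mulf_eq0.
by rewrite (negPf nz2) orbF.
Qed.

End FormalSums.

(** * Jacobi theta series and their bilinear and duplication identities *)

Module Theta.
Import PowerSeries FormalSums.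

Lemma abszX2 (x : int) : ((`|x|%N ^ 2)%N)%:Z = x ^+ 2.
Proof. by rewrite -mulnn PoszM abszE -expr2 real_normK ?num_real. Qed.

Lemma proper_quad (k : nat) (a b : int) : (0 < k)%N -> a != 0 ->
  proper (fun n : int => (k * `|(a * n + b)%R| ^ 2)%N).
Proof.
move=> k0 a0 e; exists [seq i%:Z - (e + `|b|)%:Z | i <- iota 0 (2 * (e + `|b|)).+1].
move=> n E; have Hn : (`|n| <= e + `|b|)%N.
  have H1 : (`|(a * n + b)%R| <= e)%N.
    rewrite -E; apply: leq_trans (leq_pmull _ k0).
    by case: `|_|%N => // m; rewrite -mulnn leq_pmull.
  have H2 : (`|n| <= `|(a * n)%R|)%N by rewrite abszM leq_pmull // lt0n absz_eq0.
  lia.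
apply/mapP; exists `|(n + (e + `|b|)%:Z)%R|%N; last by lia.
by rewrite mem_iota; lia.
Qed.

Section Theta.
Variable R : idomainType.
Variable N : nat.
Hypothesis N0 : (0 < N)%N.

(** With nome q = S^(8 N^2) and u = c S^(4 N m), completing the square in q^(n(n-1)/2) u^n gives the
    exponent (2 N n + m - N)^2 up to a constant. Keeping the full square makes exponents natural
    numbers and turns products of theta series into sums over a quadratic form. The exponents [e0]
    and [e1] appear after rotating that form. *)
Definition ex (m n : int) : nat := (`|((2 * N)%:Z * n + (m - N%:Z))%R| ^ 2)%N.
Definition e0 (m b : int) : nat := (2 * `|((2 * N)%:Z * b + m)%R| ^ 2)%N.
Definition e1 (m b : int) : nat := (2 * `|((2 * N)%:Z * b + (N%:Z + m))%R| ^ 2)%N.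

Lemma exE m n : (ex m n)%:Z = (2 * N%:Z * n + (m - N%:Z)) ^+ 2.
Proof. by rewrite /ex abszX2 PoszM. Qed.
Lemma e0E m n : (e0 m n)%:Z = 2 * (2 * N%:Z * n + m) ^+ 2.
Proof. by rewrite /e0 [LHS]PoszM abszX2 PoszM. Qed.
Lemma e1E m n : (e1 m n)%:Z = 2 * (2 * N%:Z * n + (N%:Z + m)) ^+ 2.
Proof. by rewrite /e1 [LHS]PoszM abszX2 PoszM. Qed.

Lemma twoN_neq0 : (2 * N)%:Z != 0. Proof. lia. Qed.
Lemma proper_ex m : proper (ex m).
Proof.
move=> e; have [s Hs] := proper_quad (m - N%:Z) (ltn0Sn 0) twoN_neq0 e.
by exists s => i Hi; apply: Hs; rewrite mul1n.
Qed.
Lemma proper_e0 m : proper (e0 m). Proof. exact: proper_quad twoN_neq0. Qed.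
Lemma proper_e1 m : proper (e1 m). Proof. exact: proper_quad twoN_neq0. Qed.

(* The pair [(c, m)] stands for the argument [u = c S ^ (4 N m)] of the Jacobi theta function with nome [q = S ^ (8 N ^ 2)]. *)
Definition th (c : R) (m : int) : fps R := gs (fun n : int => (- c) ^ n) (ex m).
Definition R0 (c : R) (m : int) : fps R := gs (fun b : int => c ^ (2 * b)) (e0 m).
Definition R1 (c : R) (m : int) : fps R := gs (fun b : int => c ^ (2 * b + 1)) (e1 m).

(** The rotation (n, n') -> (n + n', n - n') has image of index two in Z^2: equal parity gives the
    first series, opposite parity the second, and x^2 + y^2 = ((x + y)^2 + (x - y)^2) / 2 separates
    the exponents. *)
Lemma gs_bil (w : int -> int -> R) m1 m2 :
  gs (fun p : int * int => w p.1 p.2)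
     (fun p => ex (m1 + m2) p.1 + ex (m1 - m2) p.2)%N =
  gs (fun p : int * int => w (p.1 + p.2 + 1) (p.1 - p.2 + 1))
     (fun p => e1 m1 p.1 + e0 m2 p.2)%N +
  gs (fun p : int * int => w (p.1 + p.2 + 1) (p.1 - p.2))
     (fun p => e0 m1 p.1 + e1 m2 p.2)%N.
Proof.
pose h (z : (int * int) + (int * int)) : int * int :=
  match z with inl p => (p.1 + p.2 + 1, p.1 - p.2 + 1)
             | inr p => (p.1 + p.2 + 1, p.1 - p.2) end.
pose g (p : int * int) : (int * int) + (int * int) :=
  if ((p.1 - p.2) %% 2)%Z == 0
  then inl (((p.1 + p.2) %/ 2)%Z - 1, ((p.1 - p.2) %/ 2)%Z)
  else inr (((p.1 + p.2) %/ 2)%Z, ((p.1 - p.2) %/ 2)%Z).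
have bh : bijective h.
  exists g => [[[a b]|[a b]]|[n n']]; rewrite /g /h /=.
  - by rewrite ifT; [congr (inl (_, _)); lia | lia].
  - by rewrite ifF; [congr (inr (_, _)); lia | lia].
  - by case: ifP => H /=; congr pair; lia.
have px := proper_add (proper_ex (m1 + m2)) (proper_ex (m1 - m2)).
rewrite (gs_reindex _ bh px) gs_sum; last first.
  by case: bh => g' hK gK; apply: proper_can hK px.
congr (_ + _); apply: eq_gs => // -[a b] /=; apply/eqP; rewrite -eqz_nat.
- by rewrite PoszD [X in _ == X]PoszD !exE e0E e1E; apply/eqP; ring.
- by rewrite PoszD [X in _ == X]PoszD !exE e0E e1E; apply/eqP; ring.
Qed.

Lemma exprz_odd (c : R) (n : int) : (- c) ^ (2 * n) = c ^ (2 * n).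
Proof. by rewrite -!exprz_exp -[_ ^ 2]/(_ ^+ 2) sqrrN. Qed.

(** Each factor on the right depends on one argument only, so theta(u1 u2) theta(u1 / u2) is a 2 x 2
    minor built from the vectors (R0, R1); the addition identities of the curve are relations
    between such minors. *)
Lemma th_bil c1 c2 m1 m2 : c1 \is a GRing.unit -> c2 \is a GRing.unit ->
  th (c1 * c2) (m1 + m2) * th (c1 / c2) (m1 - m2) =
  fpsC c1 * (R1 c1 m1 * R0 c2 m2 - R0 c1 m1 * R1 c2 m2).
Proof.
move=> U1 U2; rewrite gs_mul; try exact: proper_ex.
rewrite (gs_bil (fun n n' => (- (c1 * c2)) ^ n * (- (c1 / c2)) ^ n')) mulrBr.
have E n n' : (- (c1 * c2)) ^ n * (- (c1 / c2)) ^ n' =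
    (-1) ^ (n + n') * c1 ^ (n + n') * c2 ^ (n - n').
  have U3 : c2^-1 \is a GRing.unit by rewrite unitrV.
  rewrite -[- (c1 * c2)]mulN1r -[- (c1 / c2)]mulN1r.
  rewrite !exprzMl ?unitrN ?unitr1 ?unitrM ?U1 ?U2 ?U3 //.
  rewrite !exprzDr ?unitrN ?unitr1 //.
  by rewrite exprz_inv; ring.
congr (_ + _).
  rewrite /R1 /R0 gs_mul; try exact: proper_e0; try exact: proper_e1.
  rewrite -gsZ; apply: eq_gs => // -[a b] /=; rewrite E.
  have -> : a + b + 1 + (a - b + 1) = 2 * (a + 1) by ring.
  have -> : a + b + 1 - (a - b + 1) = 2 * b by ring.
  rewrite exprz_odd exp1rz mul1r mulrA; congr (_ * _).
  have -> : 2 * (a + 1) = 1 + (2 * a + 1) :> int by ring.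
  by rewrite (exprzDr U1 1) expr1z.
rewrite /R1 /R0 gs_mul; try exact: proper_e0; try exact: proper_e1.
rewrite -gsZ -gsN; apply: eq_gs => // -[a b] /=; rewrite E.
have -> : a + b + 1 + (a - b) = 2 * a + 1 by ring.
have -> : a + b + 1 - (a - b) = 2 * b + 1 by ring.
rewrite !(@exprzDr R _ _ (2 * a) 1) ?unitrN ?unitr1 // exprz_odd exp1rz mul1r !expr1z.
by ring.
Qed.

Lemma th_shift c m : c \is a GRing.unit ->
  th c (m + (2 * N)%:Z) = - (fpsC c^-1 * th c m).
Proof.
move=> Uc; have b1 : bijective (fun n : int => n - 1).
  by exists (fun n => n + 1) => n; ring.
rewrite /th (gs_reindex _ b1 (proper_ex _)) -gsZ -gsN; apply: eq_gs => n /=.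
  rewrite exprzDr ?unitrN // -[(- c) ^ (-1)]/((- c) ^- 1) expr1 invrN mulrC.
  by rewrite mulNr.
by rewrite /ex; congr (_ ^ _)%N; congr absz; ring.
Qed.

Lemma th_inv c m : c \is a GRing.unit -> th c^-1 (- m) = - (fpsC c^-1 * th c m).
Proof.
move=> Uc; have b1 : bijective (fun n : int => 1 - n).
  by exists (fun n => 1 - n) => n; ring.
rewrite /th (gs_reindex _ b1 (proper_ex _)) -gsZ -gsN; apply: eq_gs => n /=.
  rewrite -invrN exprz_inv opprB exprzDr ?unitrN //.
  by rewrite -[(- c) ^ (-1)]/((- c) ^- 1) expr1 invrN mulrC mulNr.
by rewrite /ex -abszN; congr (_ ^ _)%N; congr absz; ring.
Qed.

Lemma R0_opp c m : R0 (- c) m = R0 c m.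
Proof. by apply: eq_gs => // b; rewrite exprz_odd. Qed.

Lemma R1_opp c m : c \is a GRing.unit -> R1 (- c) m = - R1 c m.
Proof.
move=> Uc; rewrite /R1 -gsN; apply: eq_gs => // b.
by rewrite !(@exprzDr R _ _ _ 1) ?unitrN // exprz_odd !expr1z mulrN.
Qed.

(** The analogues of [R0] and [R1] with alternating signs; [vth] is the Jacobi constant, the sum of
    (-1)^b q^(b^2). *)
Definition thA (c : R) (m : int) : fps R := gs (fun b : int => (-1) ^ b * c ^ (2 * b)) (e0 m).
Definition thB (c : R) (m : int) : fps R := gs (fun b : int => (-1) ^ b * c ^ (2 * b + 1)) (e1 m).
Definition vth : fps R := gs (fun b : int => (-1) ^ b) (e0 0).

(** Both parity classes of [gs_bil] give the same product here, whence the factor 2. *)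
Lemma th_sqr c m : c \is a GRing.unit ->
  th (c ^+ 2) (2 * m) * th (-1) 0 = - (fpsC (2%:R * c) * (thA c m * thB c m)).
Proof.
move=> Uc; rewrite gs_mul; try exact: proper_ex.
have -> : (fun p : int * int => (ex (2 * m) p.1 + ex 0 p.2)%N) =
          (fun p => (ex (m + m) p.1 + ex (m - m) p.2)%N).
  by apply: funext => p; congr (ex _ _ + ex _ _)%N; ring.
rewrite (gs_bil (fun n n' => (- c ^+ 2) ^ n * (- -1) ^ n')).
have E n n' : (- c ^+ 2) ^ n * (- -1) ^ n' = (-1) ^ n * c ^ (2 * n).
  rewrite opprK exp1rz mulr1 -[- c ^+ 2]mulN1r exprzMl ?unitrN ?unitr1 ?unitrX //.
  by rewrite (exprnP c) exprz_exp.
have F a b : (-1) ^ (a + b + 1) * c ^ (2 * (a + b + 1)) =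
    - (c * (((-1) ^ a * c ^ (2 * a)) * ((-1) ^ b * c ^ (2 * b + 1)))).
  have -> : 2 * (a + b + 1) = 2 * a + (2 * b + 1) + 1 :> int by ring.
  rewrite !exprzDr ?unitrN ?unitr1 // !expr1z; ring.
rewrite [X in X + _](_ : _ = - (fpsC c * (thB c m * thA c m))); last first.
  rewrite gs_mul; try exact: proper_e0; try exact: proper_e1.
  rewrite -gsZ -gsN; apply: eq_gs => // -[a b] /=.
  by rewrite E F !exprzDr // !expr1z; ring.
rewrite [X in _ + X](_ : _ = - (fpsC c * (thA c m * thB c m))); last first.
  rewrite gs_mul; try exact: proper_e0; try exact: proper_e1.
  by rewrite -gsZ -gsN; apply: eq_gs => // -[a b] /=; rewrite E F.
by rewrite rmorphM rmorph_nat; ring.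
Qed.

Lemma thB_shift c m : c \is a GRing.unit -> thB c (m + N%:Z) = - (fpsC c^-1 * thA c m).
Proof.
move=> Uc; have b1 : bijective (fun n : int => n - 1).
  by exists (fun n => n + 1) => n; ring.
rewrite /thB (gs_reindex _ b1 (proper_e1 _)) -gsZ -gsN; apply: eq_gs => n /=.
  have -> : 2 * (n - 1) + 1 = 2 * n - 1 :> int by ring.
  rewrite !exprzDr ?unitrN ?unitr1 //.
  rewrite -[(- 1) ^ (-1)]/((- 1) ^- 1) -[c ^ (-1)]/(c ^- 1) !expr1 invrN invr1.
  ring.
by rewrite /e0 /e1; congr (_ * _ ^ _)%N; congr absz; ring.
Qed.
End Theta.

Section ThetaDomain.
Variable R : idomainType.
Variable N : nat.
Hypothesis N0 : (0 < N)%N.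
Hypothesis nz2 : (2%:R : R) != 0.
Local Notation th := (@th R N).
Local Notation thA := (@thA R N).
Local Notation thB := (@thB R N).
Local Notation vth := (@vth R N).

(** One parity class contributes nothing: its second factor is the sum of (-1)^b over the exponents
    [e1 0], which is odd under b -> -1 - b. *)
Lemma th_opp_mul c m : c \is a GRing.unit ->
  th c m * th (- c) m = - (fpsC c * (thB c m * vth)).
Proof.
move=> Uc; rewrite gs_mul; try exact: proper_ex.
have -> : (fun p : int * int => (ex N m p.1 + ex N m p.2)%N) =
          (fun p => (ex N (m + 0) p.1 + ex N (m - 0) p.2)%N).
  by apply: funext => p; congr (ex _ _ _ + ex _ _ _)%N; ring.
rewrite (gs_bil N0 (fun n n' => (- c) ^ n * (- - c) ^ n')).
have E n n' : (- c) ^ n * (- - c) ^ n' = (-1) ^ n * c ^ (n + n').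
  rewrite opprK -[- c]mulN1r exprzMl ?unitrN ?unitr1 //.
  by rewrite exprzDr // mulrA.
rewrite [X in X + _](_ : _ = - (fpsC c * (thB c m * vth))); last first.
  rewrite gs_mul; try exact: proper_e0; try exact: proper_e1.
  rewrite -gsZ -gsN; apply: eq_gs => // -[a b] /=; rewrite E.
  have -> : a + b + 1 + (a - b + 1) = (2 * a + 1) + 1 by ring.
  by rewrite !(@exprzDr R _ _ _ 1) ?unitrN ?unitr1 // exprzDr ?unitrN ?unitr1 // !expr1z; ring.
rewrite [X in _ + X](_ : _ = gs (fun b : int => - (-1) ^ b * c ^ (2 * b + 1)) (e0 N m) *
    gs (fun b : int => (-1) ^ b) (e1 N 0)); last first.
  rewrite gs_mul; try exact: proper_e0; try exact: proper_e1.
  apply: eq_gs => // -[a b] /=; rewrite E.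
  have -> : a + b + 1 + (a - b) = 2 * a + 1 by ring.
  by rewrite !(@exprzDr R _ _ _ 1) ?unitrN ?unitr1 // exprzDr ?unitrN ?unitr1 // !expr1z; ring.
rewrite [X in _ + _ * X](_ : _ = 0) ?mulr0 ?addr0 //.
apply: (@gs_odd _ _ (fun b => - 1 - b)) => //.
- by exists (fun b => -1 - b) => b; ring.
- exact: proper_e1.
- move=> b; have E1 : (-1 : R) ^ b * (-1) ^ b = 1.
    by rewrite -exprzMl ?unitrN ?unitr1 // mulrNN mulr1 exp1rz.
  apply: (@mulIr _ ((-1) ^ b)); first by rewrite unitrXz ?unitrN ?unitr1.
  rewrite mulNr E1 -exprzDr ?unitrN ?unitr1 // subrK.
  by rewrite -[(- 1) ^ (-1)]/((- 1) ^- 1) expr1 invrN invr1.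
- by move=> b; rewrite /e1 -abszN; congr (_ * _ ^ _)%N; congr absz; ring.
Qed.

Lemma th_shiftN c m : c \is a GRing.unit ->
  th c m * th (- c) m = - (fpsC c * (thB c m * vth)) ->
  th c (m + N%:Z) * th (- c) (m + N%:Z) = thA c m * vth.
Proof.
move=> Uc _; rewrite th_opp_mul // thB_shift // mulNr mulrN opprK !mulrA -rmorphM.
by rewrite divrr // rmorph1 mul1r.
Qed.

Lemma thA10 : thA 1 0 = vth.
Proof. by apply: eq_gs => // b; rewrite exp1rz mulr1. Qed.

Lemma th34 : th 1 N%:Z * th (-1) N%:Z = vth ^+ 2.
Proof.
have := th_shiftN (unitr1 R) (th_opp_mul 0 (unitr1 R)).
by rewrite add0r thA10 expr2.
Qed.

(** The four arguments on the right are the translates of u by the 2-torsion points 1, -1, q^(1/2),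
    -q^(1/2) of the Tate curve; replacing m by m + N is multiplication by q^(1/2). *)
Lemma th_dup c m : c \is a GRing.unit ->
  th (c ^+ 2) (2 * m) * (th (-1) 0 * th (-1) N%:Z * th 1 N%:Z) =
  2%:R * (th c m * th (- c) m * (th c (m + N%:Z) * th (- c) (m + N%:Z))).
Proof.
move=> Uc.
rewrite th_shiftN // ?th_opp_mul // -mulrA [th (-1) N%:Z * _]mulrC th34 mulrA th_sqr //.
by rewrite rmorphM rmorph_nat; ring.
Qed.
End ThetaDomain.

End Theta.

(** * Infinite products and the Jacobi triple product *)

Module TripleProduct.
Import PowerSeries FormalSums Theta.

Lemma bin2D a b : 'C(a + b, 2) = ('C(a, 2) + a * b + 'C(b, 2))%N.
Proof.
elim: b => [|b IH]; first by rewrite addn0 muln0 !addn0.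
by rewrite addnS !binS !bin1 IH mulnS; lia.
Qed.

Lemma bin2sq b : (b * b = 2 * 'C(b, 2) + b)%N.
Proof. by elim: b => // b IH; rewrite binS bin1 mulnS mulSn IH; lia. Qed.

Section QBinomial.
Variables (R : comNzRingType) (q : R).

(** Gaussian binomials through Pascal's rule, so that no division by 1 - q^i occurs; [qbE] recovers
    the quotient of factorials. *)
Fixpoint qb (n k : nat) : R :=
  match n, k with
  | _, 0 => 1
  | 0, _.+1 => 0
  | n'.+1, k'.+1 => qb n' k + q ^+ (n' - k') * qb n' k'
  end.
Definition qf (n : nat) : R := \prod_(i < n) (1 - q ^+ i.+1).

Arguments qb : simpl never.

Lemma qb0 n : qb n 0 = 1. Proof. by case: n. Qed.
Lemma qbSS n k : qb n.+1 k.+1 = qb n k.+1 + q ^+ (n - k) * qb n k. Proof. by []. Qed.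
Lemma qb_small n k : (n < k)%N -> qb n k = 0.
Proof.
elim: n k => [|n IH] [|k] // lt; rewrite qbSS !IH ?mulr0 ?addr0 //.
exact: ltn_trans lt.
Qed.

Lemma qbinomial x y n :
  \prod_(i < n) (y + q ^+ i * x) =
  \sum_(j < n.+1) q ^+ 'C(j, 2) * qb n j * x ^+ j * y ^+ (n - j).
Proof.
elim: n => [|n IH]; first by rewrite big_ord0 big_ord1 /= !expr0 !mulr1.
rewrite big_ord_recr /= {}IH mulrDr [RHS]big_ord_recl [nat_of_ord ord0]/= subn0 bin0n qb0 !expr0 !mulr1 mul1r.
under [X in _ = _ + X]eq_bigr => j _ do rewrite lift0 qbSS subSS
  !mulrDr !mulrDl.
rewrite big_split /= [RHS]addrA; congr (_ + _).
  rewrite mulr_suml [LHS]big_ord_recl [nat_of_ord ord0]/= subn0 bin0n qb0 !expr0 !mulr1 mul1r exprSr; congr (_ + _).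
  rewrite [RHS]big_ord_recr /= (@qb_small n n.+1) // !(mulr0, mul0r) addr0.
  apply: eq_bigr => i _; rewrite /bump leq0n add1n -!mulrA; do 3 congr (_ * _).
  by rewrite -exprSr; congr (_ ^+ _); have := ltn_ord i; lia.
rewrite mulr_suml; apply: eq_bigr => j _.
have le_jn : (j <= n)%N by rewrite -ltnS.
have -> : q ^+ n = q ^+ j * q ^+ (n - j) by rewrite -exprD subnKC.
by rewrite binS bin1 exprD [x ^+ j.+1]exprS; ring.
Qed.

Lemma qbE n j : (j <= n)%N -> qb n j * qf j * qf (n - j) = qf n.
Proof.
elim: n j => [|n IH] [|j] //; rewrite ?ltnS => le.
- by rewrite /qf /= !big_ord0 !mulr1.
- by rewrite qb0 /qf big_ord0 subn0 !mul1r.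
rewrite qbSS subSS.
have qfS m : qf m.+1 = qf m * (1 - q ^+ m.+1) by rewrite /qf big_ord_recr.
have Hj := IH j le.
rewrite 2!mulrDl qfS.
have -> : q ^+ (n - j) * qb n j * (qf j * (1 - q ^+ j.+1)) * qf (n - j) =
  q ^+ (n - j) * (1 - q ^+ j.+1) * qf n by rewrite -Hj; ring.
have [lt|ge] := ltnP j n.
  have Hj1 := IH j.+1 lt.
  have E : (n - j)%N = (n - j.+1).+1 by lia.
  have -> : qb n j.+1 * (qf j * (1 - q ^+ j.+1)) * qf (n - j) =
     (1 - q ^+ (n - j)) * qf n.
    by rewrite -Hj1 {1 2}E !qfS -E; ring.
  rewrite qfS; have -> : q ^+ n.+1 = q ^+ (n - j) * q ^+ j.+1.
    by rewrite -exprD; congr (_ ^+ _); lia.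
  by ring.
have -> : j = n by lia.
by rewrite qb_small // subnn expr0 qfS; ring.
Qed.
End QBinomial.

Section IProd.
Variable R : comNzRingType.
Implicit Types (F G : nat -> fps R).

(** Coefficient i is read off the first i + 1 factors. This is the infinite product provided that
    the n-th factor is 1 modulo S^n, which is [conv1]. *)
Definition iprod F : fps R := Fps (fun i => fcoef (\prod_(n < i.+1) F n) i).

Definition conv1 F := forall n, feqm n (F n) 1.

Lemma prod_feqm F n m k : conv1 F -> (k <= n)%N -> (n <= m)%N ->
  feqm k (\prod_(i < m) F i) (\prod_(i < n) F i).
Proof.
move=> cF kn; elim: m => [|m IH] nm; first by have -> : n = 0 by lia.
have [->|lt] := eqVneq n m.+1; first by [].
rewrite big_ord_recr -[X in feqm _ _ X]mulr1; apply: feqmM; first by apply: IH; lia.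
by apply: feqm_le (cF m); lia.
Qed.

Lemma iprodE F n m : conv1 F -> (n <= m)%N -> feqm n (iprod F) (\prod_(i < m) F i).
Proof.
move=> cF nm i lt /=; apply: esym; apply: (prod_feqm cF (leqnn i.+1)) => //.
exact: leq_trans nm.
Qed.

Lemma iprod_uniq F f : conv1 F -> (forall n, exists2 m, (n <= m)%N & feqm n f (\prod_(i < m) F i)) ->
  f = iprod F.
Proof.
move=> cF H; apply: feqm_eq => n; have [m nm Hm] := H n.
exact: feqm_trans Hm (feqm_sym (iprodE cF nm)).
Qed.

Lemma conv1M F G : conv1 F -> conv1 G -> conv1 (fun n => F n * G n).
Proof. by move=> cF cG n; rewrite -[X in feqm _ _ X](mulr1 1); apply: feqmM. Qed.

Lemma iprodM F G : conv1 F -> conv1 G -> iprod F * iprod G = iprod (fun n => F n * G n).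
Proof.
move=> cF cG; apply: iprod_uniq; first exact: conv1M.
by move=> n; exists n => //; rewrite big_split; apply: feqmM; apply: iprodE.
Qed.

Lemma eq_iprod F G : F =1 G -> iprod F = iprod G.
Proof. by move=> /funext ->. Qed.

Lemma iprod_recl F : conv1 F -> conv1 (fun n => F n.+1) ->
  iprod F = F 0 * iprod (fun n => F n.+1).
Proof.
move=> cF cG; apply: esym; apply: iprod_uniq => // n; exists n.+1 => //.
by rewrite big_ord_recl; apply: feqmM => //; apply: iprodE.
Qed.

Lemma prod_mul (d m : nat) F :
  \prod_(i < d * m) F i = \prod_(j < d) \prod_(a < m) F (d * a + j)%N.
Proof.
rewrite exchange_big /=; elim: m => [|m IH]; first by rewrite muln0 !big_ord0.
by rewrite mulnS addnC big_ord_recr /= -IH big_split_ord.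
Qed.

Lemma conv1_sub (d j : nat) F : (0 < d)%N -> conv1 F -> conv1 (fun a => F (d * a + j)%N).
Proof.
by move=> d0 cF n; apply: feqm_le (cF _); apply: leq_trans (leq_addr _ _); rewrite leq_pmull.
Qed.

Lemma iprod_split (d : nat) F : (0 < d)%N -> conv1 F ->
  iprod F = \prod_(j < d) iprod (fun a => F (d * a + j)%N).
Proof.
move=> d0 cF; apply: esym; apply: iprod_uniq => // n; exists (d * n)%N.
  by rewrite leq_pmull.
rewrite prod_mul; elim/big_rec2: _ => // j x y _ H; apply: feqmM => //.
by apply: iprodE => //; apply: conv1_sub.
Qed.

Lemma fcoef0_iprod F : fcoef (iprod F) 0 = fcoef (F 0) 0.
Proof. by rewrite /= big_ord_recl big_ord0 mulr1. Qed.

(* Meaningful only for [q] without constant term. *)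
Definition pinf (q z : fps R) := iprod (fun i => 1 - q ^+ i * z).
Definition euler (q : fps R) := pinf q q.

Lemma feqm_exp (q : fps R) n : fcoef q 0 = 0 -> feqm n (q ^+ n) 0.
Proof. by move=> q0 i lt; rewrite fps_lowpow. Qed.

Lemma conv1_pinf q z : fcoef q 0 = 0 -> conv1 (fun i => 1 - q ^+ i * z).
Proof.
move=> q0 n; rewrite -[X in feqm _ _ X](subr0 1); apply: feqmD => //; apply: feqmN.
by rewrite -[X in feqm _ _ X](mul0r z); apply: feqmM => //; apply: feqm_exp.
Qed.

Lemma pinfE q z n m : fcoef q 0 = 0 -> (n <= m)%N ->
  feqm n (pinf q z) (\prod_(i < m) (1 - q ^+ i * z)).
Proof. by move=> q0 nm; apply: iprodE => //; apply: conv1_pinf. Qed.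

Lemma pinf_recl q z : fcoef q 0 = 0 -> pinf q z = (1 - z) * pinf q (q * z).
Proof.
move=> q0; rewrite /pinf iprod_recl; first 1 last.
- exact: conv1_pinf.
- have -> : (fun n => 1 - q ^+ n.+1 * z) = (fun n => 1 - q ^+ n * (q * z)).
    by apply: funext => n; rewrite exprSr mulrA.
  exact: conv1_pinf.
rewrite expr0 mul1r; congr (_ * _); apply: eq_iprod => n.
by rewrite exprSr mulrA.
Qed.

Lemma euler_qf q n m : fcoef q 0 = 0 -> (n <= m)%N -> feqm n (euler q) (qf q m).
Proof.
move=> q0 nm; apply: feqm_trans (pinfE q q0 nm) _.
rewrite [X in feqm _ _ X](_ : _ = \prod_(i < m) (1 - q ^+ i * q)) //.
by apply: eq_bigr => i _; rewrite exprSr.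
Qed.

Lemma pinf_split d q z : (0 < d)%N -> fcoef q 0 = 0 ->
  pinf q z = \prod_(j < d) pinf (q ^+ d) (q ^+ j * z).
Proof.
move=> d0 q0; rewrite /pinf (iprod_split d0) ?conv1_pinf //; last exact: conv1_pinf.
apply: eq_bigr => j _; apply: eq_iprod => a.
by rewrite mulrA -exprM -exprD.
Qed.
End IProd.

Section JTP.
Variable R : idomainType.
Implicit Types q z : fps R.

Lemma euler_neq0 q : fcoef q 0 = 0 -> euler q != 0.
Proof.
move=> q0; apply/eqP => /(congr1 (fun f => fcoef f 0)).
rewrite /euler /pinf fcoef0_iprod expr0 mul1r fcoefB q0 subr0 fcoef0 => /eqP.
by rewrite oner_eq0.
Qed.

Lemma euler_unit q : fcoef q 0 = 0 -> euler q \is a GRing.unit.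
Proof.
move=> q0; apply: fps_unitE.
by rewrite /euler /pinf fcoef0_iprod expr0 mul1r fcoefB q0 subr0 unitr1.
Qed.

Lemma finite_jtp q z z' M : z * z' = q -> q != 0 ->
  \prod_(i < M) (1 - q ^+ i * z) * \prod_(i < M) (1 - q ^+ i * z') =
  qb q (2 * M) M + \sum_(n < M) (-1) ^+ n.+1 * q ^+ 'C(n.+1, 2) *
    (qb q (2 * M) (M + n.+1) * z ^+ n.+1 + qb q (2 * M) (M - n.+1) * z' ^+ n.+1).
Proof.
move=> zz q0; have z0 : z != 0 by apply: contraNneq q0 => z0; rewrite -zz z0 mul0r.
have prodMl (a : fps R) (F : nat -> fps R) :
    \prod_(i < M) (a * F i) = a ^+ M * \prod_(i < M) F i.
  by rewrite big_split prodr_const card_ord.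
(* The q-binomial product with x = - z and y = q^M over 2 M factors is the wanted double product
   times this monomial, which is cancelled since the ring is a domain. *)
pose c := (- z) ^+ M * q ^+ ('C(M, 2) + M * M).
have c0 : c != 0 by rewrite mulf_neq0 ?expf_neq0 ?oppr_eq0.
apply: (mulfI c0).
transitivity (\prod_(i < 2 * M) (q ^+ M + q ^+ i * (- z))).
  have -> : (2 * M = M + M)%N by lia.
  rewrite big_split_ord /=.
  have -> : \prod_(i < M) (q ^+ M + q ^+ (M + i) * - z) =
            q ^+ (M * M) * \prod_(i < M) (1 - q ^+ i * z).
    rewrite exprM -(prodMl _ (fun i => 1 - q ^+ i * z)); apply: eq_bigr => i _ /=.
    by rewrite exprD; ring.
  have -> : \prod_(i < M) (q ^+ M + q ^+ i * - z) =
            (- z) ^+ M * q ^+ 'C(M, 2) * \prod_(i < M) (1 - q ^+ i * z').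
    rewrite -bin2_sum big_mkord -prodrXr.
    rewrite [X in _ = _ * X](reindex_inj rev_ord_inj) /= -mulrA -big_split.
    rewrite -(prodMl _ (fun i => q ^+ i * (1 - q ^+ (M - i.+1) * z'))) /=.
    apply: eq_bigr => i _ /=.
    have -> : q ^+ M = q ^+ i * (q * q ^+ (M - i.+1)).
      by rewrite -exprS -exprD; congr (_ ^+ _); have := ltn_ord i; lia.
    by rewrite -{2}zz; ring.
  by rewrite /c exprD; ring.
rewrite qbinomial.
have -> : (2 * M).+1 = (M + (1 + M))%N by lia.
rewrite big_split_ord /= [X in _ + X]big_split_ord /= big_ord1 addn0 mulrDr addrCA; congr (_ + _).
  rewrite (_ : (2 * M - M)%N = M); last by lia.
  by rewrite /c exprD exprM; ring.
rewrite [X in X + _](reindex_inj rev_ord_inj) /= -big_split /= mulr_sumr.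
apply: eq_bigr => n _.
have ltn : (n < M)%N by [].
have E1 : 'C(M + n.+1, 2) = ('C(M, 2) + M * n.+1 + 'C(n.+1, 2))%N.
  by rewrite bin2D.
have E2 : ('C(M - n.+1, 2) + M * n.+1 = 'C(M, 2) + 'C(n.+1, 2) + n.+1)%N.
  have := bin2D (M - n.+1) n.+1; rewrite subnK // => ->.
  by have := bin2sq n.+1; rewrite mulnBl; have : (n.+1 * n.+1 <= M * n.+1)%N; [rewrite leq_mul2r ltn orbT | lia].
have -> : (2 * M - (M + (1 + n)))%N = (M - n.+1)%N by lia.
have -> : (2 * M - (M - n.+1))%N = (M + n.+1)%N by lia.
rewrite add1n mulrDr.
have -> : (- z) ^+ (M + n.+1) = (- z) ^+ M * (-1) ^+ n.+1 * z ^+ n.+1.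
  by rewrite exprD -[in X in _ * X](mulN1r z) exprMn mulrA.
rewrite addrC mulrDr; congr (_ + _).
  rewrite E1 /c !exprD; have -> : q ^+ (M * M) = q ^+ (M * n.+1) * q ^+ (M * (M - n.+1)).
    by rewrite -exprD -mulnDr; congr (_ ^+ (_ * _)); lia.
  by rewrite -[in q ^+ M ^+ _]exprM; ring.
have -> : c = (- z) ^+ (M - n.+1) * (-1) ^+ n.+1 * z ^+ n.+1 * q ^+ ('C(M, 2) + M * M).
  rewrite /c; have -> : (- z) ^+ M = (- z) ^+ (M - n.+1) * (- z) ^+ n.+1.
    by rewrite -exprD subnK.
  by rewrite [(- z) ^+ n.+1]exprNn mulrA.
have -> : q ^+ 'C(M - n.+1, 2) * qb q (2 * M) (M - n.+1) * (- z) ^+ (M - n.+1) * q ^+ M ^+ (M + n.+1)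
   = q ^+ ('C(M - n.+1, 2) + M * n.+1) * q ^+ (M * M) * qb q (2 * M) (M - n.+1) * (- z) ^+ (M - n.+1).
  by rewrite -exprM mulnDr !exprD; ring.
have -> : q ^+ ('C(M - n.+1, 2) + M * n.+1) =
    q ^+ 'C(M, 2) * q ^+ 'C(n.+1, 2) * (z ^+ n.+1 * z' ^+ n.+1).
  by rewrite E2 (exprD q ('C(M, 2) + 'C(n.+1, 2))) (exprD q 'C(M, 2)) -exprMn zz.
rewrite (exprD q 'C(M, 2) (M * M)).
have S1 : (-1) ^+ n.+1 * (-1) ^+ n.+1 = 1 :> fps R by rewrite -expr2 sqrr_sign.
set a := (-1) ^+ n.+1 in S1 *.
transitivity ((a * a) * (q ^+ 'C(M, 2) * q ^+ 'C(n.+1, 2) * (z ^+ n.+1 * z' ^+ n.+1) * q ^+ (M * M) *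
  qb q (2 * M) (M - n.+1) * (- z) ^+ (M - n.+1))); first by rewrite S1 mul1r.
by ring.
Qed.

Definition jser q z z' L : fps R :=
  1 + \sum_(n < L) (-1) ^+ n.+1 * q ^+ 'C(n.+1, 2) * (z ^+ n.+1 + z' ^+ n.+1).

(** Limit of [finite_jtp] with M = L + K. The central Gaussian binomials tend to 1 / E(q), and the
    terms with n >= L are killed by q^(n(n+1)/2). *)
Lemma jtp q z z' K L : z * z' = q -> q != 0 -> fcoef q 0 = 0 -> (K.+2 <= L)%N ->
  feqm K (euler q * pinf q z * pinf q z') (jser q z z' L).
Proof.
move=> zz q0 q00 KL; pose M := (L + K)%N.
have Hsmall n : (K < n)%N -> feqm K (q ^+ 'C(n.+1, 2)) 0.
  move=> lt; apply: (@feqm_le _ K 'C(n.+1, 2)); last exact: feqm_exp.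
  rewrite binS bin1; apply: leq_trans (leq_addl _ _); exact: ltnW.
(* Away from both ends the binomial is a quotient of truncations of E(q), all congruent to E(q)
   modulo S^K. *)
have Hqb j : (K <= j)%N -> (j <= 2 * M - K)%N -> feqm K (euler q * qb q (2 * M) j) 1.
  move=> Kj jM; have U := euler_unit q00.
  have E := qbE q (leq_trans jM (leq_subr _ _)).
  suff H : feqm K (euler q * (euler q * qb q (2 * M) j)) (euler q).
    by have := feqmM (@feqm_refl _ K (euler q)^-1) H; rewrite mulKr // mulVr.
  apply: (@feqm_trans _ _ _ (qf q (2 * M))); last first.
    by apply: feqm_sym; apply: euler_qf => //; lia.
  have -> : euler q * (euler q * qb q (2 * M) j) = qb q (2 * M) j * euler q * euler q by ring.
  by rewrite -E; apply: feqmM; [apply: feqmM => // |]; apply: euler_qf => //; lia.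
apply: (@feqm_trans _ _ _ (euler q * (\prod_(i < M) (1 - q ^+ i * z) * \prod_(i < M) (1 - q ^+ i * z')))).
  rewrite -mulrA; apply: feqmM => //.
  by apply: feqmM; apply: pinfE => //; rewrite /M leq_addl.
rewrite (finite_jtp M zz q0) mulrDr; apply: feqmD.
  by apply: Hqb; rewrite /M; lia.
rewrite mulr_sumr.
have -> : \sum_(n < L) (-1) ^+ n.+1 * q ^+ 'C(n.+1, 2) * (z ^+ n.+1 + z' ^+ n.+1) =
  \sum_(n < M) (if (n < L)%N then (-1) ^+ n.+1 * q ^+ 'C(n.+1, 2) * (z ^+ n.+1 + z' ^+ n.+1) else 0).
  rewrite -big_mkcond /= -(big_mkord xpredT (fun n => (-1) ^+ n.+1 * q ^+ 'C(n.+1, 2) * (z ^+ n.+1 + z' ^+ n.+1))).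
  rewrite (big_nat_widen 0 L M) /= ?big_mkord //.
  by rewrite /M leq_addr.
apply: feqm_sum => n _; case: ltnP => [ltnL|leLn].
  have -> : euler q * ((-1) ^+ n.+1 * q ^+ 'C(n.+1, 2) *
     (qb q (2 * M) (M + n.+1) * z ^+ n.+1 + qb q (2 * M) (M - n.+1) * z' ^+ n.+1)) =
     (-1) ^+ n.+1 * q ^+ 'C(n.+1, 2) * (euler q * qb q (2 * M) (M + n.+1) * z ^+ n.+1 +
        euler q * qb q (2 * M) (M - n.+1) * z' ^+ n.+1) by ring.
  rewrite -[X in feqm _ _ (_ * (X + _))]mul1r -[X in feqm _ _ (_ * (_ + X))]mul1r.
  by apply: feqmM => //; apply: feqmD; apply: feqmM => //; apply: Hqb; move: ltnL; rewrite /M; clear; move: (n : nat) => i; lia.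
have Z := Hsmall n (ltnW (leq_trans KL leLn)).
set A := (X in euler q * (_ * _ * X)).
have -> : euler q * ((-1) ^+ n.+1 * q ^+ 'C(n.+1, 2) * A) =
   q ^+ 'C(n.+1, 2) * (euler q * (-1) ^+ n.+1 * A) by ring.
by rewrite -[X in feqm _ _ X](mul0r (euler q * (-1) ^+ n.+1 * A)); apply: feqmM.
Qed.

Lemma gs_trunc (I : eqType) (w : I -> R) (x : I -> nat) K (s : seq I) :
  uniq s -> (forall i, (x i < K)%N -> i \in s) ->
  feqm K (gs w x) (\sum_(i <- s) fpsC (w i) * fpsX (x i)).
Proof.
move=> us Hs e lt; rewrite (@gsE _ _ _ _ _ s) //; last by move=> i E; apply: Hs; rewrite E.
rewrite fcoef_sum big_mkcond; apply: eq_bigr => i _; rewrite fcoefCM /= eq_sym.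
by case: eqP; rewrite ?mulr1 ?mulr0.
Qed.

(** The sum over Z is folded into the one-sided form of [jser]; the third condition confines the
    exponents below K to finitely many n. *)
Lemma gs_jser (w : int -> R) (x : int -> nat) q z z' K :
  (forall n, fpsC (w n%:Z) * fpsX (x n%:Z) = (-1) ^+ n * q ^+ 'C(n, 2) * z ^+ n) ->
  (forall n, fpsC (w (- n%:Z)) * fpsX (x (- n%:Z)) = (-1) ^+ n * q ^+ 'C(n, 2) * z' ^+ n) ->
  (forall n : int, (x n < K)%N -> (`|n| <= K.+2)%N) ->
  feqm K (gs w x) (jser q z z' K.+2).
Proof.
move=> H1 H2 H3; pose s := [seq i%:Z - (K.+2)%:Z | i <- iota 0 (2 * K.+2).+1].
apply: feqm_trans (gs_trunc _ _ (s := s) _) _.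
- by rewrite map_inj_uniq ?iota_uniq // => a b; lia.
- move=> n /H3 le; apply/mapP; exists `|(n + K.+2%:Z)%R|%N; last by lia.
  by rewrite mem_iota; lia.
suff -> : \sum_(i <- s) fpsC (w i) * fpsX (x i) = jser q z z' K.+2 by [].
rewrite /s big_map -[iota 0 _]/(index_iota 0 (2 * K.+2).+1) big_mkord.
have -> : (2 * K.+2).+1 = (K.+2 + (1 + K.+2))%N by lia.
rewrite big_split_ord /= [X in _ + X]big_split_ord /= big_ord1 addn0 addrCA; congr (_ + _).
  by rewrite subrr -[0]/(0%:Z) H1 /= !expr0 !mulr1.
rewrite [X in X + _](reindex_inj rev_ord_inj) /= -big_split /=.
apply: eq_bigr => n _; rewrite addrC mulrDr; congr (_ + _).
  have -> : Posz (K.+2 + (1 + n)) - Posz K.+2 = n.+1%:Z by lia.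
  exact: H1.
have -> : Posz (K.+2 - n.+1) - Posz K.+2 = - n.+1%:Z by have := ltn_ord n; lia.
exact: H2.
Qed.
End JTP.

End TripleProduct.

(** * Product formulas for theta series, theta constants and the pentagonal series *)

Module ProductFormula.
Import PowerSeries FormalSums Theta TripleProduct.

Lemma bin2sqz (n : nat) : n%:Z * n%:Z = 2 * 'C(n, 2)%:Z + n%:Z.
Proof. by rewrite -PoszM bin2sq [LHS]PoszD PoszM. Qed.

Section Ev0.
Variable R : comNzRingType.
Definition ev0 (f : fps R) : R := fcoef f 0.
Lemma ev0_zmod : zmod_morphism ev0. Proof. by []. Qed.
Lemma ev0_monoid : monoid_morphism ev0.
Proof. by split=> // f g; rewrite /ev0 fcoefM big_ord_recl big_ord0 addr0. Qed.
HB.instance Definition _ := GRing.isZmodMorphism.Build (fps R) R ev0 ev0_zmod.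
HB.instance Definition _ := GRing.isMonoidMorphism.Build (fps R) R ev0 ev0_monoid.
End Ev0.
Arguments ev0 : simpl never.

Section MapProd.
Variables (R R' : comNzRingType) (phi : {rmorphism R -> R'}).
Lemma fmap_feqm n f g : feqm n f g -> feqm n (fmap phi f) (fmap phi g).
Proof. by move=> H i lt /=; rewrite H. Qed.
Lemma fmap_X e : fmap phi (fpsX e) = fpsX e.
Proof. by apply: fpsP => n /=; rewrite rmorph_nat. Qed.
Lemma fmap_C c : fmap phi (fpsC c) = fpsC (phi c).
Proof. by apply: fpsP => n /=; case: eqP; rewrite ?rmorph0. Qed.
Lemma fmap_pinf q z : fcoef q 0 = 0 -> fmap phi (pinf q z) = pinf (fmap phi q) (fmap phi z).
Proof.
move=> q0; have q0' : fcoef (fmap phi q) 0 = 0 by rewrite /= q0 rmorph0.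
apply: iprod_uniq; first exact: conv1_pinf.
move=> n; exists n => //; apply: feqm_trans (fmap_feqm (pinfE z q0 (leqnn n))) _.
by rewrite rmorph_prod; under eq_bigr => i _ do rewrite rmorphB rmorphM rmorph1 rmorphXn.
Qed.
End MapProd.

Section Products.
Variable R : idomainType.
Variable N : nat.
Hypothesis N0 : (0 < N)%N.
Local Notation qq := (fpsX (8 * N ^ 2)%N : fps R).
Local Notation th := (@th R N).

Lemma fpsX_coef0 e : (0 < e)%N -> fcoef (fpsX e : fps R) 0 = 0.
Proof. by case: e. Qed.

Lemma qq0 : fcoef qq 0 = 0.
Proof. by apply: fpsX_coef0; rewrite muln_gt0 expn_gt0 N0. Qed.

Lemma feqm_all (f g : fps R) : (forall K, feqm K f g) -> f = g.
Proof. exact: feqm_eq. Qed.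

Lemma fpsCX (c : R) n : fpsC c ^+ n = fpsC (c ^+ n). Proof. by rewrite rmorphXn. Qed.

Lemma fpsCM (a b : R) : fpsC (a * b) = fpsC a * fpsC b. Proof. by rewrite rmorphM. Qed.

Lemma sgz_exprN (n : nat) : (-1 : R) ^ (- n%:Z) = (-1) ^+ n.
Proof. by rewrite -exprz_inv invrN invr1. Qed.

Lemma fpsCN1 n : fpsC ((-1) ^+ n : R) = (-1) ^+ n.
Proof. by rewrite rmorphXn rmorphN1. Qed.

(** Triple product with z = c S^(4 N m) and z z' = q; the bound m <= 2 N is what makes z' a power
    series. *)
Lemma th_prod c (m : nat) : c \is a GRing.unit -> (m <= 2 * N)%N ->
  th c m%:Z = fpsX (`|m%:Z - N%:Z| ^ 2)%N *
    (euler qq * pinf qq (fpsC c * fpsX (4 * N * m)) *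
     pinf qq (fpsC c^-1 * fpsX (8 * N ^ 2 - 4 * N * m))).
Proof.
move=> Uc le; pose x' (n : int) := `|(4 * N%:Z * n * (N%:Z * n + (m%:Z - N%:Z)))%R|%N.
have x'E (n : int) : (x' n)%:Z = 4 * N%:Z * n * (N%:Z * n + (m%:Z - N%:Z)).
  rewrite /x' gez0_abs //; have [n0|n1] := lerP n 0.
    have [->|n0'] := eqVneq n 0; first by rewrite mulr0 mul0r.
    by rewrite -mulrNN mulr_ge0 //; [nia | nia].
  by rewrite mulr_ge0 //; nia.
have exE' (n : int) : ex N m%:Z n = (`|m%:Z - N%:Z| ^ 2 + x' n)%N.
  apply/eqP; rewrite -eqz_nat PoszD exE x'E abszX2; apply/eqP; ring.
have px' : proper x'.
  move=> e; have [s Hs] := proper_ex N0 m%:Z (`|m%:Z - N%:Z| ^ 2 + e)%N.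
  by exists s => i E; apply: Hs; rewrite exE' E.
have -> : th c m%:Z = fpsX (`|m%:Z - N%:Z| ^ 2)%N * gs (fun n : int => (- c) ^ n) x'.
  by rewrite fpsX_gs //; apply: eq_gs.
congr (_ * _); apply: feqm_all => K.
have le2 : (4 * N * m <= 8 * N ^ 2)%N by rewrite -mulnn; nia.
apply: feqm_trans (feqm_sym (jtp (L := K.+2) _ _ qq0 _)) => //; last 2 first.
- rewrite mulrACA -fpsCM divrr // rmorph1 mul1r -fpsXD; congr fpsX; lia.
- exact: fpsX_neq0.
apply: gs_jser => n.
- have -> : (- c) ^ n%:Z = (-1) ^+ n * c ^+ n by rewrite -exprnP -exprNn.
  have -> : x' n%:Z = (8 * N ^ 2 * 'C(n, 2) + 4 * N * m * n)%N.
    apply/eqP; rewrite -eqz_nat x'E -mulnn.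
    move: (bin2sqz n); move: 'C(n, 2) => b B; rewrite PoszD !PoszM; apply/eqP; nia.
  rewrite fpsCM fpsCN1 -[fpsC (c ^+ n)]fpsCX fpsXD !fpsXM exprMn.
  by ring.
- have -> : (- c) ^ (- n%:Z) = (-1) ^+ n * c^-1 ^+ n.
    by rewrite -exprz_inv -exprnP invrN -exprNn.
  have -> : x' (- n%:Z) = (8 * N ^ 2 * 'C(n, 2) + (8 * N ^ 2 - 4 * N * m) * n)%N.
    apply/eqP; rewrite -eqz_nat x'E; move: (le2); rewrite -mulnn => le3.
    move: (bin2sqz n); move: 'C(n, 2) => b B; rewrite PoszD [X in _ == _ + X]PoszM.
    by rewrite -subzn // !PoszM; apply/eqP; nia.
  rewrite fpsCM fpsCN1 -[fpsC (c^-1 ^+ n)]fpsCX fpsXD !fpsXM exprMn.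
  by ring.
- move=> lt; have := x'E n; move: lt; set X := x' n => lt E.
  have [n0|n1] := lerP n 0; first by have [->|] := eqVneq n 0; [ | nia].
  nia.
Qed.

Definition pent (n : int) : nat := (`|(n * (3 * n - 1))%R| %/ 2)%N.

Lemma pentE (n : int) : 2 * (pent n)%:Z = n * (3 * n - 1).
Proof.
have ge0 : 0 <= n * (3 * n - 1) by have [n0|n1] := lerP n 0; nia.
have ev : (2 %| `|(n * (3 * n - 1))%R|)%N.
  rewrite -(absz_nat 2) -[(_ %| _)%N]/(2%:Z %| n * (3 * n - 1))%Z.
  have [k [Ek|Ek]] : exists k : int, n = 2 * k \/ n = 2 * k + 1.
    by exists (n %/ 2)%Z; lia.
    by apply/dvdzP; exists (k * (3 * n - 1)); rewrite Ek; ring.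
  by apply/dvdzP; exists (n * (3 * k + 1)); rewrite Ek; ring.
by rewrite /pent -PoszM mulnC divnK // gez0_abs.
Qed.

(** Triple product at (q, z, z') = (t^3, t, t^2): the three residue classes of exponents modulo 3
    recombine to E(t). *)
Lemma euler_pent (c : R) a : c \is a GRing.unit -> (0 < a)%N ->
  euler (fpsC c * fpsX a) =
  gs (fun n : int => (-1) ^ n * c ^+ pent n) (fun n => a * pent n)%N.
Proof.
move=> Uc a0; set t := fpsC c * fpsX a.
have t0 : fcoef t 0 = 0 by rewrite fcoefCM /=; case: a a0 @t => // a _ t; rewrite mulr0.
have t30 : fcoef (t ^+ 3) 0 = 0 by rewrite fcoefX0 t0 expr0n.
have tn0 : t != 0.
  rewrite mulf_neq0 ?fpsX_neq0 // -(rmorph0 (@fpsC R)) (inj_eq (@fpsC_inj R)).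
  by apply: contraTneq Uc => ->; rewrite unitr0.
have -> : euler t = euler (t ^+ 3) * pinf (t ^+ 3) t * pinf (t ^+ 3) (t ^+ 2).
  rewrite /euler (@pinf_split _ 3 t t) // !big_ord_recl big_ord0 /= expr0 mul1r expr1 mulr1.
  by rewrite -expr2 -exprSr; ring.
apply: feqm_all => K.
have := @jtp _ (t ^+ 3) t (t ^+ 2) K K.+2 _ _ t30 (leqnn _).
rewrite -exprS expf_neq0 // => /(_ erefl isT) H.
apply: feqm_trans H (feqm_sym _).
apply: gs_jser => n.
- have -> : pent n%:Z = (3 * 'C(n, 2) + n)%N.
    move: (pentE n%:Z); move: (bin2sqz n); move: 'C(n, 2) => b B E.
    apply/eqP; rewrite -eqz_nat PoszD PoszM; apply/eqP; nia.
  rewrite -exprnP fpsCM fpsCN1 -fpsCX fpsXM -mulrA -exprMn -/t exprD exprM.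
  by rewrite mulrA.
- have -> : pent (- n%:Z) = (3 * 'C(n, 2) + 2 * n)%N.
    move: (pentE (- n%:Z)); move: (bin2sqz n); move: 'C(n, 2) => b B E.
    apply/eqP; rewrite -eqz_nat PoszD !PoszM; apply/eqP; nia.
  by rewrite sgz_exprN fpsCM fpsCN1 -fpsCX fpsXM -mulrA -exprMn -/t exprD !exprM mulrA.
- move=> lt; have E := pentE n; have lt' : (pent n < K)%N by nia.
  by have [n0|n1] := lerP n 0; nia.
Qed.

Lemma proper_pent a : (0 < a)%N -> proper (fun n => a * pent n)%N.
Proof.
move=> a0 e; exists [seq i%:Z - e.+1%:Z | i <- iota 0 (2 * e.+1).+1] => n E.
have P := pentE n; have le : (`|n| <= e.+1)%N.
  have : (pent n <= e)%N by rewrite -E leq_pmull.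
  by have [n0|n1] := lerP n 0; nia.
by apply/mapP; exists `|(n + e.+1%:Z)%R|%N; [rewrite mem_iota; lia | lia].
Qed.

(** Put u = c S^(8 N), so that u^N = q. The factors for i and N - i run over all nonzero residues
    modulo N, and the products over all residues recombine to E(u). This is how a product over half
    of the multiples of a torsion point becomes a single Euler product. *)
Lemma th_half_prod c r : N = (2 * r).+1 -> c ^+ N = 1 ->
  (\prod_(1 <= i < r.+1) th (c ^+ i) (2 * i)%:Z) * euler qq =
  fpsX (\sum_(1 <= i < r.+1) `|(2 * i)%:Z - N%:Z| ^ 2)%N *
    (euler qq ^+ r * euler (fpsC c * fpsX (8 * N))).
Proof.
move=> Nr cN; have Uc : c \is a GRing.unit by rewrite -(@unitrX_pos _ c N) // cN unitr1.
set u := fpsC c * fpsX (8 * N).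
have uN : u ^+ N = qq.
  by rewrite exprMn fpsCX cN rmorph1 mul1r -fpsXM; congr fpsX; rewrite -mulnn mulnA.
have u0 : fcoef u 0 = 0 by rewrite fcoefCM /=; case: eqP => [|_]; [lia | rewrite mulr0].
have -> : euler u = (\prod_(1 <= i < r.+1) (pinf qq (u ^+ i) * pinf qq (u ^+ (N - i)))) * euler qq.
  rewrite /euler (@pinf_split _ N u u) // uN.
  have -> : \prod_(j < N) pinf qq (u ^+ j * u) = \prod_(1 <= j < N.+1) pinf qq (u ^+ j).
    by rewrite big_add1 /= big_mkord; apply: eq_bigr => j _; rewrite exprSr.
  rewrite big_nat_recr //= uN; congr (_ * _).
  rewrite (big_cat_nat _ (n := r.+1)) //=; last by lia.
  rewrite big_split /=; congr (_ * _).
  rewrite [RHS]big_nat_rev /= -[in LHS](add1n r) big_addn.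
  have -> : (N - r = r.+1)%N by lia.
  by apply: eq_big_nat => i /andP[h1 h2]; congr (pinf _ (_ ^+ _)); lia.
have P i : (0 < i < r.+1)%N -> th (c ^+ i) (2 * i)%:Z =
    fpsX (`|(2 * i)%:Z - N%:Z| ^ 2)%N * (euler qq * (pinf qq (u ^+ i) * pinf qq (u ^+ (N - i)))).
  move=> /andP[h1 h2]; rewrite th_prod ?unitrX //; last by lia.
  congr (_ * _); rewrite -mulrA; congr (_ * (pinf _ _ * pinf _ _)).
    by rewrite exprMn fpsCX -fpsXM; congr (_ * fpsX _); lia.
  rewrite exprMn fpsCX -fpsXM; congr (fpsC _ * fpsX _); last by rewrite -mulnn; nia.
  rewrite -exprVn; apply: (@mulrI _ (c ^+ i)); first by rewrite unitrX.
  by rewrite -exprD subnKC ?cN -?exprMn ?divrr ?expr1n //; lia.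
rewrite (eq_big_nat _ _ P) 2!big_split /= prodr_const_nat subn1 /=.
have -> : \prod_(1 <= i < r.+1) fpsX (`|(2 * i)%:Z - N%:Z| ^ 2)%N =
    fpsX (\sum_(1 <= i < r.+1) `|(2 * i)%:Z - N%:Z| ^ 2)%N :> fps R.
  by elim/big_rec2: _ => [|i x y _ ->]; rewrite ?fpsX0 // fpsXD.
by ring.
Qed.
End Products.

Section ThetaConstants.
Variable R : idomainType.
Variable N : nat.
Hypothesis N0 : (0 < N)%N.
Local Notation qq := (fpsX (8 * N ^ 2)%N : fps R).
Local Notation th := (@th R N).

Lemma vth_prod : vth R N = euler (qq ^+ 2) * pinf (qq ^+ 2) qq ^+ 2.
Proof.
have q2 : fcoef (qq ^+ 2) 0 = 0 by rewrite fcoefX0 qq0 // expr0n.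
apply: feqm_all => K.
apply: feqm_trans (feqm_sym _); last first.
  rewrite [pinf _ _ ^+ 2]expr2 mulrA; apply: (jtp (L := K.+2)) => //.
  by rewrite expf_neq0 // fpsX_neq0.
have E0 (n : int) : (e0 N 0 n)%:Z = 8 * (N%:Z * N%:Z) * (n * n).
  by rewrite e0E; ring.
have F (n : nat) : e0 N 0 n%:Z = (8 * N ^ 2 * 2 * 'C(n, 2) + 8 * N ^ 2 * n)%N.
  apply/eqP; rewrite -eqz_nat E0 -mulnn.
  by move: (bin2sqz n); move: 'C(n, 2) => b B; rewrite PoszD !PoszM; apply/eqP; nia.
have G n : e0 N 0 (- n) = e0 N 0 n.
  by apply/eqP; rewrite -eqz_nat !E0; apply/eqP; ring.
apply: gs_jser => n.
- by rewrite -exprnP fpsCN1 F fpsXD !fpsXM -mulrA.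
- by rewrite sgz_exprN fpsCN1 G F fpsXD !fpsXM -mulrA.
- move=> lt; have := E0 n; have N1 : (0 < N * N)%N by rewrite muln_gt0 N0.
  move: lt; set X := e0 _ _ _ => lt E.
  have : `|n|%:Z * `|n|%:Z = n * n by rewrite abszE -expr2 real_normK ?num_real.
  nia.
Qed.

Lemma th2_prod : th (-1) 0 = 2%:R * fpsX (N ^ 2)%N * euler qq * pinf qq (- qq) ^+ 2.
Proof.
rewrite -[0]/(0%:Z) th_prod ?unitrN ?unitr1 // muln0 subn0 fpsX0 mulr1 invrN invr1.
rewrite !rmorphN !rmorph1 mulN1r (@pinf_recl _ qq (-1)) ?qq0 // mulrN1 opprK.
have -> : (`|0%:Z - N%:Z| ^ 2 = N ^ 2)%N by rewrite sub0r abszN.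
by rewrite -[1 + 1]/(2%:R); ring.
Qed.

(** The identity theta2 theta3 theta4 = 2 eta^3; together with [T1_prod] it is Jacobi's derivative
    formula, which ties the scale of the curve to the theta constants. *)
Lemma theta_null_prod : (2%:R : R) != 0 ->
  th (-1) 0 * (th 1 N%:Z * th (-1) N%:Z) = 2%:R * fpsX (N ^ 2)%N * euler qq ^+ 3.
Proof.
move=> nz2; rewrite th34 // th2_prod vth_prod.
have q0 : fcoef qq 0 = 0 by exact: qq0.
have q2 : fcoef (qq ^+ 2) 0 = 0 by rewrite fcoefX0 q0 expr0n.
have E1 : euler qq = pinf (qq ^+ 2) qq * euler (qq ^+ 2).
  rewrite /euler (@pinf_split _ 2 qq qq) // !big_ord_recl big_ord0 [nat_of_ord _]/= expr0 mul1r.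
  by rewrite mulr1 -[lift _ _ : nat]/(1%N) expr1 -expr2.
have E2 : pinf qq (- qq) * euler qq = euler (qq ^+ 2).
  rewrite /euler /pinf iprodM; try exact: conv1_pinf.
  by apply: eq_iprod => i; rewrite exprAC; ring.
have U := euler_unit q2; have U1 := euler_unit q0.
apply: (@mulIf _ (euler qq ^+ 2)); first by rewrite expf_neq0 // euler_neq0.
transitivity (2%:R * fpsX (N ^ 2)%N * euler qq * (pinf qq (- qq) * euler qq) ^+ 2 *
  (euler (qq ^+ 2) * pinf (qq ^+ 2) qq ^+ 2) ^+ 2); first by ring.
by rewrite E2 E1; ring.
Qed.

(* The derivative of [th c 0] at [c = 1]. *)
Definition T1 : fps R := gs (fun n : int => (-1) ^ n * n%:~R) (ex N 0).
End ThetaConstants.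

Section T1Prod.
Variable k : fieldType.
Variable N : nat.
Hypothesis N0 : (0 < N)%N.
Local Notation A := (fps k).
Local Notation qq := (fpsX (8 * N ^ 2)%N).

(** Taking k[[t]] as coefficient ring and c = 1 + t gives theta series in two variables;
    differentiating at c = 1 is reading the coefficient of t. *)
Definition opt : A := 1 + fpsX 1.

Lemma opt_unit : opt \is a GRing.unit.
Proof. by apply: fps_unitE; rewrite /= addr0 unitr1. Qed.

Definition tcoef (i : nat) (f : fps A) : fps k := Fps (fun n => fcoef (fcoef f n) i).

Lemma tcoefD i f g : tcoef i (f + g) = tcoef i f + tcoef i g. Proof. exact: fpsP. Qed.
Lemma tcoef_gs i (I : eqType) (w : I -> A) (x : I -> nat) :
  tcoef i (gs w x) = gs (fun j => fcoef (w j) i) x.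
Proof.
apply: fpsP => e; rewrite /tcoef /=; case: pselect => [H|_] //.
by rewrite fcoef_sum.
Qed.

Lemma opt_exp (n : int) : (fcoef (opt ^ n) 0 = 1) /\ (fcoef (opt ^ n) 1 = n%:~R).
Proof.
have H0 m : fcoef (opt ^+ m) 0 = 1 by rewrite fcoefX0 /= addr0 expr1n.
have H1 m : fcoef (opt ^+ m) 1 = m%:R.
  elim: m => // m IH; rewrite exprS fcoefM !big_ord_recl big_ord0 /= H0 IH.
  by rewrite !addr0 !add0r !mul1r natr1.
case: n => m; first by rewrite -exprnP H0 H1.
rewrite NegzE -[opt ^ _]/(opt ^- m.+1).
have U : opt ^+ m.+1 \is a GRing.unit by rewrite unitrX // opt_unit.
have E := divrr U; set g := _^-1 in E *.
have /(congr1 (fun f => fcoef f 0)) := E; rewrite fcoefM big_ord_recl big_ord0 addr0 H0 mul1r fcoef1 /= => g0; rewrite subn0 in g0.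
have /(congr1 (fun f => fcoef f 1)) := E; rewrite fcoefM !big_ord_recl big_ord0 addr0 fcoef1.
rewrite -[nat_of_ord ord0]/0%N -[nat_of_ord (lift _ _)]/1%N subn0 subnn H0 H1 g0 mul1r mulr1 => /eqP.
by rewrite addr_eq0 => /eqP ->; rewrite rmorphN.
Qed.

Lemma th_opt_T1 : tcoef 1 (th N opt 0) = T1 k N.
Proof.
rewrite tcoef_gs; apply: eq_gs => // n; have [E0 E1] := opt_exp n.
rewrite -[- opt]mulN1r exprzMl ?unitrN ?unitr1 ?opt_unit //.
have -> : (-1 : A) ^ n = fpsC ((-1) ^ n).
  case: n {E0 E1} => m; first by rewrite -!exprnP rmorphXn rmorphN1.
  rewrite NegzE -!exprz_inv !invrN !invr1 -!exprnP rmorphXn rmorphN1 //.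
by rewrite fcoefCM E1.
Qed.

(** The simple zero of theta at u = 1 with its leading coefficient. A general x is allowed because
    the argument (1 + t)^ell = 1 + t^ell is needed as well as 1 + t. *)
Lemma th_zero (x : A) : fcoef x 0 = 0 -> exists E, th N (1 + x) 0 = fpsC x * E /\
  fmap (@ev0 k) E = - (fpsX (N ^ 2)%N * euler qq ^+ 3).
Proof.
move=> x0; have Uc : 1 + x \is a GRing.unit by apply: fps_unitE; rewrite fcoefD x0 addr0 unitr1.
rewrite -[X in th _ _ X]/(0%:Z) th_prod // muln0 subn0 fpsX0 mulr1.
rewrite (@pinf_recl _ qq) ?qq0 //.
set G := pinf _ (qq * _); set H := pinf _ (fpsC (1 + x)^-1 * _).
have -> : (`|0%:Z - N%:Z| ^ 2 = N ^ 2)%N by rewrite sub0r abszN.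
exists (- (fpsX (N ^ 2)%N * (euler qq * G * H))); split; first by rewrite rmorphD rmorph1; ring.
rewrite rmorphN !rmorphM /= fmap_X; congr (- (_ * _)).
have q0 : fcoef (qq : fps A) 0 = 0 by exact: qq0.
have e0 : ev0 (1 + x) = 1 by rewrite -[ev0 _]/(1 + fcoef x 0) x0 addr0.
have e1 : ev0 (1 + x)^-1 = 1.
  have : ev0 (1 + x) * ev0 (1 + x)^-1 = 1 by rewrite -(rmorphM (@ev0 k)) divrr // rmorph1.
  by rewrite e0 mul1r.
rewrite /euler /G /H !fmap_pinf // !rmorphM /= !fmap_X !fmap_C.
rewrite [X in qq * fpsC X](_ : _ = 1) // [X in fpsC X * qq](_ : _ = 1) // rmorph1 mulr1 mul1r.
by ring.
Qed.

Lemma tcoef_X1 f : tcoef 1 (fpsC (fpsX 1) * f) = fmap (@ev0 k) f.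
Proof.
apply: fpsP => n; rewrite -[LHS]/(fcoef (fcoef (fpsC (fpsX 1) * f) n) 1) fcoefCM fcoefXM.
by rewrite ltnn subnn.
Qed.

Lemma T1_prod : T1 k N = - (fpsX (N ^ 2)%N * euler qq ^+ 3).
Proof.
rewrite -th_opt_T1; have [E [-> <-]] := @th_zero (fpsX 1) erefl.
exact: tcoef_X1.
Qed.
End T1Prod.

End ProductFormula.

(** * Location of the zeros of theta *)

Module ThetaIdentities.
Import PowerSeries FormalSums Theta TripleProduct ProductFormula.

Section ThNeq0.
Variable R : idomainType.
Variable N : nat.
Hypothesis N0 : (0 < N)%N.

Lemma th_shiftz (c : R) m (a : int) : c \is a GRing.unit ->
  th N c (m + (2 * N)%:Z * a) = fpsC ((- c^-1) ^ a) * th N c m.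
Proof.
move=> Uc; have U : - c^-1 \is a GRing.unit by rewrite unitrN unitrV.
have P (b : nat) m' : th N c (m' + (2 * N)%:Z * b%:Z) = fpsC ((- c^-1) ^ b%:Z) * th N c m'.
  elim: b => [|b IH]; first by rewrite mulr0 addr0 expr0z rmorph1 mul1r.
  rewrite intS mulrDr mulr1 addrCA -[X in th N c X]addrC th_shift // IH.
  rewrite (exprzDr U 1) expr1z fpsCM -mulrA -mulNr; congr (_ * _).
  by rewrite rmorphN.
case: a => b; first exact: P.
rewrite NegzE mulrN.
have := P b.+1 (m - (2 * N)%:Z * b.+1%:Z); rewrite subrK => ->.
rewrite mulrA -fpsCM -exprzDr // addNr expr0z.
by rewrite -[fpsC 1]/(fpsC (1 : R)) rmorph1 mul1r.
Qed.

Lemma pinf_neq0 (q z : fps R) : fcoef q 0 = 0 -> fcoef z 0 != 1 -> pinf q z != 0.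
Proof.
move=> q0 z1; apply/eqP => /(congr1 (fun f => fcoef f 0)).
rewrite /pinf fcoef0_iprod expr0 mul1r fcoefB fcoef1 fcoef0 => /eqP.
by rewrite subr_eq0 eq_sym; apply/negP.
Qed.

(** After reducing m modulo 2 N by quasi-periodicity, the product formula allows zeros only at the
    powers of q, that is c = 1 with m divisible by 2 N. *)
Lemma th_neq0 (c : R) m : c \is a GRing.unit ->
  (((2 * N)%:Z %| m)%Z -> c != 1) -> th N c m != 0.
Proof.
move=> Uc H; rewrite (divz_eq m (2 * N)%:Z) addrC mulrC th_shiftz //.
have U : - c^-1 \is a GRing.unit by rewrite unitrN unitrV.
rewrite mulf_neq0 //.
  rewrite -(rmorph0 (@fpsC R)) (inj_eq (@fpsC_inj R)).
  by apply: contraTneq (unitrXz (m %/ (2 * N)%:Z)%Z U) => ->; rewrite unitr0.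
have ge := modz_ge0 m (twoN_neq0 N0).
have lt : (m %% (2 * N)%:Z)%Z < (2 * N)%:Z by apply: ltz_pmod; lia.
have {}H : (m %% (2 * N)%:Z)%Z = 0 -> c != 1 by move=> E; apply: H; apply/dvdz_mod0P.
case: (m %% _)%Z ge lt H => // a _ lt H; rewrite th_prod //; last by lia.
rewrite !mulf_neq0 ?fpsX_neq0 ?euler_neq0 ?qq0 //; apply: pinf_neq0; rewrite ?qq0 // fcoefCM.
  have [a0|a1] := posnP a; first by rewrite a0 muln0 /= mulr1; apply: H; rewrite a0.
  by rewrite fpsX_coef0 ?muln_gt0 ?N0 ?a1 // mulr0 eq_sym oner_eq0.
by rewrite fpsX_coef0 ?mulr0 1?eq_sym ?oner_eq0 // -mulnn; nia.
Qed.
End ThNeq0.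

End ThetaIdentities.

(** * Fractions of power series and the Tate curve from theta quotients *)

Module TateCurve.
Import generic_quotient.
Import PowerSeries FormalSums Theta TripleProduct ProductFormula ThetaIdentities.

Definition is_frac (R : idomainType) (F : fieldType) (iota : R -> F) :=
  injective iota /\ forall x, exists a b, b != 0 /\ x = iota a / iota b.

Lemma frac_ex (R : idomainType) (x : {fraction R}) :
  exists a b : R, b != 0 /\ x = FracField.tofrac a / FracField.tofrac b.
Proof.
exists \n_(repr x), \d_(repr x); have nz := denom_ratioP (repr x); split=> //.
apply: (canRL (mulfK _)); first by rewrite tofrac_eq0.
rewrite -{1}[x]reprK !piE; apply/eqmodP.
rewrite /= FracField.equivfE /FracField.mulf !numden_Ratio ?oner_eq0 // ?mulf_neq0 ?oner_eq0 //.
by rewrite !mulr1 mulrC.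
Qed.

(* The fraction field is only used through [is_frac]: unfolding the quotient
   construction makes unification very slow. *)
Lemma frac_exists (R : idomainType) :
  exists (F : fieldType) (iota : {rmorphism R -> F}), is_frac iota.
Proof.
exists {fraction R}, (@FracField.tofrac R); split=> [a b /eqP|x].
  by rewrite tofrac_eq => /eqP.
exact: frac_ex.
Qed.

Section FracExt.
Variables (R : idomainType) (F : fieldType) (iota : {rmorphism R -> F}).
Hypothesis Fr : is_frac iota.

Lemma iota_eq (a b : R) : (iota a == iota b) = (a == b).
Proof. by apply/eqP/eqP => [/(proj1 Fr)|->]. Qed.
Lemma iota_eq0 (a : R) : (iota a == 0) = (a == 0).
Proof. by rewrite -(rmorph0 iota) iota_eq. Qed.

Lemma divF_eq (a b c d : R) : b != 0 -> d != 0 ->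
  (iota a / iota b == iota c / iota d) = (a * d == c * b).
Proof.
move=> b0 d0; rewrite -(iota_eq (a * d)) !rmorphM.
by rewrite eqr_div ?iota_eq0.
Qed.
End FracExt.

Section FracMap.
Variables (R : idomainType) (F : fieldType) (iota : {rmorphism R -> F}).
Hypothesis Fr : is_frac iota.
Variable phi : {rmorphism R -> R}.
Hypothesis phi_inj : injective phi.

Definition fracmap (x : F) : F :=
  let ab := cid (proj2 Fr x) in iota (phi (projT1 ab)) / iota (phi (projT1 (cid (projT2 ab)))).

Lemma phi_neq0 b : b != 0 -> phi b != 0.
Proof. by apply: contraNneq => E; apply/eqP/phi_inj; rewrite E rmorph0. Qed.

Lemma fracmapE a b : b != 0 -> fracmap (iota a / iota b) = iota (phi a) / iota (phi b).
Proof.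
move=> b0; rewrite /fracmap; case: cid => a' H /=; case: cid => b' [b'0 E] /=.
move/eqP: E; rewrite (divF_eq Fr) // => /eqP E.
by apply/eqP; rewrite (divF_eq Fr) ?phi_neq0 // -!rmorphM E.
Qed.

Lemma fracmap_iota a : fracmap (iota a) = iota (phi a).
Proof. by have := @fracmapE a 1 (oner_neq0 _); rewrite !rmorph1 !divr1. Qed.

Lemma fracmap_zmod : zmod_morphism fracmap.
Proof.
move=> x y; have [a [b [b0 ->]]] := proj2 Fr x; have [c [d [d0 ->]]] := proj2 Fr y.
rewrite -mulNr -rmorphN addf_div ?(iota_eq0 Fr) // -!rmorphM -rmorphD !fracmapE ?mulf_neq0 //.
rewrite -mulNr -rmorphN addf_div ?(iota_eq0 Fr) ?phi_neq0 //.
by rewrite -!rmorphM -rmorphD !(rmorphD, rmorphM, rmorphN).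
Qed.

Lemma fracmap_monoid : monoid_morphism fracmap.
Proof.
split; first by rewrite -(rmorph1 iota) fracmap_iota rmorph1.
move=> x y; have [a [b [b0 ->]]] := proj2 Fr x; have [c [d [d0 ->]]] := proj2 Fr y.
rewrite mulf_div -!rmorphM !fracmapE ?mulf_neq0 // mulf_div -!rmorphM.
by rewrite !rmorphM.
Qed.
HB.instance Definition _ := GRing.isZmodMorphism.Build _ _ fracmap fracmap_zmod.
HB.instance Definition _ := GRing.isMonoidMorphism.Build _ _ fracmap fracmap_monoid.
End FracMap.

Section FracDer.
Variables (R : idomainType) (F : fieldType) (iota : {rmorphism R -> F}).
Hypothesis Fr : is_frac iota.
Variable d : R -> R.
Hypothesis dD : forall x y, d (x + y) = d x + d y.
Hypothesis dM : forall x y, d (x * y) = d x * y + x * d y.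

Definition fracder (x : F) : F :=
  let ab := cid (proj2 Fr x) in
  let a := projT1 ab in let b := projT1 (cid (projT2 ab)) in
  iota (d a * b - a * d b) / iota (b ^+ 2).

Lemma fracderE a b : b != 0 -> fracder (iota a / iota b) = iota (d a * b - a * d b) / iota (b ^+ 2).
Proof.
move=> b0; rewrite /fracder; case: cid => a' H /=; case: cid => b' [b'0 E] /=.
move/eqP: E; rewrite (divF_eq Fr) // => /eqP E.
have E' : d a * b' + a * d b' = d a' * b + a' * d b by rewrite -!dM E.
apply/eqP; rewrite (divF_eq Fr) ?expf_neq0 //; apply/eqP.
transitivity (b * b' * (d a' * b) - (a' * b) * b * d b'); first by ring.
have -> : d a' * b = d a * b' + a * d b' - a' * d b by rewrite E'; ring.
transitivity (b * b' ^+ 2 * d a + b * b' * a * d b' - b' * (a' * b) * d b - (a' * b) * b * d b').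
  by ring.
by rewrite -E; ring.
Qed.

Lemma der1 : d 1 = 0.
Proof.
have := dM 1 1; rewrite !mulr1 mul1r => E.
by apply: (@addrI _ (d 1)); rewrite addr0 -E.
Qed.

Lemma fracder_iota a : fracder (iota a) = iota (d a).
Proof.
have := @fracderE a 1 (oner_neq0 _).
by rewrite der1 mulr0 subr0 mulr1 expr1n rmorph1 !divr1.
Qed.

Lemma fracderD x y : fracder (x + y) = fracder x + fracder y.
Proof.
have [a [b [b0 ->]]] := proj2 Fr x; have [c [e [e0 ->]]] := proj2 Fr y.
rewrite addf_div ?(iota_eq0 Fr) // -!rmorphM -rmorphD !fracderE ?mulf_neq0 //.
rewrite addf_div ?(iota_eq0 Fr) ?expf_neq0 // -!rmorphM -rmorphD; apply/eqP.
rewrite (divF_eq Fr) ?mulf_neq0 ?expf_neq0 ?mulf_neq0 // !(dD, dM); apply/eqP; ring.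
Qed.

Lemma fracderM x y : fracder (x * y) = fracder x * y + x * fracder y.
Proof.
have [a [b [b0 ->]]] := proj2 Fr x; have [c [e [e0 ->]]] := proj2 Fr y.
rewrite mulf_div -!rmorphM !fracderE ?mulf_neq0 // !mulf_div -!rmorphM.
rewrite addf_div ?(iota_eq0 Fr) ?mulf_neq0 ?expf_neq0 // -!rmorphM -rmorphD; apply/eqP.
rewrite (divF_eq Fr) ?mulf_neq0 ?expf_neq0 ?mulf_neq0 // !(dD, dM); apply/eqP; ring.
Qed.
End FracDer.

(** The properties of theta series from which the elliptic identities follow, with the scale [TT]
    left free. The record is instantiated over k for the torsion points and over k[[t]] for a point
    near the origin, and it hides the series from unification. *)
Record thdata (R : idomainType) (N : nat) (F : fieldType) := Thdata {
  cst : R -> F; tt : R -> int -> F; rr0 : R -> int -> F; rr1 : R -> int -> F; TT : F;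
  cstM : forall a b, cst (a * b) = cst a * cst b;
  cst1 : cst 1 = 1;
  cstN : forall a, cst (- a) = - cst a;
  cst_neq0 : forall a, a \is a GRing.unit -> cst a != 0;
  tt_neq0 : forall c m, c \is a GRing.unit -> (((2 * N)%:Z %| m)%Z -> c != 1) -> tt c m != 0;
  tt_shift : forall c m, c \is a GRing.unit -> tt c (m + (2 * N)%:Z) = - (tt c m / cst c);
  tt_inv : forall c m, c \is a GRing.unit -> tt c^-1 (- m) = - (tt c m / cst c);
  rr0N : forall c m, rr0 (- c) m = rr0 c m;
  rr1N : forall c m, c \is a GRing.unit -> rr1 (- c) m = - rr1 c m;
  tt_bil0 : forall c1 m1 c2 m2, c1 \is a GRing.unit -> c2 \is a GRing.unit ->
    tt (c1 * c2) (m1 + m2) * tt (c1 / c2) (m1 - m2) =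
    cst c1 * (rr1 c1 m1 * rr0 c2 m2 - rr0 c1 m1 * rr1 c2 m2);
  tt_dup : forall c m, c \is a GRing.unit ->
    tt (c ^+ 2) (2 * m) * (tt (-1) 0 * tt (-1) N%:Z * tt 1 N%:Z) =
    2%:R * (tt c m * tt (- c) m * (tt c (m + N%:Z) * tt (- c) (m + N%:Z)));
  TT_neq0 : TT != 0;
  two_neq0 : (2%:R : F) != 0 }.

Section Concrete.
Variable R : idomainType.
Variable N : nat.
Hypothesis N0 : (0 < N)%N.
Hypothesis nz2 : (2%:R : R) != 0.
Variables (F : fieldType) (iota : {rmorphism fps R -> F}).
Hypothesis Fr : is_frac iota.
Variable T : F.
Hypothesis T0 : T != 0.

Lemma iota_cst_neq0 a : a \is a GRing.unit -> iota (fpsC a) != 0.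
Proof.
move=> Ua; rewrite (iota_eq0 Fr) -(rmorph0 (@fpsC R)) (inj_eq (@fpsC_inj R)).
by apply: contraTneq Ua => ->; rewrite unitr0.
Qed.

Lemma iota_cstV a : a \is a GRing.unit -> iota (fpsC a^-1) = (iota (fpsC a))^-1.
Proof.
move=> Ua; have E : iota (fpsC a) * iota (fpsC a^-1) = 1.
  by rewrite -rmorphM -fpsCM divrr // !rmorph1.
by apply: (mulfI (iota_cst_neq0 Ua)); rewrite E divff // iota_cst_neq0.
Qed.

Definition thdata_of : thdata R N F.
Proof.
exists (fun c => iota (fpsC c)) (fun c m => iota (th N c m))
  (fun c m => iota (R0 N c m)) (fun c m => iota (R1 N c m)) T => //.
- by move=> a b; rewrite fpsCM rmorphM.
- by rewrite !rmorph1.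
- by move=> a; rewrite !rmorphN.
- exact: iota_cst_neq0.
- by move=> c m Uc H; rewrite (iota_eq0 Fr); apply: th_neq0.
- by move=> c m Uc; rewrite th_shift // rmorphN rmorphM iota_cstV // mulrC.
- by move=> c m Uc; rewrite th_inv // rmorphN rmorphM iota_cstV // mulrC.
- by move=> c m; rewrite R0_opp.
- by move=> c m Uc; rewrite R1_opp // rmorphN.
- by move=> c1 m1 c2 m2 U1 U2; rewrite -rmorphM th_bil // rmorphM rmorphB !rmorphM.
- by move=> c m Uc; rewrite -!rmorphM th_dup // !rmorphM rmorph_nat.
- rewrite -(rmorph_nat iota) (iota_eq0 Fr) -(rmorph_nat (@fpsC R)) -(rmorph0 (@fpsC R)).
  by rewrite (inj_eq (@fpsC_inj R)).
Defined.
End Concrete.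

Section Elliptic.
Variables (R : idomainType) (N : nat) (F : fieldType) (D : thdata R N F).
Hypothesis N0 : (0 < N)%N.
Hypothesis nz2 : (2%:R : R) != 0.
Local Notation cst := (cst D).
Local Notation tt := (tt D).
Local Notation rr0 := (rr0 D).
Local Notation rr1 := (rr1 D).
Local Notation T := (TT D).
Local Notation T0 := (TT_neq0 D).
Definition th2 := tt (-1) 0.
Definition th3 := tt (-1) N%:Z.
Definition th4 := tt 1 N%:Z.

Lemma cstV a : a \is a GRing.unit -> cst a^-1 = (cst a)^-1.
Proof.
move=> Ua; have n0 := cst_neq0 D Ua; apply: (mulfI n0).
by rewrite divff // -cstM divrr // cst1.
Qed.
Lemma cstX a n : cst (a ^+ n) = cst a ^+ n.
Proof. by elim: n => [|n IH]; rewrite ?expr0 ?cst1 // !exprS cstM IH. Qed.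

Local Notation good c m := (((2 * N)%:Z %| m)%Z -> c != 1).

Lemma ndvdN : ((2 * N)%:Z %| N%:Z)%Z = false.
Proof.
clear D nz2.
apply/negbTE/dvdzP => -[a]; rewrite PoszM => E; have := N0.
by have [a0|a1] := lerP a 0; nia.
Qed.

Lemma N1_neq1 : -1 != 1 :> R.
Proof. by rewrite eq_sym -subr_eq0 opprK. Qed.

Lemma th2_neq0 : th2 != 0. Proof. by apply: tt_neq0 => [|_]; rewrite ?unitrN ?unitr1 ?N1_neq1. Qed.
Lemma th3_neq0 : th3 != 0. Proof. by apply: tt_neq0; rewrite ?unitrN ?unitr1 ?ndvdN. Qed.
Lemma th4_neq0 : th4 != 0. Proof. by apply: tt_neq0; rewrite ?unitr1 ?ndvdN. Qed.

(** The 2 x 2 minors of the vectors (rr0, rr1), weighted by the constants; their three-term Plucker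
    relation is the source of the elliptic recurrence. *)
Definition dR (c1 : R) (m1 : int) (c2 : R) (m2 : int) : F :=
  cst c1 * cst c2 * (rr1 c1 m1 * rr0 c2 m2 - rr0 c1 m1 * rr1 c2 m2).

Lemma tt_bil c1 m1 c2 m2 : c1 \is a GRing.unit -> c2 \is a GRing.unit ->
  cst c2 * tt (c1 * c2) (m1 + m2) * tt (c1 / c2) (m1 - m2) = dR c1 m1 c2 m2.
Proof.
by move=> U1 U2; rewrite -mulrA tt_bil0 // /dR; ring.
Qed.

Lemma tt_sqr c m : c \is a GRing.unit -> tt c m ^+ 2 = dR c m 1 0.
Proof.
by move=> Uc; rewrite -tt_bil ?unitr1 // cst1 mul1r !mulr1 invr1 mulr1 ?subr0 ?addr0 expr2.
Qed.

Lemma tt_plucker ca ma cb mb cc mc cd md :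
  dR ca ma cb mb * dR cc mc cd md - dR ca ma cc mc * dR cb mb cd md
    + dR ca ma cd md * dR cb mb cc mc = 0.
Proof. by rewrite /dR; ring. Qed.

Lemma tt_B c1 m1 c2 m2 : c1 \is a GRing.unit -> c2 \is a GRing.unit ->
  tt c1 m1 ^+ 2 * tt (- c2) m2 ^+ 2 - tt (- c1) m1 ^+ 2 * tt c2 m2 ^+ 2 =
  cst c2 * tt (c1 * c2) (m1 + m2) * tt (c1 / c2) (m1 - m2) * th2 ^+ 2.
Proof.
move=> U1 U2; rewrite tt_bil // /th2 !tt_sqr ?unitrN ?unitr1 //.
rewrite /dR !rr0N !rr1N ?unitr1 // !cstN !cst1.
by ring.
Qed.

(** Jacobi's quartic identity, from [tt_B] at the 2-torsion points q^(1/2) and - q^(1/2). *)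
Lemma jacobi_id : th3 ^+ 4 - th4 ^+ 4 = th2 ^+ 4.
Proof.
have U : (-1 : R) \is a GRing.unit by rewrite unitrN unitr1.
have := @tt_B 1 N%:Z (-1) N%:Z (unitr1 _) U.
rewrite opprK !mul1r subrr cstN cst1 invrN invr1 -/th3 -/th4 -/th2.
have -> : N%:Z + N%:Z = 0 + (2 * N)%:Z by lia.
rewrite tt_shift // cstN cst1 -/th2 => E.
transitivity (- (th4 ^+ 2 * th4 ^+ 2 - th3 ^+ 2 * th3 ^+ 2)); first by ring.
by rewrite E; field; rewrite oppr_eq0 oner_eq0.
Qed.

(** Up to scaling, X is the Weierstrass function minus its value at u = -1 and Y is its derivative,
    in the form sigma(2 z) / sigma(z)^4. Thus the three points of order two have X = 0, [al] and
    [be]. *)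
Definition Xf (c : R) (m : int)  := T ^+ 2 * tt (- c) m ^+ 2 / (tt c m ^+ 2 * th2 ^+ 2).
Definition Yf (c : R) (m : int)  := cst c * tt (c ^+ 2) (2 * m) * T ^+ 3 / tt c m ^+ 4.
Definition al := Xf 1 N%:Z.
Definition be := Xf (-1) N%:Z.

Lemma alE : al = T ^+ 2 * th3 ^+ 2 / (th4 ^+ 2 * th2 ^+ 2). Proof. by []. Qed.
Lemma beE : be = T ^+ 2 * th4 ^+ 2 / (th3 ^+ 2 * th2 ^+ 2).
Proof. by rewrite /be /Xf opprK. Qed.

Lemma al_neq0 : al != 0.
Proof. by rewrite alE !mulf_neq0 ?invr_eq0 ?mulf_neq0 ?expf_neq0 ?T0 ?th2_neq0 ?th3_neq0 ?th4_neq0. Qed.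
Lemma be_neq0 : be != 0.
Proof. by rewrite beE !mulf_neq0 ?invr_eq0 ?mulf_neq0 ?expf_neq0 ?T0 ?th2_neq0 ?th3_neq0 ?th4_neq0. Qed.
Lemma al_sub_be : al - be = T ^+ 2 * th2 ^+ 2 / (th3 ^+ 2 * th4 ^+ 2).
Proof.
rewrite alE beE; have := th2_neq0; have := th3_neq0; have := th4_neq0 => h4 h3 h2.
have E : th2 ^+ 4 = th3 ^+ 4 - th4 ^+ 4 by rewrite jacobi_id.
apply: (@mulIf _ (th2 ^+ 2 * th3 ^+ 2 * th4 ^+ 2)); first by rewrite !mulf_neq0 ?expf_neq0.
transitivity (T ^+ 2 * (th3 ^+ 4 - th4 ^+ 4)); first by field; rewrite h2 h3 h4.
by rewrite -E; field; rewrite h3 h4.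
Qed.
Lemma disc_prod : al * be * (al - be) = T ^+ 6 / (th2 * (th3 * th4)) ^+ 2.
Proof.
rewrite al_sub_be alE beE; field.
by rewrite th2_neq0 th3_neq0 th4_neq0.
Qed.

Section OnePoint.
Variables (c : R) (m : int).
Hypothesis Uc : c \is a GRing.unit.
Hypothesis gc : good c m.

Lemma X_shift : Xf c (m + (2 * N)%:Z) = Xf c m.
Proof.
rewrite /Xf !tt_shift ?unitrN // cstN; have := tt_neq0 D Uc gc => t0.
by field; rewrite ?oppr_eq0 ?th2_neq0 ?t0 ?cst_neq0.
Qed.

Lemma Y_shift : Yf c (m + (2 * N)%:Z) = Yf c m.
Proof.
rewrite /Yf; have -> : 2 * (m + (2 * N)%:Z) = 2 * m + (2 * N)%:Z + (2 * N)%:Z by ring.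
rewrite !tt_shift ?unitrX // cstX; have := tt_neq0 D Uc gc => t0.
by field; rewrite ?oppr_eq0 ?t0 ?cst_neq0.
Qed.

Lemma X_inv : Xf c^-1 (- m) = Xf c m.
Proof.
rewrite /Xf -invrN !tt_inv ?unitrN // cstN; have := tt_neq0 D Uc gc => t0.
by field; rewrite ?oppr_eq0 ?th2_neq0 ?t0 ?cst_neq0.
Qed.

Lemma Y_inv : Yf c^-1 (- m) = - Yf c m.
Proof.
rewrite /Yf exprVn mulrN !tt_inv ?unitrX // cstX cstV //; have := tt_neq0 D Uc gc => t0.
by field; rewrite ?oppr_eq0 ?t0 ?cst_neq0.
Qed.
End OnePoint.

(** The analogue of the sigma-function formula for the difference of two values of the Weierstrass
    function; it shows that X separates points up to sign. *)
Lemma X_sub c1 m1 c2 m2 : c1 \is a GRing.unit -> c2 \is a GRing.unit ->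
  good c1 m1 -> good c2 m2 ->
  Xf c1 m1 - Xf c2 m2 = - (T ^+ 2 * cst c2 * tt (c1 * c2) (m1 + m2) * tt (c1 / c2) (m1 - m2)
     / (tt c1 m1 * tt c2 m2) ^+ 2).
Proof.
move=> U1 U2 g1 g2; have t1 := tt_neq0 D U1 g1; have t2 := tt_neq0 D U2 g2.
have E := tt_B m1 m2 U1 U2.
have h2 := th2_neq0.
apply: (@mulIf _ (tt c1 m1 ^+ 2 * tt c2 m2 ^+ 2 * th2 ^+ 2)); first by rewrite !mulf_neq0 ?expf_neq0.
rewrite /Xf.
transitivity (- (T ^+ 2 * (tt c1 m1 ^+ 2 * tt (- c2) m2 ^+ 2 - tt (- c1) m1 ^+ 2 * tt c2 m2 ^+ 2))).
  by field; rewrite h2 t1 t2.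
by rewrite E; field; rewrite t1 t2.
Qed.

Lemma al_be : al * be = T ^+ 4 / th2 ^+ 4.
Proof. by rewrite alE beE; field; rewrite th2_neq0 th3_neq0 th4_neq0. Qed.
Lemma al_albe : al * (al - be) = T ^+ 4 / th4 ^+ 4.
Proof. by rewrite al_sub_be alE; field; rewrite th2_neq0 th3_neq0 th4_neq0. Qed.
Lemma be_beal : be * (be - al) = - (T ^+ 4 / th3 ^+ 4).
Proof. by rewrite -opprB al_sub_be beE; field; rewrite th2_neq0 th3_neq0 th4_neq0. Qed.

Section Points.
Variables (c : R) (m : int).
Hypothesis Uc : c \is a GRing.unit.

Let U1 : (-1 : R) \is a GRing.unit. Proof. by rewrite unitrN unitr1. Qed.

Lemma tt_back : tt c (m - N%:Z) = - (cst c * tt c (m + N%:Z)).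
Proof.
have -> : m + N%:Z = m - N%:Z + (2 * N)%:Z by lia.
by rewrite tt_shift //; field; rewrite cst_neq0.
Qed.

Lemma X_al : good c m -> Xf c m - al = T ^+ 2 * cst c * tt c (m + N%:Z) ^+ 2 / (tt c m * th4) ^+ 2.
Proof.
move=> g; have t0 := tt_neq0 D Uc g.
rewrite X_sub ?unitr1 ?ndvdN //.
rewrite cst1 invr1 !mulr1 tt_back -/th4; field.
by rewrite t0 th4_neq0.
Qed.

Lemma X_be : good c m ->
  Xf c m - be = T ^+ 2 * cst c * tt (- c) (m + N%:Z) ^+ 2 / (tt c m * th3) ^+ 2.
Proof.
move=> g; have t0 := tt_neq0 D Uc g.
rewrite X_sub ?ndvdN //.
rewrite cstN cst1 invrN invr1 !mulrN1.
have -> : m + N%:Z = m - N%:Z + (2 * N)%:Z by lia.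
rewrite tt_shift ?unitrN // cstN -/th3; field.
by rewrite t0 ?oppr_eq0 cst_neq0 // th3_neq0.
Qed.

Lemma Y_sqr : good c m -> Yf c m ^+ 2 = 4%:R * (Xf c m * (Xf c m - al) * (Xf c m - be)).
Proof.
move=> g; have t0 := tt_neq0 D Uc g; rewrite X_al // X_be // /Yf /Xf.
have h2 := th2_neq0; have h3 := th3_neq0; have h4 := th4_neq0.
have E := tt_dup D m Uc; rewrite -/th2 -/th3 -/th4 in E.
have -> : tt (c ^+ 2) (2 * m) =
  2%:R * (tt c m * tt (- c) m * (tt c (m + N%:Z) * tt (- c) (m + N%:Z))) / (th2 * th3 * th4).
  by rewrite -E mulfK // !mulf_neq0.
by field; rewrite t0 h2 h3 h4.
Qed.
End Points.

Lemma X_sqr_sub c m : c \is a GRing.unit -> tt c m != 0 ->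
  Xf c m ^+ 2 - al * be = T ^+ 4 * cst c * tt (- c ^+ 2) (2 * m) / (tt c m ^+ 4 * th2).
Proof.
move=> Uc t0; have U' : - c \is a GRing.unit by rewrite unitrN.
have := tt_B m m Uc U'; rewrite opprK mulrN -expr2 subrr invrN mulrN divrr // cstN -/th2.
rewrite (_ : m + m = 2 * m) => [E|]; last by ring.
rewrite al_be /Xf; have h2 := th2_neq0.
transitivity (- (T ^+ 4 * (tt c m ^+ 2 * tt c m ^+ 2 - tt (- c) m ^+ 2 * tt (- c) m ^+ 2) /
  (tt c m ^+ 4 * th2 ^+ 4))); first by field; rewrite t0 h2.
by rewrite E; field; rewrite t0 h2.
Qed.

Lemma X_dbl c m : c \is a GRing.unit -> tt c m != 0 -> tt (c ^+ 2) (2 * m) != 0 ->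
  Xf (c ^+ 2) (2 * m) * Yf c m ^+ 2 = (Xf c m ^+ 2 - al * be) ^+ 2.
Proof.
move=> Uc t0 t2; rewrite X_sqr_sub // /Xf /Yf; field.
by rewrite t0 t2 th2_neq0.
Qed.

(** Translation by the 2-torsion point of abscissa [al] is a Moebius involution in X. *)
Lemma X_al_shift c m : c \is a GRing.unit -> good c m -> good c (m + N%:Z) ->
  (Xf c m - al) * (Xf c (m + N%:Z) - al) = al * (al - be).
Proof.
move=> Uc g g1; have t0 := tt_neq0 D Uc g; have t1 := tt_neq0 D Uc g1; have h4 := th4_neq0.
rewrite al_albe !X_al // -addrA (_ : N%:Z + N%:Z = (2 * N)%:Z); last by lia.
by rewrite tt_shift //; field; rewrite t0 t1 h4 cst_neq0.
Qed.

Lemma X_al_sub c m : c \is a GRing.unit -> good c m -> good c (m + N%:Z) ->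
  Xf c m ^+ 2 - 2%:R * al * Xf c m + al * be =
  T ^+ 4 * cst c ^+ 2 * tt (c ^+ 2) (2 * m + N%:Z) / (tt c m ^+ 4 * th4).
Proof.
move=> Uc g g1; have t0 := tt_neq0 D Uc g; have t1 := tt_neq0 D Uc g1; have h4 := th4_neq0.
transitivity ((Xf c m - al) * (Xf c m - al) - al * (al - be)); first by ring.
rewrite -(X_al_shift Uc g g1).
rewrite -mulrBr opprB addrA subrK X_al // X_sub // -expr2 divrr //.
have -> : m - (m + N%:Z) = - N%:Z by ring.
have -> : m + (m + N%:Z) = 2 * m + N%:Z by ring.
have E : tt 1 (- N%:Z) = - th4.
  by have := tt_inv D N%:Z (unitr1 R); rewrite invr1 cst1 divr1.
rewrite E; field.
by rewrite t0 t1 h4.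
Qed.

Lemma X_be_sub c m : c \is a GRing.unit -> good c m -> good (- c) (m + N%:Z) ->
  Xf c m ^+ 2 - 2%:R * be * Xf c m + al * be =
  T ^+ 4 * cst c ^+ 2 * tt (- c ^+ 2) (2 * m + N%:Z) / (tt c m ^+ 4 * th3).
Proof.
move=> Uc g g1; have U' : - c \is a GRing.unit by rewrite unitrN.
have t0 := tt_neq0 D Uc g; have t1 := tt_neq0 D U' g1; have h3 := th3_neq0.
transitivity ((Xf c m - be) * (Xf c m - be) - be * (be - al)); first by ring.
have -> : be * (be - al) = (Xf c m - be) * (Xf (- c) (m + N%:Z) - be).
  rewrite be_beal !X_be // opprK -addrA (_ : N%:Z + N%:Z = (2 * N)%:Z); last by lia.
  by rewrite tt_shift // cstN; field; rewrite t0 t1 h3 cst_neq0.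
rewrite -mulrBr opprB addrA subrK X_be // X_sub //.
have -> : c * - c = - c ^+ 2 by rewrite mulrN expr2.
have -> : c / - c = -1 by rewrite invrN mulrN divrr.
have -> : m - (m + N%:Z) = - N%:Z by ring.
have -> : m + (m + N%:Z) = 2 * m + N%:Z by ring.
have E : tt (-1) (- N%:Z) = th3.
  have := tt_inv D N%:Z (_ : (-1 : R) \is a GRing.unit); rewrite invrN invr1 unitrN unitr1 => -> //.
  by rewrite cstN cst1 -/th3; field; rewrite oppr_eq0 oner_eq0.
rewrite E cstN; field.
by rewrite t0 t1 h3.
Qed.

Lemma Y_dbl c m : c \is a GRing.unit -> good c m -> good c (m + N%:Z) ->
  good (- c) (m + N%:Z) -> good (c ^+ 2) (2 * m) ->
  Yf (c ^+ 2) (2 * m) * Yf c m ^+ 3 = 2%:R * (Xf c m ^+ 2 - al * be) *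
    (Xf c m ^+ 2 - 2%:R * al * Xf c m + al * be) *
    (Xf c m ^+ 2 - 2%:R * be * Xf c m + al * be).
Proof.
move=> Uc g g1 g2 g3; have U2 : c ^+ 2 \is a GRing.unit by rewrite unitrX.
have t0 := tt_neq0 D Uc g; have t2 := tt_neq0 D U2 g3.
have h2 := th2_neq0; have h3 := th3_neq0; have h4 := th4_neq0.
rewrite X_sqr_sub // X_al_sub // X_be_sub // /Yf cstX.
have E := tt_dup D (2 * m) U2; rewrite -/th2 -/th3 -/th4 in E.
have -> : tt ((c ^+ 2) ^+ 2) (2 * (2 * m)) = 2%:R * (tt (c ^+ 2) (2 * m) * tt (- c ^+ 2) (2 * m) *
  (tt (c ^+ 2) (2 * m + N%:Z) * tt (- c ^+ 2) (2 * m + N%:Z))) / (th2 * th3 * th4).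
  by rewrite -E mulfK // !mulf_neq0.
by field; rewrite t0 t2 h2 h3 h4.
Qed.

Section Addition.
Variables (c1 : R) (m1 : int) (c2 : R) (m2 : int).
Hypotheses (U1 : c1 \is a GRing.unit) (U2 : c2 \is a GRing.unit).
Hypotheses (g1 : good c1 m1) (g2 : good c2 m2).
Hypotheses (gp : good (c1 * c2) (m1 + m2)) (gm : good (c1 / c2) (m1 - m2)).

Let t1 : tt c1 m1 != 0. Proof. exact: (tt_neq0 D U1 g1). Qed.
Let t2 : tt c2 m2 != 0. Proof. exact: (tt_neq0 D U2 g2). Qed.
Let Up : c1 * c2 \is a GRing.unit. Proof. by rewrite unitrM U1. Qed.
Let Um : c1 / c2 \is a GRing.unit. Proof. by rewrite unitrM U1 unitrV. Qed.
Let tp : tt (c1 * c2) (m1 + m2) != 0. Proof. exact: (tt_neq0 D Up gp). Qed.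
Let tm : tt (c1 / c2) (m1 - m2) != 0. Proof. exact: (tt_neq0 D Um gm). Qed.

(** The addition law is recorded through the difference and the sum of X at P - Q and P + Q, so that
    Y of the sum never occurs. *)
Lemma X_diff : (Xf c1 m1 - Xf c2 m2) ^+ 2 * (Xf (c1 / c2) (m1 - m2) - Xf (c1 * c2) (m1 + m2)) =
  Yf c1 m1 * Yf c2 m2.
Proof.
rewrite (X_sub U1 U2 g1 g2) (X_sub Um Up gm gp) /Yf.
have -> : c1 / c2 * (c1 * c2) = c1 ^+ 2 by rewrite mulrACA mulVr // mulr1 expr2.
have -> : c1 / c2 / (c1 * c2) = (c2 ^+ 2)^-1.
  by rewrite invrM // mulrA mulrC -!mulrA mulKr // expr2 invrM.
have -> : m1 - m2 + (m1 + m2) = 2 * m1 by ring.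
have -> : m1 - m2 - (m1 + m2) = - (2 * m2) by ring.
rewrite tt_inv ?unitrX // cstM cstX; field.
by rewrite t1 t2 tp tm cst_neq0.
Qed.

Lemma X_prod0 : (Xf c1 m1 - Xf c2 m2) ^+ 2 * (Xf (c1 * c2) (m1 + m2) * Xf (c1 / c2) (m1 - m2)) =
  (al * be - Xf c1 m1 * Xf c2 m2) ^+ 2.
Proof.
have U' : - c1 \is a GRing.unit by rewrite unitrN.
have h2 := th2_neq0.
have -> : al * be - Xf c1 m1 * Xf c2 m2 = - (T ^+ 4 * cst c2 * tt (- (c1 * c2)) (m1 + m2) *
    tt (- (c1 / c2)) (m1 - m2) / (tt c1 m1 ^+ 2 * tt c2 m2 ^+ 2 * th2 ^+ 2)).
  have := tt_B m1 m2 U' U2; rewrite opprK !mulNr => E.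
  rewrite al_be /Xf.
  transitivity (- (T ^+ 4 * (tt (- c1) m1 ^+ 2 * tt (- c2) m2 ^+ 2 - tt c1 m1 ^+ 2 * tt c2 m2 ^+ 2) /
    (tt c1 m1 ^+ 2 * tt c2 m2 ^+ 2 * th2 ^+ 4))); first by field; rewrite t1 t2 h2.
  by rewrite E; field; rewrite t1 t2 h2.
rewrite (X_sub U1 U2 g1 g2) /Xf; field.
by rewrite t1 t2 tp tm h2.
Qed.

Lemma X_prod_al : good c1 (m1 + N%:Z) ->
  (Xf c1 m1 - Xf c2 m2) ^+ 2 *
    ((Xf (c1 * c2) (m1 + m2) - al) * (Xf (c1 / c2) (m1 - m2) - al)) =
  (al * (Xf c1 m1 + Xf c2 m2) - al * be - Xf c1 m1 * Xf c2 m2) ^+ 2.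
Proof.
move=> g3; have t3 := tt_neq0 D U1 g3; have h4 := th4_neq0.
have E : al * (Xf c1 m1 + Xf c2 m2) - al * be - Xf c1 m1 * Xf c2 m2 =
   (Xf c1 m1 - al) * (Xf c1 (m1 + N%:Z) - Xf c2 m2).
  have A := X_al_shift U1 g1 g3.
  transitivity ((Xf c1 m1 - al) * (Xf c1 (m1 + N%:Z) - al) +
    (Xf c1 m1 - al) * (al - Xf c2 m2)); last by ring.
  by rewrite A; ring.
rewrite {}E (X_sub U1 U2 g1 g2) (X_al U1 g1) (X_al Up gp) (X_al Um gm) (X_sub U1 U2 g3 g2).
have -> : m1 + N%:Z + m2 = m1 + m2 + N%:Z by ring.
have -> : m1 + N%:Z - m2 = m1 - m2 + N%:Z by ring.
rewrite !cstM cstV //; field.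
by rewrite t1 t2 tp tm t3 h4 cst_neq0.
Qed.

(** Expanding (x - al)(x' - al) isolates al (x + x') once x x' and (x - al)(x' - al) are known from
    [X_prod0] and [X_prod_al]. *)
Lemma X_sum : good c1 (m1 + N%:Z) ->
  al * (Xf c1 m1 - Xf c2 m2) ^+ 2 * (Xf (c1 * c2) (m1 + m2) + Xf (c1 / c2) (m1 - m2)) =
  (al * be - Xf c1 m1 * Xf c2 m2) ^+ 2 + al ^+ 2 * (Xf c1 m1 - Xf c2 m2) ^+ 2 -
  (al * (Xf c1 m1 + Xf c2 m2) - al * be - Xf c1 m1 * Xf c2 m2) ^+ 2.
Proof. by move=> g3; rewrite -X_prod0 -X_prod_al //; ring. Qed.
End Addition.

(** The sequence sigma(n z) / sigma(z)^(n^2). The power of [cst c] absorbs the asymmetry of theta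
    under u -> 1/u, so that the recurrence has no extra constants. *)
Definition Wf (c : R) (m : int) (n : nat) : F :=
  cst c ^+ 'C(n, 2) * tt (c ^+ n) (m *+ n) * (T / tt c m) ^+ (n ^ 2) / T.

Lemma tt10 : tt 1 0 = 0.
Proof.
have := tt_inv D 0 (unitr1 R); rewrite invr1 oppr0 cst1 divr1 => /eqP.
by rewrite -addr_eq0 -mulr2n -mulr_natr mulf_eq0 (negPf (two_neq0 D)) orbF => /eqP.
Qed.

(** The Plucker relation for the multiples a, b, 1, 0 of one point; the rest matches exponents,
    using C(a + b, 2) + C(a - b, 2) + a = a^2 + b^2. *)
Lemma W_rec c m (a b : nat) : c \is a GRing.unit -> good c m -> (b <= a)%N -> (0 < b)%N ->
  Wf c m (a + b) * Wf c m (a - b) =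
  Wf c m a.+1 * Wf c m a.-1 * Wf c m b ^+ 2 - Wf c m b.+1 * Wf c m b.-1 * Wf c m a ^+ 2.
Proof.
move=> Uc g ba b0; have t0 := tt_neq0 D Uc g; have T0 := TT_neq0 D.
pose tau n := tt (c ^+ n) (m *+ n).
have BE x y : (y <= x)%N ->
    cst c ^+ y * tau (x + y)%N * tau (x - y)%N = dR (c ^+ x) (m *+ x) (c ^+ y) (m *+ y).
  move=> le; rewrite -tt_bil ?unitrX // /tau cstX -exprD mulrnDr mulrnBr //; congr (_ * tt _ _).
  by rewrite -{2}(subnK le) exprD mulrK ?unitrX.
have P := tt_plucker (c ^+ a) (m *+ a) (c ^+ b) (m *+ b) (c ^+ 1) (m *+ 1) (c ^+ 0) (m *+ 0).
have a0 : (0 < a)%N by apply: leq_trans ba.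
rewrite -!BE // !expr0 !mul1r !addn0 !subn0 !addn1 !subn1 !expr1 -!expr2 in P.
have bin2pm x y : (y <= x)%N -> ('C(x + y, 2) + 'C(x - y, 2) + x = x * x + y * y)%N.
  move=> le; have := bin2sq (x + y); have := bin2sq (x - y); nia.
set rho := T / tt c m; have r0 : rho != 0 by rewrite mulf_neq0 ?invr_eq0.
have E1 : tau 1%N = T / rho by rewrite /tau expr1 mulr1n /rho; field; rewrite t0 T0.
have e1 := bin2pm a b ba; have e2 := bin2pm a 1%N a0; have e3 := bin2pm b 1%N b0.
have e4 := bin2sq a; have e5 := bin2sq b.
rewrite addn1 subn1 in e2; rewrite addn1 subn1 in e3.
have ge : (a + b <= a * a + b * b)%N by nia.
pose e := (a * a + b * b - a - b)%N.
have WW x y : Wf c m x * Wf c m y = cst c ^+ ('C(x, 2) + 'C(y, 2)) *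
   (tau x * tau y) * rho ^+ (x * x + y * y) / T ^+ 2.
  rewrite /Wf -/rho -/(tau x) -/(tau y) -!mulnn.
  move: ('C(x, 2)) ('C(y, 2)) (x * x)%N (y * y)%N (tau x) (tau y) => p p' q q' z z'.
  by rewrite (exprD _ p) (exprD _ q); field; rewrite T0.
rewrite WW (WW a.+1) (WW b.+1) [Wf c m b ^+ 2]expr2 [Wf c m a ^+ 2]expr2 (WW b) (WW a).
have -> : ('C(a + b, 2) + 'C(a - b, 2) = e + b)%N by rewrite /e; lia.
have -> : ('C(a.+1, 2) + 'C(a.-1, 2) = a * a + 1 - a)%N by lia.
have -> : ('C(b.+1, 2) + 'C(b.-1, 2) = b * b + 1 - b)%N by lia.
have -> : ('C(a, 2) + 'C(a, 2) = a * a - a)%N by lia.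
have -> : ('C(b, 2) + 'C(b, 2) = b * b - b)%N by lia.
have -> : ((a + b) * (a + b) + (a - b) * (a - b) = 2 * (a * a + b * b))%N by nia.
have -> : (a.+1 * a.+1 + a.-1 * a.-1 = 2 * (a * a) + 2)%N by nia.
have -> : (b.+1 * b.+1 + b.-1 * b.-1 = 2 * (b * b) + 2)%N by nia.
have -> : (a * a + a * a = 2 * (a * a))%N by lia.
have -> : (b * b + b * b = 2 * (b * b))%N by lia.
set C := cst c; set r := rho.
have X1 : C ^+ (a * a + 1 - a) * C ^+ (b * b - b) = C ^+ e * C.
  by rewrite -exprD -exprSr; congr (_ ^+ _); rewrite /e; nia.
have X2 : C ^+ (b * b + 1 - b) * C ^+ (a * a - a) = C ^+ e * C.
  by rewrite -exprD -exprSr; congr (_ ^+ _); rewrite /e; nia.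
transitivity (C ^+ e * r ^+ (2 * (a * a + b * b)) * r ^+ 2 / T ^+ 4 *
  (C ^+ b * tau (a + b)%N * tau (a - b)%N * tau 1%N ^+ 2)).
  rewrite E1 (exprD C e b) -/r.
  move: (C ^+ e) (C ^+ b) (r ^+ (2 * (a * a + b * b))) (tau (a + b)%N) (tau (a - b)%N) => x y z v w.
  by field; rewrite T0 r0.
have -> : C ^+ b * tau (a + b)%N * tau (a - b)%N * tau 1%N ^+ 2 =
   C * tau a.+1 * tau a.-1 * tau b ^+ 2 - tau a ^+ 2 * (C * tau b.+1 * tau b.-1).
  by apply/eqP; rewrite -subr_eq0 -{}P; apply/eqP; rewrite -/C; ring.
transitivity ((C ^+ (a * a + 1 - a) * C ^+ (b * b - b)) * (r ^+ (2 * (a * a) + 2) * r ^+ (2 * (b * b))) *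
   (tau a.+1 * tau a.-1 * tau b ^+ 2) / T ^+ 4 -
   (C ^+ (b * b + 1 - b) * C ^+ (a * a - a)) * (r ^+ (2 * (b * b) + 2) * r ^+ (2 * (a * a))) *
   (tau b.+1 * tau b.-1 * tau a ^+ 2) / T ^+ 4).
  rewrite X1 X2 -!exprD.
  have -> : (2 * (a * a) + 2 + 2 * (b * b) = 2 * (a * a + b * b) + 2)%N by lia.
  have -> : (2 * (b * b) + 2 + 2 * (a * a) = 2 * (a * a + b * b) + 2)%N by lia.
  rewrite (exprD r (2 * (a * a + b * b))).
  move: (C ^+ e) (r ^+ (2 * (a * a + b * b))) => x z.
  by field; rewrite T0.
move: (C ^+ (a * a + 1 - a)) (C ^+ (b * b - b)) (C ^+ (b * b + 1 - b)) (C ^+ (a * a - a)) => x x' y y'.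
move: (r ^+ (2 * (a * a) + 2)) (r ^+ (2 * (b * b))) (r ^+ (2 * (b * b) + 2)) (r ^+ (2 * (a * a))) => z z' v v'.
by field; rewrite T0.
Qed.

Lemma W0 c m : Wf c m 0 = 0.
Proof. by rewrite /Wf expr0 mulr0n tt10 !(mulr0, mul0r). Qed.
Lemma W1 c m : c \is a GRing.unit -> good c m -> Wf c m 1 = 1.
Proof.
move=> Uc g; rewrite /Wf !expr1 mulr1n expr0 mul1r; field.
by rewrite TT_neq0 (tt_neq0 D Uc g).
Qed.
Lemma W2 c m : c \is a GRing.unit -> good c m -> Wf c m 2 = Yf c m.
Proof.
move=> Uc g; rewrite /Wf /Yf -[(2 ^ 2)%N]/4%N expr1 -[m *+ 2]mulr_natl; field.
by rewrite TT_neq0 (tt_neq0 D Uc g).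
Qed.

End Elliptic.

End TateCurve.

(** * Homogeneity in two parameters and the division polynomials *)

Module DivisionPolynomials.
Import PowerSeries FormalSums Theta TripleProduct ProductFormula ThetaIdentities TateCurve.

Section Hom.
Variables (A F : comNzRingType) (phi : {rmorphism A -> F}) (a b : F).

(** A property of values rather than of polynomials: x can be homogeneous of several degrees at
    once, which is what the Hasse invariant produces. *)
Inductive hom : nat -> F -> Prop :=
| hom0 n : hom n 0
| homC c : hom 0 (phi c)
| homa : hom 1 a
| homb : hom 1 b
| homD n x y : hom n x -> hom n y -> hom n (x + y)
| homM m n x y : hom m x -> hom n y -> hom (m + n) (x * y).

Lemma homN n x : hom n x -> hom n (- x).
Proof.
move=> h; rewrite -[n]add0n -mulN1r -(rmorph1 phi) -(rmorphN phi).
by apply: homM h; apply: homC.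
Qed.
Lemma homB n x y : hom n x -> hom n y -> hom n (x - y).
Proof. by move=> hx hy; apply: homD => //; apply: homN. Qed.
Lemma hom_nat m : hom 0 m%:R.
Proof. by rewrite -(rmorph_nat phi); apply: homC. Qed.
Lemma homZ c n x : hom n x -> hom n (phi c * x).
Proof. by move=> h; rewrite -[n]add0n; apply: homM h; apply: homC. Qed.
Lemma homX n m x : hom n x -> hom (n * m) (x ^+ m).
Proof.
move=> h; elim: m => [|m IH]; first by rewrite muln0 expr0; apply: (hom_nat 1).
by rewrite mulnS exprS; apply: homM.
Qed.
Lemma hom_sum n (I : Type) (r : seq I) (P : pred I) (E : I -> F) :
  (forall i, P i -> hom n (E i)) -> hom n (\sum_(i <- r | P i) E i).
Proof. by move=> H; apply: big_ind => //; [apply: hom0|move=> x y; apply: homD]. Qed.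

Lemma hom_prod (I : Type) (r : seq I) (d : I -> nat) (E : I -> F) :
  (forall i, hom (d i) (E i)) -> hom (\sum_(i <- r) d i) (\prod_(i <- r) E i).
Proof.
move=> H; elim: r => [|i r IH]; first by rewrite !big_nil; apply: (hom_nat 1).
by rewrite !big_cons; apply: homM.
Qed.

(** Weighted homogeneity of total degree d, the variable having weight one like a and b. The
    coefficient of degree d is tracked because it must be inverted later. *)
Definition hpol d (l : F) (p : {poly F}) :=
  [/\ (size p <= d.+1)%N, p`_d = l & forall i, (i <= d)%N -> hom (d - i) p`_i].

Lemma hpol_out d l p i : hpol d l p -> (d < i)%N -> p`_i = 0.
Proof. by case=> s _ _ h; rewrite nth_default // (leq_trans s). Qed.

Lemma hpolD d l l' p p' : hpol d l p -> hpol d l' p' -> hpol d (l + l') (p + p').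
Proof.
case=> s e h [s' e' h']; split; rewrite ?coefD ?e ?e' //.
  by apply: (leq_trans (size_polyD _ _)); rewrite geq_max s.
by move=> i le; rewrite coefD; apply: homD; [apply: h|apply: h'].
Qed.
Lemma hpolN d l p : hpol d l p -> hpol d (- l) (- p).
Proof.
case=> s e h; split; rewrite ?size_polyN ?coefN ?e //.
by move=> i le; rewrite coefN; apply/homN/h.
Qed.
Lemma hpolB d l l' p p' : hpol d l p -> hpol d l' p' -> hpol d (l - l') (p - p').
Proof. by move=> h h'; apply: hpolD => //; apply: hpolN. Qed.
Lemma hpolM d l p d' l' p' : hpol d l p -> hpol d' l' p' -> hpol (d + d') (l * l') (p * p').
Proof.
move=> H H'; have [s e h] := H; have [s' e' h'] := H'; split.
- by apply: (leq_trans (size_polyMleq _ _)); lia.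
- have lt : (d < (d + d').+1)%N by lia.
  rewrite coefM (bigD1 (Ordinal lt)) //= addKn e e' big1 ?addr0 // => -[i li] /= ne.
  have : (i != d)%N by apply: contra ne => /eqP E; apply/eqP/val_inj.
  rewrite neq_ltn => /orP[lt'|lt'].
    by rewrite (hpol_out H') ?mulr0 //; lia.
  by rewrite (hpol_out H) ?mul0r.
- move=> i le; rewrite coefM; apply: hom_sum => -[j lj] _ /=.
  have [ld|ld] := leqP j d; last by rewrite (hpol_out H) // mul0r; apply: hom0.
  have [ld'|ld'] := leqP (i - j) d'; last by rewrite (hpol_out H') // mulr0; apply: hom0.
  have -> : (d + d' - i = (d - j) + (d' - (i - j)))%N by lia.
  by apply: homM; [apply: h|apply: h'].
Qed.
Lemma hpolE d l d' l' p : hpol d l p -> d = d' -> l = l' -> hpol d' l' p.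
Proof. by move=> h <- <-. Qed.
Lemma hpolC d x : hom d x -> (0 < d)%N -> hpol d 0 x%:P.
Proof.
move=> h d0; split; rewrite ?coefC ?size_polyC; first by case: (x == 0).
  by rewrite -[_ == _]negbK -lt0n d0.
by move=> [|i] _; rewrite coefC ?subn0 //; apply: hom0.
Qed.
Lemma hpol1 m : hpol 0 m%:R m%:R.
Proof.
rewrite -polyC_natr; split; rewrite ?coefC ?size_polyC //; first by case: (_ == 0).
by move=> [|//] _; rewrite coefC; apply: hom_nat.
Qed.
Lemma hpolXx : hpol 1 1 'X.
Proof.
split; rewrite ?size_polyX ?coefX //.
by move=> [|[|//]] _; rewrite coefX; [apply: hom0|apply: (hom_nat 1)].
Qed.
Lemma hpolX d l p m : hpol d l p -> hpol (d * m) (l ^+ m) (p ^+ m).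
Proof.
move=> h; elim: m => [|m IH]; first by rewrite muln0 !expr0; apply: (hpol1 1).
by rewrite mulnS !exprS; apply: hpolM.
Qed.

Definition cubic : {poly F} := 4%:R * ('X * ('X - a%:P) * ('X - b%:P)).
Lemma hpol_cubic : hpol 3 4%:R cubic.
Proof.
have ha : hpol 1 1 ('X - a%:P).
  by have := hpolB hpolXx (hpolC homa isT); rewrite subr0.
have hb : hpol 1 1 ('X - b%:P).
  by have := hpolB hpolXx (hpolC homb isT); rewrite subr0.
by apply: hpolE (hpolM (hpol1 4) (hpolM (hpolM hpolXx ha) hb)) _ _; rewrite ?mulr1.
Qed.
Lemma cubicE x : cubic.[x] = 4%:R * (x * (x - a) * (x - b)).
Proof. by rewrite /cubic -polyC_natr !hornerE. Qed.

Lemma hpol_sum_roots (I : Type) (r : seq I) (x : I -> F) d l p :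
  (forall m, hom m (\sum_(i <- r) x i ^+ m)) -> hpol d l p ->
  hom d (\sum_(i <- r) p.[x i]).
Proof.
move=> H [s _ h]; under eq_bigr => i _ do rewrite (horner_coef_wide _ s).
rewrite exchange_big /=; apply: hom_sum => -[j lj] _ /=.
rewrite -mulr_sumr -[d](@subnK j) //; apply: homM => //; exact: h.
Qed.
End Hom.

Lemma hom_poly (A : comNzRingType) (F : fieldType) (phi : {rmorphism A -> F}) (a b : F) n x :
  a != 0 -> hom phi a b n x ->
  exists p : {poly A}, (size p <= n.+1)%N /\ x = a ^+ n * (map_poly phi p).[b / a].
Proof.
move=> a0; elim=> {n x} [n|c|||n x y _ [p [sp ->]] _ [q [sq ->]]|m n x y _ [p [sp ->]] _ [q [sq ->]]].
- by exists 0; rewrite size_poly0 rmorph0 horner0 mulr0.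
- by exists c%:P; rewrite size_polyC map_polyC hornerC expr0 mul1r; split=> //; case: (c == 0).
- by exists 1; rewrite size_poly1 rmorph1 hornerC expr1 mulr1.
- by exists 'X; rewrite size_polyX map_polyX hornerX expr1 mulrC divfK.
- exists (p + q); rewrite rmorphD hornerD mulrDr; split=> //.
  by apply: (leq_trans (size_polyD _ _)); rewrite geq_max sp.
- exists (p * q); rewrite rmorphM hornerM exprD mulrACA; split=> //.
  by apply: (leq_trans (size_polyMleq _ _)); lia.
Qed.

Lemma hom_map (A F F' : comNzRingType) (phi : {rmorphism A -> F}) (phi' : {rmorphism A -> F'})
  (psi : {rmorphism F -> F'}) a b n x : (forall c, phi' c = psi (phi c)) ->
  hom phi a b n x -> hom phi' (psi a) (psi b) n (psi x).
Proof.
move=> E; elim=> {n x} [n|c|||n x y _ h _ h'|m n x y _ h _ h'].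
- by rewrite rmorph0; apply: hom0.
- by rewrite -E; apply: homC.
- exact: homa.
- exact: homb.
- by rewrite rmorphD; apply: homD.
- by rewrite rmorphM; apply: homM.
Qed.

(** A homogeneous expression uses only a, b and constants, so it can be rebuilt in the source of
    [psi], although x is only known in the target. *)
Lemma hom_lift (A F F' : comNzRingType) (phi : {rmorphism A -> F}) (phi' : {rmorphism A -> F'})
  (psi : {rmorphism F -> F'}) a b n x : (forall c, phi' c = psi (phi c)) ->
  hom phi' (psi a) (psi b) n x -> exists y, hom phi a b n y /\ x = psi y.
Proof.
move=> E; elim=> {n x} [n|c|||n x y _ [x' [h ->]] _ [y' [h' ->]]|m n x y _ [x' [h ->]] _ [y' [h' ->]]].
- by exists 0; rewrite rmorph0; split=> //; apply: hom0.
- by exists (phi c); split=> //; apply: homC.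
- by exists a; split=> //; apply: homa.
- by exists b; split=> //; apply: homb.
- by exists (x' + y'); rewrite rmorphD; split=> //; apply: homD.
- by exists (x' * y'); rewrite rmorphM; split=> //; apply: homM.
Qed.

(** Degree in X and leading coefficient of the n-th division polynomial; for even n a factor Y has
    been removed, whence (n^2 - 4)/2 and n/2 instead of (n^2 - 1)/2 and n. *)
Definition dd n := let s := n./2 in if odd n then (2 * s * s + 2 * s)%N else (2 * s * s - 2)%N.
Definition ld n := if odd n then n else n./2.

Lemma dd_odd s : dd (2 * s + 1) = (2 * s * s + 2 * s)%N.
Proof.
have e : (2 * s + 1)./2 = s by lia.
by rewrite /dd e; case: ifP => // /negP[]; lia.
Qed.
Lemma dd_even s : dd (2 * s) = (2 * s * s - 2)%N.
Proof.
have e : (2 * s)./2 = s by lia.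
by rewrite /dd e; case: ifP => // o; exfalso; lia.
Qed.

Section EDS.
Variables (R : idomainType) (N : nat) (F : fieldType) (D : thdata R N F).
Hypothesis N0 : (0 < N)%N.
Hypothesis nz2 : (2%:R : R) != 0.
Local Notation good c m := (((2 * N)%:Z %| m)%Z -> c != 1).

(** Neither the origin nor a point of order two, phrased as the conditions under which the thetas
    entering the doubling formulas do not vanish. *)
Definition okpt (c : R) (m : int) :=
  [/\ c \is a GRing.unit, good c m, good (c ^+ 2) (2 * m), good c (m + N%:Z) & good (- c) (m + N%:Z)].

Lemma W_X c m n : c \is a GRing.unit -> good c m -> good (c ^+ n) (m *+ n) -> (0 < n)%N ->
  (Xf D c m - Xf D (c ^+ n) (m *+ n)) * Wf D c m n ^+ 2 = Wf D c m n.+1 * Wf D c m n.-1.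
Proof.
move=> Uc g gn n0; have Un : c ^+ n \is a GRing.unit by rewrite unitrX.
have t0 := tt_neq0 D Uc g; have tn := tt_neq0 D Un gn; have T0 := TT_neq0 D.
rewrite -opprB X_sub // /Wf.
have -> : c ^+ n * c = c ^+ n.+1 by rewrite exprSr.
have -> : c ^+ n / c = c ^+ n.-1 by rewrite -{1}(prednK n0) exprSr mulrK.
have -> : m *+ n + m = m *+ n.+1 by rewrite mulrSr.
have -> : m *+ n - m = m *+ n.-1 by rewrite -{1}(prednK n0) mulrSr addrK.
have e1 : ('C(n.+1, 2) + 'C(n.-1, 2) = 2 * 'C(n, 2) + 1)%N.
  by have := bin2sq n.+1; have := bin2sq n.-1; have := bin2sq n; nia.
have e2 : (n.+1 ^ 2 + n.-1 ^ 2 = 2 * (n ^ 2) + 2)%N by rewrite -!mulnn; nia.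
move: ('C(n.+1, 2)) ('C(n.-1, 2)) ('C(n, 2)) (n.+1 ^ 2)%N (n.-1 ^ 2)%N (n ^ 2)%N e1 e2.
move=> p p' q x x' y e1 e2; set C := cst D c; set r := TT D / tt D c m.
set t1 := tt D (c ^+ n.+1) _; set t2 := tt D (c ^+ n.-1) _; set t := tt D _ (m *+ n).
transitivity (C ^+ (p + p') * r ^+ (x + x') * (t1 * t2) / TT D ^+ 2); last first.
  rewrite !exprD; move: (C ^+ p) (C ^+ p') (r ^+ x) (r ^+ x') => ? ? ? ?; field.
  by rewrite T0.
rewrite e1 e2 (exprD C) (exprD r) mulnC (mulnC 2 y) !exprM.
move: (C ^+ q) (r ^+ y) => ? ?; rewrite /r expr1; field.
by rewrite T0 t0 tn.
Qed.

Notation phi := (intr : {rmorphism int -> F}).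
Notation a := (al D).
Notation b := (be D).
Notation hp := (hpol phi a b).

Lemma W4E c m : c \is a GRing.unit -> good c m -> good (c ^+ 2) (2 * m) ->
  Wf D c m 4 = Yf D (c ^+ 2) (2 * m) * Yf D c m ^+ 4.
Proof.
move=> Uc g g2; have U2 : c ^+ 2 \is a GRing.unit by rewrite unitrX.
have t0 := tt_neq0 D Uc g; have t2 := tt_neq0 D U2 g2; have T0 := TT_neq0 D.
rewrite /Wf /Yf -[(4 ^ 2)%N]/16%N -['C(4, 2)]/6%N cstX.
have -> : (c ^+ 2) ^+ 2 = c ^+ 4 by rewrite -exprM.
have -> : 2 * (2 * m) = m *+ 4 by rewrite -mulr_natl; ring.
by field; rewrite t0 t2 T0.
Qed.

Lemma okpt_Y c m : okpt c m -> Yf D c m != 0.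
Proof.
case=> Uc g g2 _ _; have U2 : c ^+ 2 \is a GRing.unit by rewrite unitrX.
by rewrite /Yf !mulf_neq0 ?invr_eq0 ?expf_neq0 ?TT_neq0 ?cst_neq0 ?tt_neq0.
Qed.

(** Members of even index are odd functions of the point, hence carry one factor Y. *)
Definition edsP n G := hp (dd n) (ld n)%:R G /\
  forall c m, okpt c m -> Wf D c m n = G.[Xf D c m] * (if odd n then 1 else Yf D c m).

Lemma W_odd c m n : c \is a GRing.unit -> good c m -> (0 < n)%N ->
  Wf D c m (2 * n + 1) = Wf D c m n.+2 * Wf D c m n ^+ 3 - Wf D c m n.-1 * Wf D c m n.+1 ^+ 3.
Proof.
have [e1 e2] : (n.+1 + n = 2 * n + 1)%N /\ (n.+1 - n = 1)%N by lia.
move=> Uc g n0; have := W_rec D N0 nz2 (a := n.+1) (b := n) Uc g (leqnSn n) n0.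
by rewrite e1 e2 W1 // mulr1 => ->; rewrite -pred_Sn; ring.
Qed.

Lemma W_even c m n : c \is a GRing.unit -> good c m -> (1 < n)%N ->
  Wf D c m (2 * n) * Yf D c m =
  Wf D c m n * (Wf D c m n.+2 * Wf D c m n.-1 ^+ 2 - Wf D c m n.-2 * Wf D c m n.+1 ^+ 2).
Proof.
have e : (1 < n -> [/\ n.+1 + n.-1 = 2 * n, n.+1 - n.-1 = 2, n.-1.+1 = n, n.-1 <= n.+1 & 0 < n.-1])%N.
  by split; lia.
move=> Uc g /e[e1 e2 e3 e4 e5]; have := W_rec D N0 nz2 (a := n.+1) (b := n.-1) Uc g e4 e5.
by rewrite e1 e2 e3 W2 // => ->; rewrite -pred_Sn; ring.
Qed.

Lemma dd_ld_odd n : (1 < n)%N ->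
  (if odd n then (dd n.+2 + dd n * 3 = dd (2 * n + 1))%N /\ (3 * 2 + (dd n.-1 + dd n.+1 * 3) = dd (2 * n + 1))%N
   else (3 * 2 + (dd n.+2 + dd n * 3) = dd (2 * n + 1))%N /\ (dd n.-1 + dd n.+1 * 3 = dd (2 * n + 1))%N) /\
  (ld (2 * n + 1))%:R = (if odd n then (ld n.+2)%:R * (ld n)%:R ^+ 3 - 4%:R ^+ 2 * ((ld n.-1)%:R * (ld n.+1)%:R ^+ 3)
   else 4%:R ^+ 2 * ((ld n.+2)%:R * (ld n)%:R ^+ 3) - (ld n.-1)%:R * (ld n.+1)%:R ^+ 3) :> F.
Proof.
move=> n1; have [s En] : exists s, n = (odd n + 2 * s.+1)%N by exists (n./2.-1); lia.
rewrite dd_odd /ld; case: (odd n) En => En.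
  have -> : n.+2 = (2 * s.+2 + 1)%N by lia.
  have -> : n.-1 = (2 * s.+1)%N by lia.
  have -> : n.+1 = (2 * s.+2)%N by lia.
  have -> : n = (2 * s.+1 + 1)%N by lia.
  rewrite !dd_odd !dd_even; split; first by split; nia.
  by do ![case: ifP => ?]; try lia; rewrite !mul2n !doubleK !addn1 -!mul2n; ring.
have -> : n.+2 = (2 * s.+2)%N by lia.
have -> : n.-1 = (2 * s + 1)%N by lia.
have -> : n.+1 = (2 * s.+1 + 1)%N by lia.
have -> : n = (2 * s.+1)%N by lia.
rewrite !dd_odd !dd_even; split; first by split; nia.
by do ![case: ifP => ?]; try lia; rewrite !mul2n !doubleK !addn1 -!mul2n; ring.
Qed.

Lemma dd_ld_even n : (2 < n)%N ->
  [/\ (dd n.+2 + dd n.-1 * 2 = dd (2 * n) - dd n)%N,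
     (dd n.-2 + dd n.+1 * 2 = dd (2 * n) - dd n)%N, (dd n + (dd (2 * n) - dd n) = dd (2 * n))%N &
  (ld (2 * n))%:R = (ld n)%:R * ((ld n.+2)%:R * (ld n.-1)%:R ^+ 2 - (ld n.-2)%:R * (ld n.+1)%:R ^+ 2) :> F].
Proof.
move=> n1; have [s En] : exists s, n = (odd n + 2 * s.+1)%N by exists (n./2.-1); lia.
rewrite dd_even /ld; case: (odd n) En => En.
  have -> : n.-2 = (2 * s + 1)%N by lia.
  have -> : n.+2 = (2 * s.+2 + 1)%N by lia.
  have -> : n.-1 = (2 * s.+1)%N by lia.
  have -> : n.+1 = (2 * s.+2)%N by lia.
  have -> : n = (2 * s.+1 + 1)%N by lia.
  rewrite !dd_odd !dd_even; split; try nia.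
  by do ![case: ifP => ?]; try lia; rewrite !mul2n !doubleK !addn1 -!mul2n; ring.
case: s En => [|s] En; first by lia.
have -> : n.-2 = (2 * s.+1)%N by lia.
have -> : n.+2 = (2 * s.+3)%N by lia.
have -> : n.-1 = (2 * s.+1 + 1)%N by lia.
have -> : n.+1 = (2 * s.+2 + 1)%N by lia.
have -> : n = (2 * s.+2)%N by lia.
rewrite !dd_odd !dd_even; split; try nia.
by do ![case: ifP => ?]; try lia; rewrite !mul2n !doubleK !addn1 -!mul2n; ring.
Qed.

Lemma eds_odd n G1 G2 G3 G4 : (1 < n)%N -> edsP n.+2 G1 -> edsP n G2 ->
  edsP n.-1 G3 -> edsP n.+1 G4 -> exists G, edsP (2 * n + 1) G.
Proof.
have o3 : (0 < n)%N -> odd n.-1 = ~~ odd n by lia.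
have o5 : odd (2 * n + 1) by lia.
move=> n1 [h1 w1] [h2 w2] [h3 w3] [h4 w4]; have n0 := ltnW n1; have o3' := o3 n0.
have H1 := hpolM h1 (hpolX 3 h2); have H2 := hpolM h3 (hpolX 3 h4).
have HC := hpolX 2 (hpol_cubic phi a b).
have [a0 b0] := dd_ld_odd n1.
(* Exactly one of the two products has all its factors of even index; it contributes Y^4, the square
   of the cubic. *)
exists (if odd n then (G1 * G2 ^+ 3) - cubic a b ^+ 2 * (G3 * G4 ^+ 3)
        else cubic a b ^+ 2 * (G1 * G2 ^+ 3) - (G3 * G4 ^+ 3)); split.
  rewrite {}b0; case: (odd n) a0 => -[e e'].
    by have H3 := hpolM HC H2; rewrite e in H1; rewrite e' in H3; apply: hpolB.
  by have H3 := hpolM HC H1; rewrite e in H3; rewrite e' in H2; apply: hpolB.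
move=> c m ok; have [Uc g g2 g3 g4] := ok.
rewrite o5 mulr1 W_odd // (w1 _ _ ok) (w2 _ _ ok) (w3 _ _ ok) (w4 _ _ ok) o3' /= negbK.
have YC : (cubic a b).[Xf D c m] = Yf D c m ^+ 2 by rewrite cubicE Y_sqr.
by case: (odd n) => /=; rewrite hornerD hornerN (hornerM (cubic a b ^+ 2)) (hornerM G1) (hornerM G3)
   !horner_exp YC; ring.
Qed.

(** The recurrence gives the new term times Y; Y can be cancelled because [okpt] excludes the points
    of order two. *)
Lemma eds_even n G0 G1 G2 G3 G4 : (2 < n)%N -> edsP n G0 -> edsP n.+2 G1 -> edsP n.-1 G2 ->
  edsP n.-2 G3 -> edsP n.+1 G4 -> exists G, edsP (2 * n) G.
Proof.
have o2 : (2 < n)%N -> odd n.-1 = ~~ odd n by lia.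
have o3 : (2 < n)%N -> odd n.-2 = odd n by lia.
have o5 : odd (2 * n) = false by lia.
move=> n2 [h0 w0] [h1 w1] [h2 w2] [h3 w3] [h4 w4]; exists (G0 * (G1 * G2 ^+ 2 - G3 * G4 ^+ 2)); split.
  have H1 := hpolM h1 (hpolX 2 h2); have H2 := hpolM h3 (hpolX 2 h4).
  have [e e' e0 ->] := dd_ld_even n2.
  by rewrite e in H1; rewrite e' in H2; apply: hpolE (hpolM h0 (hpolB H1 H2)) _ _.
move=> c m ok; have [Uc g g2 g3 g4] := ok; have Y0 := okpt_Y ok.
apply: (mulIf Y0); rewrite W_even // ?(ltnW n2) //.
rewrite (w0 _ _ ok) (w1 _ _ ok) (w2 _ _ ok) (w3 _ _ ok) (w4 _ _ ok) o2 // o3 // o5 /= negbK.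
rewrite (hornerM G0) hornerD hornerN (hornerM G1) (hornerM G3) !horner_exp.
by case: (odd n) => /=; ring.
Qed.

(** The recurrences are used from index 5 on; indices 3 and 4 come from the duplication formulas for
    X and Y. *)
Lemma eds3 : exists G, edsP 3 G.
Proof.
exists (3%:R * 'X^4 - (4%:R * (a + b))%:P * 'X^3 + (6%:R * (a * b))%:P * 'X^2 - ((a * b) ^+ 2)%:P).
have ha := homa phi a b; have hb := homb phi a b; have hX k := hpolX k (hpolXx phi a b).
split.
  have h1 := hpolM (hpol1 phi a b 3) (hX 4%N).
  have h2 := hpolM (hpolC (homM (hom_nat phi a b 4) (homD ha hb)) isT) (hX 3%N).
  have h3 := hpolM (hpolC (homM (hom_nat phi a b 6) (homM ha hb)) isT) (hX 2%N).
  have h4 := hpolC (homX 2 (homM ha hb)) isT.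
  apply: hpolE (hpolB (hpolD (hpolB h1 h2) h3) h4) _ _ => //.
  by rewrite !mul0r !subr0 addr0 expr1n mulr1.
move=> c m ok; have [Uc g g2 g3 g4] := ok.
have := W_X (n := 2) Uc g; rewrite -[m *+ 2]mulr_natl => /(_ g2 isT).
rewrite /= W1 // W2 // !mulr1 => <-.
have t0 := tt_neq0 D Uc g.
have t2 : tt D (c ^+ 2) (2 * m) != 0 by apply: tt_neq0 => //; rewrite unitrX.
rewrite mulrBl X_dbl // Y_sqr //; move: (Xf D c m) a b => x u v.
by rewrite -!polyC_natr !(hornerD, hornerN, hornerCM, hornerXn, hornerC); ring.
Qed.

Lemma eds4 : exists G, edsP 4 G.
Proof.
exists (2%:R * ('X^2 - (a * b)%:P) * ('X^2 - (2%:R * a)%:P * 'X + (a * b)%:P) *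
   ('X^2 - (2%:R * b)%:P * 'X + (a * b)%:P)).
have ha := homa phi a b; have hb := homb phi a b; have hX := hpolX 2 (hpolXx phi a b).
split.
  have h0 := hpolC (homM ha hb) isT.
  have h1 := hpolM (hpol1 phi a b 2) (hpolB hX h0).
  have h2 := hpolD (hpolB hX (hpolM (hpolC (homM (hom_nat phi a b 2) ha) isT) (hpolXx phi a b))) h0.
  have h3 := hpolD (hpolB hX (hpolM (hpolC (homM (hom_nat phi a b 2) hb) isT) (hpolXx phi a b))) h0.
  apply: hpolE (hpolM (hpolM h1 h2) h3) _ _ => //.
  by rewrite !mul0r !subr0 addr0 expr1n !mulr1.
move=> c m ok; have [Uc g g2 g3 g4] := ok.
rewrite W4E // [Yf D c m ^+ 4]exprSr mulrA Y_dbl //; move: (Xf D c m) a b => x u v.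
by rewrite -!polyC_natr !hornerM !(hornerD, hornerN, hornerCM, hornerXn, hornerC, hornerX).
Qed.

(* The elliptic divisibility sequence of the theta quotients [Wf], as polynomials in X. *)
Lemma eds n : exists G, edsP n G.
Proof.
elim/ltn_ind: n => n IH.
have [n5|] := leqP 5 n; last first.
  case: n {IH} => [|[|[|[|[|//]]]]] _.
  - exists 0; split=> [|c m _]; last by rewrite W0 horner0 mul0r.
    by apply: hpolE (hpol1 phi a b 0) _ _.
  - exists 1; split=> [|c m [Uc g _ _ _]]; last by rewrite W1 // hornerC mulr1.
    by apply: hpolE (hpol1 phi a b 1) _ _.
  - exists 1; split=> [|c m [Uc g _ _ _]]; last by rewrite W2 // hornerC mul1r.
    by apply: hpolE (hpol1 phi a b 1) _ _.
  - exact: eds3.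
  - exact: eds4.
have [[G0 h0] [G1 h1] [G2 h2] [G4 h4]] : [/\ exists G, edsP n./2 G, exists G, edsP n./2.+2 G,
    exists G, edsP n./2.-1 G & exists G, edsP n./2.+1 G].
  by split; apply: IH; lia.
have [o|e] := boolP (odd n).
  by rewrite (_ : n = 2 * n./2 + 1)%N; [apply: (eds_odd _ h1 h0 h2 h4)|]; lia.
have [G3 h3] : exists G, edsP n./2.-2 G by apply: IH; lia.
by rewrite (_ : n = 2 * n./2)%N; [apply: (eds_even _ h0 h1 h2 h3 h4)|]; lia.
Qed.
End EDS.

End DivisionPolynomials.

(** * Heat equation and Hasse invariant *)

Module Hasse.
Import PowerSeries FormalSums Theta TripleProduct ProductFormula ThetaIdentities TateCurve DivisionPolynomials.

(** The relation assumed between [TT] and the theta constants is Jacobi's derivative formula; with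
    this scale [al] and [be] are power series and not mere fractions. *)
Lemma al_theta (R : idomainType) N (F : fieldType) (D : thdata R N F) : (0 < N)%N -> (2%:R : R) != 0 ->
  2%:R * TT D = - (th2 D * (th4 D * th3 D)) -> al D = th3 D ^+ 4 / 4%:R /\ be D = th4 D ^+ 4 / 4%:R.
Proof.
move=> N0 nz2 E; have nz := two_neq0 D.
have nz4 : (4%:R : F) != 0 by rewrite (_ : 4%:R = 2%:R * 2%:R :> F) ?mulf_neq0 //; ring.
have := th2_neq0 D nz2; have := th3_neq0 D N0; have := th4_neq0 D N0 => h4 h3 h2.
have ET : TT D = - (th2 D * (th4 D * th3 D)) / 2%:R by rewrite -E [2%:R * _]mulrC mulfK.
by split; [rewrite alE ET|rewrite beE ET]; field; rewrite ?h2 ?h3 ?h4 ?nz ?nz4.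
Qed.

Section TwoVar.
Variable k : fieldType.
Variable N : nat.
Hypothesis N0 : (0 < N)%N.
Hypothesis nz2 : (2%:R : k) != 0.
Notation A := (fps k).
Notation t := (fpsC (fpsX 1) : fps A).
Definition cmap : {rmorphism fps k -> fps A} := fmap (@fpsC k).
Definition atz : {rmorphism fps A -> fps k} := fmap (@ev0 k).

Lemma atzK x : atz (cmap x) = x.
Proof. by apply: fpsP. Qed.
Lemma atz_t x : atz (t * x) = 0.
Proof. by rewrite rmorphM /atz /= fmap_C /ev0 /= rmorph0 mul0r. Qed.

Lemma t_neq0 : t != 0.
Proof. by rewrite -(rmorph0 (@fpsC A)) (inj_eq (@fpsC_inj A)) fpsX_neq0. Qed.

Lemma nz2A : (2%:R : A) != 0.
Proof. by rewrite -(rmorph_nat (@fpsC k)) -(rmorph0 (@fpsC k)) (inj_eq (@fpsC_inj k)). Qed.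

Lemma fpsC_expz (c : k) (n : int) : c \is a GRing.unit -> fpsC (c ^ n) = fpsC c ^ n.
Proof.
move=> Uc; case: n => m; first by rewrite -!exprnP rmorphXn.
rewrite NegzE -!invr_expz -!exprnP; apply: (mulrI (x := fpsC c ^+ m.+1)).
  by rewrite unitrX // rmorph_unit.
by rewrite divrr ?unitrX ?rmorph_unit // -rmorphXn -rmorphM divrr ?unitrX // rmorph1.
Qed.

Lemma cmap_th c m : c \is a GRing.unit -> cmap (th N c m) = th N (fpsC c) m.
Proof.
move=> Uc; rewrite /cmap /= fmap_gs; apply: eq_gs => [n|//] /=.
have U' : - c \is a GRing.unit by rewrite unitrN.
by rewrite -(rmorphN (@fpsC k)) -fpsC_expz.
Qed.

(** All the B s have the same value M at t = 0, so comparing powers of t from below forces y s = 0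
    for s < n and then y n = 1. *)
Lemma t_lead D n (B : nat -> fps A) (a : fps A) (y : nat -> fps k) M :
  M != 0 -> (forall s, (s <= D)%N -> atz (B s) = M) -> atz a = M -> (n <= D)%N ->
  a * t ^+ (2 * n) = \sum_(s < D.+1) cmap (y s) * B s * t ^+ (2 * s) -> y n = 1.
Proof.
move=> M0 HB Ha nD E.
suff H s : (s <= n)%N -> y s = (s == n)%:R by rewrite H // eqxx.
elim/ltn_ind: s => s IH sn.
have sD : (s < D.+1)%N by rewrite ltnS (leq_trans sn).
have [Z EZ] : exists Z, \sum_(i < D.+1) cmap (y i) * B i * t ^+ (2 * i) =
   t ^+ (2 * s) * (cmap (y s) * B s + t * Z).
  exists (\sum_(i < D.+1 | (s < i)%N) cmap (y i) * B i * t ^+ (2 * (i - s)).-1).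
  rewrite (bigID (fun i : 'I_D.+1 => (s < i)%N)) /= addrC; symmetry; rewrite mulrDr.
  congr (_ + _); last first.
    rewrite mulrA mulr_sumr; apply: eq_bigr => i lt.
    have -> : t ^+ (2 * i) = t ^+ (2 * s) * t * t ^+ (2 * (i - s)).-1.
      by rewrite -exprSr -exprD; congr (_ ^+ _); lia.
    by ring.
  rewrite (bigD1 (Ordinal sD)) /= ?ltnn // big1 ?addr0; first by ring.
  move=> i /andP[le ne]; rewrite IH; last 2 first.
  - by move: ne; rewrite -val_eqE /=; lia.
  - by move: ne le sn; rewrite -val_eqE /=; lia.
  have -> : (nat_of_ord i == n) = false by move: ne le sn; rewrite -val_eqE /=; lia.
  by rewrite rmorph0 !mul0r.
rewrite EZ (_ : (2 * n)%N = (2 * s + 2 * (n - s))%N) in E; last by lia.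
rewrite exprD mulrCA in E.
have /(mulfI (expf_neq0 _ t_neq0)) E' : t ^+ (2 * s) * (a * t ^+ (2 * (n - s))) =
   t ^+ (2 * s) * (cmap (y s) * B s + t * Z) by [].
have := congr1 atz E'; rewrite rmorphD atz_t addr0 !rmorphM atzK HB //.
case: (eqVneq s n) => [->|ne].
  by rewrite subnn muln0 expr0 rmorph1 mulr1 Ha -{1}[M]mul1r => /(mulIf M0).
have -> : t ^+ (2 * (n - s)) = t * t ^+ (2 * (n - s)).-1.
  by rewrite -exprS; congr (_ ^+ _); move: ne; lia.
rewrite atz_t mulr0 => /esym/eqP; rewrite mulf_eq0 (negPf M0) orbF => /eqP ->.
by [].
Qed.

Notation TH c m := (th N (c : k) m).
Definition A0 : fps k := fpsC 4%:R^-1 * TH (-1) N%:Z ^+ 4.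
Definition B0 : fps k := fpsC 4%:R^-1 * TH 1 N%:Z ^+ 4.

Lemma theta_T1 : 2%:R * T1 k N = - (TH (-1) 0 * (TH 1 N%:Z * TH (-1) N%:Z)).
Proof. by rewrite theta_null_prod // T1_prod // mulrN mulrA. Qed.

Lemma T1_neq0 : T1 k N != 0.
Proof. by rewrite T1_prod // oppr_eq0 mulf_neq0 ?fpsX_neq0 ?expf_neq0 ?euler_neq0 ?qq0. Qed.

Lemma nz4 : (4%:R : k) != 0.
Proof. by rewrite (_ : 4%:R = 2%:R * 2%:R :> k) ?mulf_neq0 //; ring. Qed.

Lemma tcoefM2 (f g : fps A) : tcoef 2 (f * g) =
  tcoef 0 f * tcoef 2 g + tcoef 1 f * tcoef 1 g + tcoef 2 f * tcoef 0 g.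
Proof.
apply: fpsP => n; rewrite -[LHS]/(fcoef (fcoef (f * g) n) 2) (fcoefM f g) fcoef_sum.
rewrite (fcoefD (_ + _)) (fcoefD (tcoef 0 f * _)) !(fcoefM (tcoef _ f)).
rewrite -!big_split; apply: eq_bigr => i _; rewrite (fcoefM (fcoef f i)) !big_ord_recl big_ord0 /=.
by rewrite addr0 addrA.
Qed.
Lemma tcoefM1 (f g : fps A) : tcoef 1 (f * g) = tcoef 0 f * tcoef 1 g + tcoef 1 f * tcoef 0 g.
Proof.
apply: fpsP => n; rewrite -[LHS]/(fcoef (fcoef (f * g) n) 1) (fcoefM f g) fcoef_sum.
rewrite (fcoefD (tcoef 0 f * _)) !(fcoefM (tcoef _ f)).
rewrite -!big_split; apply: eq_bigr => i _; rewrite (fcoefM (fcoef f i)) !big_ord_recl big_ord0 /=.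
by rewrite addr0.
Qed.
Lemma tcoefM0 (f g : fps A) : tcoef 0 (f * g) = tcoef 0 f * tcoef 0 g.
Proof. exact: (rmorphM atz). Qed.
Lemma tcoefB i (f g : fps A) : tcoef i (f - g) = tcoef i f - tcoef i g.
Proof. exact: fpsP. Qed.
Lemma tcoef_cmap i x : tcoef i (cmap x) = if i == 0 then x else 0.
Proof. by apply: fpsP => n /=; case: ifP. Qed.

Lemma tcoef_tS i f : tcoef i.+1 (t * f) = tcoef i f.
Proof.
apply: fpsP => n; rewrite -[LHS]/(fcoef (fcoef (t * f) n) i.+1) fcoefCM fcoefXM.
by rewrite ltnS ltn0 subSS subn0.
Qed.

Lemma opt_exp2 (n : int) : 2%:R * fcoef (opt k ^ n) 2 = n%:~R ^+ 2 - n%:~R.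
Proof.
have S (m : int) : 2%:R * fcoef (opt k ^ (m + 1)) 2 = 2%:R * fcoef (opt k ^ m) 2 + 2%:R * m%:~R.
  rewrite exprzDr ?opt_unit // expr1z fcoefM !big_ord_recl big_ord0 /=.
  have [_ E1] := opt_exp k m; rewrite /bump /= E1 !addr0 !add0r mulr0 add0r mulr1 mulr1.
  by rewrite addrC mulrDr.
elim: n => [|n IH|n IH].
- by rewrite expr0z mulr0 expr0n subr0.
- have := S n; rewrite addrC -intS => ->; rewrite IH intS rmorphD /=; ring.
- have := S (- n.+1%:Z); rewrite (_ : - n.+1%:Z + 1 = - n%:Z); last by lia.
  rewrite IH => /eqP; rewrite -subr_eq => /eqP <-.
  rewrite (_ : - n.+1%:Z = - n%:Z - 1) ?rmorphB /=; last by lia.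
  ring.
Qed.

(* [th (c (1 + t)) N] is an even function of [log (1 + t)]. *)
Lemma th_opt_even (e : k) : e ^+ 2 = 1 -> [/\ tcoef 0 (th N (fpsC e * opt k) N%:Z) = TH e N%:Z,
  tcoef 1 (th N (fpsC e * opt k) N%:Z) = 0 &
  (8 * N ^ 2)%:R * tcoef 2 (th N (fpsC e * opt k) N%:Z) = fderiv (TH e N%:Z)].
Proof.
move=> e2; have Ue : e \is a GRing.unit.
  by apply: contraT; rewrite unitfE negbK => /eqP e0; move: e2; rewrite e0 expr0n => /eqP; rewrite eq_sym oner_eq0.
have E n : (- (fpsC e * opt k)) ^ n = fpsC ((- e) ^ n) * opt k ^ n.
  rewrite -mulNr -(rmorphN (@fpsC k)) exprzMl ?opt_unit ?rmorph_unit ?unitrN //.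
  by rewrite fpsC_expz ?unitrN.
have px := @proper_ex N N0 N%:Z.
have bN : bijective (fun n : int => - n) by exists (fun n : int => - n) => n; rewrite opprK.
have exN n : ex N N%:Z (- n) = ex N N%:Z n.
  by apply/eqP; rewrite -eqz_nat !exE; apply/eqP; ring.
have eN n : (- e) ^ (- n) = (- e) ^ n.
  have e2N : (- e) ^+ 2 = 1 by rewrite sqrrN.
  have : (- e) ^ n * (- e) ^ n = 1.
    by rewrite -exprzDr ?unitrN // -mulr2n -mulr_natl -exprz_exp -exprnP e2N exp1rz.
  have ne : - e != 0 by rewrite -unitfE unitrN.
  by move=> H; rewrite -invr_expz; apply: (mulfI (expfz_neq0 n ne)); rewrite H mulfV ?expfz_neq0.
split.
- rewrite tcoef_gs; apply: eq_gs => [n|//]; rewrite E fcoefCM.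
  by have [-> _] := opt_exp k n; rewrite mulr1.
- rewrite tcoef_gs; apply: (gs_odd nz2 bN px) => // n; rewrite !E !fcoefCM.
  have [_ ->] := opt_exp k n; have [_ ->] := opt_exp k (- n).
  by rewrite eN rmorphN /= mulrN.
have O : gs (fun n : int => (- e) ^ n * n%:~R) (ex N N%:Z) = 0.
  by apply: (gs_odd nz2 bN px) => // n; rewrite eN rmorphN /= mulrN.
rewrite tcoef_gs fderiv_gs.
have gsD (w v : int -> k) : gs (fun n => w n + v n) (ex N N%:Z) = gs w (ex N N%:Z) + gs v (ex N N%:Z).
  apply: fpsP => n; have [s us Hs] := proper_le px n.
  have Hs' i : ex N N%:Z i = n -> i \in s by move=> En; apply: Hs; rewrite En.
  by rewrite fcoefD !(gsE _ us Hs') -big_split.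
rewrite -[RHS]addr0 -(mulr0 (fpsC (4 * N ^ 2)%:R)) -oppr0 -O -gsN -!gsZ.
rewrite -(rmorph_nat (@fpsC k)) -gsZ -gsD; apply: eq_gs => [n|//].
rewrite E fcoefCM.
have -> : (8 * N ^ 2)%:R = (4 * N ^ 2)%:R * 2%:R :> k by rewrite -natrM; congr _%:R; lia.
have -> : (-e) ^ n *+ ex N N%:Z n = (4 * N ^ 2)%:R * ((-e) ^ n * n%:~R ^+ 2).
  rewrite -mulr_natr [(ex _ _ _)%:R]pmulrn exE mulrCA; congr (_ * _).
  rewrite subrr addr0 !rmorphXn !rmorphM /= expr2 natrM natrX; ring.
rewrite -mulrA; transitivity ((4 * N ^ 2)%:R * ((-e)^n * (2%:R * fcoef (opt k ^ n) 2))); first by ring.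
by rewrite opt_exp2; ring.
Qed.

Lemma th_sym (c : A) : c \is a GRing.unit -> th N c^-1 N%:Z = th N c N%:Z.
Proof.
move=> Uc; have -> : N%:Z = - (- N%:Z) by rewrite opprK.
rewrite th_inv // opprK (_ : N%:Z = - N%:Z + (2 * N)%:Z) ?th_shift //; last by lia.
by rewrite (_ : - (- N%:Z + (2 * N)%:Z) = - N%:Z) //; lia.
Qed.

(** Chosen for its expansion to second order at o = 1 + t: the left side has a double zero, governed
    by the derivative of theta, and the right side involves second derivatives of even thetas. *)
Lemma pluckerO (o : A) : o \is a GRing.unit ->
  th N (-1) 0 ^+ 2 * th N o 0 ^+ 2 =
  fpsC o * (th N 1 N%:Z ^+ 2 * th N (- o) N%:Z ^+ 2 - th N (-1) N%:Z ^+ 2 * th N o N%:Z ^+ 2).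
Proof.
move=> Uo; have c1 : fpsC (1 : A) = 1 := rmorph1 _; have cN : fpsC (-1 : A) = -1 := rmorphN1 _.
have U1 := unitr1 A; have UN : (-1 : A) \is a GRing.unit by rewrite unitrN.
have e4v := th_bil N0 N%:Z 0 U1 Uo; have e3v := th_bil N0 N%:Z 0 UN Uo.
have e40 := th_bil N0 N%:Z 0 U1 U1; have e30 := th_bil N0 N%:Z 0 UN U1.
have ev0 := th_bil N0 0 0 Uo U1; have e43 := th_bil N0 N%:Z N%:Z U1 UN.
rewrite addr0 ?subr0 !mul1r in e4v; rewrite addr0 ?subr0 !mulN1r in e3v.
rewrite addr0 ?subr0 !mul1r invr1 in e40.
rewrite addr0 ?subr0 mulr1 divr1 in e30; rewrite ?subr0 mulr1 divr1 in ev0.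
rewrite subrr mul1r mul1r invrN1 c1 mul1r in e43.
rewrite (_ : N%:Z + N%:Z = 0 + (2 * N)%:Z) ?th_shift // in e43; last by lia.
rewrite invrN1 cN mulN1r opprK in e43.
rewrite c1 mul1r in e40; rewrite c1 mul1r in e4v; rewrite cN in e30; rewrite cN in e3v.
rewrite th_sym // in e4v; rewrite -invrN th_sym ?unitrN // in e3v.
move: e4v e3v e40 e30 ev0 e43.
move: (th N o N%:Z) (th N (- o) N%:Z) (th N 1 N%:Z) (th N (-1) N%:Z) (th N o 0) (th N (-1) 0).
move: (R1 N 1 N%:Z) (R0 N o 0) (R0 N 1 N%:Z) (R1 N o 0) (R1 N (-1) N%:Z) (R0 N (-1) N%:Z) (R0 N 1 0) (R1 N 1 0).
move: (fpsC o) => ? ? ? ? ? ? ? ? ? x1 x2 x3 x4 x5 x6 e4v e3v e40 e30 ev0 e43.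
by rewrite !expr2 e4v e3v e40 e30 ev0 e43; ring.
Qed.

(** Coefficient of t^2 in [pluckerO]. The first-order coefficients vanish by evenness, and the heat
    equation of [th_opt_even] turns the second-order ones into derivatives in S. *)
Lemma heat_theta : TH (-1) 0 ^+ 2 * T1 k N ^+ 2 * (4 * N ^ 2)%:R =
  TH 1 N%:Z * TH (-1) N%:Z * (TH 1 N%:Z * fderiv (TH (-1) N%:Z) - TH (-1) N%:Z * fderiv (TH 1 N%:Z)).
Proof.
have Uo := opt_unit k; have P := pluckerO Uo.
have c1 : (1 : A) = fpsC 1 by rewrite rmorph1.
have cN : (-1 : A) = fpsC (-1) by rewrite rmorphN1.
have E1 m : th N (1 : A) m = cmap (TH 1 m) by rewrite c1 cmap_th ?unitr1.
have EN m : th N (-1 : A) m = cmap (TH (-1) m) by rewrite cN cmap_th ?unitrN ?unitr1.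
rewrite !E1 !EN in P.
have oE : fpsC 1 * opt k = opt k by rewrite -c1 mul1r.
have oN : fpsC (-1) * opt k = - opt k by rewrite -cN mulN1r.
have s1 : (1 : k) ^+ 2 = 1 by rewrite expr1n.
have sN : (-1 : k) ^+ 2 = 1 by rewrite sqrrN expr1n.
have [a0 a1 a2] := th_opt_even s1; have [b0 b1 b2] := th_opt_even sN.
rewrite {}oE in a0 a1 a2; rewrite {}oN in b0 b1 b2.
move: a0 a1 a2 b0 b1 b2 P.
have [E [Eth E0]] := @th_zero k N N0 (fpsX 1) erefl; rewrite -T1_prod // in E0.
rewrite -/(opt k) in Eth; rewrite Eth.
move: (th N (opt k) N%:Z) (th N (- opt k) N%:Z) => f g.
rewrite [fpsC (opt k)](_ : _ = 1 + t); last by rewrite /opt rmorphD rmorph1.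
move: (TH (-1) 0) (TH 1 N%:Z) (TH (-1) N%:Z) (T1 k N) E0 => h2 h4 h3 T E0 a0 a1 a2 b0 b1 b2 P.
have := congr1 (tcoef 2) P.
have -> : cmap h2 ^+ 2 * (t * E) ^+ 2 = t * (t * (E * E * (cmap h2 * cmap h2))) by ring.
have E0' : tcoef 0 E = T := E0.
rewrite mulrDl mul1r tcoefD !tcoef_tS 3!tcoefM0 E0' tcoef_cmap /= !expr2 !tcoefB.
rewrite !tcoefM2 !tcoefM1 !tcoefM0 !tcoef_cmap /= a0 a1 b0 b1 !(mul0r, mulr0, add0r, addr0) ?subr0 ?addr0.
move=> Q; rewrite -a2 -b2.
transitivity (T * T * (h2 * h2) * (4 * N ^ 2)%:R); first by ring.
have -> : (8 * N ^ 2)%:R = (4 * N ^ 2)%:R * 2%:R :> fps k by rewrite -natrM; congr _%:R; lia.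
by rewrite Q; move: ((4 * N ^ 2)%:R : fps k) => z; ring.
Qed.

Lemma fderivC (c : k) : fderiv (fpsC c) = 0.
Proof. by apply: fpsP => -[|n] /=; rewrite ?mulr0n // mul0rn. Qed.
Lemma fderivZ (c : k) x : fderiv (fpsC c * x) = fpsC c * fderiv x.
Proof. by rewrite fderivM fderivC mul0r add0r. Qed.
Lemma fderivX n (x : fps k) : fderiv (x ^+ n.+1) = n.+1%:R * x ^+ n * fderiv x.
Proof.
elim: n => [|n IH]; first by rewrite expr0 mulr1 mul1r.
by rewrite exprS fderivM IH [x ^+ n.+1]exprS [in RHS]mulrS; ring.
Qed.

Lemma th_neq0_half (c : k) : c != 0 -> TH c N%:Z != 0.
Proof. by move=> c0; apply: (th_neq0 N0); rewrite ?unitfE ?(ndvdN N0). Qed.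

Lemma jacobi_theta : TH (-1) N%:Z ^+ 4 - TH 1 N%:Z ^+ 4 = TH (-1) 0 ^+ 4.
Proof.
have [F [iota Fr]] := frac_exists (fps k).
have := jacobi_id (thdata_of N0 nz2 Fr (oner_neq0 F)) N0 nz2; rewrite /th2 /th3 /th4 /=.
by move=> H; apply: (proj1 Fr); rewrite rmorphB !rmorphXn.
Qed.

(* The heat equation turns [S d/dS] into the second derivative in the elliptic variable. *)
Lemma A0B0_deriv : B0 * fderiv A0 - A0 * fderiv B0 = (16 * N ^ 2)%:R * (A0 * B0 * (A0 - B0)).
Proof.
have h3 : TH (-1) N%:Z != 0 by apply: th_neq0_half; rewrite oppr_eq0 oner_eq0.
have h4 : TH 1 N%:Z != 0 by apply: th_neq0_half; rewrite oner_eq0.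
have H := heat_theta; have J := jacobi_theta; have T := theta_T1.
rewrite /A0 /B0 !fderivZ !fderivX.
have c4 : fpsC 4%:R^-1 * 4%:R = 1 :> fps k.
  by rewrite -(rmorph_nat (@fpsC k)) -rmorphM mulVf ?nz4 // rmorph1.
move: c4 J T H h3 h4; move: (fderiv (TH 1 N%:Z)) (fderiv (TH (-1) N%:Z)) => d4 d3.
move: (fpsC _) (TH (-1) 0) (TH (-1) N%:Z) (TH 1 N%:Z) (T1 k N) => c a2 a3 a4 T c4 J E H h3 h4.
have W : a2 ^+ 4 * a3 * a4 * (N ^ 2)%:R = a4 * d3 - a3 * d4.
  apply: (mulfI (mulf_neq0 h4 h3)); rewrite -H.
  transitivity (a2 ^+ 2 * (- (a2 * (a4 * a3))) ^+ 2 * (N ^ 2)%:R); first by ring.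
  by rewrite -E natrM; ring.
transitivity (c * c * 4%:R * (a3 ^+ 3 * a4 ^+ 3) * (a4 * d3 - a3 * d4)); first by ring.
rewrite -W -mulrBr J; move: ((N ^ 2)%:R : fps k) (natrM (fps k) 16 (N ^ 2)%N) => z ->.
transitivity (c * c * (c * 4%:R) * 4%:R * (a3 ^+ 4 * a4 ^+ 4 * a2 ^+ 4 * z)).
  by rewrite c4; ring.
by ring.
Qed.

Section Hasse.
Variable ell : nat.
Hypothesis pl : prime ell.
Hypothesis l2 : (2 < ell)%N.
Hypothesis chl : ell \in [pchar k].

Lemma opt_ell : opt k ^+ ell = 1 + fpsX ell.
Proof.
have chA : ell \in [pchar A] by apply: (rmorph_pchar (@fpsC k)).
by rewrite /opt exprDn_pchar ?pnatE // expr1n -fpsXM mul1n.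
Qed.

(** Evaluate the ell-th division polynomial at u = 1 + t, where X has a double pole in t. Since
    u^ell = 1 + t^ell, the pole order of W_ell is ell^2 - ell instead of ell^2 - 1, so the top
    coefficients vanish and the first surviving one, homogeneous of degree (ell - 1)/2, equals 1. *)
Lemma hasse : hom (intr : {rmorphism int -> fps k}) A0 B0 ell.-1./2 1.
Proof.
have [F [iota Fr]] := frac_exists (fps A).
pose psi : {rmorphism fps k -> F} := iota \o cmap.
have psi_inj : injective psi by move=> x y /(proj1 Fr)/(congr1 atz); rewrite !atzK.
have T0 : psi (T1 k N) != 0.
  by apply: contraNneq T1_neq0 => E; apply/eqP/psi_inj; rewrite E rmorph0.
pose D := thdata_of N0 nz2A Fr T0.
have ttE c m : tt D c m = iota (th N c m) by [].
have cN : (-1 : A) = fpsC (-1) by rewrite rmorphN1.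
have c1 : (1 : A) = fpsC 1 by rewrite rmorph1.
have e2 : th2 D = psi (TH (-1) 0) by rewrite /th2 ttE cN -cmap_th ?unitrN ?unitr1.
have e3 : th3 D = psi (TH (-1) N%:Z) by rewrite /th3 ttE cN -cmap_th ?unitrN ?unitr1.
have e4 : th4 D = psi (TH 1 N%:Z) by rewrite /th4 ttE c1 -cmap_th ?unitr1.
have [Ea Eb] : al D = psi A0 /\ be D = psi B0.
  have [] := @al_theta _ _ _ D N0 nz2A.
    rewrite e2 e3 e4 -[TT D]/(psi (T1 k N)) -!rmorphM -rmorphN -theta_T1.
    by rewrite rmorphM rmorph_nat.
  have Q : psi (fpsC 4%:R^-1) = 4%:R^-1.
    have H : 4%:R * psi (fpsC 4%:R^-1) = 1.
      by rewrite -(rmorph_nat psi) -(rmorph_nat (@fpsC k)) -!rmorphM mulfV ?nz4 // !rmorph1.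
    have nz : (4%:R : F) != 0 by apply: contra_eq_neq H => ->; rewrite mul0r eq_sym oner_eq0.
    by apply: (mulfI nz); rewrite H mulfV.
  move=> -> ->; rewrite e3 e4 /A0 /B0.
  by rewrite (rmorphM psi) (rmorphM psi (fpsC _) (TH 1 _ ^+ 4)) Q !(rmorphXn psi) ![_^-1 * _]mulrC.
have Uo := opt_unit k.
have o1 : opt k != 1.
  rewrite /opt -subr_eq0 addrAC subrr add0r; exact: fpsX_neq0.
have o2 : opt k ^+ 2 != 1.
  rewrite -subr_eq0 (_ : _ - 1 = fpsX 1 * (2%:R + fpsX 1)); last by rewrite /opt; ring.
  rewrite mulf_neq0 ?fpsX_neq0 //; apply/eqP => /(congr1 (fun f => fcoef f 0)) /eqP.
  by rewrite fcoefD -(rmorph_nat (@fpsC k)) /= addr0 (negPf nz2).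
have ok : okpt N (opt k) 0 by split=> //; rewrite add0r (ndvdN N0).
have [G [hG wG]] := eds D N0 nz2A ell.
have ol : odd ell by case: (even_prime pl) l2 => [->|//].
set DD := dd ell in hG; have ED : (ell ^ 2 = (2 * DD).+1)%N.
  rewrite /DD (_ : ell = 2 * ell./2 + 1)%N ?dd_odd; last by lia.
  by rewrite -mulnn; nia.
have /choice[y Hy] : forall s, exists z : fps k,
    hom intr A0 B0 s z /\ ((s <= DD)%N -> G`_(DD - s) = psi z).
  move=> s; have [sD|sD] := leqP s DD; last by exists 0; split=> //; exact: hom0.
  case: hG => _ _ /(_ (DD - s)%N (leq_subr _ _)); rewrite subKn // Ea Eb => h.
  have [z [hz Ez]] := @hom_lift _ _ _ (intr : {rmorphism int -> fps k}) _ psi _ _ _ _ (fun c => esym (rmorph_int psi c)) h.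
  by exists z.
have := wG _ _ ok; rewrite ol mulr1 /Wf mul0rn !ttE opt_ell.
have [E1 [Eth1 E10]] := @th_zero k N N0 (fpsX 1) erefl; rewrite -T1_prod // in E10.
have fl0 : fcoef (fpsX ell : A) 0 = 0 by rewrite fpsX_coef0 // prime_gt0.
have [E2 [Eth2 E20]] := @th_zero k N N0 (fpsX ell) fl0; rewrite -T1_prod // in E20.
rewrite -/(opt k) in Eth1; rewrite Eth1 Eth2 ED => W.
have nD : (ell.-1./2 <= DD)%N by clear -ED ol; rewrite -mulnn in ED; nia.
suff S : y ell.-1./2 = 1 by have [h _] := Hy ell.-1./2; rewrite S in h.
(* Once the poles are cleared with powers of t, [E1] and theta2, the identity has the shape required
   by [t_lead], with M the common value at t = 0 of a and of all B s. *)
pose thm := th N (- opt k) 0.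
pose M := T1 k N * (T1 k N * TH (-1) 0) ^+ (2 * DD).
pose B s := E1 * (cmap (T1 k N) * thm) ^+ (2 * (DD - s)) * (E1 * cmap (TH (-1) 0)) ^+ (2 * s).
pose a := fpsC (opt k) ^+ 'C(ell, 2) * E2 * (cmap (T1 k N) * cmap (TH (-1) 0)) ^+ (2 * DD).
have h20 : TH (-1) 0 != 0 by apply: (th_neq0 N0); rewrite ?unitrN ?unitr1 // => _; apply: N1_neq1.
have athm : atz thm = TH (-1) 0.
  rewrite /atz /thm /= fmap_gs; apply: eq_gs => [n|//] /=.
  by rewrite !opprK exp1rz; have [] := opt_exp k n.
have E1z : atz E1 = T1 k N := E10.
have E2z : atz E2 = T1 k N := E20.
apply: (@t_lead DD _ B a _ M) => //.
- by rewrite /M mulf_neq0 ?expf_neq0 ?mulf_neq0 ?T1_neq0.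
- move=> s sD; rewrite /B !(rmorphM atz) !(rmorphXn atz) !(rmorphM atz) !atzK athm E1z /M -mulrA -exprD.
  by rewrite -mulnDr subnK.
- rewrite /a !(rmorphM atz) !(rmorphXn atz) !(rmorphM atz) !atzK E2z.
  have -> : atz (fpsC (opt k)) = 1.
    by apply: fpsP => -[|n] /=; rewrite /ev0 /= ?addr0.
  by rewrite expr1n mul1r.
have t0 : iota t != 0 by rewrite (iota_eq0 Fr) t_neq0.
have e10 : iota E1 != 0.
  rewrite (iota_eq0 Fr); apply: contraNneq T1_neq0 => H; by rewrite -E1z H rmorph0.
have h0 : psi (TH (-1) 0) != 0 by apply: contraNneq h20 => H; apply/eqP/psi_inj; rewrite H rmorph0.
apply: (proj1 Fr); rewrite (rmorph_sum iota).
have EX : Xf D (opt k) 0 = (psi (T1 k N) * iota thm / (iota t * iota E1 * psi (TH (-1) 0))) ^+ 2.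
  rewrite /Xf e2 !ttE Eth1 (rmorphM iota) -/thm -[TT D]/(psi (T1 k N)); field.
  by rewrite t0 e10 h0.
have tl : fpsC (fpsX ell) = t * t ^+ (2 * ell.-1./2).
  by rewrite -exprS -rmorphXn -fpsXM mul1n; congr (fpsC (fpsX _)); clear -ol; lia.
case: hG => sG _ _; rewrite (horner_coef_wide _ sG) EX tl -[TT D]/(psi (T1 k N)) in W.
have pE x : psi x = iota (cmap x) by [].
have Hy' s : (s <= DD)%N -> G`_(DD - s) = iota (cmap (y s)) by move=> sD; rewrite (proj2 (Hy s)).
rewrite !pE in W h0; rewrite -[cst D _]/(iota (fpsC (opt k))) !(rmorphM iota) in W.
have := congr1 (fun z => z * (iota E1 * (iota t * iota E1 * iota (cmap (TH (-1) 0))) ^+ (2 * DD))) W.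
rewrite /= mulr_suml (reindex_inj rev_ord_inj) /= => {}W.
transitivity (\sum_(s < DD.+1) iota (cmap (y s)) * ((iota (cmap (T1 k N)) * iota thm /
   (iota t * iota E1 * iota (cmap (TH (-1) 0)))) ^+ 2) ^+ (DD - s) *
   (iota E1 * (iota t * iota E1 * iota (cmap (TH (-1) 0))) ^+ (2 * DD))); last first.
  apply: eq_bigr => -[s sD] _ /=; rewrite /B !(rmorphM iota) !(rmorphXn iota) !(rmorphM iota) -exprM.
  move: (iota t) t0 (iota E1) e10 (iota (cmap (TH (-1) 0))) h0 (iota (cmap (T1 k N))) (iota thm) (iota (cmap (y s))).
  move=> v v0 e e0 h h0' T m z.
  rewrite (_ : 2 * DD = 2 * (DD - s) + 2 * s)%N; last by clear -sD; lia.
  rewrite [(v * e * h) ^+ (_ + _)]exprD expr_div_n [(v * e * h) ^+ (2 * s)]exprMn [(v * e) ^+ (2 * s)]exprMn.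
  rewrite [(e * h) ^+ _]exprMn.
  have nz : (v * e * h) ^+ (2 * (DD - s)) != 0 by rewrite expf_neq0 // !mulf_neq0.
  move: ((v * e * h) ^+ (2 * (DD - s))) nz => w w0; move: ((T * m) ^+ _) (v ^+ _) (e ^+ _) (h ^+ _) => *.
  by field.
transitivity (iota (fpsC (opt k)) ^+ 'C(ell, 2) * (iota t * iota (t ^+ (2 * ell.-1./2)) * iota E2) *
   (iota (cmap (T1 k N)) / (iota t * iota E1)) ^+ (2 * DD).+1 / iota (cmap (T1 k N)) *
   (iota E1 * (iota t * iota E1 * iota (cmap (TH (-1) 0))) ^+ (2 * DD))); last first.
  rewrite W; apply: eq_bigr => -[s sD] _ /=; rewrite subSS Hy' //.
rewrite /a !(rmorphM iota) !(rmorphXn iota) !(rmorphM iota).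
have T0' : iota (cmap (T1 k N)) != 0 by [].
move: (iota t) t0 (iota E1) e10 (iota (cmap (TH (-1) 0))) h0 (iota (cmap (T1 k N))) T0'.
move=> v v0 e e0 h h0' T T0'.
rewrite exprS expr_div_n !exprMn.
have vP : v ^+ (2 * DD) != 0 by rewrite expf_neq0.
have eP : e ^+ (2 * DD) != 0 by rewrite expf_neq0.
move: (v ^+ (2 * DD)) (e ^+ (2 * DD)) vP eP => p p' p0 p0'.
move: (v ^+ _) (T ^+ _) (h ^+ _) => *; field.
by rewrite v0 e0 T0' p0 p0'.
Qed.
End Hasse.

End TwoVar.

End Hasse.

(** * Coordinates of the N-torsion points of the Tate curve *)

Module TorsionPoints.
Import PowerSeries FormalSums Theta TripleProduct ProductFormula ThetaIdentities TateCurve DivisionPolynomials Hasse.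

Lemma Zp_nat_eq0 N (n : nat) : (1 < N)%N -> ((n%:R : 'Z_N) == 0) = (N %| n)%N.
Proof. by move=> N1; rewrite -val_eqE /= val_Zp_nat. Qed.

Lemma Zp_int_eq0 N (i : int) : (1 < N)%N -> ((i%:~R : 'Z_N) == 0) = (N%:Z %| i)%Z.
Proof.
move=> N1; case: i => n; first by rewrite -pmulrn Zp_nat_eq0.
by rewrite NegzE rmorphN oppr_eq0 /= -pmulrn Zp_nat_eq0 // dvdzE abszN.
Qed.

Lemma Zp_int_surj N (x : 'Z_N) : ((x : nat)%:Z)%:~R = x.
Proof. by rewrite -pmulrn natr_Zp. Qed.

Section Shiftz.
Variables (R : idomainType) (N : nat) (F : fieldType) (D : thdata R N F).
Hypothesis nz2 : (2%:R : R) != 0.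
Local Notation good c m := (((2 * N)%:Z %| m)%Z -> c != 1).

Lemma good_shift (c : R) m z : good c m -> good c (m + (2 * N)%:Z * z).
Proof. by move=> g h; apply: g; move: h; rewrite rpredDr // dvdz_mulr. Qed.

Lemma XY_shiftz (c : R) m z : c \is a GRing.unit -> good c m ->
  Xf D c (m + (2 * N)%:Z * z) = Xf D c m /\ Yf D c (m + (2 * N)%:Z * z) = Yf D c m.
Proof.
move=> Uc; have H (n : nat) m' : good c m' -> Xf D c (m' + (2 * N)%:Z * n%:Z) = Xf D c m' /\
    Yf D c (m' + (2 * N)%:Z * n%:Z) = Yf D c m'.
  move=> g; elim: n => [|n [IX IY]]; first by rewrite mulr0 addr0.
  have -> : m' + (2 * N)%:Z * n.+1%:Z = m' + (2 * N)%:Z * n%:Z + (2 * N)%:Z by rewrite intS; ring.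
  by have g' := @good_shift c m' n%:Z g; rewrite X_shift // Y_shift.
move=> g; case: z => n; first exact: H.
rewrite NegzE; have g' := @good_shift c m (- n.+1%:Z) g.
have [EX EY] := H n.+1 _ g'.
have e : m + (2 * N)%:Z * - n.+1%:Z + (2 * N)%:Z * n.+1%:Z = m by ring.
by rewrite e in EX EY.
Qed.
End Shiftz.

Section Points.
Variable k : fieldType.
Variable ell : nat.
Hypothesis pl : prime ell.
Hypothesis l3 : (3 < ell)%N.
Hypothesis chl : ell \in [pchar k].
Variable N : nat.
Hypothesis N1 : (1 < N)%N.
Hypothesis cN6 : coprime N 6.
Variable xi : k.
Hypothesis xiP : (N ^ 2).-primitive_root xi.
Variables (F : fieldType) (iota : {rmorphism fps k -> F}).
Hypothesis Fr : is_frac iota.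

Lemma N0 : (0 < N)%N. Proof. exact: ltnW. Qed.
Lemma oddN : odd N.
Proof. by move: cN6; rewrite (_ : 6 = 2 * 3)%N // coprimeMr coprimen2 => /andP[]. Qed.
Lemma k2 : (2%:R : k) != 0.
Proof.
rewrite -(dvdn_pcharf chl); apply: contraL l3 => /(dvdn_leq (isT : 0 < 2)%N) h.
by rewrite -leqNgt (leq_trans h).
Qed.
Lemma TF0 : iota (T1 k N) != 0.
Proof. by rewrite (iota_eq0 Fr) T1_neq0 // N0. Qed.

Definition DD := thdata_of N0 k2 Fr TF0.
(** The points have u = zeta^i S^(8 N j), so S -> xi S multiplies u by zeta^j and acts as a shear.
    As 8 is prime to N, zeta is a primitive N-th root of unity. *)
Definition zeta := xi ^+ (8 * N).

Lemma zetaP : N.-primitive_root zeta.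
Proof.
have -> : N = (N ^ 2 %/ gcdn (8 * N) (N ^ 2))%N.
  have -> : gcdn (8 * N) (N ^ 2) = N; last by rewrite -mulnn mulnK ?N0.
  rewrite -mulnn -muln_gcdl (eqP (_ : coprime 8 N)) ?mul1n //.
  by rewrite (_ : 8 = 2 ^ 3)%N // coprimeXl // coprime2n oddN.
exact: exp_prim_root.
Qed.
Lemma zeta_neq0 : zeta != 0.
Proof.
apply: contra_eq_neq (prim_expr_order zetaP) => ->; rewrite expr0n gtn_eqF ?N0 //.
by rewrite eq_sym oner_eq0.
Qed.
Lemma zeta_eq1 (i : int) : (zeta ^ i == 1) = (N%:Z %| i)%Z.
Proof.
case: i => n; first by rewrite -exprnP -(prim_order_dvd zetaP).
by rewrite NegzE -invr_expz invr_eq1 -exprnP -(prim_order_dvd zetaP) dvdzE abszN.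
Qed.
Lemma zetaX_unit (i : int) : zeta ^ i \is a GRing.unit.
Proof. by rewrite unitfE expfz_neq0 ?zeta_neq0. Qed.

Local Notation good c m := (((2 * N)%:Z %| m)%Z -> c != 1).
Local Notation nz i j := (~~ ((N%:Z %| i)%Z && (N%:Z %| j)%Z)).

Lemma dvd2N (j : int) : ((2 * N)%:Z %| 2 * j)%Z = (N%:Z %| j)%Z.
Proof. by rewrite PoszM dvdz_mul2l. Qed.

Lemma pt_good i j : nz i j -> good (zeta ^ i) (2 * j).
Proof. by move=> h d; rewrite zeta_eq1; apply: contra h => ->; rewrite dvd2N in d. Qed.

Lemma cop2 (i : int) : (N%:Z %| 2 * i)%Z = (N%:Z %| i)%Z.
Proof. by rewrite !dvdzE abszM Gauss_dvdr // coprimen2 oddN. Qed.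

(** By parity: N is odd, so 2 j + N is never a multiple of 2 N and translates by half periods avoid
    the zeros of theta. *)
Lemma pt_half (c : k) j : good c (2 * j + N%:Z).
Proof.
move=> /dvdzP[z E]; exfalso; have := oddN; rewrite PoszM mulrCA in E.
by move: (z * N%:Z) E => w; clear; lia.
Qed.

Lemma pt_ok i j : nz i j -> okpt N (zeta ^ i) (2 * j).
Proof.
move=> h; split; try exact: pt_half; rewrite ?zetaX_unit //; first exact: pt_good.
have -> : (zeta ^ i) ^+ 2 = zeta ^ (2 * i) by rewrite mulrC -exprz_exp.
by apply: pt_good; rewrite !cop2.
Qed.

Notation V := ('Z_N * 'Z_N)%type.
(** At the origin, where the true values are infinite, (0, 0) is used: it still satisfies the curve
    equation and the parity in the point, so these relations hold on all of V. *)
Definition Xp (a : V) : F := if a == 0 then 0 else Xf DD (zeta ^ ((a.1 : nat)%:Z)) (2 * (a.2 : nat)%:Z).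
Definition Yp (a : V) : F := if a == 0 then 0 else Yf DD (zeta ^ ((a.1 : nat)%:Z)) (2 * (a.2 : nat)%:Z).

Definition pt (i j : int) : V := (i%:~R, j%:~R).
Lemma pt_eq0 i j : (pt i j == 0) = ~~ nz i j.
Proof. by rewrite negbK -(Zp_int_eq0 _ N1) -(Zp_int_eq0 j N1). Qed.

Lemma pt_surj (a : V) : a = pt (a.1 : nat)%:Z (a.2 : nat)%:Z.
Proof. by case: a => x y; rewrite /pt /= !Zp_int_surj. Qed.

Lemma Zp_dvd_sub (i : int) : (N%:Z %| i - ((i%:~R : 'Z_N) : nat)%:Z)%Z.
Proof. by rewrite -(Zp_int_eq0 _ N1) rmorphB /= Zp_int_surj subrr. Qed.

Lemma XYp i j : nz i j ->
  Xf DD (zeta ^ i) (2 * j) = Xp (pt i j) /\ Yf DD (zeta ^ i) (2 * j) = Yp (pt i j).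
Proof.
move=> h; rewrite /Xp /Yp pt_eq0 negbK (negPf h) /pt /=.
have /dvdzP[z Ez] := Zp_dvd_sub j; pose j' := ((j%:~R : 'Z_N) : nat); rewrite -/j' in Ez *.
have -> : zeta ^ ((i%:~R : 'Z_N) : nat)%:Z = zeta ^ i.
  have := Zp_dvd_sub i; rewrite -zeta_eq1 expfzDr ?zeta_neq0 // -invr_expz => /eqP E.
  by rewrite -[LHS]mul1r -E mulfVK // expfz_neq0 ?zeta_neq0.
have -> : 2 * j'%:Z = 2 * j + (2 * N)%:Z * (- z).
  by rewrite (_ : j'%:Z = j - z * N%:Z) ?PoszM; [ring|rewrite -Ez; ring].
by have [-> ->] := XY_shiftz DD k2 (- z) (zetaX_unit i) (pt_good h).
Qed.

Lemma Xp0 : Xp 0 = 0. Proof. by rewrite /Xp eqxx. Qed.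
Lemma Yp0 : Yp 0 = 0. Proof. by rewrite /Yp eqxx. Qed.

Lemma ptD i j i' j' : pt i j + pt i' j' = pt (i + i') (j + j').
Proof. by rewrite /pt !rmorphD. Qed.
Lemma ptN i j : - pt i j = pt (- i) (- j).
Proof. by rewrite /pt !rmorphN. Qed.

Lemma XYpN a : Xp (- a) = Xp a /\ Yp (- a) = - Yp a.
Proof.
have [->|a0] := eqVneq a 0; first by rewrite oppr0 Xp0 Yp0 oppr0.
have a0' : - a != 0 by rewrite oppr_eq0.
move: a0 a0'; rewrite [a]pt_surj; move: ((a.1 : nat)%:Z) ((a.2 : nat)%:Z) => i j.
rewrite ptN !pt_eq0 !negbK => h h'.
have [<- <-] := XYp h; have [<- <-] := XYp h'.
rewrite mulrN -invr_expz X_inv ?Y_inv ?zetaX_unit ?k2 //; exact: pt_good.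
Qed.

Lemma Yp_neq0 a : a != 0 -> Yp a != 0.
Proof.
rewrite [a]pt_surj; move: ((a.1 : nat)%:Z) ((a.2 : nat)%:Z) => i j.
rewrite pt_eq0 negbK => h; have [_ <-] := XYp h.
exact: (okpt_Y DD (pt_ok h)).
Qed.

Notation a_ := (al DD).
Notation b_ := (be DD).
Lemma Yp_sqr a : Yp a ^+ 2 = 4%:R * (Xp a * (Xp a - a_) * (Xp a - b_)).
Proof.
have [->|] := eqVneq a 0; first by rewrite Xp0 Yp0 expr0n !mul0r mulr0.
rewrite [a]pt_surj; move: ((a.1 : nat)%:Z) ((a.2 : nat)%:Z) => i j.
rewrite pt_eq0 negbK => h; have [<- <-] := XYp h.
by rewrite Y_sqr ?N0 ?k2 ?zetaX_unit //; apply: pt_good.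
Qed.

Lemma Xp_eq a b : a != 0 -> b != 0 -> Xp a = Xp b -> a = b \/ a = - b.
Proof.
move=> a0 b0 E; have [->|n1] := eqVneq a b; first by left.
have [->|n2] := eqVneq a (- b); first by right.
move: a0 b0 E n1 n2; rewrite -[a == b]subr_eq0 -addr_eq0 [a]pt_surj [b]pt_surj.
move: ((a.1 : nat)%:Z) ((a.2 : nat)%:Z) ((b.1 : nat)%:Z) ((b.2 : nat)%:Z) => i j i' j'.
rewrite ptN !ptD !pt_eq0 !negbK => h h'; have [<- _] := XYp h; have [<- _] := XYp h'.
move/eqP; rewrite -subr_eq0 => E n1 n2; exfalso; move: E; apply/negP.
rewrite (X_sub DD k2 (zetaX_unit i) (zetaX_unit i') (pt_good h) (pt_good h')) oppr_eq0.
have Ep : zeta ^ (i + i') = zeta ^ i * zeta ^ i' by rewrite expfzDr ?zeta_neq0.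
have Em : zeta ^ (i - i') = zeta ^ i / zeta ^ i' by rewrite expfzDr ?zeta_neq0 // invr_expz.
rewrite -Ep -Em -mulrDr -mulrBr; rewrite !mulf_neq0 ?invr_eq0 ?expf_neq0 ?mulf_neq0 ?TT_neq0 ?cst_neq0 ?zetaX_unit //.
all: by apply: tt_neq0; rewrite ?zetaX_unit //; exact: pt_good.
Qed.

Section TwoPts.
Variables a b : V.
Hypotheses (a0 : a != 0) (b0 : b != 0) (n1 : a - b != 0) (n2 : a + b != 0).

Lemma Xp_add :
  (Xp a - Xp b) ^+ 2 * (Xp (a - b) - Xp (a + b)) = Yp a * Yp b /\
  a_ * (Xp a - Xp b) ^+ 2 * (Xp (a + b) + Xp (a - b)) =
  (a_ * b_ - Xp a * Xp b) ^+ 2 + a_ ^+ 2 * (Xp a - Xp b) ^+ 2 -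
  (a_ * (Xp a + Xp b) - a_ * b_ - Xp a * Xp b) ^+ 2.
Proof.
move: a0 b0 n1 n2; rewrite [a]pt_surj [b]pt_surj.
move: ((a.1 : nat)%:Z) ((a.2 : nat)%:Z) ((b.1 : nat)%:Z) ((b.2 : nat)%:Z) => i j i' j'.
rewrite ptN !ptD !pt_eq0 !negbK => h h' h1 h2.
have [<- <-] := XYp h; have [<- <-] := XYp h'; have [<- _] := XYp h1; have [<- _] := XYp h2.
have Ep : zeta ^ (i + i') = zeta ^ i * zeta ^ i' by rewrite expfzDr ?zeta_neq0.
have Em : zeta ^ (i - i') = zeta ^ i / zeta ^ i' by rewrite expfzDr ?zeta_neq0 // invr_expz.
have g1 := pt_good h1; have g2 := pt_good h2.
have d1 : 2 * (j - j') = 2 * j - 2 * j' by ring.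
have d2 : 2 * (j + j') = 2 * j + 2 * j' by ring.
rewrite d1 Em in g1; rewrite d2 Ep in g2; rewrite d1 d2 Ep Em.
have [U U'] := (zetaX_unit i, zetaX_unit i'); have [g g'] := (pt_good h, pt_good h').
split; first exact: (X_diff DD k2 U U' g g' g2 g1).
exact: (X_sum DD N0 k2 U U' g g' g2 g1 (@pt_half _ j)).
Qed.
End TwoPts.

Lemma dbl_neq0 (a : V) : a != 0 -> a + a != 0.
Proof.
rewrite [a]pt_surj; move: ((a.1 : nat)%:Z) ((a.2 : nat)%:Z) => i j.
rewrite ptD !pt_eq0 !negbK.
have D2 (x : int) : x + x = 2 * x by ring.
by rewrite !D2 !cop2.
Qed.

Lemma Xp_dbl a : a != 0 -> Xp (a + a) * Yp a ^+ 2 = (Xp a ^+ 2 - a_ * b_) ^+ 2 /\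
  Yp (a + a) * Yp a ^+ 3 = 2%:R * (Xp a ^+ 2 - a_ * b_) *
    (Xp a ^+ 2 - 2%:R * a_ * Xp a + a_ * b_) * (Xp a ^+ 2 - 2%:R * b_ * Xp a + a_ * b_).
Proof.
move=> a0; have := dbl_neq0 a0; move: a0.
rewrite [a]pt_surj; move: ((a.1 : nat)%:Z) ((a.2 : nat)%:Z) => i j.
rewrite ptD !pt_eq0 !negbK => h h2; have [<- <-] := XYp h; have [<- <-] := XYp h2.
have D2 : 2 * (j + j) = 2 * (2 * j) by ring.
have g2 := pt_good h2; rewrite D2 in g2; rewrite D2.
have -> : zeta ^ (i + i) = (zeta ^ i) ^+ 2 by rewrite expr2 expfzDr ?zeta_neq0.
have g2' : good ((zeta ^ i) ^+ 2) (2 * (2 * j)) by rewrite expr2 -expfzDr ?zeta_neq0.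
have U := zetaX_unit i; have g := pt_good h.
have t1 := tt_neq0 DD U g.
have t2 : tt DD ((zeta ^ i) ^+ 2) (2 * (2 * j)) != 0 by apply: tt_neq0; rewrite ?unitrX.
split; first exact: (X_dbl N0 k2 U t1 t2).
exact: (Y_dbl DD N0 k2 U g (@pt_half _ j) (@pt_half _ j) g2').
Qed.

(** At an N-torsion point u^N is a power of q, a zero of theta, so W_N vanishes; as N is odd no
    factor Y intervenes. *)
Lemma torsion_poly : exists G : {poly F}, hpol (intr : {rmorphism int -> F}) a_ b_ (dd N) N%:R G /\
  forall a, a != 0 -> G.[Xp a] = 0.
Proof.
have [G [hG wG]] := eds DD N0 k2 N; exists G; split.
  by move: hG; rewrite /ld oddN.
move=> a; rewrite [a]pt_surj; move: ((a.1 : nat)%:Z) ((a.2 : nat)%:Z) => i j.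
rewrite pt_eq0 negbK => h; have [<- _] := XYp h.
have := wG _ _ (pt_ok h); rewrite oddN mulr1 => <-.
rewrite /Wf (_ : tt DD _ _ = 0) ?mulr0 ?mul0r //=.
have T10 := tt10 DD; rewrite /= in T10.
have -> : (zeta ^ i) ^+ N = 1.
  by rewrite exprnP exprz_exp mulrC -exprz_exp -exprnP (prim_expr_order zetaP) exp1rz.
have -> : 2 * j *+ N = 0 + (2 * N)%:Z * j by rewrite add0r -mulr_natr PoszM natz; ring.
by rewrite th_shiftz ?unitr1 ?N0 // rmorphM T10 mulr0.
Qed.
End Points.

End TorsionPoints.

(** * Maps of the torsion that preserve all polynomial relations *)

Module GaloisAction.
Import DivisionPolynomials.

Section Newton.
Variable F : fieldType.

Lemma deriv_prod_XsubC (rs : seq F) : let G := \prod_(r <- rs) ('X - r%:P) in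
  G^`() = \sum_(r <- rs) G %/ ('X - r%:P).
Proof.
elim: rs => [|r rs IH] /=; first by rewrite !big_nil derivC.
rewrite !big_cons derivM derivXsubC mul1r mulKp ?polyXsubC_eq0 // IH; congr (_ + _).
rewrite mulr_sumr; apply: eq_big_seq => s s_rs.
have /dvdpP[Q EQ] : 'X - s%:P %| \prod_(j <- rs) ('X - j%:P).
  by rewrite (big_rem s) //= dvdp_mulr.
by rewrite EQ mulrA !mulpK ?polyXsubC_eq0.
Qed.

Lemma divp_XsubC_coef (G : {poly F}) r d j : (size G <= d.+1)%N -> root G r ->
  (G %/ ('X - r%:P))`_j = \sum_(l < d - j) G`_(j.+1 + l) * r ^+ l.
Proof.
move=> sG /factor_theorem[Q EQ]; rewrite EQ mulpK ?polyXsubC_eq0 //.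
have [Q0|Q0] := eqVneq Q 0.
  rewrite Q0 mul0r coef0 big1 // => l _; by rewrite coef0 mul0r.
have sQ : (size Q <= d)%N.
  by move: sG; rewrite EQ size_Mmonic ?monicXsubC // size_XsubC addn2.
have rec i : Q`_i = (Q * ('X - r%:P))`_i.+1 + r * Q`_i.+1.
  by rewrite mulrBr coefB coefMX coefMC /= mulrC subrK.
move: (Q * _) rec => P rec.
move En : (d - j)%N => n; elim: n j En => [|n IH] j Ej.
  by rewrite big_ord0 nth_default // (leq_trans sQ) // -subn_eq0 Ej.
rewrite big_ord_recl addn0 expr0 mulr1 rec (IH j.+1); last by lia.
rewrite mulr_sumr; congr (_ + _); apply: eq_bigr => l _ /=.
by rewrite /bump /= exprS add1n addSnnS; ring.
Qed.

Variables (k : fieldType) (cst : {rmorphism k -> F}) (a b : F).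
(** Newton's identities, read from the logarithmic derivative of G for m < d and from the sum of
    r^(m-d) G(r) for m >= d. They only divide by the leading coefficient, never by an integer, so
    the characteristic does not matter. *)
Lemma newton_hom (rs : seq F) (l : k) G : l != 0 -> hpol cst a b (size rs) (cst l) G ->
  G = cst l *: \prod_(r <- rs) ('X - r%:P) ->
  forall m, hom cst a b m (\sum_(r <- rs) r ^+ m).
Proof.
move=> l0 hG EG; set d := size rs in hG; have [sG ld hh] := hG.
have ll : cst l != 0 by rewrite fmorph_eq0.
have rG r : r \in rs -> root G r by move=> h; rewrite EG rootZ // root_prod_XsubC.
have key m x : hom cst a b m (cst l * x) -> hom cst a b m x.
  move=> h; rewrite -[x](mulKf ll) -fmorphV; exact: homZ.
elim/ltn_ind=> m IH; have [lt|ge] := ltnP m d.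
  set j := (d.-1 - m)%N.
  have E : j.+1%:R * G`_j.+1 = \sum_(i < d - j) G`_(j.+1 + i) * \sum_(r <- rs) r ^+ i.
    have := congr1 (fun p : {poly F} => (cst l *: p)`_j) (deriv_prod_XsubC rs).
    rewrite /= -derivZ -EG coef_deriv mulr_natl => ->.
    rewrite scaler_sumr coef_sum.
    rewrite (eq_big_seq (fun r => \sum_(i < d - j) G`_(j.+1 + i) * r ^+ i)) => [|r r_rs]; last first.
      by rewrite -divpZl -EG (divp_XsubC_coef j sG) // rG.
    by rewrite exchange_big; apply: eq_bigr => i _; rewrite mulr_sumr.
  have Ed : (d - j = m.+1)%N by rewrite /j; lia.
  rewrite Ed big_ord_recr /= in E; have e1 : (j.+1 + m = d)%N by rewrite /j; lia.
  rewrite e1 ld in E; apply: key.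
  have -> : cst l * \sum_(r <- rs) r ^+ m = j.+1%:R * G`_j.+1 -
     \sum_(i < m) G`_(j.+1 + i) * \sum_(r <- rs) r ^+ i by rewrite E [_ + cst l * _]addrC addrK.
  apply: homB.
    have e : (0 + (d - j.+1) = m)%N by lia.
    rewrite -{1}e.
    by apply: homM; [exact: hom_nat|apply: hh; lia].
  apply: hom_sum => -[i im] _ /=; have e : ((d - (j.+1 + i)) + i = m)%N by lia.
  by rewrite -{1}e; apply: homM; [apply: hh; lia|apply: IH].
apply: key.
have E : \sum_(i < d.+1) G`_i * \sum_(r <- rs) r ^+ (m - d + i) = 0.
  rewrite (eq_bigr (fun i : 'I_d.+1 => \sum_(r <- rs) G`_i * r ^+ i * r ^+ (m - d))); last first.
    by move=> i _; rewrite mulr_sumr; apply: eq_bigr => r _; rewrite addnC exprD mulrA.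
  rewrite exchange_big big_seq big1 // => r r_rs /=.
  by rewrite -mulr_suml -(horner_coef_wide _ sG) (rootP (rG _ r_rs)) mul0r.
rewrite big_ord_recr /= subnK // ld in E.
have -> : cst l * \sum_(r <- rs) r ^+ m = - \sum_(i < d) G`_i * \sum_(r <- rs) r ^+ (m - d + i).
  by apply/eqP; rewrite -addr_eq0 addrC E.
apply/homN/hom_sum => -[i im] _ /=; have e : ((d - i) + (m - d + i) = m)%N by lia.
by rewrite -{1}e; apply: homM; [apply: hh; lia|apply: IH; lia].
Qed.
End Newton.

Section Integral.
Variables (k F : fieldType) (cst : {rmorphism k -> F}) (lam : F).
Definition evl (p : {poly k}) : F := (map_poly cst p).[lam].
Lemma evl_zmod : zmod_morphism evl.
Proof. by move=> p q; rewrite /evl rmorphB hornerD hornerN. Qed.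
Lemma evl_monoid : monoid_morphism evl.
Proof. by split=> [|p q]; rewrite /evl ?rmorph1 ?hornerC // rmorphM hornerM. Qed.
HB.instance Definition _ := GRing.isZmodMorphism.Build _ _ evl evl_zmod.
HB.instance Definition _ := GRing.isMonoidMorphism.Build _ _ evl evl_monoid.
Lemma evlM p q : evl (p * q) = evl p * evl q. Proof. by case: evl_monoid => _; apply. Qed.
Lemma evlX p n : evl (p ^+ n) = evl p ^+ n.
Proof. by elim: n => [|n IH]; rewrite ?exprS ?evlM ?IH // expr0; case: evl_monoid. Qed.
Hypothesis trans : forall p, p != 0 -> evl p != 0.

Lemma evl_inj : injective evl.
Proof.
move=> p q E; apply/eqP; rewrite -subr_eq0; apply/negPn/negP => /trans.
by rewrite evl_zmod E subrr eqxx.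
Qed.

(** Rational root theorem: [lam] is transcendental, so k[lam] is a polynomial ring, which is
    integrally closed. *)
Lemma integral_poly x p q : p != 0 -> x * evl p = evl q -> integralOver evl x -> exists r, x = evl r.
Proof.
move=> p0 E [P mP rP].
pose g := gcdp p q; have g0 : g != 0 by rewrite gcdp_eq0 negb_and p0.
have Ep : p = (p %/ g) * g by rewrite divpK // dvdp_gcdl.
have Eq : q = (q %/ g) * g by rewrite divpK // dvdp_gcdr.
set u := p %/ g in Ep; set v := q %/ g in Eq.
have cuv : coprimep u v by rewrite coprimep_div_gcd ?p0.
have u0 : u != 0 by apply: contraNneq p0 => z; rewrite Ep z mul0r.
have E' : x * evl u = evl v.
  by apply: (mulIf (trans g0)); rewrite -mulrA -!evlM -Ep -Eq.
have [n sP] : exists n, size P = n.+1.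
  by exists (size P).-1; rewrite prednK // size_poly_gt0 monic_neq0.
have H : evl (\sum_(i < n.+1) P`_i * v ^+ i * u ^+ (n - i)) = 0.
  rewrite -(mul0r (evl u ^+ n)) -(rootP rP) rmorph_sum (@horner_coef_wide _ n.+1) ?size_map_poly //; last first.
    by rewrite (leq_trans (size_poly _ _)) // sP.
  rewrite mulr_suml; apply: eq_bigr => -[i le] _ /=.
  by rewrite !evlM !evlX -E' coef_map exprMn -!mulrA -exprD subnKC.
have {}H := evl_inj (etrans H (esym (rmorph0 evl))).
have Pn : P`_n = 1 by have := mP; rewrite monicE lead_coefE sP => /eqP.
rewrite big_ord_recr /= subnn expr0 mulr1 Pn mul1r in H.
have dv : u %| v ^+ n.
  rewrite (_ : v ^+ n = - \sum_(i < n) P`_i * v ^+ i * u ^+ (n - i)); last first.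
    by apply/eqP; rewrite -addr_eq0 addrC H.
  rewrite dvdpNr; apply: (big_ind (fun z => u %| z)) => [|a b|[i le] _]; [exact: dvdp0|exact: dvdp_add|].
  by rewrite /= dvdp_mull // -(subnSK le) exprS dvdp_mulr.
have /size_poly1P[c c0 Ec] : size u == 1%N.
  by rewrite -coprimepp (coprimep_dvdl dv) // coprimep_expr.
exists (c^-1 *: v); rewrite -mul_polyC evlM -E' Ec mulrCA -evlM -polyCM mulVf //.
by rewrite rmorph1 mulr1.
Qed.

(* [x = a r(b/a) = b r'(a/b)] forces [r] to be linear. *)
Lemma two_sided_linear (a b : F) r r' : a != 0 -> b != 0 -> lam = b / a ->
  a * evl r = b * (map_poly cst r').[a / b] -> exists c1 c2, a * evl r = cst c1 * a + cst c2 * b.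
Proof.
move=> a0 b0 El E; set m := size r'.
pose Rv := \poly_(i < m.+1) r'`_(m - i).
have l0 : lam != 0 by rewrite El mulf_neq0 ?invr_eq0.
have ER : (map_poly cst r').[a / b] * lam ^+ m = evl Rv.
  rewrite /evl (@horner_coef_wide _ m.+1) ?(leq_trans (size_poly _ _)) //.
  rewrite (@horner_coef_wide _ m.+1 (map_poly cst Rv)); last first.
    by rewrite (leq_trans (size_poly _ _)) // size_poly.
  rewrite mulr_suml [RHS](reindex_inj rev_ord_inj) /=; apply: eq_bigr => -[i le] _ /=.
  rewrite !coef_map coef_poly subSS ltnS leq_subr subKn // -mulrA; congr (_ * _).
  rewrite -{1}(subnK (le : (i <= m)%N)) exprD mulrCA -exprMn El (_ : a / b * (b / a) = 1) ?expr1n ?mulr1 //.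
  by field; rewrite a0 b0.
have Q : evl (r * 'X^m) = evl ('X * Rv).
  rewrite !evlM -ER /evl map_polyX map_polyXn hornerX hornerXn -/(evl r).
  by apply: (mulfI a0); rewrite [LHS]mulrA E El; field.
have {}Q := evl_inj Q.
have sr : (size r <= 2)%N.
  have [->|r0] := eqVneq r 0; first by rewrite size_poly0.
  have := congr1 (fun p : {poly k} => size p) Q; rewrite /= size_Mmonic ?monicXn // size_polyXn.
  have [R0|R0] := eqVneq Rv 0.
    by rewrite R0 mulr0 size_poly0; have := r0; rewrite -size_poly_gt0; lia.
  rewrite mulrC size_mulX //; have : (size Rv <= m.+1)%N by exact: size_poly.
  by move: (size r) (size Rv) (m) => u v w; clear; lia.
exists r`_0, r`_1; rewrite /evl (@horner_coef_wide _ 2) ?(leq_trans (size_poly _ _)) //.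
rewrite !big_ord_recl big_ord0 /= !coef_map expr0 mulr1 expr1 addr0 El; field.
exact: a0.
Qed.
End Integral.

Lemma hom_sym (k F : fieldType) (cst : {rmorphism k -> F}) (a b : F) n x :
  hom cst a b n x -> hom cst b a n x.
Proof.
elim=> {n x} [n|c|||n x y _ h _ h'|m n x y _ h _ h'].
- exact: hom0.
- exact: homC.
- exact: homb.
- exact: homa.
- exact: homD.
- exact: homM.
Qed.

(** Dividing G(x) = 0 by a^d and the leading coefficient gives a monic equation for x / a over
    k[b / a]. *)
Lemma hpol_integral (k F : fieldType) (cst : {rmorphism k -> F}) (a b x : F) d (l : k) G :
  a != 0 -> l != 0 -> hpol cst a b d (cst l) G -> G.[x] = 0 -> integralOver (evl cst (b / a)) (x / a).
Proof.
move=> a0 l0 [sG lG hG] Gx.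
have /choice[p Hp] : forall i, exists p, (i <= d)%N -> G`_i = a ^+ (d - i) * evl cst (b / a) p.
  move=> i; have [le|//] := leqP i d; last by exists 0.
  by have [p [_ E]] := hom_poly a0 (hG i le); exists p.
have cl : cst l != 0 by rewrite fmorph_eq0.
pose P := \poly_(i < d.+1) (if i == d then 1 else l^-1%:P * p i).
have Pd : P`_d = 1 by rewrite coef_poly ltnSn eqxx.
have sP : size P = d.+1 by rewrite size_poly_eq // eqxx oner_eq0.
exists P; first by rewrite monicE lead_coefE sP Pd.
apply/rootP; rewrite (@horner_coef_wide _ d.+1) ?(leq_trans (size_poly _ _)) ?sP //.
apply: (mulfI (mulf_neq0 cl (expf_neq0 d a0))); transitivity G.[x]; last by rewrite Gx mulr0.
rewrite (horner_coef_wide _ sG) mulr_sumr.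
apply: eq_bigr => -[i le] _ /=; rewrite coef_map /= coef_poly le; have le' : (i <= d)%N by [].
have ad : a ^+ d = a ^+ (d - i) * a ^+ i by rewrite -exprD subnK.
have ai : a ^+ i != 0 by rewrite expf_neq0.
have C c : evl cst (b / a) c%:P = cst c by rewrite /evl map_polyC hornerC.
case: eqP => [E|_].
  rewrite E lG (_ : evl _ _ 1 = 1); last by rewrite /evl rmorph1 hornerC.
  have ad0 : a ^+ d != 0 by rewrite expf_neq0.
  by rewrite mul1r expr_div_n; move: (a ^+ d) (x ^+ d) ad0 => u w u0; field.
rewrite evlM C Hp // ad expr_div_n fmorphV; field.
by rewrite ai cl.
Qed.

Section World.
Variables (k F : fieldType) (cst : {rmorphism k -> F}) (N ell : nat) (om : k).
Hypothesis N1 : (1 < N)%N.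
Hypothesis oddN : odd N.
Hypothesis kN : (N%:R : k) != 0.
Hypothesis k2 : (2%:R : k) != 0.
Hypothesis l3 : (3 < ell)%N.
Hypothesis oddl : odd ell.
Hypothesis chl : ell%:R = 0 :> k.
Hypothesis omP : (ell.-1).-primitive_root om.
Variable V : finZmodType.
Hypothesis cardV : #|V| = (N * N)%N.
Hypothesis V2 : forall v : V, v + v = 0 -> v = 0.
Variables (a b : F) (X Y : V -> F).
Hypotheses (X0 : X 0 = 0) (Y0 : Y 0 = 0) (XN : forall v : V, X (- v) = X v) (YN : forall v : V, Y (- v) = - Y v).
Hypothesis Yn0 : forall v : V, v != 0 -> Y v != 0.
Hypothesis Ysq : forall v, Y v ^+ 2 = 4%:R * (X v * (X v - a) * (X v - b)).
Hypothesis Xeq : forall v w : V, v != 0 -> w != 0 -> X v = X w -> v = w \/ v = - w.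
Variable Gt : {poly F}.
Hypothesis hGt : hpol cst a b (dd N) N%:R Gt.
Hypothesis rGt : forall v : V, v != 0 -> Gt.[X v] = 0.
Hypothesis hasse : hom cst a b ell.-1./2 1.
Notation hom := (hom cst a b).

Lemma F2 : (2%:R : F) != 0.
Proof. by rewrite -(rmorph_nat cst) fmorph_eq0. Qed.

Lemma XY_inj v w : X v = X w -> Y v = Y w -> v = w.
Proof.
have [->|v0] := eqVneq v 0.
  by rewrite Y0 => _ E; apply: contraTeq isT => w0; have := Yn0 (v := w); rewrite -E eqxx eq_sym w0 => /(_ isT).
have [->|w0] := eqVneq w 0; first by rewrite Y0 => _ E; have := Yn0 v0; rewrite E eqxx.
move=> EX EY; case: (Xeq v0 w0 EX) => // Ev; exfalso; have := Yn0 w0.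
have : Y w + Y w = 0 by rewrite -{1}EY Ev YN addNr.
by rewrite -mulr2n -mulr_natl => /eqP; rewrite mulf_eq0 (negPf F2) /= => ->.
Qed.

(** One point in each pair v, - v, chosen by rank in an enumeration; V has no 2-torsion. *)
Definition H := [set v : V | (enum_rank v < enum_rank (- v))%N].
Lemma H_opp (v : V) : v != 0 -> (- v \in H) = (v \notin H).
Proof.
move=> v0; rewrite !inE opprK -leqNgt [RHS]leq_eqVlt.
have -> // : (nat_of_ord (enum_rank (- v)) == enum_rank v) = false.
apply: contraNF v0 => /eqP E; have E' : - v = v by apply/enum_rank_inj/val_inj.
by apply/eqP/V2; rewrite -{1}E' addNr.
Qed.
Lemma H0 (v : V) : v \in H -> v != 0.
Proof. by apply: contraTneq => ->; rewrite inE oppr0 ltnn. Qed.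

Lemma H_sum (E : V -> F) : \sum_v E v = E 0 + (\sum_(v in H) E v + \sum_(v in H) E (- v)).
Proof.
rewrite (bigD1 0) //=; congr (_ + _); rewrite (bigID (mem H)) /=; congr (_ + _).
  by apply: eq_bigl => v; case h: (v \in H); rewrite ?andbF // andbT H0.
rewrite (reindex_inj (@oppr_inj _)) /=; apply: eq_bigl => v.
have [->|v0] := eqVneq v 0; first by rewrite oppr0 eqxx /= ; symmetry; apply/negbTE/negP => /H0; rewrite eqxx.
by rewrite oppr_eq0 v0 /= H_opp // negbK.
Qed.

(** The count equals the degree of the division polynomial, so the X-coordinates over [H] are all
    its roots and [Gt] splits. *)
Lemma card_H : #|H| = dd N.
Proof.
pose H' := [set v : V | - v \in H]; have H'E v : (v \in H') = (- v \in H) by rewrite inE.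
have z0 : 0 \notin H by apply/negP => /H0; rewrite eqxx.
have E : (#|V| = 1 + (#|H| + #|H|))%N.
  have NH : #|H'| = #|H|.
    rewrite -(card_imset (mem H) (@oppr_inj V)); apply: eq_card => v; rewrite H'E.
    by apply/idP/imsetP => [h|[w h ->]]; [exists (- v); rewrite ?opprK|rewrite opprK].
  rewrite -cardsT (_ : [set: V] = 0 |: (H :|: H')); last first.
    apply/setP => v; rewrite in_setT in_setU1 in_setU H'E.
    by have [//|v0] := eqVneq v 0; rewrite H_opp // orbN.
  rewrite cardsU1 cardsU (_ : H :&: H' = set0) ?cards0 ?subn0 ?NH; last first.
    apply/setP => v; rewrite in_setI in_set0 H'E.
    by case h: (v \in H) => //=; rewrite H_opp ?h // H0.
  by rewrite in_setU H'E oppr0 (negPf z0).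
move: E; rewrite cardV (_ : N = 2 * N./2 + 1)%N ?dd_odd; last by lia.
by clear; nia.
Qed.

Lemma X_H_inj : {in H &, injective X}.
Proof.
move=> v w hv hw E; case: (Xeq (H0 hv) (H0 hw) E) => // Ev.
by move: hv; rewrite Ev H_opp ?H0 // hw.
Qed.

Lemma Gt_prod : Gt = N%:R *: \prod_(r <- [seq X v | v in H]) ('X - r%:P).
Proof.
have [sG lG _] := hGt; have N0 : (N%:R : F) != 0 by rewrite -(rmorph_nat cst) fmorph_eq0.
have sz : size [seq X v | v in H] = dd N by rewrite size_map -cardE card_H.
have sG' : size Gt = (dd N).+1.
  by apply/eqP; rewrite eqn_leq sG ltnNge; apply: contra N0 => le; rewrite -lG nth_default.
have lc : lead_coef Gt = N%:R by rewrite lead_coefE sG'.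
rewrite -lc; apply: all_roots_prod_XsubC; first by rewrite sz.
  by apply/allP => r /imageP[v hv ->]; apply/rootP/rGt/H0.
rewrite uniq_rootsE map_inj_in_uniq ?enum_uniq // => v w; rewrite !mem_enum.
exact: X_H_inj.
Qed.

Lemma psumH m : hom m (\sum_(v in H) X v ^+ m).
Proof.
have := @newton_hom F k cst a b [seq X v | v in H] N%:R Gt kN.
rewrite size_map -cardE card_H rmorph_nat => /(_ hGt Gt_prod m).
by rewrite big_map big_enum.
Qed.

(** An odd power of Y cancels between v and - v; an even one is a polynomial in X and reduces to
    Newton sums over the roots of [Gt]. *)
Lemma psum m n : (odd n -> \sum_v X v ^+ m * Y v ^+ n = 0) /\
  (~~ odd n -> hom (m + 3 * n./2) (\sum_v X v ^+ m * Y v ^+ n)).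
Proof.
split=> on; rewrite H_sum.
  rewrite -big_split /= big1 ?addr0 => [|v _]; last first.
    by rewrite XN YN exprNn -signr_odd on expr1 mulN1r mulrN addrN.
  by rewrite Y0 expr0n; case: n on => // n _; rewrite mulr0.
have nE : n = (2 * n./2)%N by lia.
have E v : X v ^+ m * Y v ^+ n = ('X^m * cubic a b ^+ n./2).[X v].
  by rewrite hornerM hornerXn horner_exp cubicE -Ysq -exprM -nE.
have hp : hpol cst a b (m + 3 * n./2) (1 * 4%:R ^+ n./2) ('X^m * cubic a b ^+ n./2).
  apply: hpolM; last exact: hpolX (hpol_cubic _ _ _).
  by have := hpolX m (hpolXx cst a b); rewrite mul1n expr1n.
have S : hom (m + 3 * n./2) (\sum_(v in H) ('X^m * cubic a b ^+ n./2).[X v]).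
  have := @hpol_sum_roots _ _ cst a b _ [seq v <- enum V | v \in H] X _ _ _ _ hp.
  rewrite big_filter big_enum_cond /=; apply => i; rewrite big_filter big_enum_cond; exact: psumH.
apply: homD; last first.
  have S1 : \sum_(v in H) X v ^+ m * Y v ^+ n = \sum_(v in H) ('X^m * cubic a b ^+ n./2).[X v].
    by apply: eq_bigr => v _; exact: E.
  have S2 : \sum_(v in H) X (- v) ^+ m * Y (- v) ^+ n = \sum_(v in H) ('X^m * cubic a b ^+ n./2).[X v].
    by apply: eq_bigr => v _; rewrite E XN.
  by rewrite S1 S2; apply: homD.
rewrite X0 Y0; case: m {E hp S} => [|m]; last by rewrite exprS !mul0r; apply: hom0.
case: n nE {on} => [|n] nE; last by rewrite [0 ^+ n.+1]exprS mul0r mulr0; apply: hom0.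
by rewrite !expr0 mulr1; apply: (hom_nat _ _ _ 1).
Qed.

Record env := Env {eA : F; eB : F; eX : V -> F; eY : V -> F}.

(** Polynomials over k in a, b and the coordinates of all points, represented by the functions they
    induce on arbitrary environments, so that they can be evaluated at relabelled and rescaled
    coordinates. *)
Inductive pf : (env -> F) -> Prop :=
| pfC c : pf (fun=> cst c)
| pf_a : pf eA
| pf_b : pf eB
| pfX v : pf (fun e => eX e v)
| pfY v : pf (fun e => eY e v)
| pfD P Q : pf P -> pf Q -> pf (fun e => P e + Q e)
| pfM P Q : pf P -> pf Q -> pf (fun e => P e * Q e).

Lemma pf1 : pf (fun=> 1).
Proof. by have := pfC 1; rewrite rmorph1. Qed.
Lemma pfN P : pf P -> pf (fun e => - P e).
Proof.
move=> h; have := pfM (pfC (-1)) h; congr pf; apply: funext => e.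
by rewrite rmorphN1 mulN1r.
Qed.
Lemma pfB P Q : pf P -> pf Q -> pf (fun e => P e - Q e).
Proof. by move=> hP hQ; apply: pfD => //; apply: pfN. Qed.
Lemma pf_sum (I : Type) (r : seq I) (P : I -> env -> F) :
  (forall i, pf (P i)) -> pf (fun e => \sum_(i <- r) P i e).
Proof.
move=> h; elim: r => [|i r IH].
  by have := pfC 0; congr pf; apply: funext => e; rewrite big_nil rmorph0.
by have := pfD (h i) IH; congr pf; apply: funext => e; rewrite big_cons.
Qed.
Lemma pf_prod (I : Type) (r : seq I) (P : I -> env -> F) :
  (forall i, pf (P i)) -> pf (fun e => \prod_(i <- r) P i e).
Proof.
move=> h; elim: r => [|i r IH].
  by have := pf1; congr pf; apply: funext => e; rewrite big_nil.
by have := pfM (h i) IH; congr pf; apply: funext => e; rewrite big_cons.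
Qed.
Lemma pfXn P n : pf P -> pf (fun e => P e ^+ n).
Proof.
move=> h; elim: n => [|n IH]; first by have := pf1; congr pf.
by have := pfM h IH; congr pf; apply: funext => e; rewrite exprS.
Qed.

Record mono := Mono {mc : k; mx : nat; my : nat; mX : V -> nat; mY : V -> nat}.
Definition mev (t : mono) (e : env) : F :=
  cst (mc t) * eA e ^+ mx t * eB e ^+ my t * \prod_v (eX e v ^+ mX t v * eY e v ^+ mY t v).

(** The averages [SS] are computed monomial by monomial. *)
Lemma pf_mono P : pf P -> exists s : seq mono, forall e, P e = \sum_(t <- s) mev t e.
Proof.
pose z (_ : V) := 0%N.
have pz e : \prod_v (eX e v ^+ z v * eY e v ^+ z v) = 1 by rewrite big1 // => v _; rewrite !expr0 mulr1.
elim=> {P} [c|||v|v|P Q _ [s hs] _ [s' hs']|P Q _ [s hs] _ [s' hs']].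
- by exists [:: Mono c 0 0 z z] => e; rewrite big_seq1 /mev /= pz !expr0 !mulr1.
- by exists [:: Mono 1 1 0 z z] => e; rewrite big_seq1 /mev /= pz rmorph1 !expr0 expr1 mul1r !mulr1.
- by exists [:: Mono 1 0 1 z z] => e; rewrite big_seq1 /mev /= pz rmorph1 !expr0 expr1 !mul1r !mulr1.
- exists [:: Mono 1 0 0 (fun w => (w == v)%N : nat) z] => e; rewrite big_seq1 /mev /= rmorph1 !expr0 !mul1r.
  rewrite (bigD1 v) //= eqxx expr1 expr0 mulr1 big1 ?mulr1 // => w /negPf ->.
  by rewrite !expr0 mulr1.
- exists [:: Mono 1 0 0 z (fun w => (w == v)%N : nat)] => e; rewrite big_seq1 /mev /= rmorph1 !expr0 !mul1r.
  rewrite (bigD1 v) //= eqxx expr1 expr0 mul1r big1 ?mulr1 // => w /negPf ->.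
  by rewrite !expr0 mulr1.
- by exists (s ++ s') => e; rewrite big_cat hs hs'.
- exists [seq Mono (mc t * mc t') (mx t + mx t') (my t + my t') (fun v => mX t v + mX t' v)%N
     (fun v => mY t v + mY t' v)%N | t <- s, t' <- s'] => e.
  rewrite hs hs' big_allpairs_dep big_distrl /=; apply: eq_bigr => t _.
  rewrite big_distrr /=; apply: eq_bigr => t' _; rewrite /mev /= rmorphM !exprD.
  rewrite [in RHS](eq_bigr (fun v => (eX e v ^+ mX t v * eY e v ^+ mY t v) *
     (eX e v ^+ mX t' v * eY e v ^+ mY t' v))); last by move=> v _; rewrite /= !exprD; ring.
  by rewrite [in RHS]big_split /=; ring.
Qed.

(** The weights 2, 2, 2, 3 of a, b, X, Y make the curve equation homogeneous of weight 6; c acts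
    through this grading and f relabels the points. *)
Definition act (c : F) (f : V -> V) (e : env) : env :=
  Env (c ^+ 2 * eA e) (c ^+ 2 * eB e) (fun v => c ^+ 2 * eX e (f v)) (fun v => c ^+ 3 * eY e (f v)).

Lemma pf_act c f P : pf P -> pf (fun e => P (act (cst c) f e)).
Proof.
have hc n : pf (fun=> cst c ^+ n) by have := pfC (c ^+ n); rewrite rmorphXn.
elim=> {P} [d|||v|v|P Q _ h _ h'|P Q _ h _ h'] /=.
- exact: pfC.
- by apply: pfM; [exact: hc|exact: pf_a].
- by apply: pfM; [exact: hc|exact: pf_b].
- by apply: pfM; [exact: hc|exact: pfX].
- by apply: pfM; [exact: hc|exact: pfY].
- exact: pfD.
- exact: pfM.
Qed.

Lemma act_comp c f c' f' e : act c' f' (act c f e) = act (c * c') (f \o f') e.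
Proof. by rewrite /act /=; congr Env; try apply: funext => v; rewrite exprMn; ring. Qed.

Definition e0 := Env a b X Y.
Definition kap (i : nat) : F := cst (om ^+ i).

(** The sum runs over all maps V -> V and not only over those that preserve relations: then the sum
    of a monomial factors into power sums over V. The factor kap^j selects the weights congruent to
    - j modulo ell - 1. *)
Definition SS (j : nat) (P : env -> F) : F :=
  \sum_(i < ell.-1) kap i ^+ j * \sum_(f : {ffun V -> V}) P (act (kap i) f e0).

Lemma kap_sum (w : nat) : \sum_(i < ell.-1) kap i ^+ w = if (ell.-1 %| w)%N then ell.-1%:R else 0.
Proof.
have E i : kap i ^+ w = cst ((om ^+ w) ^+ i) by rewrite /kap -rmorphXn -!exprM mulnC.
rewrite (eq_bigr (fun i : 'I__ => cst ((om ^+ w) ^+ i))) => [|i _]; last exact: E.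
rewrite -rmorph_sum /=.
case: ifP => dv.
  rewrite (prim_order_dvd omP) in dv; rewrite (eqP dv) (eq_bigr (fun=> 1)) => [|i _]; last by rewrite expr1n.
  by rewrite sumr_const card_ord rmorph_nat.
have ne : om ^+ w - 1 != 0 by rewrite subr_eq0 -(prim_order_dvd omP) dv.
have : (om ^+ w - 1) * \sum_(i < ell.-1) (om ^+ w) ^+ i = 0.
  by rewrite -subrX1 exprAC (prim_expr_order omP) expr1n subrr.
by move/eqP; rewrite mulf_eq0 (negPf ne) /= => /eqP ->; rewrite rmorph0.
Qed.

Definition wt (t : mono) : nat := (2 * (mx t + my t) + \sum_v (2 * mX t v + 3 * mY t v))%N.

Lemma mev_act t c f e : mev t (act c f e) = c ^+ wt t *
  (cst (mc t) * eA e ^+ mx t * eB e ^+ my t * \prod_v (eX e (f v) ^+ mX t v * eY e (f v) ^+ mY t v)).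
Proof.
have -> : c ^+ wt t = (c ^+ 2) ^+ mx t * (c ^+ 2) ^+ my t * \prod_v c ^+ (2 * mX t v + 3 * mY t v)%N.
  by rewrite prodrXr -!exprM -!exprD /wt mulnDr.
rewrite /mev /= [(_ * eA e) ^+ _]exprMn [(_ * eB e) ^+ _]exprMn.
rewrite (eq_bigr (fun v => c ^+ (2 * mX t v + 3 * mY t v)%N * (eX e (f v) ^+ mX t v * eY e (f v) ^+ mY t v))).
  by rewrite big_split /=; ring.
move=> v _; rewrite [(_ * eX e _) ^+ _]exprMn [(_ * eY e _) ^+ _]exprMn -!exprM (exprD c (2 * _)).
by ring.
Qed.

(** Degree n in a and b has weight 2 n, and weights are only visible modulo ell - 1. *)
Definition homj (j : nat) (x : F) := exists n, (ell.-1 %| 2 * n + j)%N /\ hom n x.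

(** Multiplication by 1, which has degree (ell - 1)/2 by the Hasse invariant. *)
Lemma hom_raise n m x : hom n x -> hom (n + m * ell.-1./2) x.
Proof.
move=> h; elim: m => [|m IH]; first by rewrite mul0n addn0.
by rewrite mulSn addnCA -[x]mul1r; apply: homM.
Qed.

Lemma ell1 : ell.-1 = (2 * ell.-1./2)%N. Proof. by lia. Qed.

Lemma mod_eq_add h n n' : (n = n' %[mod h])%N -> exists q q', (n + q * h = n' + q' * h)%N.
Proof.
move=> E; exists (n' %/ h)%N, (n %/ h)%N.
by rewrite {1}(divn_eq n h) {2}(divn_eq n' h) E; lia.
Qed.

Lemma hom_cong n n' x y : (n = n' %[mod ell.-1./2])%N -> hom n x -> hom n' y ->
  exists m, [/\ (m = n %[mod ell.-1./2])%N, hom m x & hom m y].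
Proof.
move=> /mod_eq_add[q [q' E]] hx hy; exists (n + q * ell.-1./2)%N.
split; [by rewrite addnC modnMDl|exact: hom_raise|by rewrite E; apply: hom_raise].
Qed.

Lemma cong_half j n n' : (ell.-1 %| 2 * n + j)%N ->
  (ell.-1 %| 2 * n' + j)%N = (n' == n %[mod ell.-1./2])%N.
Proof.
have h0 : (0 < ell.-1./2)%N by lia.
rewrite {1 2}ell1; set h := ell.-1./2 in h0 * => dn.
have K m m' : (m <= m')%N -> (2 * h %| 2 * m + j)%N = (2 * h %| 2 * m' + j)%N \/ ~~ (h %| m' - m)%N.
  move=> le; have [dv|] := boolP (h %| m' - m)%N; [left|by right].
  by rewrite -[in RHS](subnKC le) mulnDr -addnA addnCA [RHS]dvdn_addr // dvdn_pmul2l.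
have D m m' : (m <= m')%N -> (2 * h %| 2 * m + j)%N -> (2 * h %| 2 * m' + j)%N -> (h %| m' - m)%N.
  by move=> le d1 d2; have := dvdn_sub d2 d1; rewrite subnDr -mulnBr dvdn_pmul2l.
have [le|/ltnW le] := leqP n n'.
  rewrite eqn_mod_dvd //; apply/idP/idP => [d|d]; first exact: (D n).
  by case: (K n n' le) => [<- //|]; rewrite d.
rewrite eq_sym eqn_mod_dvd //; apply/idP/idP => [d|d]; first exact: (D n').
by case: (K n' n le) => [-> //|]; rewrite d.
Qed.

Lemma homjD j x y : homj j x -> homj j y -> homj j (x + y).
Proof.
move=> [n [dn hx]] [n' [dn' hy]].
have /eqP E : (n == n' %[mod ell.-1./2])%N by rewrite -(cong_half _ dn').
have [m [Em hx' hy']] := hom_cong E hx hy; exists m; split; last exact: homD.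
by rewrite (cong_half _ dn); apply/eqP.
Qed.

Lemma SS_mev j t : homj j (SS j (mev t)) \/ SS j (mev t) = 0.
Proof.
have E : SS j (mev t) = (if (ell.-1 %| j + wt t)%N then ell.-1%:R else 0) *
    (cst (mc t) * a ^+ mx t * b ^+ my t * \prod_v \sum_u (X u ^+ mX t v * Y u ^+ mY t v)).
  rewrite -kap_sum /SS mulr_suml; apply: eq_bigr => i _; rewrite exprD -mulrA; congr (_ * _).
  rewrite bigA_distr_bigA mulr_sumr mulr_sumr; apply: eq_bigr => f _.
  by rewrite mev_act.
rewrite {}E; case: ifP => dv; last by right; rewrite mul0r.
have [/existsP[v ov]|] := boolP [exists v, odd (mY t v)].
  by right; rewrite (bigD1 v) //= (proj1 (psum _ _) ov) mul0r !mulr0.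
rewrite negb_exists => /forallP ev; left.
exists (0 + (mx t + my t + \sum_v (mX t v + 3 * (mY t v)./2)))%N; split; last first.
  apply: homM; first exact: hom_nat.
  apply: homM; last by apply: hom_prod => v; apply: (proj2 (psum _ _)).
  apply: homM; last by have := homX (my t) (homb cst a b); rewrite mul1n.
  by apply: homZ; have := homX (mx t) (homa cst a b); rewrite mul1n.
rewrite add0n [(2 * _)%N]mulnDr big_distrr /= (eq_bigr (fun v => 2 * mX t v + 3 * mY t v)%N).
  by rewrite -/(wt t) addnC.
by move=> v _; have := ev v; lia.
Qed.

Lemma SS_sum j (s : seq mono) : SS j (fun e => \sum_(t <- s) mev t e) = \sum_(t <- s) SS j (mev t).
Proof.
rewrite /SS exchange_big /=; apply: eq_bigr => i _; rewrite -mulr_sumr exchange_big /=.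
by [].
Qed.

Lemma SS_hom j P : pf P -> SS j P != 0 -> homj j (SS j P).
Proof.
move=> /pf_mono[s hs]; have -> : P = (fun e => \sum_(t <- s) mev t e) by apply: funext.
rewrite SS_sum; elim: s {hs} => [|t s IH]; first by rewrite big_nil eqxx.
rewrite big_cons; have [h|->] := SS_mev j t; last by rewrite add0r.
by have [->|/IH h'] := eqVneq (\sum_(t <- s) SS j (mev t)) 0; [rewrite addr0|move=> _; apply: homjD].
Qed.

(* [f], combined with the weight action of [om ^ i], preserves all polynomial relations between the coordinates. *)
Definition Rel (i : nat) (f : V -> V) := forall P, pf P -> P (act (kap i) f e0) = 0 -> P e0 = 0.

(** Independence of characters: evaluation at f is multiplicative in P, and distinct maps are told
    apart by some coordinate, since X and Y together determine a point. *)
Lemma dedekind (s : seq {ffun V -> V}) (c : {ffun V -> V} -> F) : uniq s ->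
  (forall P, pf P -> \sum_(f <- s) c f * P (act 1 f e0) = 0) -> forall f, f \in s -> c f = 0.
Proof.
elim: s c => [|f0 s IH] c //= /andP[nf us] Hc.
have Hs f : f \in s -> c f = 0.
  move=> fs; have nef : f != f0 by apply: contraNneq nf => <-.
  have [v nv] : exists v, f v != f0 v.
    by apply/existsP; apply: contraNT nef; rewrite negb_exists => /forallP h; apply/eqP/ffunP => v; apply/eqP; have := h v; rewrite negbK.
  have K P : pf P -> c f * (P (act 1 f e0) - P (act 1 f0 e0)) = 0.
    move=> hP; apply: (IH (fun f => c f * (P (act 1 f e0) - P (act 1 f0 e0)))) => // Q hQ.
    have E1 := Hc _ (pfM hP hQ); have E2 := Hc _ hQ; rewrite !big_cons in E1 E2.
    transitivity (c f0 * (P (act 1 f0 e0) * Q (act 1 f0 e0)) +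
       \sum_(j <- s) c j * (P (act 1 j e0) * Q (act 1 j e0)) - P (act 1 f0 e0) *
       (c f0 * Q (act 1 f0 e0) + \sum_(j <- s) c j * Q (act 1 j e0))); last first.
      by rewrite E1 E2 mulr0 subrr.
    rewrite mulrDr mulr_sumr opprD addrACA -sumrB [X in X + _](_ : _ = 0) ?add0r; last by ring.
    by apply: eq_bigr => g _; ring.
  apply: contraTeq isT => cf /=; have := K _ (pfX v); have := K _ (pfY v); move/eqP.
  rewrite mulf_eq0 (negPf cf) subr_eq0 /= !expr1n !mul1r => /eqP EY /eqP.
  rewrite mulf_eq0 (negPf cf) subr_eq0 /= => /eqP EX.
  by rewrite (XY_inj EX EY) eqxx in nv.
move=> f; rewrite inE => /orP[/eqP ->|/Hs //].
have := Hc _ pf1; rewrite big_cons mulr1 big_seq big1 ?addr0 // => g gs.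
by rewrite Hs // mul0r.
Qed.

(** Multiply, over all pairs (i, f) that violate a relation, polynomials that vanish there but not
    at [e0]. If every average of multiples of this product E vanished, independence of characters
    would force E to vanish at [e0]. *)
Lemma SS_separate : exists j P, [/\ pf P, SS j P != 0 & forall i f, (i < ell.-1)%N -> ~ Rel i f ->
   P (act (kap i) f e0) = 0].
Proof.
have C (p : 'I_ell.-1 * {ffun V -> V}) : exists P, [/\ pf P, P e0 != 0 &
    ~ Rel p.1 p.2 -> P (act (kap p.1) p.2 e0) = 0].
  have [r|nr] := pselect (Rel p.1 p.2); first by exists (fun=> 1); split; [exact: pf1|exact: oner_neq0|].
  have [P [hP [P0 Pn]]] : exists P, pf P /\ P (act (kap p.1) p.2 e0) = 0 /\ P e0 <> 0.
    by apply: contrapT => H; apply: nr => P hP E; apply: contrapT => ne; apply: H; exists P.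
  by exists P; split=> //; apply/eqP.
have [Pc HP] := choice C.
pose E e := \prod_(p : 'I_ell.-1 * {ffun V -> V}) Pc p e.
have hE : pf E by apply: pf_prod => p; have [] := HP p.
have E0 : E e0 != 0 by apply/prodf_neq0 => p _; have [] := HP p.
have Enr i f : (i < ell.-1)%N -> ~ Rel i f -> E (act (kap i) f e0) = 0.
  move=> li nr; rewrite /E (bigD1 (Ordinal li, [ffun v => f v])) //=.
  have [_ _ /= H] := HP (Ordinal li, [ffun v => f v]).
  have Ef : ([ffun v => f v] : {ffun V -> V}) = f :> (V -> V) by apply: funext => v; rewrite ffunE.
  by move: H; rewrite Ef => ->; rewrite ?mul0r.
apply: contrapT => nx; have Z j P : pf P -> SS j (fun e => E e * P e) = 0.
  move=> hP; apply/eqP; apply: contrapT => /negP ne; apply: nx; exists j, (fun e => E e * P e).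
  by split=> // [|i f li nr]; [exact: pfM|rewrite Enr ?mul0r].
pose id' : {ffun V -> V} := [ffun v => v].
have aid : act 1 id' e0 = e0.
  by rewrite /act /e0 /= !expr1n !mul1r; congr Env; apply: funext => v; rewrite ffunE mul1r.
suff H1 P : pf P -> \sum_(f <- enum {ffun V -> V}) E (act 1 f e0) * P (act 1 f e0) = 0.
  have := @dedekind _ (fun f => E (act 1 f e0)) (enum_uniq _) H1 id'.
  by rewrite mem_enum aid => /(_ isT) /eqP; rewrite (negPf E0).
move=> hP.
(* Summing over j kills every i except i = 0, by orthogonality of the powers of [om], and leaves a
   relation between the maps f alone. *)
have : \sum_(j < ell.-1) SS j (fun e => E e * P e) = 0 by rewrite big1 // => j _; apply: Z.
rewrite /SS exchange_big /= big_enum /=.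
have l1 : (0 < ell.-1)%N by have := l3; lia.
rewrite (bigD1 (Ordinal l1)) //= [X in _ + X]big1 ?addr0.
  have k0 : kap 0 = 1 by rewrite /kap expr0 rmorph1.
  rewrite (eq_bigr (fun=> \sum_(f : {ffun V -> V}) E (act 1 f e0) * P (act 1 f e0))); last first.
    by move=> i _; rewrite k0 expr1n mul1r.
  rewrite sumr_const card_ord -mulr_natl => /eqP; rewrite mulf_eq0 -(rmorph_nat cst) fmorph_eq0.
  case/orP=> [|/eqP //]; rewrite -subn1 natrB ?(leq_trans _ l3) // chl sub0r oppr_eq0 oner_eq0 //.
move=> i ni; rewrite -mulr_suml; apply/eqP; rewrite mulf_eq0; apply/orP; left; apply/eqP.
have K j : kap i ^+ j = cst ((om ^+ i) ^+ j) by rewrite /kap -rmorphXn.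
rewrite (eq_bigr (fun j : 'I__ => cst ((om ^+ i) ^+ j))) => [|j _]; last exact: K.
rewrite -rmorph_sum /=.
have ne : om ^+ i - 1 != 0.
  rewrite subr_eq0 -(prim_order_dvd omP); apply: contra ni => dv; apply/eqP/val_inj => /=.
  by apply/eqP; apply: contraTT dv => i0; rewrite gtnNdvd // lt0n.
have : (om ^+ i - 1) * \sum_(j < ell.-1) (om ^+ i) ^+ j = 0.
  by rewrite -subrX1 exprAC (prim_expr_order omP) expr1n subrr.
by move/eqP; rewrite mulf_eq0 (negPf ne) /= => /eqP ->; rewrite rmorph0.
Qed.

(** A quantity of weight 2 that all relation-preserving pairs fix up to its weight can be pulled out
    of the average of E, which displays it as a quotient of homogeneous elements whose degrees
    differ by one. The shift by ell - 3 comes from kap^(-2) = kap^(ell - 3). *)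
Lemma galois_fix P : pf P ->
  (forall i f, (i < ell.-1)%N -> Rel i f -> P (act (kap i) f e0) = kap i ^+ 2 * P e0) ->
  exists n x y, [/\ x != 0, hom n x, hom n.+1 y & P e0 * x = y].
Proof.
move=> hP fx; have [j [E [hE E0 En]]] := SS_separate.
have EP : P e0 * SS j E = SS (j + (ell - 3)) (fun e => E e * P e).
  rewrite /SS mulr_sumr; apply: eq_bigr => -[i li] _ /=.
  rewrite mulrCA exprD -mulrA; congr (_ * _); rewrite !mulr_sumr; apply: eq_bigr => f _.
  have [r|nr] := pselect (Rel i f); last by rewrite En // mul0r !mulr0.
  have k1 : kap i ^+ ell.-1 = 1 by rewrite /kap -rmorphXn exprAC (prim_expr_order omP) expr1n rmorph1.
  have e2 : (ell.-1 = (ell - 3) + 2)%N by have := l3; lia.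
  rewrite fx // -[LHS]mul1r -k1 e2 (exprD _ (ell - 3)).
  by ring.
have [n [dn hx]] := SS_hom hE E0.
have [P0|P0] := eqVneq (P e0) 0.
  by exists n, (SS j E), 0; split=> //; [exact: hom0|rewrite P0 mul0r].
have S0 : SS (j + (ell - 3)) (fun e => E e * P e) != 0 by rewrite -EP mulf_neq0.
have [n' [dn' hy]] := SS_hom (pfM hE hP) S0.
have /eqP Em : (n.+1 == n' %[mod ell.-1./2])%N.
  rewrite -(cong_half _ dn').
  have -> : (2 * n.+1 + (j + (ell - 3)) = 2 * n + j + ell.-1)%N by have := l3; lia.
  by rewrite dvdn_addl.
have [q [q' E']] := mod_eq_add Em.
exists (n + q * ell.-1./2)%N, (SS j E), (SS (j + (ell - 3)) (fun e => E e * P e)); split=> //.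
  exact: hom_raise.
by rewrite -addSn E'; apply: hom_raise.
Qed.

Lemma kap_neq0 i : kap i != 0.
Proof.
rewrite /kap fmorph_eq0 expf_neq0 //; apply: contra_eq_neq (prim_expr_order omP) => ->.
by rewrite expr0n gtn_eqF ?(eq_sym 0) ?oner_eq0 //; have := l3; lia.
Qed.
Lemma kapD i j : kap (i + j) = kap i * kap j.
Proof. by rewrite /kap exprD rmorphM. Qed.

Lemma pf_nat n : pf (fun=> n%:R).
Proof. by have := pfC n%:R; rewrite rmorph_nat. Qed.

Lemma Rel_comp i f j g : Rel i f -> Rel j g -> Rel (i + j) (f \o g).
Proof.
move=> hf hg P hP; rewrite kapD -act_comp => E; apply: hg => //.
exact: (hf _ (pf_act (om ^+ j) g hP) E).
Qed.

Lemma act1 e : act 1 id e = e.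
Proof. by case: e => A B x y; rewrite /act /= !expr1n !mul1r; congr Env; apply: funext => v; rewrite mul1r. Qed.

Lemma Rel_id : Rel 0 id.
Proof. by move=> P hP; rewrite /kap expr0 rmorph1 act1. Qed.

Lemma Rel_iter i f n : Rel i f -> Rel (n * i) (iter n f).
Proof.
move=> h; elim: n => [|n IH]; first exact: Rel_id.
by have := Rel_comp h IH; rewrite mulSn; congr (Rel _ _); apply: funext => v.
Qed.

Lemma Rel_inj i f : Rel i f -> injective f.
Proof.
move=> h v w E; apply: XY_inj.
  have := h _ (pfB (pfX v) (pfX w)); rewrite /= E subrr => /(_ erefl) /eqP.
  by rewrite subr_eq0 => /eqP.
have := h _ (pfB (pfY v) (pfY w)); rewrite /= E subrr => /(_ erefl) /eqP.
by rewrite subr_eq0 => /eqP.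
Qed.

Lemma Rel_period i f : Rel i f -> exists n, (iter n.+1 f =1 id) /\ kap (n.+1 * i) = 1.
Proof.
move=> h; pose s := perm (Rel_inj h); have o0 : (0 < #[s]%g * ell.-1)%N.
  by rewrite muln_gt0 order_gt0; have := l3; lia.
exists (#[s]%g * ell.-1).-1; rewrite prednK //; split=> [v|].
  have E n : iter n f v = (s ^+ n)%g v.
    by rewrite permX; elim: n => //= n ->; rewrite permE.
  by rewrite E expgM expg_order expg1n perm1.
by rewrite /kap mulnAC exprM exprAC (prim_expr_order omP) expr1n -?exprM ?expr1n rmorph1.
Qed.

(** [Rel] only pulls relations back; since f permutes a finite set and [kap] has finite order, some
    iterate is trivial and relations are also pushed forward. *)
Lemma Rel_tr i f P : Rel i f -> pf P -> P e0 = 0 -> P (act (kap i) f e0) = 0.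
Proof.
move=> h hP P0; have [n [En kn]] := Rel_period h.
refine (Rel_iter (n := n) h (pf_act (om ^+ i) f hP) _).
rewrite -/(kap i) act_comp -kapD -mulSnr kn (_ : _ \o _ = id) ?act1 //.
by apply: funext => v; rewrite /= -iterSr En.
Qed.

Lemma Rel_inv i f : Rel i f -> exists j g, [/\ Rel j g, cancel f g, cancel g f & kap (i + j) = 1].
Proof.
move=> h; have [n [En kn]] := Rel_period h; exists (n * i)%N, (iter n f); split.
- exact: Rel_iter.
- by move=> v; rewrite -iterSr En.
- by move=> v; rewrite -iterS En.
- by rewrite -mulSn.
Qed.

Hypotheses (a_n0 : a != 0) (b_n0 : b != 0).
Hypothesis Xadd : forall v w : V, v != 0 -> w != 0 -> v - w != 0 -> v + w != 0 ->
  (X v - X w) ^+ 2 * (X (v - w) - X (v + w)) = Y v * Y w /\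
  a * (X v - X w) ^+ 2 * (X (v + w) + X (v - w)) =
  (a * b - X v * X w) ^+ 2 + a ^+ 2 * (X v - X w) ^+ 2 -
  (a * (X v + X w) - a * b - X v * X w) ^+ 2.
Hypothesis Xdbl : forall v : V, v != 0 ->
  X (v + v) * Y v ^+ 2 = (X v ^+ 2 - a * b) ^+ 2 /\
  Y (v + v) * Y v ^+ 3 = 2%:R * (X v ^+ 2 - a * b) *
    (X v ^+ 2 - 2%:R * a * X v + a * b) * (X v ^+ 2 - 2%:R * b * X v + a * b).

Ltac pfs := repeat first [exact: pfX | exact: pfY | exact: pf_a | exact: pf_b | exact: pf_nat
  | apply: pfXn | apply: pfB | apply: pfD | apply: pfN | apply: pfM ].

Section RelAdd.
Variables (i : nat) (f : V -> V).
Hypothesis rf : Rel i f.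
Let K := kap i.
Let K0 : K != 0. Proof. exact: kap_neq0. Qed.

Lemma Rel0 : f 0 = 0.
Proof.
have := Rel_tr rf (pfY 0) Y0; rewrite /= -/K => /eqP.
rewrite mulf_eq0 expf_eq0 (negPf K0) andbF /= => E.
by apply/eqP; apply: contraTT E; exact: Yn0.
Qed.

Lemma Rel_neq0 v : v != 0 -> f v != 0.
Proof. by apply: contra => /eqP E; apply/eqP/(Rel_inj rf); rewrite E Rel0. Qed.

Lemma RelN v : f (- v) = - f v.
Proof.
have h1 : pf (fun e => eX e (- v) - eX e v) by pfs.
have h2 : pf (fun e => eY e (- v) + eY e v) by pfs.
have := Rel_tr rf h1; rewrite /= XN subrr => /(_ erefl) /eqP.
rewrite -mulrBr mulf_eq0 expf_eq0 (negPf K0) andbF /= subr_eq0 => /eqP EX.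
have := Rel_tr rf h2; rewrite /= YN addNr => /(_ erefl) /eqP.
rewrite -mulrDr mulf_eq0 expf_eq0 (negPf K0) andbF /= addr_eq0 => /eqP EY.
by apply: XY_inj; rewrite ?XN ?YN.
Qed.

(** Doubling is expressed by relations between coordinates, so it commutes with f. The exponents 8
    and 12 of the scalar are the weights of the two doubling relations. *)
Lemma RelDbl v : f (v + v) = f v + f v.
Proof.
have [->|v0] := eqVneq v 0; first by rewrite addr0 Rel0 addr0.
have fv0 := Rel_neq0 v0; have [d1 d2] := Xdbl v0; have [f1 f2] := Xdbl fv0.
have h1 : pf (fun e => eX e (v + v) * eY e v ^+ 2 - (eX e v ^+ 2 - eA e * eB e) ^+ 2) by pfs.
have h2 : pf (fun e => eY e (v + v) * eY e v ^+ 3 - 2%:R * (eX e v ^+ 2 - eA e * eB e) *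
    (eX e v ^+ 2 - 2%:R * eA e * eX e v + eA e * eB e) * (eX e v ^+ 2 - 2%:R * eB e * eX e v + eA e * eB e)) by pfs.
have := Rel_tr rf h1; have := Rel_tr rf h2; rewrite /= d1 d2 !subrr => /(_ erefl) T2 /(_ erefl) T1.
have yf := Yn0 fv0; apply: XY_inj.
  apply: (mulIf (expf_neq0 2 yf)); rewrite f1.
  apply: (mulfI (expf_neq0 8 K0)); apply/eqP; rewrite -subr_eq0 -[X in _ == X]T1 -/K.
  by apply/eqP; ring.
apply: (mulIf (expf_neq0 3 yf)); rewrite f2.
apply: (mulfI (expf_neq0 12 K0)); apply/eqP; rewrite -subr_eq0 -[X in _ == X]T2 -/K.
by apply/eqP; ring.
Qed.

(** The difference and the sum of X at v - w and v + w are transported by f, which determines X at f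
    (v + w) and hence that point up to sign. *)
Lemma RelX_add v w : v != 0 -> w != 0 -> v - w != 0 -> v + w != 0 ->
  f (v + w) = f v + f w \/ f (v + w) = - (f v + f w).
Proof.
move=> v0 w0 n1 n2; have [fv fw] := (Rel_neq0 v0, Rel_neq0 w0).
have m1 : f v - f w != 0.
  by apply: contra n1; rewrite !subr_eq0 => /eqP/(Rel_inj rf)/eqP.
have m2 : f v + f w != 0.
  by apply: contra n2; rewrite !addr_eq0 -RelN => /eqP/(Rel_inj rf)/eqP.
have [d1 d2] := Xadd v0 w0 n1 n2; have [e1 e2] := Xadd fv fw m1 m2.
have h1 : pf (fun e => (eX e v - eX e w) ^+ 2 * (eX e (v - w) - eX e (v + w)) - eY e v * eY e w) by pfs.
have h2 : pf (fun e => eA e * (eX e v - eX e w) ^+ 2 * (eX e (v + w) + eX e (v - w)) -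
  ((eA e * eB e - eX e v * eX e w) ^+ 2 + eA e ^+ 2 * (eX e v - eX e w) ^+ 2 -
  (eA e * (eX e v + eX e w) - eA e * eB e - eX e v * eX e w) ^+ 2)) by pfs.
have := Rel_tr rf h1; have := Rel_tr rf h2; rewrite /= d1 d2 !subrr => /(_ erefl) T2 /(_ erefl) T1.
have D0 : X (f v) - X (f w) != 0.
  rewrite subr_eq0; apply/eqP => /(Xeq fv fw) [E|E].
    by rewrite E subrr eqxx in m1.
  by rewrite E addNr eqxx in m2.
have D2 := expf_neq0 2 D0.
have E1 : X (f (v - w)) - X (f (v + w)) = X (f v - f w) - X (f v + f w).
  apply: (mulfI D2); rewrite e1; apply: (mulfI (expf_neq0 6 K0)); apply/eqP.
  by rewrite -subr_eq0 -[X in _ == X]T1 -/K; apply/eqP; ring.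
have E2 : X (f (v + w)) + X (f (v - w)) = X (f v + f w) + X (f v - f w).
  apply: (mulfI (mulf_neq0 a_n0 D2)); rewrite e2; apply: (mulfI (expf_neq0 8 K0)); apply/eqP.
  by rewrite -subr_eq0 -[X in _ == X]T2 -/K; apply/eqP; ring.
have EX : X (f (v + w)) = X (f v + f w).
  apply: (mulfI F2); transitivity (X (f (v + w)) + X (f (v - w)) - (X (f (v - w)) - X (f (v + w)))); first by ring.
  by rewrite E1 E2; ring.
exact: Xeq (Rel_neq0 n2) m2 EX.
Qed.

(** The wrong sign in [RelX_add] is refuted by applying the same lemma to v + w and - w: either
    answer would produce 2-torsion. The degenerate pairs are treated first. *)
Lemma RelD v w : f (v + w) = f v + f w.
Proof.
have [->|v0] := eqVneq v 0; first by rewrite Rel0 !add0r.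
have [->|w0] := eqVneq w 0; first by rewrite Rel0 !addr0.
have [/eqP|n1] := eqVneq (v - w) 0; first by rewrite subr_eq0 => /eqP ->; rewrite RelDbl.
have [/eqP|n2] := eqVneq (v + w) 0.
  by rewrite addr_eq0 => /eqP ->; rewrite addNr Rel0 RelN addNr.
have [/eqP|n3] := eqVneq (v + w + w) 0.
  rewrite -addrA addr_eq0 => /eqP ->; rewrite opprD addrNK RelN -opprD RelN RelDbl opprD addrNK //.
have [//|E] := RelX_add v0 w0 n1 n2; exfalso.
have Nw : - w != 0 by rewrite oppr_eq0.
have := @RelX_add (v + w) (- w) n2 Nw; rewrite opprK addrK => /(_ n3 v0).
rewrite RelN E opprD => -[] E'.
  have /V2 Z : (f v + f w) + (f v + f w) = 0 by rewrite {1}E' subrK -opprD addNr.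
  by have := Rel_neq0 n2; rewrite E Z oppr0 eqxx.
move: E'; rewrite !opprD !opprK -addrA -{1}[f v]addr0 => /addrI /esym /V2 E'.
by have := Rel_neq0 w0; rewrite E' eqxx.
Qed.
End RelAdd.

Hypothesis trans : forall p, p != 0 -> evl cst (b / a) p != 0.
Hypothesis trans' : forall p, p != 0 -> evl cst (a / b) p != 0.

(** By [galois_fix] the sum is a quotient of homogeneous elements; divided by a, respectively b, it
    is integral over k[b / a], respectively k[a / b], since each X is. Being polynomial on both
    charts of the projective line, it is linear. *)
Lemma fixed_linear (M : {set V}) : 0 \notin M ->
  (forall i f, (i < ell.-1)%N -> Rel i f -> f @: M = M) ->
  exists c1 c2, \sum_(v in M) X v = cst c1 * a + cst c2 * b.
Proof.
move=> M0 hM; pose P e := \sum_(v <- enum M) eX e v.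
have PE e : P e = \sum_(v in M) eX e v by rewrite /P big_enum.
have hP : pf P by apply: pf_sum => v; exact: pfX.
have [|n [x [y [x0 hx hy E]]]] := galois_fix hP.
  move=> i f li rf; rewrite !PE /= -mulr_sumr -{2}(hM i f li rf) big_imset //.
  by move=> v w _ _; apply: (Rel_inj rf).
rewrite PE /= in E; set phi := \sum_(v in M) X v in E *.
have N0 : cst N%:R = N%:R by rewrite rmorph_nat.
have half (a' b' : F) : a' != 0 -> DivisionPolynomials.hom cst a' b' n x -> DivisionPolynomials.hom cst a' b' n.+1 y ->
    hpol cst a' b' (dd N) N%:R Gt -> (forall p, p != 0 -> evl cst (b' / a') p != 0) ->
    exists r, phi = a' * evl cst (b' / a') r.
  move=> a0 hx' hy' hG tr; have [p [_ Ep]] := hom_poly a0 hx'; have [q [_ Eq]] := hom_poly a0 hy'.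
  have p0 : p != 0 by apply: contraNneq x0 => z; rewrite Ep z rmorph0 horner0 mulr0.
  have int : integralOver (evl cst (b' / a')) (phi / a').
    rewrite /phi mulr_suml; apply: big_ind => [|u w|v vM].
    - exact: integral0.
    - exact: integral_add.
    - rewrite -N0 in hG; apply: (hpol_integral a0 kN hG); apply: rGt.
      by apply: contraNneq M0 => <-.
  have [|r Er] := integral_poly tr p0 _ int (q := q); last first.
    by exists r; rewrite -Er mulrC divfK.
  apply: (mulfI (expf_neq0 n.+1 a0)); rewrite -[RHS]Eq -E Ep -/(evl cst (b' / a') p) exprS.
  by move: (evl _ _ p) (a' ^+ n) => u w; field.
have [r Er] := half a b a_n0 hx hy hGt trans.
have hGs : hpol cst b a (dd N) N%:R Gt by case: hGt => ? ? h; split=> // i le; apply/hom_sym/h.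
have [r' Er'] := half b a b_n0 (hom_sym hx) (hom_sym hy) hGs trans'.
have [|c1 [c2 Ec]] := @two_sided_linear _ _ cst (b / a) trans a b r r' a_n0 b_n0 erefl.
  by rewrite -Er Er'.
by exists c1, c2; rewrite Er Ec.
Qed.
End World.

End GaloisAction.

(** * Rational functions of the coordinates and their derivatives, uniformly in the map *)

Module Uniformity.
Import DivisionPolynomials GaloisAction.

Lemma Gt_separable (F : fieldType) (rs : seq F) (l : F) r : l != 0 -> uniq rs -> r \in rs ->
  ((l *: \prod_(s <- rs) ('X - s%:P))^`()).[r] != 0.
Proof.
move=> l0 u rr; rewrite derivZ hornerZ mulf_neq0 //.
have := separable_prod_XsubC rs; rewrite u separable_poly.unlock => /idP cop.
by apply: (coprimep_root cop); rewrite root_prod_XsubC.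
Qed.

Section Unif.
Variables (k F : fieldType) (cst : {rmorphism k -> F}) (V : finZmodType) (a b : F) (X Y : V -> F).
Notation env := (env F V).
Notation pf := (@pf k F cst V).
Variable G : (V -> V) -> Prop.
Definition ef (f : V -> V) : env := Env a b (X \o f) (Y \o f).
Hypothesis Gid : G id.
Hypothesis Gtr : forall f P, G f -> pf P -> P (ef id) = 0 <-> P (ef f) = 0.

(** Inversion is total, with 0 inverted to 0, so the class is closed without side conditions. *)
Inductive rf : (env -> F) -> Prop :=
| rf_pf P : pf P -> rf P
| rfD P Q : rf P -> rf Q -> rf (fun e => P e + Q e)
| rfM P Q : rf P -> rf Q -> rf (fun e => P e * Q e)
| rfV P : rf P -> rf (fun e => (P e)^-1).

Lemma rfC c : rf (fun=> cst c). Proof. exact/rf_pf/pfC. Qed.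
Lemma rf_nat n : rf (fun=> n%:R). Proof. exact/rf_pf/pf_nat. Qed.
Lemma rfN P : rf P -> rf (fun e => - P e).
Proof.
move=> h; have := rfM (rfC (-1)) h; congr rf; apply: funext => e.
by rewrite rmorphN1 mulN1r.
Qed.
Lemma rfB P Q : rf P -> rf Q -> rf (fun e => P e - Q e).
Proof. by move=> hP hQ; apply: rfD => //; apply: rfN. Qed.
Lemma rfXn P n : rf P -> rf (fun e => P e ^+ n).
Proof.
move=> h; elim: n => [|n IH]; first by have := rf_nat 1; congr rf.
by have := rfM h IH; congr rf; apply: funext => e; rewrite exprS.
Qed.
Lemma rf_sum (I : Type) (r : seq I) (P : I -> env -> F) :
  (forall i, rf (P i)) -> rf (fun e => \sum_(i <- r) P i e).
Proof.
move=> h; elim: r => [|i r IH].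
  by have := rf_nat 0; congr rf; apply: funext => e; rewrite big_nil.
by have := rfD (h i) IH; congr rf; apply: funext => e; rewrite big_cons.
Qed.

Lemma G_neq0 f P : G f -> pf P -> (P (ef id) != 0) = (P (ef f) != 0).
Proof. by move=> Gf hP; congr (~~ _); apply/eqP/eqP => /(Gtr Gf hP). Qed.

(** One fraction A / B represents P at all f in G, because nonvanishing of the denominator transfers
    along G; when a numerator to be inverted vanishes, it does so at every f and the inverse is 0
    throughout. *)
Lemma rf_frac P : rf P -> exists A B, [/\ pf A, pf B, B (ef id) != 0 &
  forall f, G f -> P (ef f) = A (ef f) / B (ef f)].
Proof.
elim=> {P} [P h|P Q _ [A [B [hA hB B0 E]]] _ [A' [B' [hA' hB' B0' E']]]
  |P Q _ [A [B [hA hB B0 E]]] _ [A' [B' [hA' hB' B0' E']]]|P _ [A [B [hA hB B0 E]]]].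
- exists P, (fun=> 1); split=> //; [exact: pf1|exact: oner_neq0|].
  by move=> f _; rewrite divr1.
- exists (fun e => A e * B' e + A' e * B e), (fun e => B e * B' e); split.
  + by apply: pfD; apply: pfM.
  + exact: pfM.
  + by rewrite mulf_neq0.
  + move=> f Gf; rewrite E // E' // addf_div // -(G_neq0 Gf) //.
- exists (fun e => A e * A' e), (fun e => B e * B' e); split; try exact: pfM; first by rewrite mulf_neq0.
  by move=> f Gf; rewrite E // E' // mulf_div.
- have [A0|A0] := eqVneq (A (ef id)) 0.
    exists (fun=> 0), (fun=> 1); split; [|exact: pf1|exact: oner_neq0|].
      by have := pfC cst V 0; rewrite rmorph0.
    by move=> f Gf; rewrite E // ((Gtr Gf hA).1 A0) !mul0r invr0.
  by exists B, A; split=> // f Gf; rewrite E // invf_div.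
Qed.

Lemma rf_zero P f : rf P -> G f -> P (ef id) = 0 -> P (ef f) = 0.
Proof.
move=> /rf_frac[A [B [hA hB B0 E]]] Gf; rewrite !E // => /eqP.
rewrite mulf_eq0 invr_eq0 (negPf B0) orbF => /eqP /(Gtr Gf hA) ->.
by rewrite mul0r.
Qed.

Variable D : F -> F.
Hypothesis DD : forall x y, D (x + y) = D x + D y.
Hypothesis DM : forall x y, D (x * y) = D x * y + x * D y.
Hypothesis DC : forall c, D (cst c) = 0.
Hypothesis f2 : (2%:R : F) != 0.
Variables Ra Rb : env -> F.
Hypotheses (hRa : rf Ra) (hRb : rf Rb).
Hypotheses (ERa : forall f, Ra (ef f) = D a) (ERb : forall f, Rb (ef f) = D b).
Hypotheses (X0 : X 0 = 0) (Y0 : Y 0 = 0) (Yn0 : forall v : V, v != 0 -> Y v != 0).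
Hypothesis Ysq : forall v, Y v ^+ 2 = 4%:R * (X v * (X v - a) * (X v - b)).
Hypothesis G0 : forall f, G f -> f 0 = 0.
Hypothesis Gn0 : forall f v, G f -> v != 0 -> f v != 0.
Variables (d : nat) (l : F) (Gt : {poly F}).
Hypothesis hGt : hpol cst a b d l Gt.
Hypothesis rGt : forall v : V, v != 0 -> Gt.[X v] = 0.
Hypothesis sGt : forall v : V, v != 0 -> (Gt^`()).[X v] != 0.

Lemma D0 : D 0 = 0. Proof. by have := DC 0; rewrite rmorph0. Qed.
Lemma D1 : D 1 = 0. Proof. by rewrite -(rmorph1 cst) DC. Qed.
Lemma DN x : D (- x) = - D x.
Proof. by apply/eqP; rewrite -addr_eq0 -DD addNr D0. Qed.
Lemma DB x y : D (x - y) = D x - D y. Proof. by rewrite DD DN. Qed.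
Lemma Dsum (I : Type) (r : seq I) (P : pred I) (E : I -> F) :
  D (\sum_(i <- r | P i) E i) = \sum_(i <- r | P i) D (E i).
Proof. exact: (big_morph D DD D0). Qed.
Lemma DX x n : D (x ^+ n) = n%:R * x ^+ n.-1 * D x.
Proof.
elim: n => [|n IH]; first by rewrite expr0 D1 !mul0r.
rewrite exprS DM IH; case: n {IH} => [|n]; first by rewrite !expr0; ring.
by rewrite /= [x ^+ n.+1]exprS [n.+2%:R]mulrS; ring.
Qed.
Lemma DV x : D x^-1 = - (D x * x^-1 ^+ 2).
Proof.
have [->|x0] := eqVneq x 0; first by rewrite invr0 D0 mul0r oppr0.
apply: (mulfI x0); have := DM x x^-1; rewrite divff // D1 => /eqP.
rewrite eq_sym addrC addr_eq0 => /eqP ->; field.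
exact: x0.
Qed.

Lemma hom_pf n x : hom cst a b n x -> exists P, pf P /\ forall f, P (ef f) = x.
Proof.
elim=> {n x} [n|c|||n x y _ [P [hP E]] _ [Q [hQ E']]|m n x y _ [P [hP E]] _ [Q [hQ E']]].
- by exists (fun=> cst 0); split=> [|f]; [exact: pfC|rewrite rmorph0].
- by exists (fun=> cst c); split=> //; exact: pfC.
- by exists (@eA F V); split=> //; exact: pf_a.
- by exists (@eB F V); split=> //; exact: pf_b.
- by exists (fun e => P e + Q e); split=> [|f]; [exact: pfD|rewrite E E'].
- by exists (fun e => P e * Q e); split=> [|f]; [exact: pfM|rewrite E E'].
Qed.

Lemma hom_D n x : hom cst a b n x -> exists P, rf P /\ forall f, P (ef f) = D x.
Proof.
elim=> {n x} [n|c|||n x y _ [P [hP E]] _ [Q [hQ E']]|m n x y hx [P [hP E]] hy [Q [hQ E']]].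
- by exists (fun=> 0%:R); split=> [|f]; [exact: rf_nat|rewrite D0].
- by exists (fun=> 0%:R); split=> [|f]; [exact: rf_nat|rewrite DC].
- by exists Ra.
- by exists Rb.
- by exists (fun e => P e + Q e); split=> [|f]; [exact: rfD|rewrite E E' DD].
- have [P' [hP' Ex]] := hom_pf hx; have [Q' [hQ' Ey]] := hom_pf hy.
  exists (fun e => P e * Q' e + P' e * Q e); split=> [|f]; last by rewrite E E' Ex Ey DM.
  by apply: rfD; apply: rfM => //; apply: rf_pf.
Qed.

(** Implicit differentiation of Gt(X) = 0. The derivative at f v is the same rational expression for
    all f, because the coefficients of [Gt] depend on a and b only and its roots are simple. *)
Lemma X_D v : exists P, rf P /\ forall f, G f -> P (ef f) = D (X (f v)).
Proof.
have [->|v0] := eqVneq v 0.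
  by exists (fun=> 0%:R); split=> [|f Gf]; [exact: rf_nat|rewrite G0 // X0 D0].
have [sG lG hG] := hGt.
have /choice[p Hp] : forall i : nat, exists p, (i <= d)%N -> pf p /\ forall f, p (ef f) = Gt`_i.
  by move=> i; have [le|//] := leqP i d; [have [p hp] := hom_pf (hG i le); exists p|exists (fun=> 0)].
have /choice[q Hq] : forall i : nat, exists q, (i <= d)%N -> rf q /\ forall f, q (ef f) = D Gt`_i.
  by move=> i; have [le|//] := leqP i d; [have [q hq] := hom_D (hG i le); exists q|exists (fun=> 0)].
exists (fun e => - (\sum_(i < d.+1) q i e * eX e v ^+ i) / (\sum_(i < d.+1) i%:R * p i e * eX e v ^+ i.-1)).
have xv n : rf (fun e => eX e v ^+ n) by apply/rfXn/rf_pf/pfX.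
split.
  apply: rfM; first apply/rfN.
    apply: rf_sum => -[i le]; apply: rfM => //; exact: (Hq i le).1.
  apply/rfV/rf_sum => -[i le]; apply: rfM => //; apply: rfM; first exact: rf_nat.
  exact/rf_pf/(Hp i le).1.
move=> f Gf; have w0 := Gn0 Gf v0; set x := X (f v).
have E1 : \sum_(i < d.+1) i%:R * p i (ef f) * eX (ef f) v ^+ i.-1 = (Gt^`()).[x].
  rewrite (@horner_coef_wide _ d); last by rewrite (leq_trans (size_poly _ _)) //; case: (size Gt) sG.
  rewrite big_ord_recl /= !mul0r add0r; apply: eq_bigr => -[i le] _ /=.
  by rewrite coef_deriv (Hp i.+1 le).2 mulr_natl.
have E2 : \sum_(i < d.+1) q i (ef f) * eX (ef f) v ^+ i = \sum_(i < d.+1) D Gt`_i * x ^+ i.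
  by apply: eq_bigr => -[i le] _ /=; rewrite (Hq i le).2.
rewrite E1 E2; apply: (mulIf (sGt w0)); rewrite divfK ?sGt //.
have := rGt w0; rewrite -/x (horner_coef_wide _ sG) => /(congr1 D); rewrite D0 Dsum.
rewrite (eq_bigr (fun i : 'I_d.+1 => D Gt`_i * x ^+ i + i%:R * Gt`_i * x ^+ i.-1 * D x)).
  rewrite big_split /= -mulr_suml => /eqP; rewrite addr_eq0 => /eqP ->; rewrite opprK mulrC -E1.
  by congr (_ * _); apply: eq_bigr => -[i le] _ /=; rewrite (Hp i le).2.
by move=> i _; rewrite DM DX; ring.
Qed.

Lemma Y_D v : exists P, rf P /\ forall f, G f -> P (ef f) = D (Y (f v)).
Proof.
have [->|v0] := eqVneq v 0.
  by exists (fun=> 0%:R); split=> [|f Gf]; [exact: rf_nat|rewrite G0 // Y0 D0].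
have [Q [hQ EQ]] := X_D v; have rx : rf (fun e => eX e v) by apply/rf_pf/pfX.
have ra : rf (@eA F V) by apply/rf_pf/pf_a.
have rb : rf (@eB F V) by apply/rf_pf/pf_b.
exists (fun e => 4%:R * (Q e * (eX e v - eA e) * (eX e v - eB e) +
   eX e v * (Q e - Ra e) * (eX e v - eB e) + eX e v * (eX e v - eA e) * (Q e - Rb e)) /
   (2%:R * eY e v)); split.
  apply: rfM; last by apply/rfV/rfM; [exact: rf_nat|exact/rf_pf/pfY].
  apply: rfM; first exact: rf_nat.
  by repeat first [apply: rfD|apply: rfM|apply: rfN|assumption].
move=> f Gf; have y0 := Yn0 (Gn0 Gf v0); rewrite EQ // ERa ERb /=.
have := congr1 D (Ysq (f v)); rewrite DX /= expr1 !DM !DB => E.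
apply: (mulfI (mulf_neq0 f2 y0)); rewrite E mulrC divfK ?mulf_neq0 //.
by rewrite -(rmorph_nat cst) DC; ring.
Qed.

(** This uniformity in f is what allows the projection to a class modulo ell, a polynomial in D, to
    be carried along the Weyl elements. *)
Lemma rf_Dclosed P : rf P -> exists Q, rf Q /\ forall f, G f -> Q (ef f) = D (P (ef f)).
Proof.
elim=> {P} [P|P Q hP [P' [hP' E]] hQ [Q' [hQ' E']]|P Q hP [P' [hP' E]] hQ [Q' [hQ' E']]|P hP [P' [hP' E]]].
- elim=> {P} [c|||v|v|P Q hP [P' [hP' E]] hQ [Q' [hQ' E']]|P Q hP [P' [hP' E]] hQ [Q' [hQ' E']]].
  + by exists (fun=> 0%:R); split=> [|f _]; [exact: rf_nat|rewrite DC].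
  + by exists Ra; split=> // f _; rewrite ERa.
  + by exists Rb; split=> // f _; rewrite ERb.
  + exact: X_D.
  + exact: Y_D.
  + by exists (fun e => P' e + Q' e); split=> [|f Gf]; [exact: rfD|rewrite E // E' // DD].
  + exists (fun e => P' e * Q e + P e * Q' e); split=> [|f Gf]; last by rewrite E // E' // DM.
    by apply: rfD; apply: rfM => //; apply: rf_pf.
- by exists (fun e => P' e + Q' e); split=> [|f Gf]; [exact: rfD|rewrite E // E' // DD].
- exists (fun e => P' e * Q e + P e * Q' e); split=> [|f Gf]; last by rewrite E // E' // DM.
  by apply: rfD; apply: rfM.
- exists (fun e => - (P' e * (P e)^-1 ^+ 2)); split=> [|f Gf]; last by rewrite E // DV.
  by apply/rfN/rfM => //; apply/rfXn/rfV.
Qed.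
End Unif.

End Uniformity.

(** * q-expansions excluding that the multiplicative p-torsion has a linear sum *)

Module QExpansion.
Import PowerSeries FormalSums Theta TripleProduct ProductFormula ThetaIdentities TateCurve DivisionPolynomials Hasse.

Section Emb.
Variables (k : fieldType) (M : nat).
Hypothesis M0 : (0 < M)%N.
(** Substitution of S^M for the variable. With M = 4 N^2 the theta constants at the half periods are
    series in S^M, so the expansions below are polynomial computations modulo degree 5. *)
Definition emb (p : {poly k}) : fps k := Fps (fun n => if (M %| n)%N then p`_(n %/ M) else 0).

Lemma embE p : emb p = (map_poly (@fpsC k) p).[fpsX M].
Proof.
apply: fpsP => n; rewrite (@horner_coef_wide _ (size p)) ?(leq_trans (size_poly _ _)) // fcoef_sum.
rewrite (eq_bigr (fun i : 'I_(size p) => p`_i * (n == M * i)%:R)) => [|i _]; last first.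
  by rewrite coef_map -fpsXM fcoefCM.
rewrite [fcoef (emb p) n]/=.
case: (boolP (M %| n)%N) => [/dvdnP[m ->]|nd]; last first.
  by rewrite big1 // => i _; case: eqP => [E|_]; [rewrite E dvdn_mulr in nd|rewrite mulr0].
rewrite mulnK //; have [le|lt] := leqP (size p) m.
  rewrite nth_default // big1 // => i _; rewrite [(m * M)%N]mulnC eqn_pmul2l //.
  by rewrite gtn_eqF ?mulr0 // (leq_trans (ltn_ord i)).
rewrite (bigD1 (Ordinal lt)) //= mulnC eqxx mulr1 big1 ?addr0 // => i ne.
by rewrite eqn_pmul2l // -val_eqE /= eq_sym in ne *; rewrite (negPf ne) mulr0.
Qed.

Lemma embM p q : emb (p * q) = emb p * emb q. Proof. by rewrite !embE rmorphM hornerM. Qed.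
Lemma embX p n : emb (p ^+ n) = emb p ^+ n. Proof. by rewrite !embE rmorphXn horner_exp. Qed.
Lemma emb_trunc m (p q : {poly k}) : (forall i, (i < m)%N -> p`_i = q`_i) -> feqm (m * M) (emb p) (emb q).
Proof.
move=> H n lt /=; case: ifP => // /dvdnP[i E]; rewrite E mulnK //; apply: H.
by move: lt; rewrite E ltn_pmul2r.
Qed.
Lemma emb_coef p i : fcoef (emb p) (M * i) = p`_i.
Proof. by rewrite /= dvdn_mulr // mulKn. Qed.
Lemma emb_coef0 p : fcoef (emb p) 0 = p`_0.
Proof. by rewrite /= dvdn0 div0n. Qed.
End Emb.

Lemma feqm_unitI (k : fieldType) n (u x y : fps k) : u \is a GRing.unit ->
  feqm n (u * x) (u * y) -> feqm n x y.
Proof.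
move=> Uu h; rewrite -[x](mulKr Uu) -[y](mulKr Uu).
by apply: feqmM => //; apply: feqm_refl.
Qed.

Section QExp.
Variables (k : fieldType) (N : nat).
Hypothesis N0 : (0 < N)%N.
Hypothesis nz2 : (2%:R : k) != 0.
Notation M := (4 * N ^ 2)%N.
Let M0 : (0 < M)%N. Proof. by rewrite muln_gt0 expn_gt0 N0. Qed.
Notation em := (@emb k M).

Lemma sq_bounds (n : int) (B : nat) : (n * n < B%:Z * B%:Z) -> (- B%:Z < n < B%:Z).
Proof. by move=> h; apply/andP; split; nia. Qed.

(** The common factor S^(N^2) is removed, so that X becomes a quotient of units. *)
Definition tw (w : int -> k) : fps k := Fps (fun e => fcoef (gs w (ex N 0)) (e + N ^ 2)%N).

Lemma ex0E n : (ex N 0 n)%:Z = (N ^ 2)%:Z * ((2 * n - 1) * (2 * n - 1)).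
Proof. by rewrite exE -mulnn PoszM; ring. Qed.

Lemma ex0_ge n : (N ^ 2 <= ex N 0 n)%N.
Proof.
rewrite -lez_nat ex0E; have : (1 <= (2 * n - 1) * (2 * n - 1))%R by nia.
by have : (0 <= (N ^ 2)%:Z)%R by []; nia.
Qed.

Lemma twE w : gs w (ex N 0) = fpsX (N ^ 2)%N * tw w.
Proof.
apply: fpsP => e; rewrite fcoefXM; case: ltnP => [lt|le]; last by rewrite /tw /= subnK.
by apply: gs_coef_out => n E; have := ex0_ge n; rewrite E leqNgt lt.
Qed.

Lemma twP w : feqm (5 * M) (tw w) (em ((w 0 + w 1)%:P + (w 2 + w (-1))%:P * 'X^2)).
Proof.
move=> e lt; have NN : (0 < N ^ 2)%N by rewrite expn_gt0 N0.
rewrite -[LHS]/(fcoef (gs w (ex N 0)) (e + N ^ 2)%N).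
have x0 : ex N 0 0 = (N ^ 2)%N by apply/eqP; rewrite -eqz_nat ex0E; apply/eqP; ring.
have x1 : ex N 0 1 = (N ^ 2)%N by apply/eqP; rewrite -eqz_nat ex0E; apply/eqP; ring.
have x2 : ex N 0 2 = (2 * M + N ^ 2)%N by apply/eqP; rewrite -eqz_nat ex0E; apply/eqP; rewrite PoszD !PoszM; ring.
have x3 : ex N 0 (-1) = (2 * M + N ^ 2)%N by apply/eqP; rewrite -eqz_nat ex0E; apply/eqP; rewrite PoszD !PoszM; ring.
have cl n : (ex N 0 n < 21 * N ^ 2)%N -> [|| n == 0, n == 1, n == 2 | n == -1].
  move=> h; have : (2 * n - 1) * (2 * n - 1) < 5%:Z * 5%:Z.
    have := ex0E n; move: (ex N 0 n) h => x h E; move: (N ^ 2)%N NN h E => y; nia.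
  by move/sq_bounds; lia.
have lt' : (e + N ^ 2 < 21 * N ^ 2)%N by move: lt; move: (N ^ 2)%N => y; lia.
have [e0|ne0] := eqVneq e 0.
  rewrite e0 add0n -x0 (@gs_coef_two _ _ _ _ 0 1) ?x0 ?x1 //; last first.
    move=> n E; have : (ex N 0 n < 21 * N ^ 2)%N by rewrite E; move: (N ^ 2)%N NN; lia.
    move/cl => /or4P[->//|->|/eqP En|/eqP En]; rewrite ?orbT //; exfalso.
      by move: E; rewrite En x2; move: (N ^ 2)%N NN; lia.
    by move: E; rewrite En x3; move: (N ^ 2)%N NN; lia.
  by rewrite emb_coef0 coefD coefC coefCM coefXn mulr0 addr0.
have [e2|ne2] := eqVneq e (M * 2)%N.
  rewrite e2 mulnC -x2 (@gs_coef_two _ _ _ _ 2 (-1)) ?x2 ?x3 //; last first.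
    move=> n E; have : (ex N 0 n < 21 * N ^ 2)%N by rewrite E; move: (N ^ 2)%N NN; lia.
    move/cl => /or4P[/eqP En|/eqP En|->|->]; rewrite ?orbT //; exfalso.
      by move: E; rewrite En x0; move: (N ^ 2)%N NN; lia.
    by move: E; rewrite En x1; move: (N ^ 2)%N NN; lia.
  by rewrite [X in fcoef _ X]mulnC emb_coef // coefD coefC coefCM coefXn mulr1 add0r.
rewrite gs_coef_out => [|n E].
  rewrite /=; case: ifP => // /dvdnP[i Ei]; rewrite Ei mulnK // coefD coefC coefCM coefXn.
  case: i Ei => [|[|[|i]]] Ei; rewrite ?mulr0 ?addr0 //.
    by rewrite Ei eqxx in ne0.
  by rewrite Ei mulnC eqxx in ne2.
have := cl n; rewrite E lt' => /(_ isT) /or4P[/eqP En|/eqP En|/eqP En|/eqP En]; move: E ne0 ne2; rewrite En ?x0 ?x1 ?x2 ?x3.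
- by rewrite -{1}[(N ^ 2)%N]add0n => /addIn <-; rewrite eqxx.
- by rewrite -{1}[(N ^ 2)%N]add0n => /addIn <-; rewrite eqxx.
- by move=> /addIn <- _; rewrite mulnC eqxx.
- by move=> /addIn <- _; rewrite mulnC eqxx.
Qed.

Lemma thNP w : feqm (5 * M) (gs w (ex N N%:Z))
  (em ((w 0)%:P + (w 1 + w (-1))%:P * 'X + (w 2 + w (-2))%:P * 'X^4)).
Proof.
move=> e lt; have NN : (0 < N ^ 2)%N by rewrite expn_gt0 N0.
have xE n : (ex N N%:Z n)%:Z = M%:Z * (n * n) by rewrite exE -mulnn !PoszM; ring.
have MM := M0; move: xE lt MM; move: (4 * N ^ 2)%N => y xE lt MM.
have x0 : ex N N%:Z 0 = (y * 0)%N by apply/eqP; rewrite -eqz_nat xE PoszM; apply/eqP; ring.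
have x1 : ex N N%:Z 1 = (y * 1)%N by apply/eqP; rewrite -eqz_nat xE PoszM; apply/eqP; ring.
have x1' : ex N N%:Z (-1) = (y * 1)%N by apply/eqP; rewrite -eqz_nat xE PoszM; apply/eqP; ring.
have x2 : ex N N%:Z 2 = (y * 4)%N by apply/eqP; rewrite -eqz_nat xE PoszM; apply/eqP; ring.
have x2' : ex N N%:Z (-2) = (y * 4)%N by apply/eqP; rewrite -eqz_nat xE PoszM; apply/eqP; ring.
have cl n : (ex N N%:Z n < 5 * y)%N -> [|| n == 0, n == 1, n == -1, n == 2 | n == -2].
  move=> h; have : n * n < 3%:Z * 3%:Z by have := xE n; move: (ex N _ n) h => x h E; nia.
  by move/sq_bounds; lia.
have [e0|ne0] := eqVneq e (y * 0)%N.
  rewrite e0 -x0 gs_coef_one => [|n E].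
    by rewrite x0 emb_coef // !coefD !coefCM coefC coefX coefXn !mulr0 !addr0.
  have : (ex N N%:Z n < 5 * y)%N by rewrite E x0; lia.
  by move/cl => /or3P[/eqP //|/eqP En|/or3P[]/eqP En]; move: E; rewrite En ?x0 ?x1 ?x1' ?x2 ?x2'; clear -MM; lia.
have [e1|ne1] := eqVneq e (y * 1)%N.
  rewrite e1 -x1 (@gs_coef_two _ _ _ _ 1 (-1)) ?x1 ?x1' // => [|n E].
    by rewrite emb_coef // !coefD !coefCM coefC coefX coefXn mulr1 !mulr0 addr0 add0r.
  have : (ex N N%:Z n < 5 * y)%N by rewrite E; lia.
  by move/cl => /or3P[/eqP En|-> //|/or3P[->|/eqP En|/eqP En]]; rewrite ?orbT //; move: E; rewrite En ?x0 ?x1 ?x1' ?x2 ?x2'; clear -MM; lia.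
have [e2|ne2] := eqVneq e (y * 4)%N.
  rewrite e2 -x2 (@gs_coef_two _ _ _ _ 2 (-2)) ?x2 ?x2' // => [|n E].
    by rewrite emb_coef // !coefD !coefCM coefC coefX coefXn mulr1 !mulr0 !add0r.
  have : (ex N N%:Z n < 5 * y)%N by rewrite E; lia.
  by move/cl => /or3P[/eqP En|/eqP En|/or3P[/eqP En|->|->]]; rewrite ?orbT //; move: E; rewrite En ?x0 ?x1 ?x1' ?x2 ?x2'; clear -MM; lia.
rewrite gs_coef_out => [|n E].
  rewrite /=; case: ifP => // /dvdnP[i Ei]; rewrite Ei mulnK // !coefD !coefCM coefC coefX coefXn.
  case: i Ei => [|[|[|[|[|i]]]]] Ei; rewrite ?mulr0 ?addr0 //; exfalso.
  - by rewrite Ei mulnC eqxx in ne0.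
  - by rewrite Ei mulnC eqxx in ne1.
  - by rewrite Ei mulnC eqxx in ne2.
have := cl n; rewrite E lt => /(_ isT) /or3P[/eqP En|/eqP En|/or3P[]/eqP En]; move: E ne0 ne1 ne2.
all: by rewrite En ?x0 ?x1 ?x1' ?x2 ?x2' => <-; rewrite ?eqxx.
Qed.

Notation tau c := (tw (fun n : int => (- c : k) ^ n)).
Notation tau1 := (tw (fun n : int => (-1 : k) ^ n * n%:~R)).
Definition pol2 (x y z : k) : {poly k} := x%:P + y%:P * 'X^2 + z%:P * 'X^4.

Lemma pol2M x y z x' y' z' i : (i < 5)%N -> (pol2 x y z * pol2 x' y' z')`_i =
  (pol2 (x * x') (x * y' + y * x') (x * z' + y * y' + z * x'))`_i.
Proof.
have E : pol2 x y z * pol2 x' y' z' = pol2 (x * x') (x * y' + y * x') (x * z' + y * y' + z * x') +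
  'X^5 * ((y * z' + z * y')%:P * 'X + (z * z')%:P * 'X^3).
  by rewrite /pol2 !polyCD !polyCM; ring.
by move=> lt; rewrite E coefD coefXnM lt addr0.
Qed.

Lemma feqm_pol2M a b x y z x' y' z' : feqm (5 * M) a (em (pol2 x y z)) -> feqm (5 * M) b (em (pol2 x' y' z')) ->
  feqm (5 * M) (a * b) (em (pol2 (x * x') (x * y' + y * x') (x * z' + y * y' + z * x'))).
Proof.
move=> ha hb; apply: feqm_trans (feqmM ha hb) _; rewrite -embM //.
by apply: emb_trunc => // i; apply: pol2M.
Qed.

Lemma tauP c : c != 0 -> feqm (5 * M) (tau c) (em (pol2 (1 - c) (c ^+ 2 - c^-1) 0)).
Proof.
move=> c0; have := twP (fun n : int => (- c) ^ n).
by rewrite expr0z expr1z -exprnP sqrrN exprN1 invrN /pol2 mul0r addr0.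
Qed.
Lemma tau1P : feqm (5 * M) tau1 (em (pol2 (-1) 3%:R 0)).
Proof.
have := twP (fun n : int => (-1) ^ n * n%:~R).
rewrite expr0z expr1z -exprnP sqrrN exprN1 invrN invr1 /pol2 mul0r addr0.
rewrite mulr0 add0r mulr1 expr1n mul1r rmorphN1 mulrNN mulr1.
by rewrite (_ : 2%:~R + 1 = 3%:R) //; ring.
Qed.

Lemma tau_unit c : c != 0 -> c != 1 -> tau c \is a GRing.unit.
Proof.
move=> c0 c1; apply: fps_unitE; rewrite unitfE (tauP c0) ?muln_gt0 ?expn_gt0 ?N0 //.
by rewrite emb_coef0 /pol2 !coefD !coefCM coefC !coefXn !mulr0 !addr0 subr_eq0 eq_sym.
Qed.

Definition xser (c : k) : fps k := tau1 ^+ 2 * tau (- c) ^+ 2 / (tau c ^+ 2 * tau (-1) ^+ 2).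

Lemma N1ne1 : (-1 : k) != 1. Proof. by rewrite eq_sym -subr_eq0 opprK. Qed.

Lemma xserP c : c != 0 -> c != 1 -> feqm (5 * M) (xser c)
  (em (pol2 ((1 + c) ^+ 2 / (4%:R * (1 - c) ^+ 2)) (c + c^-1 + 2%:R) (c + c^-1 + 2%:R * (c ^+ 2 + c ^- 2) - 2%:R))).
Proof.
move=> c0 c1; have m1 : (-1 : k) != 0 by rewrite oppr_eq0 oner_eq0.
have Uc := tau_unit c0 c1; have U1 := tau_unit m1 N1ne1.
have U : tau c ^+ 2 * tau (-1) ^+ 2 \is a GRing.unit by rewrite unitrM !unitrX.
apply: (feqm_unitI U); rewrite /xser mulrCA mulrV // mulr1.
have cN0 : - c != 0 by rewrite oppr_eq0.
rewrite !expr2.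
have h1 := feqm_pol2M tau1P tau1P; have h2 := feqm_pol2M (tauP cN0) (tauP cN0).
have h3 := feqm_pol2M (tauP c0) (tauP c0); have h4 := feqm_pol2M (tauP m1) (tauP m1).
apply: feqm_trans (feqm_pol2M h1 h2) _; apply: feqm_sym.
set P := pol2 ((1 + c) ^+ 2 / _) _ _.
apply: feqm_trans (feqm_pol2M (feqm_pol2M h3 h4) (@feqm_refl _ _ (em P))) _.
have d0 : 1 - c != 0 by rewrite subr_eq0 eq_sym.
have n4 : (4%:R : k) != 0 by rewrite (_ : 4%:R = 2%:R * 2%:R :> k) ?mulf_neq0 //; ring.
have C0 : c^-1 * c = 1 by rewrite mulVf.
rewrite /P; set P1 := pol2 _ _ _; set P2 := pol2 _ _ _; suff -> : P1 = P2 by apply: feqm_refl.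
by rewrite /P1 /P2; congr pol2; rewrite ?invrN ?invr1; field; rewrite ?c0 ?d0 ?n4 ?oppr_eq0 ?oner_eq0.
Qed.

(** For x = 1 the numbers 8, 24, 24 count the representations of 1, 2, 4 as sums of four squares. *)
Lemma theta4P (w : int -> k) x : w 0 = 1 -> w 1 + w (-1) = 2%:R * x -> w 2 + w (-2) = 2%:R -> x ^+ 2 = 1 ->
  let g := gs w (ex N N%:Z) ^+ 4 in
  [/\ fcoef g (M * 1) = 8%:R * x, fcoef g (M * 2) = 24%:R & fcoef g (M * 4) = 24%:R].
Proof.
move=> w0 w1 w2 x2 g.
have h : feqm (5 * M) g (em ((1 + (2%:R * x)%:P * 'X + 2%:R%:P * 'X^4) ^+ 4)).
  by rewrite embX //; apply: feqmX; have := thNP w; rewrite w0 w1 w2 polyC1.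
have E : (1 + (2%:R * x)%:P * 'X + 2%:R%:P * 'X^4) ^+ 4 =
  1 + (8%:R * x)%:P * 'X + 24%:R%:P * 'X^2 + (32%:R * x)%:P * 'X^3 + 24%:R%:P * 'X^4 +
  'X^5 * ((48%:R * x)%:P + 96%:R%:P * 'X + (64%:R * x)%:P * 'X^2 + 24%:R%:P * 'X^3 + (96%:R * x)%:P * 'X^4
   + 96%:R%:P * 'X^5 + 32%:R%:P * 'X^7 + (64%:R * x)%:P * 'X^8 + 16%:R%:P * 'X^11).
  have X2 : x%:P ^+ 2 = 1 by rewrite -polyC_exp x2 polyC1.
  rewrite !polyCM !polyC_natr.
  move: (x%:P) X2 => y Y2; have Y3 : y ^+ 3 = y by rewrite exprS Y2 mulr1.
  have Y4 : y ^+ 4 = 1 by rewrite (exprM y 2 2) Y2 expr1n.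
  transitivity (1 + 8%:R * y * 'X + 24%:R * y ^+ 2 * 'X^2 + 32%:R * y ^+ 3 * 'X^3 + (8%:R + 16%:R * y ^+ 4) * 'X^4 +
    'X^5 * (48%:R * y + 96%:R * y ^+ 2 * 'X + 64%:R * y ^+ 3 * 'X^2 + 24%:R * 'X^3 + 96%:R * y * 'X^4 +
     96%:R * y ^+ 2 * 'X^5 + 32%:R * 'X^7 + 64%:R * y * 'X^8 + 16%:R * 'X^11)); first by ring.
  by rewrite Y2 Y3 Y4; ring.
have lt i : (i < 5)%N -> (M * i < 5 * M)%N by move=> li; rewrite mulnC ltn_pmul2r.
by split; rewrite h ?lt // emb_coef // E !coefD !coefCM !coefXnM coef1 coefX !coefXn /= ?mulr0 ?mulr1 ?addr0 ?add0r.
Qed.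

Variables (F : fieldType) (iota : {rmorphism fps k -> F}) (Fr : is_frac iota).
Variable T0 : iota (T1 k N) != 0.
Let DD := thdata_of N0 nz2 Fr T0.

Lemma Xf_xser c : c != 0 -> c != 1 -> Xf DD c 0 = iota (xser c).
Proof.
move=> c0 c1; have m1 : (-1 : k) != 0 by rewrite oppr_eq0 oner_eq0.
have Uc := tau_unit c0 c1; have U1 := tau_unit m1 N1ne1.
have U : tau c ^+ 2 * tau (-1) ^+ 2 \is a GRing.unit by rewrite unitrM !unitrX.
have nz (u : fps k) : u \is a GRing.unit -> iota u != 0.
  by move=> Uu; rewrite (iota_eq0 Fr); apply: contraTneq Uu => ->; rewrite unitr0.
have X0 : iota (fpsX (N ^ 2)%N) != 0 by rewrite (iota_eq0 Fr) fpsX_neq0.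
have E : iota (xser c) * (iota (tau c) ^+ 2 * iota (tau (-1)) ^+ 2) = iota tau1 ^+ 2 * iota (tau (- c)) ^+ 2.
  by rewrite -!(rmorphXn iota) -!(rmorphM iota) /xser mulrVK.
rewrite /Xf /th2 -[tt DD _ _]/(iota (th N _ _)) -[tt DD c 0]/(iota (th N c 0)) -[tt DD (-1) 0]/(iota (th N (-1) 0)).
rewrite -[TT DD]/(iota (T1 k N)) /th /T1 !twE !(rmorphM iota (fpsX (N ^ 2)%N)).
apply: (mulIf (mulf_neq0 (expf_neq0 2 (nz _ Uc)) (expf_neq0 2 (nz _ U1)))); rewrite E; field.
by rewrite X0 !nz.
Qed.

(** The coefficients of S^(2 M) and S^(4 M) are both 6 in [A0] and in [B0], so they agree in every
    linear combination, while in the sum over the p-torsion they differ by 4 p. *)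
Lemma qexp_contra p (eta : k) c1 c2 : p.-primitive_root eta -> odd p -> (p%:R : k) != 0 -> (1 < p)%N ->
  \sum_(1 <= i < p) Xf DD (eta ^+ i) 0 <> iota (fpsC c1 * A0 k N + fpsC c2 * B0 k N).
Proof.
move=> etaP op p0 p1.
have e0 : eta != 0.
  by apply: contra_eq_neq (prim_expr_order etaP) => ->; rewrite expr0n gtn_eqF ?(ltnW p1) // eq_sym oner_eq0.
rewrite (eq_big_nat _ _ (F2 := fun i => iota (xser (eta ^+ i)))) => [|i /andP[i0 ip]]; last first.
  by apply: Xf_xser; rewrite ?expf_neq0 // -(prim_order_dvd etaP) gtnNdvd.
rewrite -rmorph_sum => /(proj1 Fr) E.
have lt i : (i < 5)%N -> (M * i < 5 * M)%N by move=> li; rewrite mulnC ltn_pmul2r.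
have L i (j : nat) : (0 < j < p)%N -> (i < 5)%N -> fcoef (xser (eta ^+ j)) (M * i) =
   (pol2 ((1 + eta ^+ j) ^+ 2 / (4%:R * (1 - eta ^+ j) ^+ 2)) (eta ^+ j + (eta ^+ j)^-1 + 2%:R)
    (eta ^+ j + (eta ^+ j)^-1 + 2%:R * ((eta ^+ j) ^+ 2 + (eta ^+ j) ^- 2) - 2%:R))`_i.
  move=> /andP[j0 jp] li; rewrite xserP ?lt ?emb_coef ?expf_neq0 //.
  by rewrite -(prim_order_dvd etaP) gtnNdvd.
have [a1 a2 a4] : [/\ fcoef (A0 k N) (M * 1) = 2%:R, fcoef (A0 k N) (M * 2) = 6%:R & fcoef (A0 k N) (M * 4) = 6%:R].
  have [] := @theta4P (fun n : int => (- - 1) ^ n) 1.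
  - by [].
  - by rewrite opprK !exp1rz mulr1.
  - by rewrite opprK !exp1rz.
  - by rewrite expr1n.
  rewrite /A0 !fcoefCM /th mulr1 => -> -> ->; have n4 := nz4 nz2.
  by split; apply: (mulfI n4); rewrite mulVKf //; ring.
have [b1 b2 b4] : [/\ fcoef (B0 k N) (M * 1) = - 2%:R, fcoef (B0 k N) (M * 2) = 6%:R & fcoef (B0 k N) (M * 4) = 6%:R].
  have [] := @theta4P (fun n : int => (- 1) ^ n) (-1).
  - by [].
  - by rewrite expr1z exprN1 invrN1; ring.
  - by rewrite -invr_expz -exprnP sqrrN expr1n invr1.
  - by rewrite sqrrN expr1n.
  rewrite /B0 !fcoefCM /th => -> -> ->; have n4 := nz4 nz2.
  by split; apply: (mulfI n4); rewrite mulVKf //; ring.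
have gen (x u v : fps k) n : x = fpsC c1 * u + fpsC c2 * v -> fcoef x n = c1 * fcoef u n + c2 * fcoef v n.
  by move=> ->; rewrite fcoefD !fcoefCM.
have C i := gen _ _ _ (M * i)%N E.
have C4 := C 4%N; rewrite a4 b4 fcoef_sum in C4; have C2 := C 2%N; rewrite a2 b2 fcoef_sum in C2.
have S : \sum_(1 <= j < p) (2%:R * ((eta ^+ j) ^+ 2 + (eta ^+ j) ^- 2) - 4%:R) = 0.
  transitivity (\sum_(1 <= j < p) (fcoef (xser (eta ^+ j)) (M * 4) - fcoef (xser (eta ^+ j)) (M * 2))).
    rewrite !big_nat; apply: eq_bigr => j jp; rewrite !L // /pol2 !coefD !coefCM !coefC !coefXn /=.
    by rewrite !mulr0 !mulr1 !addr0 !add0r; ring.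
  by rewrite sumrB C4 C2 subrr.
have geo (x : k) : x ^+ p = 1 -> x != 1 -> \sum_(1 <= j < p) x ^+ j = -1.
  move=> xp x1; have : (x - 1) * \sum_(i < p) x ^+ i = 0 by rewrite -subrX1 xp subrr.
  move/eqP; rewrite mulf_eq0 subr_eq0 (negPf x1) /= -(big_mkord xpredT (fun i => x ^+ i)) big_ltn ?(ltnW p1) //.
  by rewrite expr0 addrC addr_eq0 => /eqP.
have e2 : eta ^+ 2 != 1.
  rewrite -(prim_order_dvd etaP); apply/negP => /(dvdn_leq (isT : (0 < 2)%N)) le.
  by have := op; have -> : p = 2 by lia.
have ep : (eta ^+ 2) ^+ p = 1 by rewrite exprAC (prim_expr_order etaP) expr1n.
have S2 : \sum_(1 <= j < p) (eta ^+ j) ^+ 2 = -1.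
  by rewrite -(geo _ ep e2); apply: eq_bigr => j _; rewrite exprAC.
have S3 : \sum_(1 <= j < p) (eta ^+ j) ^- 2 = -1.
  rewrite -(geo (eta ^- 2)) ?invr_eq1 ?exprVn ?ep ?invr1 //.
  by apply: eq_bigr => j _; rewrite exprAC exprVn.
move: S; rewrite sumrB -mulr_sumr big_split /= S2 S3 sumr_const_nat -[_ *+ (p - 1)]mulr_natl natrB ?(ltnW p1) // => /eqP.
rewrite (_ : _ - _ = - (2%:R * 2%:R * p%:R)); last by ring.
by rewrite oppr_eq0 !mulf_eq0 (negPf nz2) (negPf p0).
Qed.
End QExp.

End QExpansion.

(** * Shears and Weyl elements among the relation-preserving maps *)

Module TorsionTwist.
Import DivisionPolynomials TorsionPoints GaloisAction Uniformity.

HB.saturate prod.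

(** The p-component of 1 in Z/N. The ideal it generates is a copy of F_p, which the last clause
    expresses through inverses relative to e. *)
Lemma Zp_idem N p : (1 < N)%N -> prime p -> (p %| N)%N -> coprime p (N %/ p) ->
  exists e : 'Z_N, [/\ e * e = e, p%:R * e = 0, (forall x, p%:R * x = 0 -> e * x = x) &
   (forall C, e * C = C -> C != 0 -> exists C', e * C' = C' /\ C * C' = e)].
Proof.
move=> N1 pp pN cop; have p0 := prime_gt0 pp; set m := (N %/ p)%N in cop.
have Em : (p * m)%N = N by rewrite mulnC divnK.
have Nz (x : nat) : (N %| x)%N -> (x%:R : 'Z_N) = 0 by move=> d; apply/eqP; rewrite Zp_nat_eq0.
have inv (c : nat) : coprime p c -> exists u z, (c * u = z * p + 1)%N.
  move=> cc; have c0 : (0 < c)%N.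
    by case: c cc => //; rewrite /coprime gcdn0 => /eqP E; rewrite E in pp.
  by have [u v E _] := egcdnP p c0; exists u, v; rewrite mulnC E gcdnC (eqP cc).
have [u [z Eu]] := inv m cop.
have eM (x : 'Z_N) : p%:R * x = 0 -> (m * u)%:R * x = x.
  move=> px; rewrite Eu natrD natrM mulrDl mul1r -mulrA px mulr0 add0r //.
have pe : p%:R * (m * u)%:R = 0 :> 'Z_N by rewrite -natrM; apply: Nz; rewrite mulnA Em dvdn_mulr.
exists (m * u)%:R; split=> //; first exact: eM.
move=> C eC C0; have cC : coprime p C.
  rewrite prime_coprime //; apply: contra C0 => /dvdnP[q Eq].
  have -> : C = (m * u)%:R * (q%:R * p%:R) by rewrite -natrM -Eq natr_Zp eC.
  by rewrite mulrCA [_ * p%:R]mulrC pe mulr0.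
have [c [y Ec]] := inv C cC; exists ((m * u)%:R * c%:R); split; first by rewrite mulrA eM.
have EC : C * c%:R = y%:R * p%:R + 1 by rewrite -{1}[C]natr_Zp -natrM Ec natrD natrM.
by rewrite mulrCA EC mulrDr mulr1 mulrCA [_ * p%:R]mulrC pe mulr0 add0r.
Qed.

Section TW.
Variables (k F : fieldType) (N ell : nat).
Notation V := (('Z_N * 'Z_N)%type : finZmodType).

Definition Ush (t : 'Z_N) (v : V) : V := (v.1 + t * v.2, v.2).
(** The nontrivial p-th roots of unity on the Tate curve: the parameter u = zeta^i involves no power
    of S. *)
Definition mup (p : nat) : {set V} := [set v : V | [&& v != 0, v.2 == 0 & p%:R * v.1 == 0]].

(** The facts about the torsion of the Tate curve on which the group-theoretic part rests. [tsig]
    abstracts S -> xi S extended to fractions, [tD] the derivation S d/dS, and [tmu] the obstruction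
    read from q-expansions. *)
Record TW := MkTW {
  tc : {rmorphism k -> F}; om : k; ta : F; tb : F; tX : V -> F; tY : V -> F;
  tN1 : (1 < N)%N; toddN : odd N; tkN : (N%:R : k) != 0; tk2 : (2%:R : k) != 0;
  tl3 : (3 < ell)%N; toddl : odd ell; tchl : ell%:R = 0 :> k; tomP : (ell.-1).-primitive_root om;
  tX0 : tX 0 = 0; tY0 : tY 0 = 0; tXN : forall v : V, tX (- v) = tX v; tYN : forall v : V, tY (- v) = - tY v;
  tYn0 : forall v : V, v != 0 -> tY v != 0;
  tYsq : forall v : V, tY v ^+ 2 = 4%:R * (tX v * (tX v - ta) * (tX v - tb));
  tXeq : forall v w : V, v != 0 -> w != 0 -> tX v = tX w -> v = w \/ v = - w;
  tGt : exists Gt, hpol tc ta tb (dd N) N%:R Gt /\ forall v : V, v != 0 -> Gt.[tX v] = 0;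
  thasse : hom tc ta tb ell.-1./2 1;
  ta0 : ta != 0; tb0 : tb != 0; tab : ta != tb;
  tXadd : forall v w : V, v != 0 -> w != 0 -> v - w != 0 -> v + w != 0 ->
    (tX v - tX w) ^+ 2 * (tX (v - w) - tX (v + w)) = tY v * tY w /\
    ta * (tX v - tX w) ^+ 2 * (tX (v + w) + tX (v - w)) =
    (ta * tb - tX v * tX w) ^+ 2 + ta ^+ 2 * (tX v - tX w) ^+ 2 -
    (ta * (tX v + tX w) - ta * tb - tX v * tX w) ^+ 2;
  tXdbl : forall v : V, v != 0 ->
    tX (v + v) * tY v ^+ 2 = (tX v ^+ 2 - ta * tb) ^+ 2 /\
    tY (v + v) * tY v ^+ 3 = 2%:R * (tX v ^+ 2 - ta * tb) *
      (tX v ^+ 2 - 2%:R * ta * tX v + ta * tb) * (tX v ^+ 2 - 2%:R * tb * tX v + ta * tb);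
  ttrans : forall p, p != 0 -> evl tc (tb / ta) p != 0;
  ttrans' : forall p, p != 0 -> evl tc (ta / tb) p != 0;
  tsig : {rmorphism F -> F};
  tsigc : forall c, tsig (tc c) = tc c; tsiga : tsig ta = ta; tsigb : tsig tb = tb;
  tsigX : forall v, tsig (tX v) = tX (Ush 1 v); tsigY : forall v, tsig (tY v) = tY (Ush 1 v);
  tD : F -> F;
  tDD : forall x y, tD (x + y) = tD x + tD y;
  tDM : forall x y, tD (x * y) = tD x * y + x * tD y;
  tDC : forall c, tD (tc c) = 0;
  tDab : tb * tD ta - ta * tD tb = tc (16 * N ^ 2)%:R * (ta * tb * (ta - tb));
  tmu : forall p c1 c2, prime p -> (p %| N)%N -> \sum_(v in mup p) tX v <> tc c1 * ta + tc c2 * tb }.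

Variable T : TW.
Notation c := (tc T).
Notation a := (ta T).
Notation b := (tb T).
Notation X := (tX T).
Notation Y := (tY T).
Notation e0 := (e0 a b X Y).
Notation kap := (kap c (om T)).

Lemma tcardV : #|V| = (N * N)%N.
Proof. by rewrite card_prod !card_ord Zp_cast // (tN1 T). Qed.
Lemma tV2 (v : V) : v + v = 0 -> v = 0.
Proof.
have U : (2%:R : 'Z_N) \is a GRing.unit by rewrite unitZpE ?(tN1 T) // coprimen2 (toddN T).
have H (z : 'Z_N) : z + z = 0 -> z = 0.
  by move=> E; apply: (mulrI U); rewrite mulr0 mulr_natl mulr2n.
case: v => x y E; have E1 := congr1 fst E; have E2 := congr1 snd E.
by have /= -> := H _ E1; have /= -> := H _ E2.
Qed.

Definition Rl i (f : V -> V) := Rel c (om T) a b X Y i f.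

Lemma Rl_comp i f j g : Rl i f -> Rl j g -> Rl (i + j) (f \o g).
Proof. by move=> h h'; apply: Rel_comp. Qed.
Lemma Rl_tr i f P : Rl i f -> pf c P -> P e0 = 0 -> P (act (kap i) f e0) = 0.
Proof.
exact: (Rel_tr (tN1 T) (toddN T) (tkN T) (tk2 T) (tl3 T) (toddl T) (tomP T) tcardV (tY0 T) (@tYN T) (@tYn0 T) (@tXeq T)).
Qed.
Lemma Rl_inv i f : Rl i f -> exists j g, [/\ Rl j g, cancel f g, cancel g f & kap (i + j) = 1].
Proof.
exact: (Rel_inv (tN1 T) (toddN T) (tkN T) (tk2 T) (tl3 T) (toddl T) (tomP T) tcardV (tY0 T) (@tYN T) (@tYn0 T) (@tXeq T)).
Qed.
Lemma Rl_inj i f : Rl i f -> injective f.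
Proof. exact: (Rel_inj (tk2 T) (tY0 T) (@tYN T) (@tYn0 T) (@tXeq T)). Qed.
Lemma RlD i f : Rl i f -> forall v w : V, f (v + w) = f v + f w.
Proof.
exact: (RelD (tN1 T) (toddN T) (tkN T) (tk2 T) (tl3 T) (toddl T) (tomP T) tcardV tV2 (tY0 T)
  (@tXN T) (@tYN T) (@tYn0 T) (@tXeq T) (ta0 T) (@tXadd T) (@tXdbl T)).
Qed.
Lemma Rl_kap i j f : kap i = kap j -> Rl i f -> Rl j f.
Proof. by rewrite /Rl /Rel => ->. Qed.
Lemma Rl_f0 i f : Rl i f -> f 0 = 0.
Proof. by move=> h; apply: (@addrI _ (f 0)); rewrite -(RlD h) !addr0. Qed.
Lemma RlMn i f : Rl i f -> forall (v : V) n, f (v *+ n) = f v *+ n.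
Proof. by move=> h v; elim=> [|n IH]; rewrite ?mulr0n ?(Rl_f0 h) // !mulrS (RlD h) IH. Qed.

Lemma kap0 : kap 0 = 1. Proof. by rewrite /kap expr0 rmorph1. Qed.

(** Relations have coefficients in k, which the field morphism [tsig] fixes, while it moves the
    points by the shear. *)
Lemma G1_sig : Rl 0 (Ush 1).
Proof.
move=> P hP; rewrite kap0 => E; apply: (fmorph_inj (tsig T)); rewrite rmorph0 -E => {E}.
elim: hP => {P} [d|||v|v|P Q _ h _ h'|P Q _ h _ h'] /=.
- exact: tsigc.
- by rewrite tsiga expr1n mul1r.
- by rewrite tsigb expr1n mul1r.
- by rewrite tsigX expr1n mul1r.
- by rewrite tsigY expr1n mul1r.
- by rewrite rmorphD h h'.
- by rewrite rmorphM h h'.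
Qed.

Lemma G1_U t : Rl 0 (Ush t).
Proof.
have H n : Rl 0 (Ush n%:R).
  elim: n => [|n IH].
    rewrite (_ : Ush 0%:R = id); first exact: Rel_id.
    by apply: funext => -[x y]; rewrite /Ush mul0r addr0.
  have := Rl_comp G1_sig IH; congr (Rl _ _); apply: funext => -[x y].
  by rewrite /Ush /= mul1r -addrA -[n.+1]addn1 natrD mulrDl mul1r.
by rewrite -[t]natr_Zp.
Qed.

Section AtP.
Variables (p : nat) (e : 'Z_N).
Hypotheses (pp : prime p) (pN : (p %| N)%N).
Hypothesis ee : e * e = e.
Hypothesis pe : p%:R * e = 0.
Hypothesis ep : forall x, p%:R * x = 0 -> e * x = x.
Hypothesis eI : forall C, e * C = C -> C != 0 -> exists C', e * C' = C' /\ C * C' = e.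

Lemma MnE (x y z : 'Z_N) : (x, y) *+ z = (z * x, z * y) :> V.
Proof.
have H (u : 'Z_N) n : u *+ n = n%:R * u by rewrite mulr_natl.
by rewrite -[in RHS](natr_Zp z) -!H; elim: (z : nat) => // n IH; rewrite !mulrS IH.
Qed.

(** Otherwise every relation-preserving map stabilises [mup p], and [fixed_linear] contradicts
    [tmu]. *)
Lemma moves : exists i f, Rl i f /\ (f (e, 0)).2 != 0.
Proof.
apply: contrapT => nx.
have H i f : Rl i f -> (f (e, 0)).2 = 0.
  by move=> h; apply/eqP; apply: contrapT => /negP ne; apply: nx; exists i, f.
have M0 : (0 : V) \notin mup p by rewrite inE eqxx.
have [|c1 [c2]] := @fixed_linear k F c N ell (om T) (tN1 T) (toddN T) (tkN T) (tk2 T) (tl3 T) (toddl T) (tchl T)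
   (tomP T) _ tcardV tV2 a b X Y (tX0 T) (tY0 T) (@tXN T) (@tYN T) (@tYn0 T) (@tYsq T) (@tXeq T) _
   (projT2 (cid (tGt T))).1 (projT2 (cid (tGt T))).2 (thasse T) (ta0 T) (tb0 T) (@ttrans T) (@ttrans' T) (mup p) M0.
  move=> i f _ rf; apply/eqP; rewrite eqEcard card_imset ?leqnn ?andbT; last exact: Rl_inj rf.
  apply/subsetP => w /imsetP[[x y]]; rewrite inE => /and3P[v0 /= /eqP y0 /eqP px] ->; subst y.
  have Ev : (x, 0) = (e, 0) *+ x :> V by rewrite MnE mulr0 [x * e]mulrC ep.
  rewrite inE; apply/and3P; split.
  - by apply: contra v0 => /eqP E; apply/eqP/(Rl_inj rf); rewrite E (Rl_f0 rf).
  - rewrite Ev (RlMn rf) (surjective_pairing (f (e, 0))) MnE /= (H i f) // mulr0 //.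
  - have : f (x, 0) *+ p = 0.
      rewrite -(RlMn rf) (_ : (x, 0) *+ p = 0) ?(Rl_f0 rf) //.
      have E n : (x, 0) *+ n = (n%:R * x, 0) :> V.
        elim: n => [|n IH]; first by rewrite mulr0n mul0r.
        by rewrite mulrS IH -[n.+1]add1n natrD mulrDl mul1r; congr pair; rewrite addr0.
      by rewrite E px.
    have F1 (n : nat) (u : V) : (u *+ n).1 = u.1 *+ n by elim: n => // n IH; rewrite !mulrS -IH.
    by move/(congr1 fst); rewrite F1 => E; rewrite mulr_natl E.
exact: tmu.
Qed.

Definition Low (t : 'Z_N) (v : V) : V := (v.1, v.2 + t * v.1).
(** The Weyl element (x, y) -> (y, - x) on the component of e and the identity elsewhere. *)
Definition Se (v : V) : V := ((1 - e) * v.1 + e * v.2, (1 - e) * v.2 - e * v.1).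

(* Conjugating the translations [Ush] by an automorphism that moves the line of [(e, 0)]
   gives transvections along another line, and a further conjugation by [Ush] makes it the
   line of [(0, e)]. *)
Lemma G1_low : Rl 0 (Low (- e)).
Proof.
have [i [f [rf ne]]] := moves; have [j [h [rh fh hf kij]]] := Rl_inv rf.
set A := (f (e, 0)).1; set C := (f (e, 0)).2 in ne; have fe : f (e, 0) = (A, C) by exact: surjective_pairing.
have fx x : f (x * e, 0) = (x * A, x * C) :> V.
  by rewrite -(MnE A C x) -fe -(RlMn rf) MnE mulr0.
have [eA eC] : e * A = A /\ e * C = C.
  have E := fx e; rewrite ee in E.
  by split; symmetry; [exact: (congr1 fst E)|exact: (congr1 snd E)].
have [C' [eC' CC]] := eI eC ne.
pose al := (h (1, 0)).2; pose be := (h (0, 1)).2.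
have hy (v : V) : (h v).2 = al * v.1 + be * v.2.
  have -> : v = (1, 0) *+ v.1 + (0, 1) *+ v.2.
    by rewrite !MnE; case: v => x y /=; congr pair; rewrite ?mulr1 ?mulr0 ?addr0 ?add0r.
  rewrite (RlD rh) !(RlMn rh) (surjective_pairing (h (1, 0))) (surjective_pairing (h (0, 1))) !MnE /=.
  by rewrite !mulr1 !mulr0 !addr0 !add0r mulrC [_ * be]mulrC -/al -/be.
have yW : al * A + be * C = 0 by have := hy (A, C); rewrite -fe fh /= fe /= => <-.
have eb : e * be = - (al * A * C').
  have : (al * A + be * C) * C' = 0 by rewrite yW mul0r.
  rewrite mulrDl -[be * C * C']mulrA CC => /eqP; rewrite addrC addr_eq0 => /eqP <-.
  by rewrite mulrC.
pose w := f (0, 1); pose g := e * w.1 - A * C' * w.2.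
have ag : al * g = e.
  have : al * w.1 + be * w.2 = 1 by rewrite -hy /w fh.
  move/(congr1 (fun z => e * z)); rewrite mulr1 mulrDr mulrA [e * (be * _)]mulrA eb => E.
  by rewrite -[RHS]E /g; ring.
pose s := - (g * C').
have R1 : Rl 0 (f \o Ush (s * e) \o h).
  have := Rl_comp (Rl_comp rf (@G1_U (s * e))) rh; apply: Rl_kap.
  by rewrite addn0 kij kap0.
have R2 := Rl_comp (Rl_comp (@G1_U (- (A * C'))) R1) (@G1_U (A * C')).
move: R2; rewrite !addn0; congr (Rl _ _); apply: funext => v.
rewrite /= /Ush /Low; set u : V := (v.1 + A * C' * v.2, v.2).
have -> : ((h u).1 + s * e * (h u).2, (h u).2) = h u + (s * (h u).2 * e, 0) :> V.
  case: (h u) => x1 x2 /=; congr pair; last by rewrite addr0.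
  by rewrite -mulrA [e * x2]mulrC mulrA.
rewrite (RlD rf) hf fx // hy /u /=.
have K : e * (al * (v.1 + A * C' * v.2) + be * v.2) = al * e * v.1.
  rewrite mulrDr [e * (be * _)]mulrA eb -{1}eA; rewrite -[X in _ = X]addr0.
  have -> : e * (al * (v.1 + e * A * C' * v.2)) = al * e * v.1 + al * (e * e * A) * C' * v.2 by ring.
  by rewrite ee eA; ring.
set y := al * _ + _ in K *.
have yA : y * A = al * e * v.1 * A by rewrite -K -{1}eA; ring.
have yC : y * C = al * e * v.1 * C by rewrite -K -{1}eC; ring.
rewrite -!mulrA [y * A]yA [y * C]yC; congr pair.
  transitivity (v.1 + s * al * e * v.1 * (A - A * (C * C'))); first by ring.
  by rewrite CC [A * e]mulrC eA subrr mulr0 addr0.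
transitivity (v.2 - (al * g) * (C * C') * e * v.1); first by rewrite /s; ring.
by rewrite ag CC !ee mulNr.
Qed.

(** The factorisation of the Weyl element into upper, lower and upper unipotents, on the component
    of e. *)
Lemma G1_S : Rl 0 Se.
Proof.
have := Rl_comp (Rl_comp (@G1_U e) G1_low) (@G1_U e); rewrite !addn0; congr (Rl _ _).
apply: funext => v; rewrite /= /Ush /Low /Se /=; congr pair.
  transitivity ((1 - e * e) * v.1 + (2%:R * e - e * e * e) * v.2); first by ring.
  by rewrite !ee; ring.
by transitivity ((1 - e * e) * v.2 - e * v.1); [ring|rewrite ee; ring].
Qed.
End AtP.

Lemma ef_act f : ef a b X Y f = act 1 f e0.
Proof. by rewrite /ef /act /= !expr1n !mul1r; congr Env; apply: funext => v; rewrite mul1r. Qed.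

Lemma Rl_Gtr f P : Rl 0 f -> pf c P -> P (ef a b X Y id) = 0 <-> P (ef a b X Y f) = 0.
Proof.
move=> h hP; rewrite -[ef a b X Y id]/e0 (ef_act f) -kap0; split; first exact: (Rl_tr h hP).
exact: (h P hP).
Qed.

Notation rfT := (@rf k F c V).
Lemma rfT_zero P f : rfT P -> Rl 0 f -> P (ef a b X Y id) = 0 -> P (ef a b X Y f) = 0.
Proof. exact: (@rf_zero k F c V a b X Y (Rl 0) (@Rel_id _ _ c (om T) _ a b X Y) Rl_Gtr P f). Qed.

Lemma F2T : (2%:R : F) != 0.
Proof. by rewrite -(rmorph_nat c) fmorph_eq0 (tk2 T). Qed.

(* Differentiating [1 = a ^ n p(b / a)] expresses [D a] rationally. *)
Lemma D_ab : exists Ra Rb, [/\ rfT Ra, rfT Rb, (forall f, Ra (ef a b X Y f) = tD T a) &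
  (forall f, Rb (ef a b X Y f) = tD T b)].
Proof.
have [p [_ Ep]] := hom_poly (ta0 T) (thasse T).
set n := ell.-1./2 in Ep; set l := b / a in Ep.
have D1 : tD T 1 = 0 by rewrite -(rmorph1 c) tDC.
have D0 : tD T 0 = 0 by have := tDC T 0; rewrite rmorph0.
have Dab := tDab T; have a0 := ta0 T; have b0 := tb0 T.
have DXn x m : tD T (x ^+ m) = m%:R * x ^+ m.-1 * tD T x := DX (@tDM T) (@tDC T) x m.
have Dl : tD T l = - (c (16 * N ^ 2)%:R * (b * (a - b)) / a).
  have Ea : l * a = b by rewrite divfK.
  have := congr1 (tD T) Ea; rewrite tDM => E.
  apply: (mulIf a0); apply: (mulfI a0); transitivity (a * tD T b - a * (l * tD T a)); first by rewrite -E; ring.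
  rewrite mulrA [a * l]mulrC Ea -opprB Dab; field.
  exact: a0.
have Dpol (q : {poly k}) x : tD T (map_poly c q).[x] = (map_poly c q^`()).[x] * tD T x.
  rewrite (@horner_coef_wide _ (size q)) ?(leq_trans (size_poly _ _)) //.
  rewrite (Dsum (@tDD T) (@tDC T)) (@horner_coef_wide _ (size q).-1); last first.
    by rewrite (leq_trans (size_poly _ _)) // size_poly.
  rewrite mulr_suml; case: (size q) => [|m] /=; first by rewrite !big_ord0.
  rewrite big_ord_recl expr0 mulr1 coef_map tDC add0r; apply: eq_bigr => i _.
  rewrite !coef_map lift0 tDM tDC mul0r add0r DXn /= coef_deriv rmorphMn /= -[c _ *+ _]mulr_natr.
  by ring.
have n0 : (n%:R : F) != 0.
  rewrite -(rmorph_nat c) fmorph_eq0; apply/negP => /eqP n0.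
  have : (2 * n).+1 = ell by rewrite /n; have := tl3 T; have := toddl T; lia.
  move/(congr1 (fun m => m%:R : k)); rewrite (tchl T) -natr1 natrM n0 mulr0 add0r => /eqP.
  by rewrite oner_eq0.
have Da : tD T a = a ^+ n.+1 * (map_poly c p^`()).[l] * (c (16 * N ^ 2)%:R * (b * (a - b)) / a) / n%:R.
  have := congr1 (tD T) Ep; rewrite D1 tDM DXn Dpol Dl => /eqP; rewrite eq_sym addr_eq0 => /eqP E.
  have an : a ^+ n = a * a ^+ n.-1 by rewrite -exprS prednK // /n; have := tl3 T; lia.
  apply: (mulfI n0).
  transitivity (a * (n%:R * a ^+ n.-1 * tD T a * (map_poly c p).[l])).
    transitivity (n%:R * tD T a * (a ^+ n * (map_poly c p).[l])); first by rewrite -Ep mulr1.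
    by rewrite an; ring.
  rewrite E exprS; field.
  by rewrite a0 n0.
have ra : rfT (@eA F V) by apply/rf_pf/pf_a.
have rb : rfT (@eB F V) by apply/rf_pf/pf_b.
have rl : rfT (fun e => eB e / eA e) by apply: rfM => //; apply: rfV.
pose Ra (e : env F V) := eA e ^+ n.+1 * (\sum_(i < size p^`()) c p^`()`_i * (eB e / eA e) ^+ i) *
   (c (16 * N ^ 2)%:R * (eB e * (eA e - eB e)) / eA e) / n%:R.
have hRa : rfT Ra.
  have h1 : rfT (fun e => \sum_(i < size p^`()) c p^`()`_i * (eB e / eA e) ^+ i).
    by apply: rf_sum => i; apply: rfM; [exact: rfC|exact: rfXn].
  apply: rfM; last exact/rfV/rf_nat.
  apply: rfM; first by apply: rfM => //; apply: rfXn.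
  apply: rfM; last exact: rfV.
  by apply: rfM; [exact: rfC|apply: rfM => //; apply: rfB].
have ERa f : Ra (ef a b X Y f) = tD T a.
  rewrite Da /Ra /=; congr (_ * _ * _ / _).
  rewrite (@horner_coef_wide _ (size p^`())) ?size_map_poly //.
  by apply: eq_bigr => i _; rewrite coef_map.
exists Ra, (fun e => (eB e * Ra e - c (16 * N ^ 2)%:R * (eA e * eB e * (eA e - eB e))) / eA e); split=> //.
  apply: rfM; last exact: rfV.
  apply: rfB; first exact: rfM.
  by apply: rfM; [exact: rfC|repeat first [apply: rfM|apply: rfB|assumption]].
move=> f; rewrite ERa /= -Dab; field.
exact: a0.
Qed.

Lemma rfT_D P : rfT P -> exists Q, rfT Q /\ forall f, Rl 0 f -> Q (ef a b X Y f) = tD T (P (ef a b X Y f)).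
Proof.
have [Ra [Rb [hRa hRb ERa ERb]]] := D_ab; have [Gt [hG rG]] := tGt T.
have sG (v : V) : v != 0 -> Gt^`().[X v] != 0.
  move=> v0; have := Gt_prod (tN1 T) (toddN T) (tkN T) (tk2 T) (tl3 T) (toddl T) (tomP T) tcardV tV2 (@tXeq T) hG rG.
  move=> ->.
  have Nn : (N%:R : F) != 0 by rewrite -(rmorph_nat c) fmorph_eq0 (tkN T).
  apply: Gt_separable => //.
    rewrite map_inj_in_uniq ?enum_uniq // => x y; rewrite !mem_enum; apply: (X_H_inj tV2 (@tXeq T)).
  have [vH|vH] := boolP (v \in H V); first exact: image_f.
  by rewrite -(tXN T v); apply: image_f; rewrite (H_opp tV2).
have Gn0 f (v : V) : Rl 0 f -> v != 0 -> f v != 0.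
  by move=> rf; apply: contra => /eqP E; apply/eqP/(Rl_inj rf); rewrite E (Rl_f0 rf).
exact: (rf_Dclosed (G := Rl 0) (@tDD T) (@tDM T) (@tDC T) F2T hRa hRb ERa ERb (tX0 T) (tY0 T) (@tYn0 T) (@tYsq T)
  (@Rl_f0 0) Gn0 hG rG sG).
Qed.
End TW.

End TorsionTwist.

(** * The Tate curve satisfies the abstract hypotheses *)

Module TateTorsion.
Import PowerSeries FormalSums Theta TripleProduct ProductFormula ThetaIdentities TateCurve DivisionPolynomials Hasse TorsionPoints GaloisAction Uniformity QExpansion TorsionTwist.

HB.saturate prod.

(** L = B / A is transcendental over k: it has constant term 1 but is not 1, so writing p = (X -
    1)^m q with q(1) nonzero makes p(L) a product of nonzero series. *)
Lemma trans_gen (k F : fieldType) (iota : {rmorphism fps k -> F}) (A B : fps k) p : is_frac iota ->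
  fcoef A 0 != 0 -> fcoef B 0 = fcoef A 0 -> A != B -> p != 0 ->
  evl (iota \o @fpsC k) (iota B / iota A) p != 0.
Proof.
move=> Fr A0 BA AB p0; have UA : A \is a GRing.unit by apply: fps_unitE; rewrite unitfE.
pose L := B / A; have EL : iota B / iota A = iota L.
  have nA : iota A != 0 by rewrite (iota_eq0 Fr); apply: contraNneq A0 => ->.
  by apply: (mulIf nA); rewrite divfK // -rmorphM /L mulrVK.
rewrite {}EL.
have L0 : ev0 L = 1.
  have : ev0 L * ev0 A = ev0 B by rewrite -(rmorphM (@ev0 k)) /L mulrVK.
  by rewrite [ev0 B]BA -[X in _ = X]mul1r => /(mulIf A0).
have L1 : L - 1 != 0.
  by apply: contraNneq AB => /eqP; rewrite subr_eq0 => /eqP E; rewrite -[B](mulrVK UA) -/L E mul1r.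
have Ev (q : {poly k}) : evl (iota \o @fpsC k) (iota L) q = iota (map_poly (@fpsC k) q).[L].
  by rewrite /evl map_poly_comp horner_map.
have [m [q /implyP/(_ p0) rq Ep]] := multiplicity_XsubC p 1.
rewrite Ev (iota_eq0 Fr) Ep rmorphM rmorphXn rmorphB /= map_polyX map_polyC /= hornerM horner_exp hornerXsubC.
rewrite rmorph1 mulf_neq0 ?expf_neq0 //; apply: contra rq => /eqP E.
have := congr1 (@ev0 k) E; rewrite -(horner_map (@ev0 k)) /= L0 -map_poly_comp rmorph0.
rewrite (_ : map_poly _ q = q) => [/eqP//|]; last by apply: map_poly_id => x.
Qed.

Section Conc.
Variable k : fieldType.
Variable ell : nat.
Hypothesis pl : prime ell.
Hypothesis l3 : (3 < ell)%N.
Hypothesis chl : ell \in [pchar k].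
Variable N : nat.
Hypothesis N1 : (1 < N)%N.
Hypothesis cN6 : coprime N 6.
Hypothesis kN : (N%:R : k) != 0.
Variables (xi om : k).
Hypothesis xiP : (N ^ 2).-primitive_root xi.
Hypothesis omP : (ell.-1).-primitive_root om.
Variables (F : fieldType) (iota : {rmorphism fps k -> F}).
Hypothesis Fr : is_frac iota.

Notation V := ('Z_N * 'Z_N)%type.
Definition cF : {rmorphism k -> F} := iota \o @fpsC k.
Notation W := (DD l3 chl N1 Fr).
Notation a := (al W).
Notation b := (be W).
Notation X := (Xp l3 chl N1 xi Fr).
Notation Y := (Yp l3 chl N1 xi Fr).
Notation N0 := (N0 N1).
Notation k2 := (k2 l3 chl).
Notation oddN := (oddN cN6).

Lemma oddl : odd ell. Proof. by case: (even_prime pl) l3 => [->|]. Qed.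
Lemma chl0 : ell%:R = 0 :> k. Proof. by case/andP: chl => _ /eqP. Qed.

Lemma al_iota : a = iota (A0 k N) /\ b = iota (B0 k N).
Proof.
have [] := @al_theta _ _ _ W N0 k2.
  rewrite /th2 /th3 /th4 -[TT W]/(iota (T1 k N)) -!rmorphM -rmorphN.
  by rewrite -(theta_T1 N0 k2) rmorphM rmorph_nat.
have Q : iota (fpsC 4%:R^-1) = 4%:R^-1.
  have H : 4%:R * iota (fpsC 4%:R^-1) = 1.
    by rewrite -(rmorph_nat iota) -(rmorph_nat (@fpsC k)) -!rmorphM mulfV ?(nz4 k2) // !rmorph1.
  have nz : (4%:R : F) != 0 by apply: contra_eq_neq H => ->; rewrite mul0r eq_sym oner_eq0.
  by apply: (mulfI nz); rewrite H mulfV.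
move=> -> ->; rewrite -[th3 W]/(iota (th N (-1) N%:Z)) -[th4 W]/(iota (th N 1 N%:Z)) /A0 /B0.
move: (th N (-1) N%:Z) (th N 1 N%:Z) => x y.
by split; rewrite (rmorphM iota) (rmorphXn iota) Q mulrC.
Qed.

Lemma hom_int_cst n x (u v : F) : hom (intr : {rmorphism int -> F}) u v n x -> hom cF u v n x.
Proof.
elim=> {n x} [n|c|||n x y _ h _ h'|m n x y _ h _ h'].
- exact: hom0.
- by have := homC cF u v (c%:~R); rewrite (rmorph_int cF).
- exact: homa.
- exact: homb.
- exact: homD.
- exact: homM.
Qed.

Lemma hasseF : hom cF a b ell.-1./2 1.
Proof.
have [-> ->] := al_iota; apply: hom_int_cst.
have := @hom_map _ _ _ _ (intr : {rmorphism int -> F}) iota _ _ _ _ _ (hasse N0 k2 pl (ltnW l3) chl).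
by rewrite rmorph1; apply=> c; rewrite rmorph_int.
Qed.

Lemma GtF : exists Gt, hpol cF a b (dd N) N%:R Gt /\ forall v : V, v != 0 -> Gt.[X v] = 0.
Proof.
have [G [[s e h] r]] := torsion_poly l3 chl N1 cN6 xiP Fr; exists G; split=> //.
by split=> // i le; apply/hom_int_cst/h.
Qed.

Lemma th_half0 (c : k) : c != 0 -> fcoef (th N c N%:Z) 0 = 1.
Proof.
move=> c0; have x0 : ex N N%:Z 0 = 0%N by apply/eqP; rewrite -eqz_nat exE; apply/eqP; ring.
rewrite -[X in fcoef _ X = _]x0 gs_coef_one //= => n; rewrite x0 => /eqP; rewrite -eqz_nat exE subrr addr0.
rewrite expf_eq0 /= !mulf_eq0 /= => /orP[|/eqP //].
by have := N0; case: N.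
Qed.

Lemma AB_ex : exists A B : fps k, [/\ a = iota A, b = iota B, fcoef A 0 = 4%:R^-1, fcoef B 0 = 4%:R^-1 &
  A != B /\ (B * fderiv A - A * fderiv B = (16 * N ^ 2)%:R * (A * B * (A - B)))].
Proof.
have m1 : (-1 : k) != 0 by rewrite oppr_eq0 oner_eq0.
have [ea eb] := al_iota; have eD := A0B0_deriv N0 k2.
have ab : a - b != 0.
  rewrite al_sub_be ?N0 ?k2 //.
  by rewrite !mulf_neq0 ?invr_eq0 ?mulf_neq0 ?expf_neq0 ?TT_neq0 ?th2_neq0 ?th3_neq0 ?th4_neq0 ?N0 ?k2.
exists (A0 k N), (B0 k N); split=> //.
- rewrite /A0; have := th_half0 m1; move: (th N _ _) => x Ex.
  by rewrite fcoefCM fcoefX0 Ex expr1n mulr1.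
- rewrite /B0; have := th_half0 (oner_neq0 k); move: (th N _ _) => x Ex.
  by rewrite fcoefCM fcoefX0 Ex expr1n mulr1.
split=> //; move: ea eb ab; move: (A0 k N) (B0 k N) => A B -> ->.
by rewrite subr_eq0 (iota_eq Fr).
Qed.

Lemma transF p : p != 0 -> evl cF (b / a) p != 0.
Proof.
have [A [B [-> -> A4 B4 [AB _]]]] := AB_ex => p0; apply: (trans_gen Fr _ _ AB p0); rewrite A4 ?B4 //.
by rewrite invr_eq0 (nz4 k2).
Qed.
Lemma transF' p : p != 0 -> evl cF (a / b) p != 0.
Proof.
have [A [B [-> -> A4 B4 [AB _]]]] := AB_ex => p0; rewrite eq_sym in AB.
by apply: (trans_gen Fr _ _ AB p0); rewrite B4 ?A4 // invr_eq0 (nz4 k2).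
Qed.

Lemma an0 : a != 0. Proof. exact: (al_neq0 W N0 k2). Qed.
Lemma bn0 : b != 0. Proof. exact: (be_neq0 W N0 k2). Qed.

Lemma cardV : #|{: V}| = (N * N)%N.
Proof. by rewrite card_prod !card_ord Zp_cast. Qed.
Lemma V2 (v : V) : v + v = 0 -> v = 0.
Proof. by move=> h; apply/eqP; apply: contraTT isT => /(dbl_neq0 N1 cN6); rewrite h eqxx. Qed.
Lemma XN (v : V) : X (- v) = X v. Proof. by have [] := XYpN l3 chl N1 cN6 xiP Fr v. Qed.
Lemma YN (v : V) : Y (- v) = - Y v. Proof. by have [] := XYpN l3 chl N1 cN6 xiP Fr v. Qed.

Notation Y0 := (Yp0 l3 chl N1 xi Fr).
Notation X0 := (Xp0 l3 chl N1 xi Fr).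
Notation Yn0 := (Yp_neq0 l3 chl N1 cN6 xiP Fr).
Notation Ysq := (Yp_sqr l3 chl N1 cN6 xiP Fr).
Notation Xeq := (Xp_eq (l3 := l3) (chl := chl) (N1 := N1) cN6 xiP (Fr := Fr)).

Lemma xi_neq0 : xi != 0.
Proof.
by apply: contra_eq_neq (prim_expr_order xiP) => ->; rewrite expr0n gtn_eqF ?expn_gt0 ?N0 // eq_sym oner_eq0.
Qed.

Lemma fscale_inj : injective (fscale xi : fps k -> fps k).
Proof.
move=> f g E; apply: fpsP => n; have /= := congr1 (fun h => fcoef h n) E.
by apply: mulfI; rewrite expf_neq0 // xi_neq0.
Qed.
Lemma sig_ex : exists s : {rmorphism F -> F}, forall x, s (iota x) = iota (fscale xi x).
Proof.
pose ph : {rmorphism fps k -> fps k} := fscale xi.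
have inj : injective ph := fscale_inj.
pose H1 := GRing.isZmodMorphism.Build _ _ (fracmap Fr ph) (fracmap_zmod Fr inj).
pose H2 := GRing.isMonoidMorphism.Build _ _ (fracmap Fr ph) (fracmap_monoid Fr inj).
pose s : {rmorphism F -> F} := HB.pack (fracmap Fr ph) H1 H2.
by exists (s inj inj) => x; exact: (fracmap_iota Fr inj).
Qed.
Definition sig : {rmorphism F -> F} := projT1 (cid sig_ex).
Lemma sigE x : sig (iota x) = iota (fscale xi x).
Proof. exact: (projT2 (cid sig_ex)). Qed.

Lemma xi_N2 (z : int) : xi ^ ((N ^ 2)%:Z * z) = 1.
Proof. by rewrite -exprz_exp -exprnP (prim_expr_order xiP) exp1rz. Qed.
Lemma xi_zeta (z : int) : xi ^ (8 * N%:Z * z) = zeta N xi ^ z.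
Proof. by rewrite -exprz_exp -PoszM -exprnP. Qed.

(** The exponents N^2 (2 n - 1)^2 are multiples of the order N^2 of xi. *)
Lemma fscale_ex0 (w : int -> k) : fscale xi (gs w (ex N 0)) = gs w (ex N 0).
Proof.
rewrite fscale_gs; apply: eq_gs => [n|//].
by rewrite exprnP ex0E xi_N2 mul1r.
Qed.
Lemma fscale_exN (w : int -> k) : fscale xi (gs w (ex N N%:Z)) = gs w (ex N N%:Z).
Proof.
rewrite fscale_gs; apply: eq_gs => [n|//].
by rewrite exprnP exE (_ : _ ^+ 2 = (N ^ 2)%:Z * (4 * n * n)) ?xi_N2 ?mul1r // -mulnn PoszM; ring.
Qed.

(** Modulo N^2 the exponent (2 N n + 2 j - N)^2 is 8 N j n plus a term free of n, so scaling S
    multiplies u by zeta^j, up to a factor that cancels in X and Y. *)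
Lemma fscale_th (c : k) (j : int) : c != 0 ->
  fscale xi (th N c (2 * j)) = fpsC (xi ^ ((2 * j - N%:Z) ^+ 2)) * th N (c * zeta N xi ^ j) (2 * j).
Proof.
move=> c0; rewrite /th fscale_gs -gsZ; apply: eq_gs => [n|//]; have x0 := xi_neq0.
have -> : - (c * zeta N xi ^ j) = (- c) * zeta N xi ^ j by rewrite mulNr.
rewrite exprnP exE expfzMl mulrCA [in RHS]mulrC -mulrA; congr (_ * _).
rewrite exprz_exp -xi_zeta -expfzDr //.
rewrite (_ : _ ^+ 2 = (N ^ 2)%:Z * (4 * n * n - 4 * n) + (8 * N%:Z * (j * n) + (2 * j - N%:Z) ^+ 2)).
  by rewrite [LHS]expfzDr // xi_N2 mul1r addrC.
by rewrite -mulnn PoszM; ring.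
Qed.

Lemma sigC c : sig (cF c) = cF c.
Proof.
rewrite -[cF c]/(iota (fpsC c)) sigE; apply: (congr1 iota); apply: fpsP => -[|n] /=; first by rewrite mul1r.
by rewrite mulr0.
Qed.
Lemma sig_tt (c : k) j : c != 0 -> sig (tt W c (2 * j)) = cF (xi ^ ((2 * j - N%:Z) ^+ 2)) * tt W (c * zeta N xi ^ j) (2 * j).
Proof. by move=> c0; rewrite -[tt W c _]/(iota (th N c (2 * j))) sigE fscale_th // rmorphM. Qed.
Lemma sig_T : sig (TT W) = TT W.
Proof. by rewrite -[TT W]/(iota (T1 k N)) sigE /T1 fscale_ex0. Qed.
Lemma sig_th2 : sig (th2 W) = th2 W.
Proof. by rewrite /th2 -[tt W _ _]/(iota (th N (-1) 0)) sigE /th fscale_ex0. Qed.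
Lemma sig_ab : sig a = a /\ sig b = b.
Proof.
have H3 : sig (th3 W) = th3 W by rewrite /th3 -[tt W _ _]/(iota (th N (-1) N%:Z)) sigE /th fscale_exN.
have H4 : sig (th4 W) = th4 W by rewrite /th4 -[tt W _ _]/(iota (th N 1 N%:Z)) sigE /th fscale_exN.
rewrite (beE W) (alE W); move: sig_T sig_th2 H3 H4; move: (TT W) (th2 W) (th3 W) (th4 W) => t x2 x3 x4 e e2 e3 e4.
have alg y z w : sig y = y -> sig z = z -> sig w = w -> sig (t ^+ 2 * y ^+ 2 / (z ^+ 2 * w ^+ 2)) = t ^+ 2 * y ^+ 2 / (z ^+ 2 * w ^+ 2).
  move=> ey ez ew; rewrite (rmorphM sig) (fmorphV sig) (rmorphM sig (t ^+ 2)) (rmorphM sig (z ^+ 2)).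
  by rewrite !(rmorphXn sig) e ey ez ew.
by split; apply: alg.
Qed.
Lemma sigX_alg (s : {rmorphism F -> F}) t x xm xc ym yc u : u != 0 -> s t = t -> s x = x ->
  s xm = u * ym -> s xc = u * yc ->
  s (t ^+ 2 * xm ^+ 2 / (xc ^+ 2 * x ^+ 2)) = t ^+ 2 * ym ^+ 2 / (yc ^+ 2 * x ^+ 2).
Proof.
move=> u0 et ex em ec; rewrite (rmorphM s) (fmorphV s) (rmorphM s (t ^+ 2)) (rmorphM s (xc ^+ 2)).
rewrite !(rmorphXn s) et ex em ec !exprMn (invfM (u ^+ 2 * _)) (invfM (u ^+ 2)) (invfM (yc ^+ 2)).
have -> : t ^+ 2 * (u ^+ 2 * ym ^+ 2) * (u ^- 2 * yc ^- 2 * x ^- 2) =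
  (u ^+ 2 * u ^- 2) * (t ^+ 2 * ym ^+ 2 * (yc ^- 2 * x ^- 2)) by ring.
by rewrite mulfV ?expf_neq0 // mul1r.
Qed.
Lemma sigY_alg (s : {rmorphism F -> F}) d z t x2 x1 y2 y1 u : u != 0 -> s d = d -> s t = t ->
  s x2 = z * u ^+ 4 * y2 -> s x1 = u * y1 ->
  s (d * x2 * t ^+ 3 / x1 ^+ 4) = d * z * y2 * t ^+ 3 / y1 ^+ 4.
Proof.
move=> u0 ed et e2 e1; rewrite (rmorphM s) (fmorphV s) (rmorphM s (d * x2)) (rmorphM s d).
rewrite !(rmorphXn s) et ed e1 e2 !exprMn (invfM (u ^+ 4)).
have -> : d * (z * u ^+ 4 * y2) * t ^+ 3 * (u ^- 4 * y1 ^- 4) =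
  (u ^+ 4 * u ^- 4) * (d * z * y2 * t ^+ 3 * y1 ^- 4) by ring.
by rewrite mulfV ?expf_neq0 // mul1r.
Qed.
Lemma sig_X (c : k) j : c != 0 -> sig (Xf W c (2 * j)) = Xf W (c * zeta N xi ^ j) (2 * j).
Proof.
move=> c0; have cN0 : - c != 0 by rewrite oppr_eq0.
have u0 : cF (xi ^ ((2 * j - N%:Z) ^+ 2)) != 0 by rewrite fmorph_eq0 expfz_neq0 // xi_neq0.
have E := sig_tt j cN0; rewrite mulNr in E.
exact: (sigX_alg u0 sig_T sig_th2 E (sig_tt j c0)).
Qed.
Lemma sig_Y (c : k) j : c != 0 -> sig (Yf W c (2 * j)) = Yf W (c * zeta N xi ^ j) (2 * j).
Proof.
move=> c0; have c20 : c ^+ 2 != 0 by rewrite expf_neq0.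
have E2 : (c * zeta N xi ^ j) ^+ 2 = c ^+ 2 * zeta N xi ^ (2 * j).
  by rewrite exprMn; congr (_ * _); rewrite -[(_ ^ j) ^+ 2]/((zeta N xi ^ j) ^ 2) exprz_exp mulrC.
pose u := cF (xi ^ ((2 * j - N%:Z) ^+ 2)).
have u0 : u != 0 by rewrite fmorph_eq0 expfz_neq0 // xi_neq0.
have Eu : cF (xi ^ ((2 * (2 * j) - N%:Z) ^+ 2)) = cF (zeta N xi ^ j) * u ^+ 4.
  rewrite /u -(rmorphXn cF) -(rmorphM cF); apply: (congr1 cF).
  rewrite -xi_zeta -[(xi ^ _) ^+ 4]/((xi ^ ((2 * j - N%:Z) ^+ 2)) ^ 4) exprz_exp -expfzDr ?xi_neq0 //.
  (* The exponents (4 j - N)^2 and 8 N j + 4 (2 j - N)^2 differ by 3 N^2, on which xi is trivial. *)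
  rewrite -[LHS]mulr1 -(xi_N2 3) -expfzDr ?xi_neq0 //; congr (_ ^ _); rewrite -mulnn PoszM; ring.
have E := sig_tt (2 * j) c20; rewrite Eu -E2 in E.
rewrite [RHS]/Yf -[cst W (c * _)]/(cF (c * zeta N xi ^ j)) (rmorphM cF).
exact: (sigY_alg u0 (sigC c) sig_T E (sig_tt j c0)).
Qed.
Lemma sig_XY (v : V) : sig (X v) = X (Ush 1 v) /\ sig (Y v) = Y (Ush 1 v).
Proof.
have z0 : zeta N xi != 0 by rewrite /zeta expf_neq0 // xi_neq0.
have [->|v0] := eqVneq v 0.
  rewrite (_ : Ush 1 0 = 0); last by rewrite /Ush mulr0 addr0.
  by rewrite X0 Y0 !(rmorph0 sig).
rewrite (pt_surj v); set i := (v.1 : nat)%:Z; set j := (v.2 : nat)%:Z.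
have nz : ~~ ((N%:Z %| i)%Z && (N%:Z %| j)%Z) by have := v0; rewrite {1}(pt_surj v) (pt_eq0 N1) negbK.
have nz' : ~~ ((N%:Z %| i + j)%Z && (N%:Z %| j)%Z).
  by apply: contra nz => /andP[d1 d2]; rewrite d2 andbT; move: d1; rewrite rpredDr.
have -> : Ush 1 (pt N i j) = pt N (i + j) j by rewrite /Ush /pt /= mul1r rmorphD.
have [<- <-] := XYp l3 chl N1 cN6 xiP Fr nz; have [<- <-] := XYp l3 chl N1 cN6 xiP Fr nz'.
by rewrite sig_X ?sig_Y ?expfz_neq0 // expfzDr.
Qed.

Definition DF : F -> F := fracder Fr (@fderiv k).
Lemma DF_iota x : DF (iota x) = iota (fderiv x).
Proof. exact: (fracder_iota Fr (@fderivM k)). Qed.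
Lemma DF_C c : DF (cF c) = 0.
Proof. by rewrite /cF /= DF_iota fderivC rmorph0. Qed.
Lemma DF_ab : b * DF a - a * DF b = cF (16 * N ^ 2)%:R * (a * b * (a - b)).
Proof.
have [A [B [-> -> _ _ [_ E]]]] := AB_ex; rewrite !DF_iota.
transitivity (iota ((16 * N ^ 2)%:R * (A * B * (A - B)))); first by rewrite -E (rmorphB iota) !(rmorphM iota).
rewrite (rmorphM iota _ (A * B * _)) (rmorphM iota (A * B)) (rmorphM iota A) (rmorphB iota).
by congr (_ * _); rewrite (rmorph_nat iota) (rmorph_nat cF).
Qed.

(** With m = N / p the set consists of the points (m i, 0) for 0 < i < p, whose parameters are the
    powers of a primitive p-th root of unity. *)
Lemma mu_sum p c1 c2 : prime p -> (p %| N)%N -> \sum_(v in mup N p) X v <> cF c1 * a + cF c2 * b.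
Proof.
move=> pp pN; set m := (N %/ p)%N; have Em : (m * p)%N = N by rewrite divnK.
have p0 := prime_gt0 pp; have [m0 p1] : (0 < m)%N /\ (1 < p)%N by rewrite divn_gt0 // dvdn_leq // ?N0 // prime_gt1.
pose eta := zeta N xi ^+ m.
have etaP : p.-primitive_root eta.
  have := exp_prim_root (zetaP N1 cN6 xiP) m.
  have /gcdn_idPl -> : (m %| N)%N by rewrite -Em dvdn_mulr.
  by have -> : (N %/ m)%N = p by rewrite -{1}Em mulKn.
suff -> : \sum_(v in mup N p) X v = \sum_(1 <= i < p) Xf W (eta ^+ i) 0.
  have -> : cF c1 * a + cF c2 * b = iota (fpsC c1 * A0 k N + fpsC c2 * B0 k N).
    have [-> ->] := al_iota; move: (A0 k N) (B0 k N) => A B.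
    by rewrite (rmorphD iota) (rmorphM iota _ A) (rmorphM iota _ B).
  apply: (qexp_contra etaP) => //; last by apply: contra kN; rewrite -Em natrM => /eqP->; rewrite mulr0.
  by move: oddN; rewrite -Em oddM => /andP[].
pose h (i : nat) : V := ((m * i)%:R, 0).
have h0 i : (0 < i < p)%N -> h i \in mup N p.
  move=> /andP[i0 ip]; rewrite inE /= -natrM mulnA [(p * m)%N]mulnC Em Zp_nat_eq0 // dvdn_mulr // !andbT.
  apply/eqP => /(congr1 fst) /= /eqP; rewrite Zp_nat_eq0 // -Em dvdn_pmul2l // => /dvdn_leq; lia.
rewrite big_add1 big_mkord.
have -> : mup N p = [set h i.+1 | i : 'I_p.-1].
  apply/setP => v; apply/idP/imsetP => [|[i _ ->]]; last by apply: h0; have := ltn_ord i; lia.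
  case: v => x y; rewrite inE /= => /and3P[v0 /eqP y0 px]; subst y.
  have gen (z : nat) : (N %| p * z)%N -> (m %| z)%N by rewrite -Em mulnC dvdn_pmul2l.
  have : (N %| p * x)%N by rewrite -(Zp_nat_eq0 _ N1) natrM natr_Zp.
  move=> /gen/dvdnP[q Eq].
  have q0 : (0 < q)%N.
    rewrite lt0n; apply: contra v0 => /eqP q0; apply/eqP; congr pair; apply: val_inj.
    by rewrite /= Eq q0.
  have qp : (q < p)%N.
    have : (x < N)%N by apply: leq_trans (ltn_ord x) _; rewrite Zp_cast.
    by rewrite Eq -Em mulnC ltn_pmul2l.
  have qp' : (q.-1 < p.-1)%N by lia.
  by exists (Ordinal qp') => //=; rewrite /h prednK // mulnC -Eq natr_Zp.
rewrite big_imset /=; last first.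
  move=> i j _ _ /(congr1 fst) /= E; apply: val_inj; have := ltn_ord i; have := ltn_ord j => hj hi.
  have E' : (m * i.+1)%N = (m * j.+1)%N.
    have := congr1 val E; rewrite /= !val_Zp_nat // !modn_small //; rewrite -Em ltn_pmul2l //; lia.
  by move/eqP: E'; rewrite eqn_pmul2l // eqSS => /eqP.
apply: eq_bigr => i _.
have ip : (0 < i.+1 < p)%N by have := ltn_ord i; lia.
have := h0 _ ip; rewrite inE => /and3P[hn0 _ _].
have Eh : h i.+1 = pt N (m * i.+1)%:Z 0 by rewrite /h /pt rmorph0.
rewrite Eh in hn0 *; rewrite (pt_eq0 N1) negbK in hn0.
have [<- _] := XYp l3 chl N1 cN6 xiP Fr hn0.
by rewrite mulr0 -exprnP exprM.
Qed.

Definition conc : TW k F N ell.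
Proof.
apply: (@MkTW k F N ell cF om a b X Y N1 oddN kN k2 l3 oddl chl0 omP X0 Y0 XN YN (@Yp_neq0 _ _ l3 chl N N1 cN6 xi xiP F iota Fr)
  Ysq (@Xp_eq _ _ l3 chl N N1 cN6 xi xiP F iota Fr) GtF hasseF an0 bn0 _ _ _ transF transF' sig sigC sig_ab.1 sig_ab.2
  (fun v => (sig_XY v).1) (fun v => (sig_XY v).2) DF (fracderD Fr (@fderivD k) (@fderivM k)) (fracderM Fr (@fderivM k)) DF_C DF_ab mu_sum).
- by have [A [B [-> -> _ _ [AB _]]]] := AB_ex; rewrite (iota_eq Fr).
- by move=> v w v0 w0 n1 n2; apply: (Xp_add l3 chl N1 cN6 xiP Fr v0 w0 n1 n2).
- by move=> v v0; apply: (Xp_dbl l3 chl N1 cN6 xiP Fr v0).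
Defined.
End Conc.

End TateTorsion.

(** * Gauss's lemma, the quadratic character and Gauss sums at a prime *)

Module GaussSums.
Import TorsionPoints.

Section HalfSystem.
Variables (N r : nat).
Hypothesis N1 : (1 < N)%N.
Hypothesis Nr : N = (2 * r).+1.

Definition hsys (x : 'Z_N) : bool := (0 < x <= r)%N.

Lemma ltZ (x : 'Z_N) : (x < N)%N. Proof. by apply: leq_trans (ltn_ord x) _; rewrite Zp_cast. Qed.
Lemma valZN (x : 'Z_N) : x != 0 -> (- x : 'Z_N) = (N - x)%N :> nat.
Proof.
move=> x0; have : x != 0 :> nat by []; have := ltZ x; rewrite /=; move: (nat_of_ord x) => y yN y0.
by rewrite Zp_cast // modn_small //; lia.
Qed.
Lemma hsysN x : x != 0 -> hsys (- x) = ~~ hsys x.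
Proof.
move=> x0; rewrite /hsys valZN //; have : x != 0 :> nat by [].
by have := ltZ x; lia.
Qed.
Lemma hsys0 : hsys 0 = false. Proof. by []. Qed.

Lemma hsys_prod (R : comNzRingType) (g : 'Z_N -> R) :
  \prod_(1 <= i < r.+1) g i%:R = \prod_(x | hsys x) g x.
Proof.
rewrite (eq_bigr (fun x : 'Z_N => g (x : nat)%:R)); last by move=> x _; rewrite natr_Zp.
rewrite -(big_mkord (fun i => (0 < i <= r)%N) (fun i => g i%:R)) Zp_cast //.
rewrite (big_nat_widen _ _ N); last by rewrite Nr; lia.
by rewrite (big_nat_widenl _ 0) //; apply: eq_bigl => i; rewrite /= ltnS andbC.
Qed.

(** Gauss's lemma. A unit permutes the half system up to signs; the sign s is chosen before R and g,
    so it can be computed with one function and used with another. *)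
Lemma half_prod (m : 'Z_N) : m \is a GRing.unit -> exists s : bool,
  forall (R : comNzRingType) (g : 'Z_N -> R),
  ((forall x, x != 0 -> g (- x) = - g x) ->
   \prod_(1 <= i < r.+1) g (m * i%:R) = (-1) ^+ s * \prod_(1 <= i < r.+1) g i%:R) /\
  ((forall x, x != 0 -> g (- x) = g x) ->
   \prod_(1 <= i < r.+1) g (m * i%:R) = \prod_(1 <= i < r.+1) g i%:R).
Proof.
move=> um; pose A := [set y : 'Z_N | ~~ hsys (m^-1 * y) && hsys y].
exists (odd #|A|) => R g.
have m0 y : (m^-1 * y == 0) = (y == 0).
  by apply/eqP/eqP => [/(congr1 (fun z => m * z))|->]; rewrite ?mulr0 // mulVKr.
have S : \prod_(1 <= i < r.+1) g (m * i%:R) =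
   (\prod_(y | hsys (m^-1 * y) && hsys y) g y) * \prod_(y in A) g (- y).
  rewrite (hsys_prod (fun x => g (m * x))) (reindex_onto (fun y => m^-1 * y) (fun x => m * x)); last first.
    by move=> x _; rewrite mulKr.
  rewrite (eq_big (fun y => hsys (m^-1 * y)) g); last 2 first.
  - by move=> y; rewrite mulVKr // eqxx andbT.
  - by move=> y _; rewrite mulVKr.
  rewrite (bigID hsys) /=; congr (_ * _).
  rewrite (reindex_onto (fun y => - y) (fun y => - y)); last by move=> y _; rewrite opprK.
  apply: eq_bigl => y; rewrite inE opprK eqxx andbT mulrN.
  have [->|y0] := eqVneq y 0; first by rewrite mulr0 oppr0 hsys0.
  by rewrite !hsysN ?m0 // negbK.
have E : \prod_(1 <= i < r.+1) g i%:R =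
   (\prod_(y | hsys (m^-1 * y) && hsys y) g y) * \prod_(y in A) g y.
  rewrite (hsys_prod g) (bigID (fun y => hsys (m^-1 * y))) /=.
  by congr (_ * _); apply: eq_bigl => y; rewrite ?inE andbC.
have A0 y : y \in A -> y != 0 by rewrite inE => /andP[_]; apply: contraTneq => ->.
split=> h; rewrite S E.
  have -> : \prod_(y in A) g (- y) = (-1) ^+ #|A| * \prod_(y in A) g y.
    by rewrite -prodr_const -big_split; apply: eq_bigr => y yA; rewrite /= h ?A0 // mulN1r.
  by rewrite signr_odd mulrCA.
by congr (_ * _); apply: eq_bigr => y yA; rewrite h ?A0.
Qed.
End HalfSystem.

Section AtPrime.
Variables (N p : nat).
Hypothesis N1 : (1 < N)%N.
Hypothesis oddN : odd N.
Hypothesis pp : prime p.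
Hypothesis pN : (p %| N)%N.
Hypothesis cop : coprime p (N %/ p).
Variable e : 'Z_N.
Hypothesis ee : e * e = e.
Hypothesis pe : p%:R * e = 0.
Hypothesis ep : forall x, p%:R * x = 0 -> e * x = x.

Lemma oddp : odd p. Proof. exact: dvdn_odd pN oddN. Qed.
Lemma p0 : (0 < p)%N. Proof. exact: prime_gt0. Qed.
Lemma Fp_nat_eq0 (n : nat) : ((n%:R : 'F_p) == 0) = (p %| n)%N.
Proof. by rewrite -(dvdn_pcharf (pchar_Fp pp)). Qed.
Lemma Fp_eq (n m : nat) : n = m %[mod p] -> n%:R = m%:R :> 'F_p.
Proof.
by move=> E; rewrite (divn_eq n p) (divn_eq m p) E !natrD !natrM (pchar_Fp_0 pp) !mulr0 ?add0r.
Qed.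
Lemma valFp (x : 'F_p) : (x < p)%N. Proof. by apply: leq_trans (ltn_ord x) _; rewrite Fp_cast. Qed.

Definition red (x : 'Z_N) : 'F_p := (x : nat)%:R.
(** A section of [red] with values in the ideal generated by e; it respects sums and products but
    sends 1 to e. *)
Definition inj (x : 'F_p) : 'Z_N := (x : nat)%:R * e.

Lemma red_nat n : red n%:R = n%:R.
Proof. by rewrite /red val_Zp_nat //; apply: Fp_eq; rewrite modn_dvdm. Qed.
Lemma redD x y : red (x + y) = red x + red y.
Proof. by rewrite -[x]natr_Zp -[y]natr_Zp -natrD !red_nat natrD. Qed.
Lemma redM x y : red (x * y) = red x * red y.
Proof. by rewrite -[x]natr_Zp -[y]natr_Zp -natrM !red_nat natrM. Qed.
Lemma red1 : red 1 = 1. Proof. exact: (red_nat 1). Qed.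
Lemma redN x : red (- x) = - red x.
Proof. by apply: (addrI (red x)); rewrite -redD !subrr -[RHS](red_nat 0). Qed.
Lemma red_e : red e = 1.
Proof.
have m0 : ((N %/ p)%:R : 'F_p) != 0 by rewrite Fp_nat_eq0 -prime_coprime.
have := ep (_ : p%:R * (N %/ p)%:R = 0); rewrite -natrM mulnC divnK // => /(_ _)/(congr1 red).
rewrite redM !red_nat => E; apply: (mulIf m0); rewrite mul1r E //.
by apply/eqP; rewrite Zp_nat_eq0.
Qed.
Lemma red0_e x : red x = 0 -> e * x = 0.
Proof.
move/eqP; rewrite Fp_nat_eq0 => /dvdnP[q Eq].
by rewrite -[x]natr_Zp Eq natrM mulrCA [e * _]mulrC pe mulr0.
Qed.
Lemma inj_nat n : inj n%:R = n%:R * e.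
Proof.
rewrite /inj val_Fp_nat // {2}(divn_eq n p) natrD natrM mulrDl -mulrA pe mulr0 add0r //.
Qed.
Lemma injD x y : inj (x + y) = inj x + inj y.
Proof. by rewrite -[x]natr_Zp -[y]natr_Zp -natrD !inj_nat natrD mulrDl. Qed.
Lemma injM x y : inj (x * y) = inj x * inj y.
Proof. by rewrite -[x]natr_Zp -[y]natr_Zp -natrM !inj_nat natrM mulrACA ee. Qed.
Lemma inj1 : inj 1 = e. Proof. by rewrite (inj_nat 1) mul1r. Qed.
Lemma inj0 : inj 0 = 0. Proof. by rewrite (inj_nat 0) mul0r. Qed.
Lemma injN x : inj (- x) = - inj x.
Proof. by apply: (addrI (inj x)); rewrite -injD !subrr inj0. Qed.
Lemma inj_e x : e * inj x = inj x. Proof. by rewrite /inj mulrCA ee. Qed.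
Lemma red_inj x : red (inj x) = x.
Proof. by rewrite redM red_e mulr1 red_nat natr_Zp. Qed.
Lemma inj_red x : inj (red x) = e * x.
Proof. by rewrite inj_nat natr_Zp mulrC. Qed.

(** For nonzero x, the unit of Z/N equal to x at p and to 1 on the complementary component. *)
Definition munit (x : 'F_p) : 'Z_N := (1 - e) + inj x.
Lemma munitM x y : munit x * munit y = munit (x * y).
Proof.
rewrite /munit injM.
have -> : (1 - e + inj x) * (1 - e + inj y) =
  1 - e - e + e * e + inj x - e * inj x + inj y - e * inj y + inj x * inj y by ring.
by rewrite !inj_e ee; ring.
Qed.
Lemma munit1 : munit 1 = 1. Proof. by rewrite /munit inj1 subrK. Qed.
Lemma munitU x : x != 0 -> munit x \is a GRing.unit.
Proof. by move=> x0; apply/unitrP; exists (munit x^-1); rewrite !munitM mulVf ?mulfV // munit1. Qed.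
Lemma red_munit x : red (munit x) = x.
Proof. by rewrite /munit !redD redN red1 red_e red_inj subrr add0r. Qed.
Lemma munit_fix x y : red y = 0 -> munit x * y = y.
Proof.
move=> y0; have ey := red0_e y0.
by rewrite /munit mulrDl mulrBl mul1r ey subr0 /inj -mulrA ey mulr0 addr0.
Qed.

Definition hp := p.-1./2.
Lemma hpE : p = (2 * hp).+1. Proof. by rewrite /hp; have := oddp; have := p0; lia. Qed.
Lemma hp_lt : (hp < p)%N. Proof. by have := hpE; lia. Qed.
Lemma euler_pm (x : 'F_p) : x != 0 -> x ^+ hp = 1 \/ x ^+ hp = -1.
Proof.
move=> x0; have : x ^+ (hp + hp) = 1.
  have -> : (hp + hp)%N = p.-1 by have := hpE; lia.
  apply: (mulfI x0); rewrite mulr1 -exprS prednK ?p0 //; have := expf_card x; rewrite card_Fp //.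
rewrite exprD -expr2 => /eqP; rewrite sqrf_eq1.
by case/orP => /eqP ->; [left|right].
Qed.
Lemma N1p : (-1 : 'F_p) != 1.
Proof.
rewrite eq_sym -subr_eq0 opprK -[1 + 1]/(2%:R) Fp_nat_eq0; apply/negP => /dvdn_leq.
by have := oddp; have := prime_gt1 pp; case: p => [|[|[|q]]] //= _ _ /(_ isT).
Qed.

Section Chi.
Variable R : comNzRingType.
(** The quadratic character through Euler's criterion, with values in any ring: it is used over the
    integers, over k and over F. *)
Definition chi (x : 'F_p) : R := if x == 0 then 0 else if x ^+ hp == 1 then 1 else -1.
Lemma chi0 : chi 0 = 0. Proof. by rewrite /chi eqxx. Qed.
Lemma chiM x y : chi (x * y) = chi x * chi y.
Proof.
rewrite /chi mulf_eq0; have [//|x0] := eqVneq x 0; first by rewrite mul0r.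
have [_|y0] := eqVneq y 0; first by rewrite mulr0.
rewrite exprMn; case: (euler_pm x0) => ->; case: (euler_pm y0) => ->.
- by rewrite mul1r eqxx mul1r.
- by rewrite mul1r eqxx mul1r.
- by rewrite mulr1 eqxx mulr1.
- by rewrite mulrNN mul1r eqxx (negPf N1p) mulrNN mul1r.
Qed.
Lemma chi1 : chi 1 = 1. Proof. by rewrite /chi oner_eq0 expr1n eqxx. Qed.
Lemma chi_sq x : x != 0 -> chi x * chi x = 1.
Proof. by rewrite /chi => /negPf->; case: ifP => _; rewrite ?mulr1 // mulrNN mulr1. Qed.
End Chi.

(* The sign of the permutation of half-systems is read off an odd function with values in [F_p]. *)
Lemma munit_sign r (R : comNzRingType) (g : 'Z_N -> R) x : N = (2 * r).+1 -> x != 0 ->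
  (forall x, x != 0 -> g (- x) = - g x) ->
  \prod_(1 <= i < r.+1) g (munit x * i%:R) = chi R x * \prod_(1 <= i < r.+1) g i%:R.
Proof.
move=> Nr x0 og; have [s Hs] := half_prod N1 Nr (munitU x0).
rewrite ((Hs R g).1 og); congr (_ * _).
pose g0 (y : 'Z_N) : 'F_p := if red y == 0 then (if hsys r y then 1 else -1) else red y.
have og0 y : y != 0 -> g0 (- y) = - g0 y.
  move=> y0; rewrite /g0 redN oppr_eq0 hsysN //; case: ifP => // _.
  by case: (hsys r y); rewrite ?opprK.
have E i : g0 (munit x * i%:R) = (if (p %| i)%N then 1 else x) * g0 i%:R.
  rewrite /g0 redM red_munit mulf_eq0 (negPf x0) /= red_nat Fp_nat_eq0.
  case: ifP => [d|//]; rewrite munit_fix ?mul1r // red_nat; apply/eqP.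
  by rewrite Fp_nat_eq0.
have := (Hs _ g0).1 og0; rewrite (eq_bigr _ (fun i _ => E i)) big_split /=.
have nz : \prod_(1 <= i < r.+1) g0 i%:R != 0.
  rewrite prodf_seq_neq0; apply/allP => i _; rewrite /= /g0; case: ifP => [_|/negbT //].
  by case: (hsys r _); rewrite ?oppr_eq0 oner_eq0.
move/(mulIf nz) => E0.
have : x ^+ hp = (-1) ^+ s.
  have oq : odd (N %/ p) by apply: dvdn_odd (dvdn_div pN) oddN.
  have -> : (-1) ^+ s = x ^+ (hp * (N %/ p)).
    rewrite -E0 (eq_bigr (fun i => x ^+ ~~ (p %| i)%N)); last by move=> i _; case: ifP.
    rewrite prodrXr; congr (_ ^+ _).
    have Ed : (r %/ p)%N = (N %/ p)./2.
      have -> : r = ((N %/ p)./2 * p + hp)%N.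
        have := divnK pN; have := hpE; have := odd_double_half (N %/ p); rewrite oq.
        move: (N %/ p)%N (_./2) (hp) => q t h; nia.
      by rewrite divnMDl ?p0 // (divn_small hp_lt) addn0.
    have S1 : (\sum_(1 <= i < r.+1) ~~ (p %| i)%N + r %/ p = r)%N.
      rewrite divn_count_dvd -big_split /= (eq_bigr (fun=> 1%N)) => [|i _]; last by case: (p %| i)%N.
      by rewrite sum_nat_const_nat; lia.
    have := divnK pN; have := hpE; have := odd_double_half (N %/ p); rewrite oq; rewrite Ed in S1.
    move: S1; move: (N %/ p)%N (_./2) (hp) (\sum_(_ <= _ < _) _)%N => q t h S1; nia.
  rewrite exprM.
  case: (euler_pm x0) => ->; first by rewrite expr1n.
  by rewrite -signr_odd oq.
rewrite /chi (negPf x0) => ->; case: s {Hs E0}; rewrite ?expr0 ?eqxx // expr1.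
by rewrite (negPf N1p).
Qed.

Lemma nonres : exists x : 'F_p, x != 0 /\ x ^+ hp = -1.
Proof.
apply: contrapT => nx.
have h (x : 'F_p) : x != 0 -> x ^+ hp = 1.
  by move=> x0; case: (euler_pm x0) => // E; case: nx; exists x.
pose q : {poly 'F_p} := 'X^hp - 1; have h0 : (0 < hp)%N by have := hpE; have := prime_gt1 pp; lia.
have sq : size q = hp.+1 by rewrite size_XnsubC.
have q0 : q != 0 by rewrite -size_poly_gt0 sq.
have := @max_poly_roots _ q (filter (predC1 0) (enum 'F_p)) q0; rewrite filter_uniq ?enum_uniq // sq.
have -> : all (root q) (filter (predC1 0) (enum 'F_p)).
  by apply/allP => x; rewrite mem_filter => /andP[/= x0 _]; rewrite rootE !hornerE h // subrr.
have -> : size (filter (predC1 0) (enum 'F_p)) = p.-1.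
  rewrite -[RHS](congr1 predn (card_Fp pp)) (cardD1 0) add1n /= cardE /enum_mem -!filter_predI.
  by congr (size _); apply: eq_filter => x /=; rewrite !inE andbT.
by move=> /(_ isT isT); have := hpE; lia.
Qed.

(** If a root x of X^h - 1 with h = (p - 1)/2 were not a square, then x and the squares of 1, ..., h
    would be h + 1 distinct roots. *)
Lemma sqr_res (x : 'F_p) : x != 0 -> (exists y, y ^+ 2 = x) <-> x ^+ hp = 1.
Proof.
move=> x0; split=> [[y E]|E].
  have y0 : y != 0 by apply: contra x0 => /eqP y0; rewrite -E y0 expr0n.
  rewrite -E -exprM mulnC exprM; case: (euler_pm y0) => ->; first by rewrite expr1n.
  by rewrite expr2 mulrNN mulr1.
apply: contrapT => nx.
pose q : {poly 'F_p} := 'X^hp - 1; have h0 : (0 < hp)%N by have := hpE; have := prime_gt1 pp; lia.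
have sq : size q = hp.+1 by rewrite size_XnsubC.
have q0 : q != 0 by rewrite -size_poly_gt0 sq.
pose ys := x :: [seq (i%:R : 'F_p) ^+ 2 | i <- iota 1 hp].
have := @max_poly_roots _ q ys q0; rewrite sq /= size_map size_iota ltnn => H.
have nz i : i \in iota 1 hp -> (i%:R : 'F_p) != 0.
  rewrite mem_iota Fp_nat_eq0 => /andP[i0 il]; apply/negP => /dvdn_leq; have := hpE; lia.
suff : false by []; apply: H.
  rewrite rootE !hornerE E subrr eqxx /=; apply/allP => _ /mapP[i iI ->].
  rewrite rootE !hornerE -exprM mulnC exprM; case: (euler_pm (nz i iI)) => ->; rewrite ?expr1n ?subrr //.
  by rewrite expr2 mulrNN mulr1 subrr.
rewrite map_inj_in_uniq ?iota_uniq ?andbT.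
  by apply/negP => /mapP[i iI Ei]; apply: nx; exists i%:R.
move=> i j iI jI /eqP; rewrite eqf_sqr; move: iI jI; rewrite !mem_iota => iI jI /orP[]/eqP Eij.
  have : (i%:R - j%:R : 'F_p) == 0 by rewrite Eij subrr.
  wlog ij : i j iI jI Eij / (j <= i)%N.
    by case: (leqP j i) => [|/ltnW] h w; [exact: w|symmetry; apply: w => //; rewrite -Eij subrr].
  by rewrite -natrB // Fp_nat_eq0 => /dvdnP[[|z] Ez]; have := hpE; [lia|nia].
have : (i%:R + j%:R : 'F_p) == 0 by rewrite Eij addNr.
by rewrite -natrD Fp_nat_eq0 => /dvdnP[[|z] Ez]; have := hpE; [lia|nia].
Qed.

Section Gauss.
Variables (k : fieldType) (eta : k).
Hypothesis etaP : p.-primitive_root eta.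
Definition psi (x : 'F_p) : k := eta ^+ x.
Lemma psi_nat n : psi n%:R = eta ^+ n.
Proof. by rewrite /psi val_Fp_nat // (prim_expr_mod etaP). Qed.
Lemma psiD x y : psi (x + y) = psi x * psi y.
Proof. by rewrite -[x]natr_Zp -[y]natr_Zp -natrD !psi_nat exprD. Qed.
Lemma psi0 : psi 0 = 1. Proof. by rewrite (psi_nat 0). Qed.
Lemma psi_sum (z : 'F_p) : \sum_x psi (x * z) = if z == 0 then p%:R else 0.
Proof.
case: eqVneq => [->|z0].
  by under eq_bigr do rewrite mulr0 psi0; rewrite sumr_const card_Fp.
have psz : psi z != 1.
  rewrite /psi -[1](expr0 eta) (eq_prim_root_expr etaP) mod0n modn_small ?valFp //.
have S : \sum_x psi (x * z) = psi z * \sum_x psi (x * z).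
  rewrite [LHS](reindex (fun x => x + 1)) /=; last by exists (fun x => x - 1) => x _; rewrite ?addrK ?subrK.
  by rewrite mulr_sumr; apply: eq_bigr => x _; rewrite mulrDl mul1r psiD mulrC.
apply/eqP; have : (psi z - 1) * \sum_x psi (x * z) == 0 by rewrite mulrBl mul1r -S subrr.
by rewrite mulf_eq0 subr_eq0 (negPf psz).
Qed.
(** The quadratic Gauss sum; the sign of x matches the scalar - x that the Weyl element produces in
    [Up_Sp_Up]. *)
Definition gam (M : 'F_p) : k := \sum_x psi (- x * M) * chi k (- x).
Lemma gamE M : M != 0 -> gam M = chi k M * gam 1.
Proof.
move=> M0; rewrite /gam [in RHS](reindex (fun x => x * M)) /=; last first.
  by exists (fun x => x / M) => x _; rewrite ?mulfK ?mulfVK.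
rewrite mulr_sumr; apply: eq_bigr => x _; rewrite mulr1 -!mulNr chiM mulrCA; congr (_ * _).
by rewrite mulrCA chi_sq // mulr1.
Qed.
Lemma chi_sum : (2%:R : k) != 0 -> \sum_x chi k x = 0.
Proof.
move=> k2; have [a [a0 Ea]] := nonres.
have ca : chi k a = -1 by rewrite /chi (negPf a0) Ea (negPf N1p).
have S : \sum_x chi k x = - \sum_x chi k x.
  rewrite {1}(reindex (fun x => a * x)) /=; last by exists (fun x => a^-1 * x) => x _; rewrite ?mulKf ?mulVKf.
  by rewrite -sumrN; apply: eq_bigr => x _; rewrite chiM ca mulN1r.
apply/eqP; have : 2%:R * \sum_x chi k x == 0 by rewrite mulr_natl mulr2n {1}S addNr.
by rewrite mulf_eq0 (negPf k2).
Qed.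
(** Substituting x z for z in the double sum leaves additive sums over x, which concentrate at z =
    -1 up to the sum of [chi], and that sum is zero. *)
Lemma gam_sq : (2%:R : k) != 0 -> gam 1 * gam 1 = chi k (-1) * p%:R.
Proof.
move=> k2; rewrite /gam.
have -> : \sum_x psi (- x * 1) * chi k (- x) = \sum_x psi x * chi k x.
  rewrite (reindex (fun x => - x)) /=; last by exists (fun x => - x) => x _; rewrite opprK.
  by apply: eq_bigr => x _; rewrite opprK mulr1.
rewrite mulr_suml (eq_bigr (fun x => \sum_z chi k z * (psi (x * (1 + z)) * (chi k x * chi k x)))); last first.
  move=> x _; have [->|x0] := eqVneq x 0.
    by rewrite chi0 mulr0 mul0r big1 // => z _; rewrite mul0r !mulr0.
  rewrite mulr_sumr (reindex (fun z => x * z)) /=; last by exists (fun z => x^-1 * z) => z _; rewrite ?mulKf ?mulVKf.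
  by apply: eq_bigr => z _; rewrite chiM mulrDr mulr1 psiD; ring.
rewrite exchange_big /=.
have H z : \sum_x chi k z * (psi (x * (1 + z)) * (chi k x * chi k x)) =
   chi k z * (if 1 + z == 0 then p%:R else 0) - chi k z.
  rewrite -mulr_sumr -psi_sum (bigD1 0) //= chi0 mulr0 mulr0 add0r [in RHS](bigD1 0) //= mul0r psi0.
  rewrite mulrDr mulr1 addrAC subrr add0r; congr (_ * _).
  by apply: eq_bigr => x x0; rewrite chi_sq // mulr1.
rewrite (eq_bigr _ (fun z _ => H z)) sumrB (chi_sum k2) subr0 (bigD1 (-1)) //= subrr eqxx big1 ?addr0 // => z zn.
by rewrite addrC addr_eq0 (negPf zn) mulr0.
Qed.
End Gauss.
End AtPrime.

End GaussSums.

(** * Torsion coordinates that are inverse Euler products *)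

Module EtaQuotients.
Import PowerSeries FormalSums Theta TripleProduct ProductFormula ThetaIdentities TateCurve DivisionPolynomials Hasse TorsionPoints GaloisAction Uniformity QExpansion TorsionTwist TateTorsion GaussSums.

HB.saturate prod.

Section Uniform.
Variables (k F : fieldType) (N ell : nat) (T : TW k F N ell).
Notation V := (('Z_N * 'Z_N)%type : finZmodType).
Notation efT := (ef (ta T) (tb T) (tX T) (tY T)).

(** One rational expression gives the values at v and at all its images f v. This replaces a modular
    transformation law. *)
Definition uf (Psi : V -> F) := forall v : V, exists P, rf (tc T) P /\ forall f, Rl T 0 f -> P (efT f) = Psi (f v).

Lemma uf_ext (P P' : V -> F) : P =1 P' -> uf P -> uf P'.
Proof. by move=> E h v; have [R [hR eR]] := h v; exists R; split=> // f hf; rewrite eR. Qed.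
Lemma ufC c : uf (fun=> tc T c).
Proof. by move=> v; exists (fun=> tc T c); split=> //; exact: rfC. Qed.
Lemma uf_a : uf (fun=> ta T).
Proof. by move=> v; exists (@eA F V); split=> //; exact/rf_pf/pf_a. Qed.
Lemma uf_b : uf (fun=> tb T).
Proof. by move=> v; exists (@eB F V); split=> //; exact/rf_pf/pf_b. Qed.
Lemma ufXn n : uf (fun v => tX T (v *+ n)).
Proof.
move=> v; exists (fun e => eX e (v *+ n)); split; first exact/rf_pf/pfX.
by move=> f hf /=; rewrite (RlMn hf).
Qed.
Lemma ufYn n : uf (fun v => tY T (v *+ n)).
Proof.
move=> v; exists (fun e => eY e (v *+ n)); split; first exact/rf_pf/pfY.
by move=> f hf /=; rewrite (RlMn hf).
Qed.
Lemma ufD P Q : uf P -> uf Q -> uf (fun v => P v + Q v).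
Proof.
move=> h h' v; have [R [hR eR]] := h v; have [S [hS eS]] := h' v.
by exists (fun e => R e + S e); split=> [|f hf]; [exact: rfD|rewrite eR ?eS].
Qed.
Lemma ufM P Q : uf P -> uf Q -> uf (fun v => P v * Q v).
Proof.
move=> h h' v; have [R [hR eR]] := h v; have [S [hS eS]] := h' v.
by exists (fun e => R e * S e); split=> [|f hf]; [exact: rfM|rewrite eR ?eS].
Qed.
Lemma ufV P : uf P -> uf (fun v => (P v)^-1).
Proof.
move=> h v; have [R [hR eR]] := h v.
by exists (fun e => (R e)^-1); split=> [|f hf]; [exact: rfV|rewrite eR].
Qed.
Lemma ufB P Q : uf P -> uf Q -> uf (fun v => P v - Q v).
Proof.
move=> h h'; apply: (uf_ext (P := fun v => P v + tc T (-1) * Q v)).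
  by move=> v; rewrite rmorphN1 mulN1r.
by apply: ufD => //; apply: ufM => //; exact: ufC.
Qed.
Lemma uf_X P n : uf P -> uf (fun v => P v ^+ n).
Proof.
move=> h; elim: n => [|n IH].
  by apply: uf_ext (ufC 1) => v; rewrite rmorph1.
by apply: uf_ext (ufM h IH) => v; rewrite exprS.
Qed.
Lemma uf_prod (I : Type) (s : seq I) (P : I -> V -> F) : (forall i, uf (P i)) -> uf (fun v => \prod_(i <- s) P i v).
Proof.
move=> h; elim: s => [|i s IH].
  by apply: uf_ext (ufC 1) => v; rewrite rmorph1 big_nil.
by apply: uf_ext (ufM (h i) IH) => v; rewrite big_cons.
Qed.
Lemma uf_D P : uf P -> uf (fun v => tD T (P v)).
Proof.
move=> h v; have [R [hR eR]] := h v; have [S [hS eS]] := rfT_D hR.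
by exists S; split=> // f hf; rewrite eS // eR.
Qed.

(** The transport principle: the relation is the vanishing of one rational function, and such
    vanishing is carried along f. *)
Lemma uf_lin (I : Type) (s : seq I) (c : I -> k) (x : I -> V) Psi f : uf Psi -> Rl T 0 f ->
  \sum_(i <- s) tc T (c i) * Psi (x i) = 0 -> \sum_(i <- s) tc T (c i) * Psi (f (x i)) = 0.
Proof.
move=> h hf E; pose P i := projT1 (cid (h (x i))).
have hP i : rf (tc T) (P i) := (projT2 (cid (h (x i)))).1.
have eP i : forall f, Rl T 0 f -> P i (efT f) = Psi (f (x i)) := (projT2 (cid (h (x i)))).2.
have := @rfT_zero _ _ _ _ T (fun e => \sum_(i <- s) tc T (c i) * P i e) f.
rewrite (eq_bigr (fun i => tc T (c i) * Psi (x i))) => [|i _]; last first.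
  by rewrite eP //; exact: Rel_id.
move=> H; rewrite -[RHS](H _ hf E); first by apply: eq_bigr => i _; rewrite eP.
by apply: rf_sum => i; apply: rfM => //; apply: rfC.
Qed.

Definition hr := N.-1./2.
Lemma hrE : N = (2 * hr).+1. Proof. by rewrite /hr; have := toddN T; have := tN1 T; lia. Qed.
(** In theta terms this is T theta(2 w)^3 / (theta(w)^3 theta(3 w)). Over half of the multiples of a
    point the values at 2 w and at 3 w permute those at w, up to elementary factors, because N is
    prime to 6; an inverse product of thetas remains, which [th_half_prod] evaluates. *)
Definition gq (w : V) : F := tY T w / (tX T w - tX T (w + w)).
Definition YY (v : V) : F := \prod_(1 <= i < hr.+1) gq (v *+ i).

Lemma YY_uf : uf YY.
Proof.
apply: uf_prod => i; apply: ufM; first exact: ufYn.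
apply/ufV/ufB; first exact: ufXn.
by apply: uf_ext (ufXn (i + i)) => v; rewrite mulrnDr.
Qed.

Lemma gqN w : gq (- w) = - gq w.
Proof. by rewrite /gq -opprD !tXN tYN mulNr. Qed.

Section AtP.
Variables (p : nat) (e : 'Z_N).
Hypotheses (pp : prime p) (pN : (p %| N)%N) (cop : coprime p (N %/ p)).
Hypothesis ee : e * e = e.
Hypothesis pe : p%:R * e = 0.
Hypothesis ep : forall x, p%:R * x = 0 -> e * x = x.

(** Each factor is odd in the point, so rescaling v costs the sign of Gauss's lemma, which is the
    quadratic character at p. *)
Lemma YY_scale (x : 'F_p) (v : V) : x != 0 -> YY (munit e x * v.1, munit e x * v.2) = chi F x * YY v.
Proof.
move=> x0; pose g (y : 'Z_N) := gq (y * v.1, y * v.2).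
have H y : gq ((y * v.1, y * v.2) *+ 1) = g y by [].
have Mn (a b : 'Z_N) n : (a, b) *+ n = (n%:R * a, n%:R * b) :> V.
  by elim: n => [|n IH]; rewrite ?mulr0n ?mul0r // mulrS IH -natr1 !mulrDl !mul1r addrC.
have og y : y != 0 -> g (- y) = - g y by move=> _; rewrite /g !mulNr -gqN.
have := munit_sign (tN1 T) (toddN T) pp pN cop ee pe ep hrE x0 og.
have -> : \prod_(1 <= i < hr.+1) g i%:R = YY v.
  by apply: eq_bigr => i _; rewrite /g; case: v {og H} @g => v1 v2 g; rewrite Mn.
move=> <-; apply: eq_bigr => i _; rewrite Mn /g; congr (gq (_, _)); ring.
Qed.
End AtP.
End Uniform.

Section Conc.
Variable k : fieldType.
Variable ell : nat.
Hypothesis pl : prime ell.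
Hypothesis l3 : (3 < ell)%N.
Hypothesis chl : ell \in [pchar k].
Variable N : nat.
Hypothesis N1 : (1 < N)%N.
Hypothesis cN6 : coprime N 6.
Hypothesis kN : (N%:R : k) != 0.
Variables (xi om : k).
Hypothesis xiP : (N ^ 2).-primitive_root xi.
Hypothesis omP : (ell.-1).-primitive_root om.
Variables (F : fieldType) (iota : {rmorphism fps k -> F}).
Hypothesis Fr : is_frac iota.

Notation V := ('Z_N * 'Z_N)%type.
Definition TW0 := conc pl l3 chl N1 cN6 kN xiP omP Fr.
Notation W := (DD l3 chl N1 Fr).
Notation X := (Xp l3 chl N1 xi Fr).
Notation Y := (Yp l3 chl N1 xi Fr).
Notation N0 := (N0 N1).
Notation k2 := (k2 l3 chl).
Notation oddN := (oddN cN6).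
Notation zeta := (zeta N xi).
Notation cF := (cF iota).
Notation r := (hr N).
Lemma rE : N = (2 * r).+1. Proof. exact: (hrE TW0). Qed.
Notation qq := (fpsX (8 * N ^ 2)%N : fps k).
(* Chosen so that [24 * E3 = -1] modulo [N]. *)
Definition E3 := (\sum_(1 <= i < r.+1) if (3 * i < N)%N then 0 else 3 * i)%N.

(** The range with 3 i > N begins near N / 3, so the sum is evaluated separately for N = 6 h + 1 and
    N = 6 h + 5. *)
Lemma E3_24 : (N %| 24 * E3 + 1)%N.
Proof.
have S a b : (\sum_(a <= i < a + b) 2 * i = b * (2 * a + b) - b)%N.
  elim: b => [|b IH]; first by rewrite addn0 big_geq.
  by rewrite addnS big_nat_recr ?leq_addr //= IH; nia.
have H a b : (a + b = r)%N -> (3 * a < N)%N -> (N <= 3 * a.+1)%N -> (2 * E3 = 3 * (b * (2 * a.+1 + b) - b))%N.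
  move=> Eab l1 l2; rewrite /E3 -Eab (@big_cat_nat _ _ _ a.+1) ?ltnS ?leq_addr //=.
  rewrite big_nat big1 ?add0n => [|i /andP[_ il]]; last by rewrite ifT //; lia.
  rewrite big_nat (eq_bigr (fun i => 3 * i)%N) => [|i /andP[ia _]]; last by rewrite ifF //; apply/negbTE; lia.
  rewrite -big_nat -big_distrr /= -addSn -(S a.+1 b) -big_distrr /=; lia.
have rr := rE.
have n3 : ~~ (3 %| N)%N.
  by move: cN6; rewrite (_ : 6 = 2 * 3)%N // coprimeMr => /andP[_]; rewrite coprime_sym prime_coprime.
have : (N %% 6 = 1)%N \/ (N %% 6 = 5)%N by have := oddN; move: n3; clear; lia.
have Eh := divn_eq N 6; case=> E; rewrite E in Eh; set h := (N %/ 6)%N in Eh.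
  have := H (2 * h)%N h; have -> : r = (3 * h)%N by lia.
  move=> /(_ _ _ _) E0; have {}E0 : (2 * E3 = 3 * (h * (2 * (2 * h).+1 + h) - h))%N by apply: E0; lia.
  have -> : (24 * E3 + 1 = N * (30 * h + 1))%N by nia.
  exact: dvdn_mulr.
have := H (2 * h).+1 h.+1; have -> : r = (3 * h + 2)%N by lia.
move=> /(_ _ _ _) E0; have {}E0 : (2 * E3 = 3 * (h.+1 * (2 * (2 * h).+2 + h.+1) - h.+1))%N by apply: E0; lia.
have -> : (24 * E3 + 1 = N * (30 * h + 29))%N by nia.
exact: dvdn_mulr.
Qed.

Section AtC.
Variable c : k.
Hypothesis cN : c ^+ N = 1.
Definition tn (n : nat) : F := tt W (c ^+ n) (2 * n%:Z).
Lemma c_unit : c \is a GRing.unit.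
Proof. by apply/unitrP; exists (c ^+ N.-1); rewrite -exprSr -exprS prednK ?N0. Qed.
Lemma cn_unit n : c ^+ n \is a GRing.unit. Proof. by rewrite unitrX ?c_unit. Qed.
Lemma tn_good n : ~~ (N %| n)%N -> ((2 * N)%:Z %| 2 * n%:Z)%Z -> c ^+ n != 1.
Proof. by move=> h; rewrite dvdzE abszM !absz_nat dvdn_pmul2l // (negPf h). Qed.
Lemma tn_neq0 n : ~~ (N %| n)%N -> tn n != 0.
Proof. by move=> h; apply: tt_neq0 (cn_unit n) (tn_good h). Qed.
Lemma tn_shift n : tn (n + N) = - (tn n / cF c ^+ n).
Proof.
rewrite /tn exprD cN mulr1 (_ : 2 * (n + N)%:Z = 2 * n%:Z + (2 * N)%:Z); last by rewrite PoszD PoszM; ring.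
by rewrite (tt_shift W _ (cn_unit n)) -[cst W _]/(cF (c ^+ n)) rmorphXn.
Qed.
Lemma tn_sym n : (n <= N)%N -> tn (N - n) = tn n.
Proof.
move=> nN; have E : c ^+ (N - n) = (c ^+ n)^-1.
  by apply: (mulrI (cn_unit n)); rewrite mulrV ?cn_unit // -exprD subnKC.
rewrite /tn E (_ : 2 * (N - n)%:Z = - (2 * n%:Z) + (2 * N)%:Z); last by rewrite -subzn // PoszM; ring.
rewrite tt_shift ?unitrV ?cn_unit // tt_inv ?cn_unit // -[cst W (c ^- n)]/(cF (c ^- n)) -[cst W (c ^+ n)]/(cF (c ^+ n)).
have nz : cF (c ^+ n) != 0 by rewrite fmorph_eq0 -unitfE cn_unit.
by rewrite fmorphV mulNr opprK invrK mulfVK.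
Qed.

Lemma gq_tn i : ~~ (N %| i)%N -> ~~ (N %| 2 * i)%N -> ~~ (N %| 3 * i)%N ->
  Yf W (c ^+ i) (2 * i%:Z) / (Xf W (c ^+ i) (2 * i%:Z) - Xf W (c ^+ (2 * i)) (2 * (2 * i)%:Z)) =
  TT W * tn (2 * i) ^+ 3 / (tn i ^+ 3 * tn (3 * i)).
Proof.
move=> n1 n2 n3; rewrite (X_sub W k2 (cn_unit _) (cn_unit _) (tn_good n1) (tn_good n2)) /Yf.
have t1 := tn_neq0 n1; have t2 := tn_neq0 n2; have t3 := tn_neq0 n3; have T0 := TT_neq0 W.
have -> : c ^+ i / c ^+ (2 * i) = (c ^+ i)^-1.
  have -> : c ^+ (2 * i) = c ^+ i * c ^+ i by rewrite mul2n -addnn exprD.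
  by rewrite invrM ?cn_unit // mulrA mulrV ?cn_unit // mul1r.
have -> : 2 * i%:Z - 2 * (2 * i)%:Z = - (2 * i%:Z) by rewrite PoszM; ring.
rewrite (tt_inv W _ (cn_unit i)) -exprD (_ : i + 2 * i = 3 * i)%N; last lia.
have -> : 2 * i%:Z + 2 * (2 * i)%:Z = 2 * (3 * i)%:Z by rewrite !PoszM; ring.
have -> : (c ^+ i) ^+ 2 = c ^+ (2 * i) by rewrite -exprM mulnC.
have -> : 2 * (2 * i%:Z) = 2 * (2 * i)%:Z by rewrite PoszM; ring.
rewrite -/(tn i) -/(tn (2 * i)) -/(tn (3 * i)) -[cst W _]/(cF (c ^+ i)) -[cst W (c ^+ (2 * i))]/(cF (c ^+ (2 * i))).
have -> : cF (c ^+ (2 * i)) = cF (c ^+ i) ^+ 2 by rewrite -rmorphXn -exprM mulnC.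
have nz : cF (c ^+ i) != 0 by rewrite fmorph_eq0 -unitfE cn_unit.
move: (tn i) (tn (2 * i)) (tn (3 * i)) (TT W) (cF (c ^+ i)) t1 t2 t3 T0 nz => x y z t d x0 y0 z0 t0 d0.
rewrite mulrN mulNr opprK; field.
by rewrite ?x0 ?y0 ?z0 ?t0 ?d0.
Qed.

Definition ksg : F := \prod_(1 <= i < r.+1) (if (3 * i < N)%N then 1 else -1).
Lemma ksg_sq : ksg * ksg = 1.
Proof. by rewrite /ksg -big_split big1_seq //= => i _; case: ifP => _; rewrite ?mulrNN mulr1. Qed.
Definition Pn := \prod_(1 <= i < r.+1) tn i.

Lemma nd i m : (0 < i < r.+1)%N -> (0 < m < 4)%N -> ~~ (N %| m * i)%N.
Proof.
move=> ir m4; rewrite Gauss_dvdr.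
  by apply/negP => /dvdn_leq; have := rE; lia.
by case: m m4 => [|[|[|[|m]]]] // _; rewrite ?coprimen1 //; move: cN6; rewrite (_ : 6 = 2 * 3)%N // coprimeMr => /andP[].
Qed.
Lemma Pn_neq0 : Pn != 0.
Proof.
rewrite /Pn prodf_seq_neq0; apply/allP => i; rewrite mem_index_iota => ir /=.
by apply: tn_neq0; rewrite -[i]mul1n; apply: nd.
Qed.
(** The theta values at n and N - n agree, so the product over a half system is unchanged when it is
    multiplied by a unit. *)
Lemma fold_prod (m : nat) : coprime N m -> \prod_(1 <= i < r.+1) tn ((m * i) %% N) = Pn.
Proof.
move=> cm; have um : (m%:R : 'Z_N) \is a GRing.unit by rewrite unitZpE.
have [s Hs] := half_prod N1 rE um; have [_ H] := Hs F (fun x : 'Z_N => tn x).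
rewrite -[RHS](_ : \prod_(1 <= i < r.+1) tn (i%:R : 'Z_N) = _); last first.
  rewrite /Pn !big_nat; apply: eq_bigr => i ir; rewrite val_Zp_nat // modn_small //.
  by have := rE; lia.
rewrite -H => [|x x0]; last first.
  have -> : (- x : 'Z_N) = (N - x)%N :> nat by apply: (valZN N1 rE).
  by rewrite tn_sym // ltnW // ltZ.
by apply: eq_bigr => i _; rewrite -natrM val_Zp_nat.
Qed.
Lemma prod2 : \prod_(1 <= i < r.+1) tn (2 * i) = Pn.
Proof.
rewrite -(@fold_prod 2); last by rewrite coprimen2 oddN.
by rewrite !big_nat; apply: eq_bigr => i ir; rewrite modn_small //; have := rE; lia.
Qed.
(** For 3 i beyond N one period is removed, at the price of a sign and a power of c; the signs form
    [ksg] and the exponents add up to [E3]. *)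
Lemma prod3 : \prod_(1 <= i < r.+1) tn (3 * i) * cF c ^+ E3 = ksg * Pn.
Proof.
rewrite -(@fold_prod 3); last by move: cN6; rewrite (_ : 6 = 2 * 3)%N // coprimeMr => /andP[].
rewrite /E3 -prodrXr -!big_split /= !big_nat; apply: eq_bigr => i ir.
case: ifP => [lt|ge]; first by rewrite expr0 mulr1 mul1r modn_small.
have [E l2] : (3 * i = (3 * i - N) + N)%N /\ (3 * i - N < N)%N by have := rE; lia.
have -> : (3 * i %% N)%N = (3 * i - N)%N by rewrite {1}E modnDr modn_small.
rewrite {1 2}E tn_shift exprD -[cF c ^+ N]rmorphXn cN rmorph1 mulr1 mulN1r mulNr mulfVK //.
by rewrite expf_neq0 // fmorph_eq0 -unitfE c_unit.
Qed.
Lemma gq_prod : \prod_(1 <= i < r.+1) (TT W * tn (2 * i) ^+ 3 / (tn i ^+ 3 * tn (3 * i))) =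
  TT W ^+ r * ksg * cF c ^+ E3 / Pn.
Proof.
rewrite prodf_div [X in X / _]big_split [X in _ / X]big_split /= !prodrXl prod2 -/Pn prodr_const_nat subn1 /=.
have P0 := Pn_neq0; have P3 := prod3; set p3 := \prod_(1 <= i < r.+1) tn (3 * i) in P3 *.
have p30 : p3 != 0.
  rewrite /p3 prodf_seq_neq0; apply/allP => i; rewrite mem_index_iota => ir /=.
  by apply: tn_neq0; apply: nd.
have -> : TT W ^+ r * ksg * cF c ^+ E3 / Pn = TT W ^+ r * ksg * (p3 * cF c ^+ E3) / (Pn * p3).
  by field; rewrite P0 p30.
rewrite P3; transitivity (TT W ^+ r * (ksg * ksg) / p3); last by field; rewrite P0 p30.
by rewrite ksg_sq; field; rewrite P0 p30.
Qed.
End AtC.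

Definition Sg := (\sum_(1 <= i < r.+1) `|(2 * i)%:Z - N%:Z| ^ 2)%N.
(** The part of [YY] at (j, 1) that does not depend on j. *)
Definition KK : F := ksg * TT W ^+ r * iota (euler qq) / (iota (fpsX Sg) * iota (euler qq) ^+ r).
Lemma EF0 : iota (euler qq) != 0.
Proof. by rewrite (iota_eq0 Fr) euler_neq0 // qq0 ?N0. Qed.
Lemma XF0 n : iota (fpsX n) != 0. Proof. by rewrite (iota_eq0 Fr) fpsX_neq0. Qed.

Lemma YY_val (j : nat) : YY TW0 (j%:R, 1) * iota (euler (fpsC (zeta ^+ j) * fpsX (8 * N))) = KK * cF zeta ^+ (j * E3).
Proof.
set c := zeta ^+ j; have cN : c ^+ N = 1.
  by rewrite /c -exprM mulnC exprM (prim_expr_order (zetaP N1 cN6 xiP)) expr1n.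
have -> : YY TW0 (j%:R, 1) = TT W ^+ r * ksg * cF c ^+ E3 / Pn c.
  rewrite -(gq_prod cN) /YY !big_nat; apply: eq_bigr => i ir.
  have n1 : ~~ (N %| i)%N by rewrite -[i]mul1n; apply: nd.
  have n2 : ~~ (N %| 2 * i)%N by apply: nd.
  have n3 : ~~ (N %| 3 * i)%N by apply: nd.
  have Mn n : (j%:R, 1) *+ n = pt N (j * n)%:Z n%:Z :> V.
    rewrite /pt -!pmulrn; elim: n => [|n IH]; first by rewrite muln0.
    by rewrite mulrS IH mulnS natrD -[n.+1]add1n natrD.
  have nz n : ~~ (N %| n)%N -> ~~ ((N%:Z %| (j * n)%:Z)%Z && (N%:Z %| n%:Z)%Z).
    by move=> h; rewrite negb_and !dvdzE !absz_nat h orbT.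
  have E n : zeta ^ (j * n)%:Z = c ^+ n by rewrite -exprnP exprM.
  rewrite -(gq_tn cN n1 n2 n3) /gq -mulrnDr addnn -mul2n !Mn.
  have [] := XYp l3 chl N1 cN6 xiP Fr (nz _ n1); rewrite E => -> ->.
  by have [] := XYp l3 chl N1 cN6 xiP Fr (nz _ n2); rewrite E => -> _.
have := congr1 iota (th_half_prod N0 rE cN).
rewrite !(rmorphM iota) (rmorphXn iota) rmorph_prod -/Sg.
rewrite (eq_bigr (tn c)) => [|i _]; last by rewrite /tn PoszM.
rewrite -/(Pn c) /KK exprM => Eth; have P0 := Pn_neq0 cN; have E0 := EF0; have X0 := XF0 Sg.
set eu := iota (euler (_ * _)) in Eth *.
apply: (mulIf P0); apply: (mulIf X0); apply: (mulIf (expf_neq0 r E0)).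
transitivity (TT W ^+ r * ksg * cF c ^+ E3 * (iota (fpsX Sg) * (iota (euler qq) ^+ r * eu))).
  by field; rewrite P0.
have -> : cF zeta ^+ j = cF c by rewrite -(rmorphXn cF).
by rewrite -Eth; field; rewrite X0 expf_neq0.
Qed.

Lemma disc_T : ta TW0 * tb TW0 * (ta TW0 - tb TW0) = cF 4%:R^-1 * TT W ^+ 4.
Proof.
rewrite -[ta TW0]/(al W) -[tb TW0]/(be W) (disc_prod W N0 k2).
have E : 2%:R * TT W = - (th2 W * (th3 W * th4 W)).
  rewrite /th2 /th3 /th4 -[TT W]/(iota (T1 k N)) -[tt W (-1) 0]/(iota (th N (-1) 0)).
  rewrite -[tt W (-1) N]/(iota (th N (-1) N%:Z)) -[tt W 1 N]/(iota (th N 1 N%:Z)).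
  have := congr1 iota (theta_T1 N0 k2); rewrite (rmorphM iota) rmorph_nat => ->.
  by rewrite (rmorphN iota) !(rmorphM iota) [iota (th N 1 _) * _]mulrC.
have T0 := TT_neq0 W; have n4 : (4%:R : F) != 0 by rewrite -(rmorph_nat cF) fmorph_eq0 (nz4 k2).
have -> : (th2 W * (th3 W * th4 W)) ^+ 2 = 4%:R * TT W ^+ 2 by rewrite -sqrrN -E; ring.
have -> : cF 4%:R^-1 = 4%:R^-1 by rewrite fmorphV rmorph_nat.
by field; rewrite ?T0 ?n4.
Qed.

(** Up to a scalar the discriminant is S^(4 N^2) E(q)^12, so its n-th power turns [KK] into a
    monomial times E(q)^(N + 12 n); n will be chosen with ell dividing N + 12 n. *)
Lemma KK_val n : exists2 kp : k, kp != 0 &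
  (ta TW0 * tb TW0 * (ta TW0 - tb TW0)) ^+ n * KK =
  iota (fpsC kp * fpsX (r * N ^ 2 - Sg + 4 * N ^ 2 * n) * euler qq ^+ (N + 12 * n)).
Proof.
have [s [s0 Es]] : exists s : k, s != 0 /\ cF s = ksg.
  rewrite /ksg; elim: (index_iota 1 r.+1) => [|i l [s [s0 Es]]].
    by exists 1; rewrite oner_eq0 big_nil rmorph1.
  exists ((if (3 * i < N)%N then 1 else -1) * s); rewrite big_cons mulf_neq0 //; last first.
    by case: ifP => _; rewrite ?oppr_eq0 oner_eq0.
  by rewrite rmorphM Es; split=> //; congr (_ * _); case: ifP => _; rewrite ?rmorphN1 ?rmorph1.
have Sl : (Sg <= r * N ^ 2)%N.
  rewrite /Sg; apply: leq_trans (_ : \sum_(1 <= i < r.+1) N ^ 2 <= _)%N.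
    by rewrite !big_nat; apply: leq_sum => i ir; rewrite leq_sqr; have := rE; lia.
  by rewrite sum_nat_const_nat subn1.
have ET : TT W = - (iota (fpsX (N ^ 2)) * iota (euler qq) ^+ 3).
  by rewrite -[TT W]/(iota (T1 k N)) (T1_prod k N0) (rmorphN iota) (rmorphM iota) (rmorphXn iota).
exists (4%:R^-1 ^+ n * s * (-1) ^+ r).
  by rewrite !mulf_neq0 ?expf_neq0 ?invr_eq0 ?(nz4 k2) // ?oppr_eq0 ?oner_eq0.
rewrite disc_T /KK -Es ET.
rewrite (rmorphM iota) (rmorphM iota (fpsC _)) -[iota (fpsC _)]/(cF _) !(rmorphM cF) !(rmorphXn cF) rmorphN1 (rmorphXn iota).
have -> : iota (fpsX (r * N ^ 2 - Sg + 4 * N ^ 2 * n)) = iota (fpsX (N ^ 2)) ^+ (r + 4 * n) / iota (fpsX Sg).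
  apply: (mulIf (XF0 Sg)); rewrite divfK ?XF0 // -(rmorphM iota) -fpsXD -(rmorphXn iota) -fpsXM; congr (iota (fpsX _)).
  by nia.
have X0 := XF0 Sg; have E0 := EF0.
have -> : iota (euler qq) ^+ (N + 12 * n) = iota (euler qq) ^+ (3 * r + 1 + 12 * n) / iota (euler qq) ^+ r.
  apply: (mulIf (expf_neq0 r E0)); rewrite divfK ?expf_neq0 // -exprD; congr (_ ^+ _).
  by have := rE; lia.
move: X0 E0; move: (iota (fpsX Sg)) (iota (fpsX (N ^ 2))) (iota (euler qq)) (cF 4%:R^-1) (cF s) => x y z u v x0 z0.
have -> : - (y * z ^+ 3) = -1 * (y * z ^+ 3) by rewrite mulN1r.
have -> : (-1 * (y * z ^+ 3)) ^+ 4 = y ^+ 4 * z ^+ 12 by ring.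
rewrite [(u * _) ^+ n]exprMn [(y ^+ 4 * _) ^+ n]exprMn [(-1 * _) ^+ r]exprMn [(y * _) ^+ r]exprMn.
rewrite -[(z ^+ 3) ^+ r]exprM -[(z ^+ 12) ^+ n]exprM -[(y ^+ 4) ^+ n]exprM.
have -> : z ^+ (3 * r + 1 + 12 * n) = z ^+ (3 * r) * z * z ^+ (12 * n) by rewrite !exprD expr1.
rewrite [y ^+ (r + _)]exprD.
by field; rewrite x0 expf_neq0.
Qed.
End Conc.

End EtaQuotients.

(** * Operators at the primes dividing N and their passage through Weyl elements *)

Module LocalOperators.
Import TorsionPoints GaloisAction Uniformity TorsionTwist GaussSums EtaQuotients.

HB.saturate prod.

Section Local.
Variable R : comNzRingType.
(** g differs from the identity in the component of e only, so maps local to orthogonal idempotents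
    commute. *)
Definition loc (e : R) (g : R * R -> R * R) := exists a b c d : R, forall v,
  g v = (v.1 + e * (a * v.1 + b * v.2), v.2 + e * (c * v.1 + d * v.2)).
Lemma loc_comm e e' g h : e * e' = 0 -> loc e g -> loc e' h -> forall v, g (h v) = h (g v).
Proof.
move=> ee [a [b [c [d Eg]]]] [a' [b' [c' [d' Eh]]]] [x y]; rewrite !Eg !Eh /=.
have H z w u : z - w = (e * e') * u -> z = w by rewrite ee mul0r => /eqP; rewrite subr_eq0 => /eqP.
congr pair; [apply: (H _ _ ((a * (a' * x + b' * y) + b * (c' * x + d' * y)) - (a' * (a * x + b * y) + b' * (c * x + d * y))))
  |apply: (H _ _ ((c * (a' * x + b' * y) + d * (c' * x + d' * y)) - (c' * (a * x + b * y) + d' * (c * x + d * y))))]; ring.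
Qed.
Lemma loc_comp e g h : loc e g -> loc e h -> loc e (g \o h).
Proof.
move=> [a [b [c [d Eg]]]] [a' [b' [c' [d' Eh]]]].
exists (a + a' + e * (a * a' + b * c')), (b + b' + e * (a * b' + b * d')), (c + c' + e * (c * a' + d * c')), (d + d' + e * (c * b' + d * d')).
by move=> [x y]; rewrite /= Eg Eh /=; congr pair; ring.
Qed.
End Local.

Section Steps.
Variables (k F : fieldType) (N ell : nat) (T : TW k F N ell).
Notation V := (('Z_N * 'Z_N)%type : finZmodType).
Hypothesis sqf : forall p, prime p -> (p %| N)%N -> coprime p (N %/ p).
Variable zeta : k.
Hypothesis zP : N.-primitive_root zeta.
Let N1 := tN1 T.
Let oddN := toddN T.

Definition pdivs p := prime p && (p %| N)%N.
Lemma idem_ex p : exists e : 'Z_N, pdivs p -> [/\ e * e = e, p%:R * e = 0, (forall x, p%:R * x = 0 -> e * x = x) &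
   (forall C, e * C = C -> C != 0 -> exists C', e * C' = C' /\ C * C' = e)].
Proof.
have [/andP[pp pN]|h] := boolP (pdivs p); last by exists 0 => hp; case/negP: h.
by have [e He] := Zp_idem N1 pp pN (sqf pp pN); exists e.
Qed.
Definition idem p : 'Z_N := projT1 (cid (idem_ex p)).
Lemma idemP p : pdivs p -> [/\ (idem p) * (idem p) = (idem p), p%:R * (idem p) = 0, (forall x, p%:R * x = 0 -> (idem p) * x = x) &
   (forall C, (idem p) * C = C -> C != 0 -> exists C', (idem p) * C' = C' /\ C * C' = (idem p))].
Proof. exact: (projT2 (cid (idem_ex p))). Qed.
Lemma idem_orth p q : pdivs p -> pdivs q -> p != q -> (idem p) * (idem q) = 0.
Proof.
move=> hp hq pq; have [_ p0 _ _] := idemP hp; have [_ q0 _ _] := idemP hq.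
have pp := andP hp; have qq := andP hq.
have cpq : coprime p q by rewrite prime_coprime ?pp.1 // dvdn_prime2 ?pp.1 ?qq.1.
have [u v E _] := egcdnP q (prime_gt0 pp.1); rewrite (eqP cpq) in E.
have : (u * p)%:R * ((idem p) * (idem q)) = 0 by rewrite natrM -mulrA [p%:R * _]mulrA p0 mul0r mulr0.
by rewrite E natrD natrM mulrDl mul1r -mulrA [q%:R * _]mulrCA q0 !mulr0 add0r.
Qed.

Section AtP.
Variable p : nat.
Hypothesis hp : pdivs p.
Let pp : prime p. Proof. by case/andP: hp. Qed.
Let pN : (p %| N)%N. Proof. by case/andP: hp. Qed.
Let ee : (idem p) * (idem p) = (idem p). Proof. by case: (idemP hp). Qed.
Let pe : p%:R * (idem p) = 0. Proof. by case: (idemP hp). Qed.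
Let ep : forall x, p%:R * x = 0 -> (idem p) * x = x. Proof. by case: (idemP hp). Qed.

Definition eta : k := zeta ^+ (idem p).
Lemma etaP : p.-primitive_root eta.
Proof.
have E : eta ^+ p = 1.
  rewrite /eta -exprM; apply/eqP; rewrite -(prim_order_dvd zP) -(Zp_nat_eq0 _ N1) mulnC natrM natr_Zp.
  by rewrite pe.
have [d dP] := prim_order_exists (prime_gt0 pp) E.
case/primeP: pp => _ H dp; case/orP: (H _ dp) => /eqP E1; last by rewrite -E1.
rewrite E1 in dP; have := prim_expr_order dP; rewrite expr1 /eta => /eqP.
rewrite -(prim_order_dvd zP) -(Zp_nat_eq0 _ N1) natr_Zp => /eqP e0.
by have := red_e N1 pp pN (sqf pp pN) ep; rewrite e0 /red /= => /eqP; rewrite eq_sym oner_eq0.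
Qed.

Definition Up (x : 'F_p) : V -> V := Ush (inj (idem p) x).
Definition Sp : V -> V := Se (idem p).
Definition mulv (m : 'Z_N) (v : V) : V := (m * v.1, m * v.2).
Notation psi := (psi eta).
Notation iN := (inj (idem p)).

Lemma Up_loc x : loc (idem p) (Up x).
Proof. by exists 0, (x : nat)%:R, 0, 0 => -[u v]; rewrite /Up /Ush /inj /=; congr pair; ring. Qed.
Lemma Sp_loc : loc (idem p) Sp.
Proof. by exists (-1), 1, (-1), (-1) => -[u v]; rewrite /Sp /Se /=; congr pair; ring. Qed.
Lemma mulv_loc (x : 'F_p) : loc (idem p) (mulv (munit (idem p) x)).
Proof.
by exists (-1 + (x : nat)%:R), 0, 0, (-1 + (x : nat)%:R) => -[u v]; rewrite /mulv /munit /inj /=; congr pair; ring.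
Qed.
Lemma Rl_Sp : Rl T 0 Sp.
Proof. by case: (idemP hp) => h1 h2 h3 h4; apply: (G1_S pp pN). Qed.

(** The p-component of v is (0, 1), and u(t) w u(x) sends it to - x (t - 1/x, 1): a scalar times
    another upper unipotent translate of v. *)
Lemma Up_Sp_Up (v : V) (x t : 'F_p) : (idem p) * v.1 = 0 -> (idem p) * v.2 = (idem p) -> x != 0 ->
  Up t (Sp (Up x v)) = mulv (munit (idem p) (- x)) (Up (t - x^-1) v).
Proof.
case: v => v1 v2 /= h1 h2 x0;
have Et : iN (t - x^-1) = iN t - iN x^-1 by rewrite injD // injN.
have Ex : iN (- x) = - iN x by rewrite injN.
rewrite /Up /Sp /Se /mulv /munit /Ush Et Ex; cbn [fst snd].
have X2 y : iN y * v2 = iN y by rewrite /inj -mulrA h2.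
have X1 y : iN y * v1 = 0 by rewrite /inj -mulrA h1 mulr0.
have Xe y : (idem p) * iN y = iN y by rewrite inj_e.
have XX : iN x * iN x^-1 = (idem p) by rewrite -injM // mulfV // inj1.
congr pair.
  transitivity (v1 - (idem p) * v1 + iN x * v2 - ((idem p) * iN x) * v2 + (idem p) * v2 +
     (iN t * v2 - ((idem p) * iN t) * v2 - ((idem p) * iN t) * v1 - ((idem p) * iN t) * iN x * v2)); first by ring.
  rewrite !Xe h1 h2 X1 !X2 -mulrA X2.
  transitivity (v1 - (idem p) * v1 + iN t * v2 - ((idem p) * iN t) * v2 - iN x^-1 * v2 + ((idem p) * iN x^-1) * v2
     - iN x * v1 - iN x * iN t * v2 + (iN x * iN x^-1) * v2); last by ring.
  by rewrite XX !Xe h1 h2 X1 !X2 -mulrA X2; ring.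
transitivity (v2 - (idem p) * v2 - (idem p) * v1 - ((idem p) * iN x) * v2); first by ring.
by rewrite Xe h1 mulrDl mulrBl mul1r mulNr; ring.
Qed.
Lemma Up_Sp0 (v : V) t : (idem p) * v.1 = 0 -> Up t (Sp v) = Sp v.
Proof.
case: v => v1 v2 /= h1; rewrite /Up /Sp /Se /Ush /=; congr pair.
have -> : iN t * ((1 - (idem p)) * v2 - (idem p) * v1) = (iN t - (idem p) * iN t) * v2 - iN t * ((idem p) * v1) by ring.
by rewrite inj_e // subrr mul0r h1 mulr0 subr0 addr0.
Qed.
Lemma Up0 v : Up 0 v = v.
Proof. by case: v => v1 v2; rewrite /Up /Ush inj0 // mul0r addr0. Qed.

(** [opX] selects the exponents in the class of M modulo p; [opZ] is what it becomes after a Weyl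
    element, the first term leading to V_p and the sum to U_p. *)
Definition opX (M : 'Z_N) (B : V -> F) (v : V) : F :=
  \sum_(x : 'F_p) tc T (psi (- x * red p M)) * B (Up x v).
Definition opZ (M : 'Z_N) (B : V -> F) (v : V) : F :=
  p%:R * B (Sp v) + tc T (gam eta (red p M)) * \sum_(x : 'F_p) B (Up x v).
Definition scal (B : V -> F) := forall (x : 'F_p) w, x != 0 -> B (mulv (munit (idem p) x) w) = tc T (chi k x) * B w.

(* The sum over [t] turns the additive character sum at [p] into a Gauss sum, because
   [Up t (Sp (Up x v))] and [Up _ v] span the same line. *)
Lemma opX_sum M B v : scal B -> (idem p) * v.1 = 0 -> (idem p) * v.2 = (idem p) ->
  \sum_(t : 'F_p) \sum_(x : 'F_p) tc T (psi (- x * red p M)) * B (Up t (Sp (Up x v))) = opZ M B v.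
Proof.
move=> sB h1 h2; rewrite exchange_big /= (bigD1 0) //= /opZ; congr (_ + _).
  rewrite (eq_bigr (fun=> B (Sp v))) => [|t _]; last first.
    by rewrite Up0 Up_Sp0 // oppr0 mul0r (_ : psi 0 = 1) // (rmorph1 (tc T)) mul1r.
  by rewrite sumr_const card_Fp // mulr_natl.
rewrite /gam rmorph_sum /= [in RHS](bigD1 0) //= oppr0 (chi0 p) mulr0 rmorph0 add0r mulr_suml.
apply: eq_bigr => x x0; rewrite mulr_sumr [RHS](reindex (fun t => t - x^-1)) /=; last first.
  by exists (fun t => t + x^-1) => t _; rewrite ?addrK ?subrK.
by apply: eq_bigr => t _; rewrite Up_Sp_Up // sB ?oppr_eq0 // rmorphM mulrA.
Qed.
End AtP.

Definition fixv (ps : seq nat) (v : V) := forall p, p \in ps -> (idem p) * v.1 = 0 /\ (idem p) * v.2 = (idem p).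
Definition nestX M ps (B : V -> F) := foldr (fun p B => opX p M B) B ps.
Definition nestZ M ps (B : V -> F) := foldl (fun B p => opZ p M B) B ps.

Lemma nestX_loc M ps B q g : all pdivs ps -> pdivs q -> q \notin ps -> loc (idem q) g ->
  forall v, nestX M ps B (g v) = nestX M ps (B \o g) v.
Proof.
elim: ps => [|p ps IH] //= /andP[hp hps] hq; rewrite inE negb_or => /andP[pq qps] lg v.
rewrite /opX; apply: eq_bigr => x _; rewrite -IH //.
by rewrite (loc_comm (idem_orth hp hq _) (Up_loc x) lg) // eq_sym.
Qed.
Lemma nestX_lin M ps (I : Type) (s : seq I) (c : I -> F) (B : I -> V -> F) v :
  nestX M ps (fun w => \sum_(i <- s) c i * B i w) v = \sum_(i <- s) c i * nestX M ps (B i) v.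
Proof.
elim: ps v => [|p ps IH] //= v; rewrite /opX (eq_bigr _ (fun x _ => congr1 _ (IH _))).
under eq_bigr do rewrite mulr_sumr; rewrite exchange_big; apply: eq_bigr => i _.
by rewrite mulr_sumr; apply: eq_bigr => x _; rewrite mulrCA.
Qed.
Lemma eq_nestX M ps (B B' : V -> F) : B =1 B' -> nestX M ps B =1 nestX M ps B'.
Proof.
by move=> E; elim: ps => [|p ps IH] //= v; apply: eq_bigr => x _; rewrite IH.
Qed.

Lemma nestX_opZ M ps p B v : all pdivs ps -> pdivs p -> p \notin ps ->
  opZ p M (nestX M ps B) v = nestX M ps (opZ p M B) v.
Proof.
move=> hps hp pps.
pose c (o : option 'F_p) : F := if o is Some _ then tc T (gam (eta p) (red p M)) else p%:R.
pose g (o : option 'F_p) : V -> V := if o is Some x then Up x else Sp p.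
have lg o : loc (idem p) (g o) by case: o => [x|]; [exact: Up_loc|exact: Sp_loc].
pose s := None :: map Some (index_enum 'F_p).
have E (B' : V -> F) w : opZ p M B' w = \sum_(o <- s) c o * B' (g o w).
  by rewrite /opZ /s big_cons big_map mulr_sumr.
rewrite E (@eq_nestX M ps (opZ p M B) _ (fun w => E B w)) nestX_lin.
by apply: eq_bigr => o _; rewrite (nestX_loc _ _ hps hp pps).
Qed.

(** Induction on the primes. The hypothesis is required for all f because at p it is used at f
    composed with u(t) and the Weyl element, for every t; summing over t then turns [opX] into [opZ]
    by [opX_sum]. *)
Lemma nest_main M ps (A : (V -> V) -> V -> F) v : uniq ps -> all pdivs ps -> fixv ps v ->
  (forall p f g, p \in ps -> Rl T 0 f -> Rl T 0 g -> loc (idem p) g -> A f \o g =1 A (f \o g)) ->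
  (forall p f, p \in ps -> Rl T 0 f -> scal p (A f)) ->
  (forall f, Rl T 0 f -> nestX M ps (A f) v = 0) -> forall f, Rl T 0 f -> nestZ M ps (A f) v = 0.
Proof.
elim: ps A => [|p ps IH] A /=; first by move=> _ _ _ _ _; apply.
move=> /andP[pps ups] /andP[hp hps] fv cA sA H f rf.
have [v1 v2] := fv p (mem_head _ _).
apply: (IH (fun f => opZ p M (A f))) => // [q qps|q f' g qps rf' rg lg w|q f' qps rf' x w x0|f' rf'].
- by apply: fv; rewrite inE qps orbT.
- have hq := allP hps q qps; have npq : p != q by apply: contraNneq pps => ->.
  have o := idem_orth hp hq npq; have qq : q \in p :: ps by rewrite inE qps orbT.
  rewrite /= /opZ (loc_comm o (Sp_loc p) lg) -(cA q f' g qq rf' rg lg (Sp p w)); congr (_ + _ * _).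
  by apply: eq_bigr => x _; rewrite (loc_comm o (Up_loc x) lg) -(cA q f' g qq rf' rg lg (Up x w)).
- have hq := allP hps q qps; have npq : p != q by apply: contraNneq pps => ->.
  have o := idem_orth hp hq npq; have qq : q \in p :: ps by rewrite inE qps orbT.
  have lm := mulv_loc x.
  rewrite /opZ (loc_comm o (Sp_loc p) lm) sA // mulrDr mulrCA; congr (_ + _).
  rewrite [RHS]mulrCA; congr (_ * _); rewrite mulr_sumr.
  by apply: eq_bigr => y _; rewrite (loc_comm o (Up_loc y) lm) sA.
have p1 := mem_head p ps.
rewrite -nestX_opZ // -opX_sum //; last first.
  by move=> x w x0; rewrite (nestX_loc _ _ hps hp pps (mulv_loc x)) (@eq_nestX M ps _ (fun w => tc T (chi k x) * A f' w));
    [have := nestX_lin M ps [:: tt] (fun=> tc T (chi k x)) (fun=> A f') w; rewrite big_seq1 => <-; apply: eq_nestX => u; rewrite big_seq1|move=> u; exact: sA].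
rewrite big1 // => t _.
have rg : Rl T 0 (Up t \o Sp p) by have := Rl_comp (@G1_U _ _ _ _ T _ : Rl T 0 (Up t)) (Rl_Sp hp); rewrite addn0.
have lg := loc_comp (Up_loc t) (Sp_loc p).
have rfg : Rl T 0 (f' \o (Up t \o Sp p)) by have := Rl_comp rf' rg; rewrite addn0.
rewrite -[RHS](H _ rfg) /opX; apply: eq_bigr => x _; congr (_ * _).
rewrite -[Up t (Sp p _)]/((Up t \o Sp p) (Up x v)) (nestX_loc _ _ hps hp pps lg).
by apply: eq_nestX => u; exact: (cA p f' _ p1 rf' rg lg).
Qed.
End Steps.

End LocalOperators.

(** * Generating series of partitions, and the quadratic character of 3 *)

Module PartitionSeries.
Import PowerSeries FormalSums Theta TripleProduct ProductFormula GaussSums.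

Section Series.
Variable R : comNzRingType.

Lemma gs_lin (J : Type) (s : seq J) (I : eqType) (c : J -> R) (w : J -> I -> R) (x : I -> nat) :
  \sum_(j <- s) fpsC (c j) * gs (w j) x = gs (fun i => \sum_(j <- s) c j * w j i) x.
Proof.
apply: fpsP => e; rewrite fcoef_sum (eq_bigr _ (fun j _ => fcoefCM _ _ _)) /gs /=.
case: pselect => H; last by rewrite big1 // => j _; rewrite mulr0.
by rewrite exchange_big; apply: eq_bigr => j _; rewrite mulr_sumr.
Qed.

(** Restriction of a sum to the image of an injection, the predicate acting as a weight 0 or 1. *)
Lemma gs_sub (I J : eqType) (h : J -> I) (D : pred I) (w : I -> R) (x : I -> nat) :
  injective h -> (forall i, D i -> exists j, h j = i) -> (forall j, D (h j)) -> proper x ->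
  gs (fun i => (D i)%:R * w i) x = gs (w \o h) (x \o h).
Proof.
move=> hI hD Dh px; apply: fpsP => e; have [s us] := proper_le px e => hs.
pose g i : option J := if pselect (exists j, h j = i) is left H then Some (projT1 (cid H)) else None.
have gK : ocancel g h by move=> i; rewrite /g; case: pselect => //= H; exact: (projT2 (cid H)).
have hg j : g (h j) = Some j.
  rewrite /g; case: pselect => [H|[]]; last by exists j.
  by congr Some; apply: hI; exact: (projT2 (cid H)).
rewrite (@gsE _ _ _ _ e s) //; last by move=> i xi; apply: hs; rewrite xi.
rewrite (@gsE _ _ _ _ e (pmap g s)); last 2 first.
- by apply: (pmap_uniq gK).
- by move=> j xj; rewrite mem_pmap; apply/mapP; exists (h j); rewrite ?hg //; apply: hs; rewrite /= in xj; rewrite xj.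
rewrite big_mkcond [RHS]big_mkcond big_pmap; apply: eq_bigr => i _.
case E: (g i) => [j|] /=.
  have <- : h j = i by have := gK i; rewrite E.
  by rewrite Dh mul1r.
case: ifP => // _; case Di: (D i); last by rewrite mul0r.
by have [j Ej] := hD i Di; move: E; rewrite -Ej hg.
Qed.

Lemma feqm_prod1 K (s : seq nat) (f : nat -> fps R) : (forall i, i \in s -> feqm K (f i) 1) -> feqm K (\prod_(i <- s) f i) 1.
Proof.
elim: s => [|i s IH] h; first by rewrite big_nil.
rewrite big_cons -[X in feqm _ _ X]mulr1; apply: feqmM; first by apply: h; rewrite mem_head.
by apply: IH => j js; apply: h; rewrite inE js orbT.
Qed.
End Series.

Section PartGf.
Variable k : fieldType.
Variables (c : k) (a : nat).
Hypothesis a0 : (0 < a)%N.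
Local Notation q := (fpsC c * fpsX a).

Lemma q_exp n : q ^+ n = fpsC (c ^+ n) * fpsX (a * n).
Proof. by rewrite exprMn -rmorphXn fpsXM. Qed.
Lemma q_coef0 : fcoef q 0 = 0. Proof. by rewrite fcoefCM fpsX_coef0 // mulr0. Qed.
Lemma q_small K n : (K <= a * n)%N -> feqm K (q ^+ n) 0.
Proof. by move=> le i iK; rewrite q_exp fcoefCM /= ltn_eqF ?mulr0 //; exact: leq_trans iK le. Qed.

Definition wt (n : nat) (f : {ffun 'I_n -> 'I_n.+1}) := (\sum_(i < n) i.+1 * f i)%N.

(** Part sizes and multiplicities are cut at n as in [partition_count]; the remaining factors 1 -
    q^(i (n + 1)) are 1 modulo S^(a (n + 1)). *)
Lemma part_fin n : feqm (a * n.+1) (euler q * \sum_(f : {ffun 'I_n -> 'I_n.+1}) q ^+ wt f) 1.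
Proof.
have E1 : feqm (a * n.+1) (euler q) (\prod_(i < n) (1 - q ^+ i.+1)).
  apply: (@feqm_trans _ _ _ (\prod_(i < a * n.+1) (1 - q ^+ i.+1))).
    have := @pinfE _ q q (a * n.+1) (a * n.+1) q_coef0 (leqnn _); rewrite -/(euler q).
    by rewrite (eq_bigr (fun i : 'I_(a * n.+1) => 1 - q ^+ i.+1)) // => i _; rewrite exprSr.
  have le : (n <= a * n.+1)%N by nia.
  rewrite -(big_mkord xpredT (fun i => 1 - q ^+ i.+1)) (big_cat_nat _ le) //= big_mkord -[X in feqm _ _ X]mulr1.
  apply: feqmM => //; apply: feqm_prod1 => i; rewrite mem_index_iota => /andP[ni _].
  rewrite -[X in feqm _ _ X](subr0 (1 : fps k)); apply: feqmD => //; apply: feqmN; apply: q_small; nia.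
apply: (@feqm_trans _ _ _ (\prod_(i < n) (1 - q ^+ i.+1) * \sum_(f : {ffun 'I_n -> 'I_n.+1}) q ^+ wt f)).
  exact: feqmM.
rewrite (eq_bigr (fun f : {ffun 'I_n -> 'I_n.+1} => \prod_(i < n) (q ^+ (i.+1 * f i)))); last first.
  by move=> f _; rewrite prodrXr.
rewrite -(bigA_distr_bigA (fun (i : 'I_n) (j : 'I_n.+1) => q ^+ (i.+1 * j))) -big_split /=.
rewrite (eq_bigr (fun i : 'I_n => 1 - q ^+ (i.+1 * n.+1))); last first.
  have S (x : fps k) : (1 - x) * \sum_(j < n.+1) x ^+ j = 1 - x ^+ n.+1.
    rewrite -[X in _ = X - _](expr1n _ n.+1) subrXX; congr (_ * _).
    by apply: eq_bigr => j _; rewrite expr1n mul1r.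
  by move=> i _; rewrite exprM -S; congr (_ * _); apply: eq_bigr => j _; rewrite exprM.
rewrite -(big_mkord xpredT (fun i => 1 - q ^+ (i.+1 * n.+1))).
apply: feqm_prod1 => i _; rewrite -[X in feqm _ _ X](subr0 (1 : fps k)); apply: feqmD => //; apply: feqmN; apply: q_small; nia.
Qed.

Lemma part_gf : euler q * gs (fun n : nat => (partition_count n)%:R * c ^+ n) (fun n => a * n)%N = 1.
Proof.
have U := euler_unit q_coef0.
suff -> : gs (fun n : nat => (partition_count n)%:R * c ^+ n) (fun n => a * n)%N = (euler q)^-1 by rewrite divrr.
have H n i : (i < a * n.+1)%N -> fcoef (euler q)^-1 i = \sum_(f : {ffun 'I_n -> 'I_n.+1}) fcoef (q ^+ wt f) i.
  move=> il; have := @part_fin n; set S := \sum_(f : _) _ => h.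
  have : feqm (a * n.+1) ((euler q)^-1 * (euler q * S)) ((euler q)^-1 * 1) by apply: feqmM.
  by rewrite mulKr // mulr1 => /(_ i il) <-; rewrite /S fcoef_sum.
apply: fpsP => e; have [/dvdnP[n En]|nd] := boolP (a %| e)%N; last first.
  rewrite gs_coef_out => [|i Ei]; last by rewrite -Ei dvdn_mulr in nd.
  rewrite (H e); last by nia.
  rewrite big1 // => f _; rewrite q_exp fcoefCM /=; case: eqP => [E|]; last by rewrite mulr0.
  by rewrite E dvdn_mulr in nd.
rewrite En mulnC (@gs_coef_one _ _ _ (fun n => a * n)%N n) => [|i /eqP]; last by rewrite eqn_pmul2l // => /eqP.
rewrite (H n); last by rewrite ltn_pmul2l.
rewrite (eq_bigr (fun f => if wt f == n then c ^+ n else 0)) => [|f _]; last first.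
  by rewrite q_exp fcoefCM /= eqn_pmul2l // eq_sym; case: eqP => [->|_]; rewrite ?mulr1 ?mulr0.
rewrite -big_mkcond /= sumr_const mulr_natl; congr (_ *+ _).
by rewrite /partition_count; apply: eq_card => f; rewrite !inE.
Qed.
End PartGf.

Section Gauss3.
Variables (p r : nat).
Hypothesis pp : prime p.
Hypothesis Nr : p = (2 * r).+1.
Hypothesis p3 : (3 < p)%N.

(** Gauss's lemma for 3: exactly b of the numbers 3 i with i <= r lie strictly between r and p, for
    both shapes of p. The sign is computed over the integers and then applied over F_p. *)
Lemma chi3 (R : comNzRingType) (b : nat) : (p = 6 * b + 1)%N \/ (p = 6 * b - 1)%N -> chi R (3%:R : 'F_p) = (-1) ^+ b.
Proof.
move=> Eb; have p1 := prime_gt1 pp; have op : odd p by rewrite Nr /= mul2n odd_double.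
have n3 : (3%:R : 'F_p) != 0.
  by rewrite Fp_nat_eq0 //; apply/negP => /dvdn_leq; lia.
have h : hp p = r by rewrite /hp Nr; lia.
have u3 : (3%:R : 'Z_p) \is a GRing.unit by rewrite unitZpE // coprime_sym prime_coprime //; apply/negP => /prime_nt_dvdP; lia.
have [s Hs] := half_prod p1 Nr u3.
have S1 : (-1 : int) ^+ s = (-1) ^+ b.
  pose g (x : 'Z_p) : int := if hsys r x then 1 else -1.
  have := (Hs _ g).1 _; rewrite (@eq_big_nat _ _ _ 1 r.+1 (fun i => g i%:R) (fun=> 1)); last first.
    by move=> i ir; rewrite /g /hsys val_Zp_nat // modn_small ?ifT //; lia.
  rewrite big1_eq mulr1 => <-; last first.
    by move=> x x0; rewrite /g (hsysN p1 Nr x0); case: (hsys r x); rewrite ?opprK.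
  rewrite (eq_big_nat _ _ (F2 := fun i => if (r < 3 * i < p)%N then -1 else 1)); last first.
    move=> i ir; rewrite /g -natrM /hsys val_Zp_nat //.
    case: (ltnP (3 * i) p) => l3.
      have i0 : (0 < 3 * i)%N by lia.
      by rewrite modn_small // andbT i0 ltnNge /=; case: (3 * i <= r)%N.
    rewrite andbF (_ : 3 * i = p + (3 * i - p))%N; last lia.
    have n0 : (3 * i != p)%N by apply/negP => /eqP E; have := pp; rewrite -E => /primePns; lia.
    by rewrite modnDl modn_small ?ifT //; lia.
  have [u [v [Eu uv vr]]] : exists u v, [/\ (v = u + b)%N, (forall i, (r < 3 * i < p)%N = (u <= i < v)%N) & (0 < u)%N && (v <= r.+1)%N].
    case: Eb => Eb; [exists b.+1, (b.+1 + b)%N|exists b, (b + b)%N]; split=> //; try (by move=> i; lia); lia.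
  case/andP: vr => u0 vr.
  have ur : (u <= r.+1)%N by lia.
  have uv' : (u <= v)%N by lia.
  rewrite (big_cat_nat u0 ur) (big_cat_nat uv' vr) /=.
  rewrite big_nat big1 => [|i il]; last by rewrite uv ifF //; lia.
  rewrite mul1r [X in _ * X]big_nat [X in _ * X]big1 => [|i il]; last by rewrite uv ifF //; lia.
  rewrite mulr1 big_nat (eq_bigr (fun=> -1)) => [|i il]; last by rewrite uv ifT //; lia.
  by rewrite -big_nat prodr_const_nat Eu addKn.
have S2 : (3%:R : 'F_p) ^+ r = (-1) ^+ s.
  pose g (x : 'Z_p) : 'F_p := (x : nat)%:R.
  have gn n : g n%:R = n%:R by apply: (red_nat p1 pp (dvdnn p)).
  have := (Hs _ g).1 _; rewrite (eq_bigr (fun i => 3%:R * g i%:R)) => [|i _]; last by rewrite -natrM !gn natrM.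
  rewrite big_split /= prodr_const_nat subn1 /= => H; apply: (mulIf _ (H _)).
    rewrite prodf_seq_neq0; apply/allP => i; rewrite mem_index_iota /= gn Fp_nat_eq0 // => ir.
    by apply/negP => /dvdn_leq; lia.
  by move=> x _; rewrite /g; exact: (redN p1 pp (dvdnn p)).
rewrite /chi (negPf n3) h S2.
have : s = odd b by move: S1; rewrite -[RHS]signr_odd; case: s {Hs S2}; case: (odd b).
move=> ->; rewrite -[in RHS]signr_odd; case: (odd b); rewrite ?expr0 ?eqxx // expr1.
by rewrite (negPf (N1p op pp (dvdnn p))).
Qed.
End Gauss3.

End PartitionSeries.

(** * Expansions at the Weyl translates and the transported vanishing *)

Module Evaluation.
Import PowerSeries FormalSums Theta TripleProduct ProductFormula Hasse TorsionPoints GaloisAction Uniformity TorsionTwist GaussSums EtaQuotients LocalOperators PartitionSeries.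

HB.saturate prod.

(** The coefficient of q^(y/24) in the shifted partition series; [val24] reads it at mu / d^2, which
    is how U and V move indices. *)
Definition fsh (y : int) : nat := if (24 %| y + 1)%Z then p_int ((y + 1) %/ 24)%Z else 0.
Definition val24 (d : nat) (mu : int) : nat := if ((d ^ 2)%:Z %| mu)%Z then fsh (mu %/ (d ^ 2)%:Z)%Z else 0.
(* The signed integer with [6 * b6 p + 1 = p] or [- p]. *)
Definition b6 (p : nat) : int := if (p %% 6 == 1)%N then (p %/ 6)%:Z else - ((p.+1) %/ 6)%:Z.
(** The composition law that makes 6 B6 + 1 multiplicative; its value is the product of the primes
    up to sign. *)
Definition B6 (ps : seq nat) : int := foldr (fun p B => 6 * b6 p * B + b6 p + B) 0 ps.

Lemma B6E ps : 6 * B6 ps + 1 = \prod_(p <- ps) (6 * b6 p + 1).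
Proof. by elim: ps => [|p ps IH]; rewrite ?big_nil // big_cons -IH /=; ring. Qed.
Lemma b6_sq p : coprime p 6 -> (6 * b6 p + 1) ^+ 2 = (p ^ 2)%:Z.
Proof.
move=> c6; have n2 : ~~ (2 %| p)%N.
  by move: c6; rewrite (_ : 6 = 2 * 3)%N // coprimeMr coprime_sym prime_coprime // => /andP[].
have n3 : ~~ (3 %| p)%N.
  by move: c6; rewrite (_ : 6 = 2 * 3)%N // coprimeMr => /andP[_]; rewrite coprime_sym prime_coprime.
rewrite /b6; case: ifP => E.
  have -> : 6 * (p %/ 6)%:Z + 1 = p%:Z by lia.
  by rewrite -mulnn PoszM expr2.
have -> : 6 * - (p.+1 %/ 6)%:Z + 1 = - p%:Z by lia.
by rewrite sqrrN -mulnn PoszM expr2.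
Qed.

(* The value at [d = 1] is the expansion of the product of the [U_p + lam p V_p], where [v d] records the coefficient at index [mu / d ^ 2]. *)
Fixpoint sm (k : comNzRingType) (lam : nat -> k) (ps : seq nat) (v : nat -> k) (d : nat) : k :=
  if ps is p :: ps' then sm lam ps' v d + lam p * sm lam ps' v (p * d)%N else v d.
Lemma sm_rcons (k : comNzRingType) (lam : nat -> k) ps p v d :
  sm lam (rcons ps p) v d = sm lam ps v d + lam p * sm lam ps v (p * d)%N.
Proof.
elim: ps d => [|q ps IH] d //=; rewrite !IH mulnCA.
by move: (sm lam ps v _) (sm lam ps v _) (sm lam ps v _) (sm lam ps v _) => x y z w; ring.
Qed.

Section Eval.
Variables (k F : fieldType) (N ell : nat) (T : TW k F N ell).
Notation V := (('Z_N * 'Z_N)%type : finZmodType).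
Hypothesis pl : prime ell.
Hypothesis chl : ell \in [pchar k].
Hypothesis cN6 : coprime N 6.
Hypothesis cNl : coprime N ell.
Hypothesis sqf : forall p, prime p -> (p %| N)%N -> coprime p (N %/ p).
Variable zeta : k.
Hypothesis zP : N.-primitive_root zeta.
Variable iota : {rmorphism fps k -> F}.
Hypothesis iota0 : forall x, iota x = 0 -> x = 0.
Hypothesis tcE : forall c, tc T c = iota (fpsC c).
Hypothesis tD_iota : forall x, tD T (iota x) = iota (fderiv x).
Variables (KK : F) (E3 y0 : nat) (Eq : fps k).
Hypothesis KK0 : KK != 0.
Hypothesis E24 : (N %| 24 * E3 + 1)%N.
Hypothesis Eq0 : Eq != 0.
Hypothesis YYv : forall j : nat, YY T (j%:R, 1) * iota (euler (fpsC (zeta ^+ j) * fpsX (8 * N))) = KK * tc T (zeta ^+ (j * E3)).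
Hypothesis VKK : forall n, exists2 kp : k, kp != 0 & (ta T * tb T * (ta T - tb T)) ^+ n * KK =
  iota (fpsC kp * fpsX (y0 + 4 * N ^ 2 * n) * Eq ^+ (N + 12 * n)).

Let N1 := tN1 T.
Let oddN := toddN T.
Notation idem := (@LocalOperators.idem k F N ell T sqf).
Notation eta := (@LocalOperators.eta k F N ell T sqf zeta).
Notation Up := (@LocalOperators.Up k F N ell T sqf).
Notation Sp := (@LocalOperators.Sp k F N ell T sqf).
Notation scal := (@LocalOperators.scal k F N ell T sqf).
Notation opX := (@LocalOperators.opX k F N ell T sqf zeta).
Notation opZ := (@LocalOperators.opZ k F N ell T sqf zeta).
Notation nestX := (@LocalOperators.nestX k F N ell T sqf zeta).
Notation nestZ := (@LocalOperators.nestZ k F N ell T sqf zeta).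
Notation etaP := (@LocalOperators.etaP k F N ell T sqf zeta zP _).
Notation idemP := (@LocalOperators.idemP k F N ell T sqf _).
Notation idem_orth := (@LocalOperators.idem_orth k F N ell T sqf _ _).
Notation Rl_Sp := (@LocalOperators.Rl_Sp k F N ell T sqf _).
Notation Sp_loc := (@LocalOperators.Sp_loc k F N ell T sqf).
Notation inj p := (inj (idem p)).
Notation psi p := (psi (eta p)).
Notation pdv := (pdivs N).
Notation cF := (tc T).

Lemma N_gt0 : (0 < N)%N. Proof. exact: ltnW N1. Qed.
Lemma zeta_neq0 : zeta != 0.
Proof. by rewrite (prim_root_eq0 zP) -lt0n N_gt0. Qed.
Definition zc (x : 'Z_N) : k := zeta ^+ x.
Lemma zc_nat n : zc n%:R = zeta ^+ n.
Proof. by rewrite /zc val_Zp_nat // (prim_expr_mod zP). Qed.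
Lemma zcD x y : zc (x + y) = zc x * zc y.
Proof. by rewrite -[x]natr_Zp -[y]natr_Zp -natrD !zc_nat exprD. Qed.
Lemma zc0 : zc 0 = 1. Proof. by rewrite (zc_nat 0). Qed.
Lemma zcMn x n : zc (x * n%:R) = zc x ^+ n.
Proof. by rewrite -[x]natr_Zp -natrM !zc_nat exprM. Qed.
Lemma zc_neq0 x : zc x != 0.
Proof.
by apply/negP => /eqP E; have := zcD x (- x); rewrite E mul0r subrr zc0 => /eqP; rewrite oner_eq0.
Qed.

Section AtP.
Variable p : nat.
Hypothesis hp : pdv p.
Let pp : prime p. Proof. by case/andP: hp. Qed.
Let pN : (p %| N)%N. Proof. by case/andP: hp. Qed.
Let ee : idem p * idem p = idem p. Proof. by case: (idemP hp). Qed.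
Let pe : p%:R * idem p = 0. Proof. by case: (idemP hp). Qed.
Let ep : forall x, p%:R * x = 0 -> idem p * x = x. Proof. by case: (idemP hp). Qed.

Lemma pk0 : (p%:R : k) != 0.
Proof. by apply: contra (tkN T) => /eqP E; rewrite -(divnK pN) natrM E mulr0. Qed.
Lemma p3 : (3 < p)%N.
Proof.
have c6 : coprime p 6 by exact: coprime_dvdl pN cN6.
by have := prime_gt1 pp; move: c6; move: p => [|[|[|[|q]]]].
Qed.
Lemma zc_inj (z : 'F_p) : zc (inj p z) = psi p z.
Proof.
by rewrite /GaussSums.inj -[idem p]natr_Zp -natrM zc_nat /GaussSums.psi /LocalOperators.eta -exprM mulnC.
Qed.
Lemma zc_injM (x : 'F_p) y : zc (inj p x * y) = psi p (x * red p y).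
Proof.
rewrite -zc_inj injM // inj_red // mulrA; congr (zc (_ * _)).
by rewrite mulrC inj_e.
Qed.

(** Here j enters only through [zc (j * nu i)]: translating j by [inj p z] multiplies the terms by
    additive characters, so the operators at p become filters on nu modulo p. *)
Definition Gf (I : eqType) (w : I -> k) (nu : I -> 'Z_N) (x : I -> nat) (j : 'Z_N) : fps k :=
  gs (fun i => w i * zc (j * nu i)) x.

Lemma eq_Gf (I : eqType) (w w' : I -> k) (nu : I -> 'Z_N) (x : I -> nat) j : w =1 w' -> Gf w nu x j = Gf w' nu x j.
Proof. by move=> E; apply: eq_gs => // i; rewrite E. Qed.
Lemma GfZ (I : eqType) c (w : I -> k) (nu : I -> 'Z_N) (x : I -> nat) j :
  cF c * iota (Gf w nu x j) = iota (Gf (fun i => c * w i) nu x j).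
Proof. by rewrite tcE -rmorphM -gsZ; congr (iota _); apply: eq_gs => // i; rewrite mulrA. Qed.
Lemma GfD (I : eqType) (w w' : I -> k) (nu : I -> 'Z_N) (x : I -> nat) j :
  iota (Gf w nu x j) + iota (Gf w' nu x j) = iota (Gf (fun i => w i + w' i) nu x j).
Proof.
rewrite -rmorphD; apply: (congr1 iota).
have := gs_lin [:: true; false] (fun=> 1) (fun (b : bool) i => (if b then w i else w' i) * zc (j * nu i)) x.
rewrite !big_cons big_nil addr0 rmorph1 !mul1r /Gf => ->.
by apply: eq_gs => // i; rewrite !big_cons big_nil addr0 !mul1r mulrDl.
Qed.

(** Orthogonality of the additive characters of F_p. *)
Lemma Gf_filter (I : eqType) (w : I -> k) (nu : I -> 'Z_N) (x : I -> nat) j (M : 'F_p) :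
  \sum_(z : 'F_p) cF (psi p (- z * M)) * iota (Gf w nu x (j + inj p z)) =
  iota (Gf (fun i => p%:R * (red p (nu i) == M)%:R * w i) nu x j).
Proof.
rewrite (eq_bigr (fun z => iota (fpsC (psi p (- z * M)) * Gf w nu x (j + inj p z)))); last first.
  by move=> z _; rewrite tcE rmorphM.
rewrite -rmorph_sum gs_lin; apply: (congr1 iota); apply: eq_gs => // i.
transitivity (w i * zc (j * nu i) * \sum_(z : 'F_p) psi p (z * (red p (nu i) - M))).
  rewrite mulr_sumr; apply: eq_bigr => z _.
  rewrite [(j + _) * _]mulrDl zcD zc_injM mulrBr psiD ?(etaP hp) // mulNr; ring.
rewrite (psi_sum pp (etaP hp)) subr_eq0.
by case: eqP => _; rewrite ?mulr1 ?mulr0 ?mul0r // mulrC mulrA.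
Qed.
Lemma Gf_filter0 (I : eqType) (w : I -> k) (nu : I -> 'Z_N) (x : I -> nat) j :
  \sum_(z : 'F_p) iota (Gf w nu x (j + inj p z)) =
  iota (Gf (fun i => p%:R * (red p (nu i) == 0)%:R * w i) nu x j).
Proof.
rewrite -Gf_filter; apply: eq_bigr => z _; rewrite mulr0 (_ : psi p 0 = 1) //.
by rewrite rmorph1 mul1r.
Qed.
Lemma Up_pt (x : 'F_p) j : Up x (j, 1) = (j + inj p x, 1) :> V.
Proof. by rewrite /LocalOperators.Up /Ush /= mulr1. Qed.

Lemma mulv_Rl f m (w : V) : Rl T 0 f -> f (mulv m w) = mulv m (f w).
Proof.
move=> rf; case: w => w1 w2; rewrite /mulv /= -(MnE w1 w2 m) (RlMn rf).
by case: (f (w1, w2)) => u1 u2; rewrite MnE.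
Qed.
Lemma chi_tc (x : 'F_p) : chi F x = cF (chi k x).
Proof. by rewrite /chi; case: ifP => _; rewrite ?rmorph0 //; case: ifP => _; rewrite ?rmorph1 ?rmorphN1. Qed.
Lemma YY_scal : scal p (YY T).
Proof. by move=> x w x0; rewrite -chi_tc; exact: (@YY_scale _ _ _ _ T p (idem p) pp pN (sqf pp pN) ee pe ep x w x0). Qed.
Lemma scal_comp B f : Rl T 0 f -> scal p B -> scal p (B \o f).
Proof. by move=> rf sB x w x0; rewrite /= mulv_Rl // sB. Qed.
Lemma scal_inv B : scal p B -> scal p (fun v => (B v)^-1).
Proof.
move=> sB x w x0; rewrite sB // invfM; congr (_ * _).
have := congr1 cF (chi_sq k x0); rewrite rmorphM rmorph1 => E.
by rewrite -[LHS]mul1r -E mulfK //; apply: contra_eq_neq E => ->; rewrite mul0r eq_sym oner_eq0.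
Qed.

Lemma gam_neq0 (M : 'F_p) : M != 0 -> gam (eta p) M != 0.
Proof.
move=> M0; rewrite (gamE N1 oddN pp pN (sqf pp pN)) //.
have nzc (x : 'F_p) : x != 0 -> chi k x != 0.
  by move=> x0; rewrite /chi (negPf x0); case: ifP => _; rewrite ?oppr_eq0 oner_eq0.
rewrite mulf_neq0 ?nzc //; have := gam_sq N1 oddN pp pN (sqf pp pN) (etaP hp) (tk2 T).
by apply: contra_eq_neq => ->; rewrite mul0r eq_sym mulf_neq0 ?pk0 ?nzc // oppr_eq0 oner_eq0.
Qed.
Lemma F24 : (24%:R : 'F_p) != 0.
Proof.
rewrite Fp_nat_eq0 // (_ : 24 = 2 * (2 * (2 * 3)))%N // !Euclid_dvdM // !dvdn_prime2 //.
by have := p3; lia.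
Qed.
(** The pentagonal exponents satisfy 24 nu = (6 n - 1)^2, so a class M with 24 M a nonresidue
    contains none of them. This supplies a vanishing relation for 1 / YY that can be transported. *)
Lemma Mn_ex : exists M : 'Z_N, red p M != 0 /\ chi k (24%:R * red p M) = -1.
Proof.
have [x [x0 Ex]] := nonres N1 oddN pp pN (sqf pp pN).
exists (inj p (x / 24%:R)); rewrite (red_inj N1 pp pN (sqf pp pN) ep); split.
  by rewrite mulf_neq0 // invr_eq0 F24.
by rewrite mulrCA mulfV ?F24 // mulr1 /chi (negPf x0) Ex (negPf (N1p oddN pp pN)).
Qed.
End AtP.

Lemma Mn_ex' p : exists M : 'Z_N, pdv p -> red p M != 0 /\ chi k (24%:R * red p M) = -1.
Proof.
have [hp|h] := boolP (pdv p); last by exists 0.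
by have [M HM] := Mn_ex hp; exists M.
Qed.
Definition Mn p : 'Z_N := projT1 (cid (Mn_ex' p)).
Lemma MnP p : pdv p -> red p (Mn p) != 0 /\ chi k (24%:R * red p (Mn p)) = -1.
Proof. exact: (projT2 (cid (Mn_ex' p))). Qed.
Definition gp p : k := gam (eta p) (red p (Mn p)).
Lemma gp_neq0 p : pdv p -> gp p != 0.
Proof. by move=> hp; apply: gam_neq0 => //; case: (MnP hp). Qed.

Definition eps : 'Z_N := E3%:R.
Lemma eps24 : 24%:R * eps = -1.
Proof.
apply/eqP; rewrite -subr_eq0 opprK -[24%:R * _]natrM -[1]/(1%:R) -natrD Zp_nat_eq0 //.
Qed.
(** The shift by [eps], for which 24 eps = -1, completes the square. *)
Definition nup (n : int) : 'Z_N := (pent n)%:R - eps.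
Lemma nup24 n : 24%:R * nup n = (6 * n - 1)%:~R ^+ 2.
Proof.
rewrite /nup mulrBr eps24 opprK -[24%:R * _]natrM natr1.
have -> : ((24 * pent n).+1)%:R = ((24 * pent n).+1%:Z)%:~R :> 'Z_N by rewrite pmulrn.
rewrite -rmorphXn; congr (_%:~R).
rewrite (_ : ((24 * pent n).+1)%:Z = 12 * (2 * (pent n)%:Z) + 1); last by move: (pent n); clear; lia.
by rewrite (@pentE 1 isT); ring.
Qed.
Lemma red_int p (z : int) : pdv p -> red p (z%:~R : 'Z_N) = z%:~R.
Proof.
move=> /andP[pp pN]; case: z => n; first by rewrite -!pmulrn red_nat.
by rewrite NegzE !mulrNz -!pmulrn (redN N1 pp pN) red_nat.
Qed.
Lemma nup_red24 p n : pdv p -> 24%:R * red p (nup n) = (6 * n - 1)%:~R ^+ 2.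
Proof.
move=> hp; have [pp pN] := andP hp.
have <- : red p (24%:R * nup n) = 24%:R * red p (nup n) by rewrite (redM N1 pp pN) (red_nat N1 pp pN).
by rewrite nup24 expr2 (redM N1 pp pN) red_int.
Qed.
Lemma Fp_int_eq0 p (z : int) : pdv p -> ((z%:~R : 'F_p) == 0) = (p%:Z %| z)%Z.
Proof.
move=> /andP[pp pN]; case: z => n; first by rewrite -pmulrn Fp_nat_eq0.
by rewrite NegzE mulrNz oppr_eq0 -pmulrn Fp_nat_eq0 // rpredN.
Qed.
Lemma nup_red0 p n : pdv p -> (red p (nup n) == 0) = (p%:Z %| 6 * n - 1)%Z.
Proof.
move=> hp; rewrite -(Fp_int_eq0 _ hp) (_ : (_%:~R == 0) = ((6 * n - 1)%:~R ^+ 2 == 0 :> 'F_p)); last by rewrite expf_eq0.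
rewrite -(nup_red24 _ hp) mulf_eq0.
by rewrite (negPf (F24 hp)).
Qed.
Lemma nup_redM p n : pdv p -> (red p (nup n) == red p (Mn p)) = false.
Proof.
move=> hp; have [pp pN] := andP hp; have [_ cM] := MnP hp; apply/eqP => E; move: cM; rewrite -E nup_red24 // expr2.
rewrite (chiM N1 oddN pp pN (sqf pp pN)); have [->|x0] := eqVneq ((6 * n - 1)%:~R : 'F_p) 0.
  by rewrite chi0 mulr0 => /eqP; rewrite eq_sym oppr_eq0 oner_eq0.
rewrite chi_sq // => /eqP; rewrite -subr_eq0 opprK -[1 + 1]/(2%:R) => /eqP E2.
by have := tk2 T; rewrite E2 eqxx.
Qed.

Definition Sq (qs : seq nat) (v : V) : V := foldl (fun v p => Sp p v) v qs.
Lemma Rl_Sq qs : all pdv qs -> Rl T 0 (Sq qs).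
Proof.
elim: qs => [|p qs IH] /=; first by move=> _; exact: Rel_id.
by move=> /andP[hp hqs]; have := Rl_comp (IH hqs) (Rl_Sp hp); rewrite addn0.
Qed.
Lemma Sq_loc qs p g v : all pdv qs -> pdv p -> p \notin qs -> loc (idem p) g -> g (Sq qs v) = Sq qs (g v).
Proof.
elim: qs v => [|q qs IH] //= v /andP[hq hqs] hp; rewrite inE negb_or => /andP[pq pqs] lg.
by rewrite IH // (loc_comm (idem_orth hp hq pq) lg (Sp_loc q)).
Qed.

Lemma nestX_sum M ps v : exists s : seq (k * V), forall B,
  nestX M ps B v = \sum_(i <- s) cF i.1 * B i.2.
Proof.
elim: ps v => [|p ps IH] v; first by exists [:: (1, v)] => B; rewrite big_seq1 rmorph1 mul1r.
pose s (x : 'F_p) := projT1 (cid (IH (Up x v))).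
exists (flatten [seq [seq (psi p (- x * red p M) * i.1, i.2) | i <- s x] | x <- index_enum 'F_p]) => B.
rewrite /= /opX big_flatten big_map; apply: eq_bigr => x _.
rewrite (projT2 (cid (IH (Up x v)))) -/(s x) mulr_sumr big_map; apply: eq_bigr => i _ /=.
by rewrite rmorphM mulrA.
Qed.
Lemma nestX_uf M ps v Psi f : uf T Psi -> Rl T 0 f ->
  nestX M ps Psi v = 0 -> nestX M ps (Psi \o f) v = 0.
Proof.
move=> hu rf; have [s Es] := nestX_sum M ps v; rewrite !Es => E.
exact: (uf_lin (x := snd) hu rf E).
Qed.

Notation fix0 qs j := (forall q, q \in qs -> idem q * j = 0).
Lemma fix0_inj qs q j (x : 'F_q) : all pdv qs -> pdv q -> q \notin qs -> fix0 qs j -> fix0 qs (j + inj q x).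
Proof.
move=> hqs hq nq fj r rq; rewrite mulrDr fj // add0r /GaussSums.inj mulrCA (idem_orth (allP hqs r rq) hq) ?mulr0 //.
by apply: contraNneq nq => <-.
Qed.

Definition allR qs (n : int) := all (fun p => p%:Z %| 6 * n - 1)%Z qs.

Lemma YYi_base j : KK * (YY T (j, 1))^-1 = iota (Gf (fun n : int => (-1) ^ n) nup (fun n => 8 * N * pent n)%N j).
Proof.
have a0 : (0 < 8 * N)%N by rewrite muln_gt0 N_gt0.
have := YYv j; rewrite natr_Zp; set eu := euler _ => E.
have E0 : iota eu != 0.
  by apply/eqP => /iota0/eqP; apply/negP; rewrite euler_neq0 // fcoefCM fpsX_coef0 // mulr0.
have z0 : cF (zeta ^+ (j * E3)) != 0 by rewrite fmorph_eq0 expf_neq0 // zeta_neq0.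
have Y0 : YY T (j, 1) != 0 by apply: contra_eq_neq E => ->; rewrite mul0r eq_sym mulf_neq0.
have zu : zeta ^+ j \is a GRing.unit by rewrite unitfE expf_neq0 // zeta_neq0.
have -> : KK * (YY T (j, 1))^-1 = cF (zeta ^+ (j * E3))^-1 * iota eu.
  by apply: (mulIf Y0); rewrite mulfVK // fmorphV -mulrA [iota eu * _]mulrC E mulrC mulfK.
rewrite tcE -rmorphM /eu (@euler_pent k 1 isT _ _ zu a0) -gsZ; apply: (congr1 iota); apply: eq_gs => // n.
rewrite mulrCA; congr (_ * _); rewrite /nup mulrBr zcD zcMn -/(zc j) mulrC; congr (_ * _).
apply: (mulfI (zc_neq0 (j * eps))); rewrite -zcD subrr zc0 /eps zcMn /zc -exprM mulfV //.
by rewrite expf_neq0 // zeta_neq0.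
Qed.

(** The vanishing of 1 / YY on the class [Mn p] becomes opZ = 0 after transport. This expresses the
    value at the Weyl translate through the sum over unipotent translates, that is through the terms
    with p dividing 6 n - 1; the factor - gp is the Gauss sum. *)
Lemma YYi_pt qs j : uniq qs -> all pdv qs -> fix0 qs j ->
  KK * (YY T (Sq qs (j, 1)))^-1 = cF (\prod_(p <- qs) (- gp p)) *
   iota (Gf (fun n : int => (allR qs n)%:R * (-1) ^ n) nup (fun n => 8 * N * pent n)%N j).
Proof.
elim: qs j => [|p qs IH] j /=.
  by move=> _ _ _; rewrite YYi_base big_nil rmorph1 mul1r; congr (iota _); apply: eq_Gf => n; rewrite mul1r.
move=> /andP[npq uq] /andP[hp hqs] fj; have [pp pN] := andP hp.
pose Yi v := (YY T v)^-1; have uYi : uf T Yi by apply/ufV/YY_uf.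
have X0 j' : opX p (Mn p) Yi (j', 1) = 0.
  apply: (mulfI KK0); rewrite mulr0 /opX mulr_sumr.
  rewrite (eq_bigr (fun x => cF (psi p (- x * red p (Mn p))) * iota (Gf (fun n : int => (-1) ^ n) nup (fun n => 8 * N * pent n)%N (j' + inj p x)))).
    rewrite Gf_filter // (@eq_Gf _ _ (fun=> 0)) => [|n]; last by rewrite nup_redM // mulr0 mul0r.
    by rewrite /Gf gs_eq0 ?rmorph0 // => n; rewrite mul0r.
  by move=> x _; rewrite mulrCA Up_pt /Yi YYi_base.
have Z0 : opZ p (Mn p) (Yi \o Sq qs) (j, 1) = 0.
  apply: (@nest_main _ _ _ _ T sqf zeta (Mn p) [:: p] (fun f => Yi \o f) (j, 1)) => //.
  - by rewrite /= hp.
  - by move=> q; rewrite inE => /eqP->; rewrite /= mulr1 fj // mem_head.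
  - by move=> q f; rewrite inE => /eqP-> rf; apply: scal_comp => //; apply/scal_inv/YY_scal.
  - by move=> f rf; apply: (@nestX_uf (Mn p) [:: p] (j, 1) Yi f uYi rf); exact: X0.
  - exact: Rl_Sq.
have p0 : (p%:R : F) != 0 by rewrite -(rmorph_nat cF) fmorph_eq0 pk0.
apply: (mulfI p0); move/(congr1 (fun z => KK * z)): Z0; rewrite mulr0 /opZ mulrDr mulrCA => /eqP.
rewrite addr_eq0 => /eqP ->; rewrite mulrCA mulr_sumr -/(gp p).
rewrite (eq_bigr (fun x => cF (\prod_(q <- qs) - gp q) * iota (Gf (fun n : int => (allR qs n)%:R * (-1) ^ n) nup (fun n => 8 * N * pent n)%N (j + inj p x)))).
  rewrite -mulr_sumr Gf_filter0 // big_cons -mulNr -rmorphN mulrA -rmorphM [RHS]mulrCA; congr (_ * _).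
  rewrite -(rmorph_nat cF) GfZ; congr (iota _); apply: eq_Gf => n; rewrite nup_red0 // /allR /=.
  by case: (_ %| _)%Z; rewrite ?mulr1 // !mulr0 !mul0r mulr0.
move=> x _; rewrite /= Up_pt /Yi -IH //; apply: fix0_inj => // q qq; apply: fj.
by rewrite inE qq orbT.
Qed.

Lemma cop_prod p qs : prime p -> all prime qs -> p \notin qs -> coprime p (\prod_(q <- qs) q).
Proof.
move=> pp; elim: qs => [|q qs IH] /=; first by rewrite big_nil coprimen1.
move=> /andP[hq hqs]; rewrite inE negb_or big_cons coprimeMr => /andP[pq nq].
by rewrite IH // andbT prime_coprime // dvdn_prime2.
Qed.
Lemma prod_all qs x : uniq qs -> all prime qs -> (\prod_(q <- qs) q %| x)%N = all (fun p => p %| x)%N qs.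
Proof.
elim: qs => [|q qs IH] /=; first by rewrite big_nil dvd1n.
by move=> /andP[nq uq] /andP[hq hqs]; rewrite big_cons Gauss_dvd ?IH // cop_prod.
Qed.
Lemma pdv_prime qs : all pdv qs -> all prime qs.
Proof. by apply: sub_all => p /andP[]. Qed.
Lemma pdv6 p : pdv p -> coprime p 6.
Proof. by move=> /andP[_ pN]; apply: coprime_dvdl pN cN6. Qed.
Lemma prod_dvd qs : uniq qs -> all pdv qs -> (\prod_(q <- qs) q %| N)%N.
Proof. by move=> uq hq; rewrite prod_all ?pdv_prime //; apply: sub_all hq => p /andP[]. Qed.
Lemma B6_abs qs : all pdv qs -> absz (6 * B6 qs + 1) = (\prod_(q <- qs) q)%N.
Proof.
rewrite B6E; elim: qs => [|q qs IH] /=; first by rewrite !big_nil.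
move=> /andP[hq hqs]; rewrite !big_cons abszM IH //; congr (_ * _)%N.
apply/eqP; rewrite -eqn_sqr -eqz_nat abszX2 b6_sq ?pdv6 //.
Qed.
Lemma N1z (z : int) : (-1 : k) ^ z != 0. Proof. by rewrite expfz_neq0 // oppr_eq0 oner_eq0. Qed.
Lemma N1opp (z : int) : (-1 : k) ^ (- z) = (-1) ^ z.
Proof. by rewrite -invr_expz; apply: (mulfI (N1z z)); rewrite mulfV ?N1z // -expfzMl mulrNN mulr1 exp1rz. Qed.
Lemma N1six (z : int) : (-1 : k) ^ (6 * z) = 1.
Proof. by rewrite -exprz_exp (_ : (-1) ^ 6 = 1) ?exp1rz // -exprnP; ring. Qed.
Lemma N1B6 qs : (-1 : k) ^ (B6 qs) = \prod_(p <- qs) (-1) ^ (b6 p).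
Proof.
have n0 : (-1 : k) != 0 by rewrite oppr_eq0 oner_eq0.
elim: qs => [|q qs IH]; first by rewrite big_nil expr0z.
by rewrite big_cons -IH /= !expfzDr // -[6 * _ * _]mulrA N1six mul1r.
Qed.

Definition Cq qs : k := \prod_(p <- qs) (- gp p * (-1) ^ (b6 p)).
Lemma Cq_neq0 qs : all pdv qs -> Cq qs != 0.
Proof.
move=> /allP hq; rewrite /Cq prodf_seq_neq0; apply/allP => p pq /=.
by rewrite mulf_neq0 ?N1z // oppr_eq0 gp_neq0 ?hq.
Qed.
Definition hB qs := pent (- B6 qs).
Notation dq qs := (\prod_(q <- qs) q)%N.

Lemma pent_h qs m : all pdv qs ->
  pent (6 * B6 qs * m - B6 qs + m) = (dq qs ^ 2 * pent m + hB qs)%N.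
Proof.
move=> hq; apply/eqP; rewrite -eqz_nat -(inj_eq (mulfI (_ : (2 : int) != 0))) //; apply/eqP.
rewrite PoszD mulrDr [in RHS]PoszM mulrCA !(@pentE 1 isT) -(B6_abs hq) abszX2.
by move: (B6 qs) => B; ring.
Qed.
Lemma hB24 qs : all pdv qs -> (24 * hB qs + 1 = dq qs ^ 2)%N.
Proof.
move=> hq; apply/eqP; rewrite -eqz_nat -(B6_abs hq) abszX2 PoszD PoszM; apply/eqP.
have := @pentE 1 isT (- B6 qs); rewrite -/(hB qs); move: (hB qs)%:Z (B6 qs) => x B E.
have -> : 24%:Z * x = 12 * (2 * x) by ring.
by rewrite E; ring.
Qed.

(** The n for which all primes of qs divide 6 n - 1 are given by 6 n - 1 = (6 B6 + 1)(6 m - 1), and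
    the restricted pentagonal series is again an Euler product, in the d^2-th power of the
    variable. *)
Lemma YYi_euler qs j : uniq qs -> all pdv qs -> fix0 qs j ->
  KK * (YY T (Sq qs (j, 1)))^-1 = cF (Cq qs * zc (j * ((hB qs)%:R - eps))) *
   iota (fpsX (8 * N * hB qs) * euler (fpsC (zc (j * (dq qs ^ 2)%:R)) * fpsX (8 * N * dq qs ^ 2))).
Proof.
move=> uq hq fj; rewrite YYi_pt //.
have a0 : (0 < 8 * N)%N by rewrite muln_gt0 N_gt0.
have d0 : (0 < dq qs ^ 2)%N by rewrite -hB24 // addn1.
have a1 : (0 < 8 * N * dq qs ^ 2)%N by rewrite muln_gt0 a0.
have zu : zc (j * (dq qs ^ 2)%:R) \is a GRing.unit by rewrite unitfE zc_neq0.
pose h (m : int) : int := 6 * B6 qs * m - B6 qs + m.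
have hE m : 6 * h m - 1 = (6 * B6 qs + 1) * (6 * m - 1) by rewrite /h; ring.
have Ball n : allR qs n = (6 * B6 qs + 1 %| 6 * n - 1)%Z.
  by rewrite dvdzE B6_abs // prod_all ?pdv_prime.
have b0 : 6 * B6 qs + 1 != 0 by move: (B6 qs); clear; lia.
rewrite /Gf -(@eq_gs _ _ (fun n => (allR qs n)%:R * ((-1) ^ n * zc (j * nup n))) _ (fun n => 8 * N * pent n)%N); last 2 first.
- by move=> n; rewrite mulrA.
- by [].
rewrite (@gs_sub _ _ _ h); last 4 first.
- by move=> m m' E; have := hE m; rewrite E hE => /(mulfI b0) e; clear - e; lia.
- move=> n; rewrite Ball => /dvdzP[z Ez].
  have [m Em] : exists m, z = 6 * m - 1.
    by exists (n - B6 qs * z); have : z = 6 * n - 1 - 6 * B6 qs * z by [rewrite Ez; ring]; move: (B6 qs); clear; lia.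
  exists m; have := hE m; rewrite -Em => hm.
  have : 6 * h m - 1 = 6 * n - 1 by rewrite hm Ez mulrC.
  by move: (h m); clear; lia.
- by move=> m; rewrite Ball hE dvdz_mulr.
- exact: (@proper_pent 1 isT).
rewrite (@euler_pent k 1 isT _ _ zu a1) fpsX_gs; last exact: (@proper_pent 1 isT).
rewrite !tcE -!rmorphM -!gsZ; apply: (congr1 iota); apply: eq_gs => m; last first.
  by rewrite /= pent_h // mulnDr addnC mulnA.
rewrite /= /nup pent_h // natrD -addrA mulrDr zcD natrM [j * (_ * _)]mulrA (zcMn (j * (dq qs ^ 2)%:R)).
rewrite /h !expfzDr ?oppr_eq0 ?oner_eq0 // N1opp (_ : (-1) ^ (6 * B6 qs * m) = 1 :> k) ?mul1r /Cq; last by rewrite -mulrA N1six.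
rewrite big_split /= -N1B6; ring.
Qed.

Section Proj.
Variables (n H Y1 : nat) (kp : k) (n0 : nat).
Hypothesis ln : (ell %| N + 12 * n)%N.
Hypothesis Y1E : (y0 + 4 * N ^ 2 * n = Y1 + 8 * N * H)%N.
Hypothesis HN : (N ^ 2 <= H)%N.
Hypothesis kp0 : kp != 0.
Hypothesis kpE : (ta T * tb T * (ta T - tb T)) ^+ n * KK =
  iota (fpsC kp * fpsX (y0 + 4 * N ^ 2 * n) * Eq ^+ (N + 12 * n)).
(** An ell-th power, hence a constant for the derivation. *)
Definition W : F := iota (Eq ^+ (N + 12 * n)).
Lemma W0 : W != 0.
Proof. by apply/eqP => /iota0/eqP; rewrite expf_eq0 (negPf Eq0) andbF. Qed.
Lemma DW : tD T W = 0.
Proof.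
rewrite /W tD_iota -(divnK ln) exprM.
have := prime_gt0 pl; case: ell chl => // l hl _; rewrite fderivX.
have -> : (l.+1)%:R = 0 :> fps k by rewrite -(rmorph_nat (@fpsC k)) (pcharf0 hl) rmorph0.
by rewrite !mul0r rmorph0.
Qed.
(** The index s counts exponents from [Y1]; s = H is the place of p(0), and H leaves room for the
    Weyl translates, whose expansions start earlier. *)
Definition mut (s : nat) : int := 24 * (s%:Z - H%:Z) - 1.
Definition nus (s : nat) : 'Z_N := eps + (s%:R - H%:R).
Definition ex (s : nat) : nat := (Y1 + 8 * N * s)%N.
Definition Th (v : V) : F := (ta T * tb T * (ta T - tb T)) ^+ n * YY T v.

(** [YYi_euler] gives 1 / YY as an Euler product and [part_gf] inverts it, so at the translate by qs
    the partition series appears in the d^2-th power of the variable. *)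
Lemma Th_pt qs j : uniq qs -> all pdv qs -> fix0 qs j ->
  Th (Sq qs (j, 1)) = W * iota (Gf (fun s => kp / Cq qs * (val24 (dq qs) (mut s))%:R) nus ex j).
Proof.
move=> uq hq fj; have := YYi_euler uq hq fj; set d := dq qs; set z' := zc (j * (_ - _)).
have h24 := hB24 hq; rewrite -/d in h24.
have dN : (d <= N)%N by apply: dvdn_leq (prod_dvd uq hq); exact: N_gt0.
have hH : (hB qs <= H)%N.
  apply: leq_trans HN.
  have : (d ^ 2 <= N ^ 2)%N by rewrite leq_sqr.
  by move: h24; move: (d ^ 2)%N (N ^ 2)%N (hB qs); clear; lia.
have a0 : (0 < 8 * N)%N by rewrite muln_gt0 N_gt0.
have d0 : (0 < d ^ 2)%N by rewrite -h24 addn1.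
have a1 : (0 < 8 * N * d ^ 2)%N by rewrite muln_gt0 a0.
have dz : (d ^ 2)%:Z != 0 by rewrite eqz_nat -lt0n.
set c := zc (j * (d ^ 2)%:R); set eu := euler _ => E.
have C0 := Cq_neq0 hq; have z0 : z' != 0 := zc_neq0 _.
have X0 : KK * (YY T (Sq qs (j, 1)))^-1 != 0.
  rewrite E mulf_neq0 ?fmorph_eq0 ?mulf_neq0 //.
  apply/eqP => /iota0/eqP; rewrite mulf_eq0 (negPf (fpsX_neq0 _ _)) /=; apply/negP.
  by rewrite euler_neq0 // fcoefCM fpsX_coef0 // mulr0.
have Y0 : YY T (Sq qs (j, 1)) != 0 by apply: contraNneq X0 => ->; rewrite invr0 mulr0.
apply: (mulIf X0); have -> : Th (Sq qs (j, 1)) * (KK * (YY T (Sq qs (j, 1)))^-1) = (ta T * tb T * (ta T - tb T)) ^+ n * KK.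
  by rewrite /Th mulrACA [YY T _ * _^-1]mulfV // mulr1.
rewrite kpE E -GfZ /W !tcE -!rmorphM; apply: (congr1 iota).
have EG : Gf (fun s => (val24 d (mut s))%:R) nus ex j =
   fpsC z'^-1 * (fpsX (Y1 + 8 * N * (H - hB qs)) * gs (fun m : nat => (partition_count m)%:R * c ^+ m) (fun m => 8 * N * d ^ 2 * m)%N).
  pose h m := (H - hB qs + d ^ 2 * m)%N.
  have muh m : mut (h m) = (24 * m%:Z - 1) * (d ^ 2)%:Z.
    by rewrite /mut /h -h24 !PoszD -subzn // !PoszM; ring.
  have vh m : val24 d (mut (h m)) = partition_count m.
    rewrite /val24 muh dvdz_mull // mulzK //.
    by rewrite /fsh subrK dvdz_mulr // mulKz.
  have px : proper (fun m => 8 * N * d ^ 2 * m)%N.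
    by move=> e; exists (seq.iota 0 e.+1) => m Em; rewrite mem_iota /= add0n ltnS -Em leq_pmull.
  have pxs : proper ex.
    by move=> e; exists (seq.iota 0 e.+1) => m Em; rewrite mem_iota /= add0n ltnS -Em /ex (leq_trans _ (leq_addl _ _)) // leq_pmull.
  rewrite fpsX_gs // -gsZ.
  rewrite /Gf -(@eq_gs _ _ (fun s => (`[< exists m, h m = s >])%:R * ((val24 d (mut s))%:R * zc (j * nus s))) _ ex); last 2 first.
  - move=> s; case: asboolP => [_|ns]; first by rewrite mul1r.
    rewrite /val24; case: ifP => [/dvdzP[y Ey]|]; last by rewrite !mul0r.
    rewrite Ey mulzK //.
    rewrite /fsh; case: ifP => [/dvdzP[u Eu]|]; last by rewrite !mul0r.
    rewrite Eu mulzK //; case: u Eu => u Eu /=; last by rewrite !mul0r.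
    case: ns; exists u; apply/eqP; rewrite -eqz_nat /h PoszD PoszM -subzn //; apply/eqP.
    have Ey' : y = 24 * u%:Z - 1 by move: Eu; clear; lia.
    by move: Ey; rewrite /mut Ey' -h24 PoszD PoszM => e; clear - e; nia.
  - by [].
  rewrite (@gs_sub _ _ _ h) //; last 3 first.
  - by move=> m m' /addnI/eqP; rewrite eqn_pmul2l // => /eqP.
  - by move=> s /asboolP.
  - by move=> m; apply/asboolP; exists m.
  apply: eq_gs => m; last by rewrite /= /ex /h mulnDr addnA mulnA.
  rewrite /= vh mulrCA; congr (_ * _).
  have -> : nus (h m) = eps - (hB qs)%:R + (d ^ 2)%:R * m%:R.
    by rewrite /nus /h natrD natrM natrB //; ring.
  rewrite mulrDr zcD mulrA zcMn; congr (_ * _).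
  by apply: (mulfI z0); rewrite mulfV // -zcD -mulrDr (_ : _ + _ = 0) ?mulr0 ?zc0 //; ring.
rewrite EG Y1E (_ : (Y1 + 8 * N * H = (Y1 + 8 * N * (H - hB qs)) + 8 * N * hB qs)%N); last by rewrite -addnA -mulnDr subnK.
rewrite [fpsX (_ + 8 * N * hB qs)]fpsXD !fpsCM.
have := part_gf c a1; rewrite -/eu; set G := gs _ _ => EP.
have z1 : fpsC z'^-1 * fpsC z' = 1 by rewrite -fpsCM mulVf // rmorph1.
have c1 : fpsC (Cq qs)^-1 * fpsC (Cq qs) = 1 by rewrite -fpsCM mulVf // rmorph1.
set x1 := fpsX _; set x2 := fpsX _; set e := Eq ^+ _.
transitivity (fpsC kp * (x1 * x2) * e * (eu * G) * (fpsC z'^-1 * fpsC z') * (fpsC (Cq qs)^-1 * fpsC (Cq qs))); last by ring.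
by rewrite EP z1 c1 !mulr1.
Qed.

Section Projector.
Variable c0 : k.
Definition Dc (y : F) : F := tD T y - cF c0 * y.
(* [1 - (D - c0) ^ (ell - 1)] projects onto the exponents congruent to [c0] modulo [ell]. *)
Definition pj (y : F) : F := y - iter ell.-1 Dc y.

Lemma DcZ a y : Dc (cF a * y) = cF a * Dc y.
Proof. by rewrite /Dc tDM tDC mul0r add0r mulrBr; congr (_ - _); rewrite mulrCA. Qed.
Lemma iterDcZ a y m : iter m Dc (cF a * y) = cF a * iter m Dc y.
Proof. by elim: m => //= m ->; rewrite DcZ. Qed.
Lemma pjZ a y : pj (cF a * y) = cF a * pj y.
Proof. by rewrite /pj iterDcZ mulrBr. Qed.
Lemma uf_iter P m : uf T P -> uf T (fun v => iter m Dc (P v)).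
Proof.
move=> h; elim: m => //= m IH; apply: ufB; first exact: uf_D.
by apply: ufM => //; apply: ufC.
Qed.
Lemma uf_pj P : uf T P -> uf T (fun v => pj (P v)).
Proof. by move=> h; apply: ufB => //; apply: uf_iter. Qed.
Lemma scal_pj p B : scal p B -> scal p (fun v => pj (B v)).
Proof. by move=> h x w x0; rewrite h // pjZ. Qed.
Lemma Dc_gs (I : eqType) (w : I -> k) (x : I -> nat) :
  Dc (W * iota (gs w x)) = W * iota (gs (fun i => ((x i)%:R - c0) * w i) x).
Proof.
rewrite /Dc tDM DW mul0r add0r tD_iota fderiv_gs mulrCA -mulrBr tcE -rmorphM -rmorphB -gsZ -gsN.
congr (_ * iota _); have := gs_lin [:: true; false] (fun=> 1) (fun (b : bool) i => if b then w i *+ x i else - (c0 * w i)) x.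
rewrite !big_cons big_nil addr0 rmorph1 !mul1r => ->; apply: eq_gs => // i.
by rewrite !big_cons big_nil addr0 !mul1r mulrBl mulr_natl.
Qed.
Lemma iterDc_gs (I : eqType) (w : I -> k) (x : I -> nat) m :
  iter m Dc (W * iota (gs w x)) = W * iota (gs (fun i => ((x i)%:R - c0) ^+ m * w i) x).
Proof.
elim: m => [|m IH] /=; first by congr (_ * iota _); apply: eq_gs => // i; rewrite expr0 mul1r.
by rewrite IH Dc_gs; congr (_ * iota _); apply: eq_gs => // i; rewrite exprS mulrA.
Qed.
Lemma pj_gs (I : eqType) (w : I -> k) (x : I -> nat) :
  pj (W * iota (gs w x)) = W * iota (gs (fun i => (1 - ((x i)%:R - c0) ^+ ell.-1) * w i) x).
Proof.
rewrite /pj iterDc_gs -mulrBr -rmorphB -gsN; congr (_ * iota _).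
have := gs_lin [:: true; false] (fun=> 1) (fun (b : bool) i => if b then w i else - (((x i)%:R - c0) ^+ ell.-1 * w i)) x.
rewrite !big_cons big_nil addr0 rmorph1 !mul1r => ->; apply: eq_gs => // i.
by rewrite !big_cons big_nil addr0 !mul1r mulrBl mul1r.
Qed.
End Projector.

Lemma k_eq_mod (a b : nat) : ((a%:R : k) == b%:R) = (a == b %[mod ell]).
Proof.
wlog ab : a b / (a <= b)%N => [h|].
  by case/orP: (leq_total a b) => /h // E; rewrite eq_sym E eq_sym.
by rewrite eq_sym -subr_eq0 -natrB // -(dvdn_pcharf chl) -eqn_mod_dvd // eq_sym.
Qed.
(** Fermat's little theorem: the projector acts on a monomial by the indicator of the class of its
    exponent. *)
Lemma fermat_k (a b : nat) : 1 - ((a%:R : k) - b%:R) ^+ ell.-1 = (a == b %[mod ell])%:R.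
Proof.
rewrite -k_eq_mod; case: eqVneq => [->|ne].
  by rewrite subrr expr0n; have := tl3 T; case: ell => // -[|l] // _; rewrite subr0.
have x0 : (a%:R : k) - b%:R != 0 by rewrite subr_eq0.
have E : ((a%:R : k) - b%:R) ^+ ell = a%:R - b%:R.
  by rewrite -(pFrobenius_autE chl) rmorphB /= !(pFrobenius_aut_nat chl).
apply/eqP; rewrite subr_eq0 eq_sym; apply/eqP/(mulfI x0).
by rewrite -exprS prednK ?prime_gt0 // E mulr1.
Qed.

Definition cls (s : nat) : bool := (s == n0 + H %[mod ell])%N.
Lemma cls_ex s : (ex s == ex (n0 + H) %[mod ell]) = cls s.
Proof.
rewrite /ex eqn_modDl /cls -!k_eq_mod !natrM.
have c0 : (8%:R * N%:R : k) != 0.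
  rewrite mulf_neq0 ?(tkN T) // (_ : 8 = 2 * (2 * 2))%N // !natrM.
  by rewrite !mulf_neq0 // (tk2 T).
by rewrite (inj_eq (mulfI c0)).
Qed.

(** The partition series cut to one class modulo ell. The projector is k-linear and polynomial in D,
    so [Psi] is still uniform and scales like [YY]. *)
Definition Psi (v : V) : F := pj (ex (n0 + H))%:R (Th v).
Definition cc qs (s : nat) : k := kp / Cq qs * ((cls s)%:R * (val24 (dq qs) (mut s))%:R).
Lemma Psi_pt qs j : uniq qs -> all pdv qs -> fix0 qs j ->
  Psi (Sq qs (j, 1)) = W * iota (Gf (cc qs) nus ex j).
Proof.
move=> uq hq fj; rewrite /Psi Th_pt // /Gf pj_gs; congr (_ * iota _); apply: eq_gs => // s.
by rewrite fermat_k cls_ex /cc; move: (kp / Cq qs) (cls s)%:R (val24 _ _)%:R => x y z; ring.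
Qed.
Lemma Psi_uf : uf T Psi.
Proof.
apply/uf_pj/ufM; last exact: YY_uf.
by apply: uf_X; apply: ufM; [apply: ufM|apply: ufB]; exact: uf_a || exact: uf_b.
Qed.
Lemma Psi_scal p : pdv p -> scal p Psi.
Proof.
by move=> hp; apply: scal_pj => x w x0; rewrite /Th (YY_scal hp) // mulrCA.
Qed.

Lemma evX M ps qs j (Phi : V -> F) (w : nat -> k) : uniq ps -> all pdv ps -> all pdv qs ->
  (forall p, p \in ps -> p \notin qs) -> fix0 qs j ->
  (forall j, fix0 qs j -> Phi (j, 1) = W * iota (Gf w nus ex j)) ->
  nestX M ps Phi (j, 1) = W * iota (Gf (fun s => \prod_(p <- ps) (p%:R * (red p (nus s) == red p M)%:R) * w s) nus ex j).
Proof.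
elim: ps j => [|p ps IH] j /=.
  by move=> _ _ _ _ fj h; rewrite h //; congr (_ * iota _); apply: eq_Gf => s; rewrite big_nil mul1r.
move=> /andP[np up] /andP[hp hps] hqs dj fj h; rewrite /opX.
have pq : p \notin qs by apply: dj; rewrite mem_head.
rewrite (eq_bigr (fun x => W * (cF (psi p (- x * red p M)) * iota (Gf (fun s => \prod_(p <- ps) (p%:R * (red p (nus s) == red p M)%:R) * w s) nus ex (j + inj p x))))).
  rewrite -mulr_sumr Gf_filter //; congr (_ * iota _); apply: eq_Gf => s.
  by rewrite big_cons mulrA.
move=> x _; rewrite Up_pt mulrCA; congr (_ * _); apply: IH => //.
- by move=> q qp; apply: dj; rewrite inE qp orbT.
- exact: fix0_inj.
Qed.

Lemma W_Gf0 (w : nat -> k) : W * iota (Gf w nus ex 0) = 0 -> forall s, w s = 0.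
Proof.
move=> /eqP; rewrite mulf_eq0 (negPf W0) /= => /eqP/iota0 E s.
have := congr1 (fun f => fcoef f (ex s)) E; rewrite /Gf gs_coef_one => [|i]; last first.
  by move/addnI/eqP; rewrite eqn_pmul2l ?muln_gt0 ?N_gt0 // => /eqP.
by rewrite mul0r zc0 mulr1.
Qed.

(** An expansion at all Weyl translates by primes outside L, the primes of L being already
    processed; this is the invariant in the computation of [nestZ]. *)
Definition EvP (L : seq nat) (Phi : V -> F) (c : seq nat -> nat -> k) := forall qs j, uniq qs -> all pdv qs ->
  (forall q, q \in qs -> q \notin L) -> fix0 L j -> fix0 qs j -> Phi (Sq qs (j, 1)) = W * iota (Gf (c qs) nus ex j).
Definition gM (M : 'Z_N) p : k := gam (eta p) (red p M).
(** One step of [opZ] on coefficients: the Weyl translate adds p to the list, and the sum over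
    unipotent translates keeps the s with [nus s] divisible by p. *)
Definition cz M (c : seq nat -> nat -> k) p (qs : seq nat) s : k :=
  p%:R * c (p :: qs) s + gM M p * (p%:R * (red p (nus s) == 0)%:R * c qs s).

Lemma EvP_opZ M L p Phi c : all pdv L -> pdv p -> p \notin L -> EvP L Phi c -> EvP (p :: L) (opZ p M Phi) (cz M c p).
Proof.
move=> hL hp pL h qs j uq hq dj fL fj.
have pqs : p \notin qs by apply/negP => /dj; rewrite mem_head.
have dj' q : q \in qs -> q \notin L by move/dj; rewrite inE negb_or => /andP[].
have fpj : idem p * j = 0 by apply: fL; rewrite mem_head.
have fL' : fix0 L j by move=> q qL; apply: fL; rewrite inE qL orbT.
rewrite /LocalOperators.opZ (Sq_loc _ hq hp pqs (Sp_loc p)) -[Sq qs (Sp p (j, 1))]/(Sq (p :: qs) (j, 1)).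
rewrite h //=; [|by rewrite pqs|by rewrite hp| |].
- rewrite (eq_bigr (fun x => W * iota (Gf (c qs) nus ex (j + inj p x)))).
    rewrite -mulr_sumr Gf_filter0 // -(rmorph_nat cF) mulrCA [cF (gam _ _) * _]mulrCA !GfZ -mulrDr GfD.
    by congr (_ * iota _); apply: eq_Gf => s; rewrite /cz mulrA.
  move=> x _; rewrite (Sq_loc _ hq hp pqs (Up_loc T sqf x)) Up_pt h //; exact: fix0_inj.
- by move=> q; rewrite inE => /predU1P[->|/dj'].
- by move=> q; rewrite inE => /predU1P[->|/fj].
Qed.
Lemma EvP_nestZ M ps L Phi c : all pdv L -> uniq ps -> all pdv ps -> (forall p, p \in ps -> p \notin L) -> EvP L Phi c ->
  EvP (catrev ps L) (nestZ M ps Phi) (foldl (cz M) c ps).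
Proof.
elim: ps L Phi c => [|p ps IH] L Phi c //= hL /andP[np up] /andP[hp hps] dj h.
apply: IH => //=; first by rewrite hp.
  move=> q qp; rewrite inE negb_or dj ?inE ?qp ?orbT // andbT.
  by apply: contraNneq np => <-.
by apply: EvP_opZ => //; apply: dj; rewrite mem_head.
Qed.

Definition aq p : k := (- gp p * (-1) ^ (b6 p))^-1.
(** Each prime contributes a common factor gM p, and what remains is U_p plus aq / gM times V_p. *)
Lemma foldl_cz M ps qs s : (forall p, p \in ps -> red p (nus s) = 0) -> (forall p, p \in ps -> gM M p != 0) ->
  foldl (cz M) cc ps qs s = \prod_(p <- ps) (gM M p * p%:R) * (kp * \prod_(q <- qs) aq q * (cls s)%:R *
    sm (fun p => aq p / gM M p) ps (fun d => (val24 d (mut s))%:R) (dq qs)).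
Proof.
elim/last_ind: ps qs => [|ps p IH] qs r0 g0.
  by rewrite /= big_nil mul1r /cc /Cq -prodfV mulrA.
have h q : q \in ps -> q \in rcons ps p by move=> qq; rewrite mem_rcons inE qq orbT.
have pp : p \in rcons ps p by rewrite mem_rcons mem_head.
rewrite foldl_rcons /cz !IH; [|by move=> q /h/r0|by move=> q /h/g0|by move=> q /h/r0|by move=> q /h/g0].
rewrite r0 // eqxx sm_rcons -cats1 big_cat big_seq1 !big_cons /=.
have := g0 p pp; move: (gM M p) (sm _ _ _ _) (sm _ _ _ _) (\prod_(q <- qs) _) (\prod_(q <- ps) _) (aq p) => g x y z u a gn.
by rewrite -/(gM M p); field.
Qed.

(** The class of n0, shifted so that 24 M0 = 24 n0 - 1. *)
Definition M0 : 'Z_N := eps + n0%:R.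

Lemma red_dvd p (x y : 'Z_N) (a b : int) : pdv p -> x - y = (a - b)%:~R -> (red p x == red p y) = (p%:Z %| a - b)%Z.
Proof.
move=> hp E; have [pp pN] := andP hp; rewrite -subr_eq0 -(redN N1 pp pN) -(redD N1 pp pN) E red_int //.
exact: Fp_int_eq0.
Qed.
Lemma redM0 p s : pdv p -> (red p (nus s) == red p M0) = (p%:Z %| s%:Z - H%:Z - n0%:Z)%Z.
Proof.
move=> hp; rewrite (red_dvd (a := s%:Z - H%:Z) (b := n0)) //.
by rewrite /nus /M0 !rmorphB /= -!pmulrn; ring.
Qed.
Lemma nus_red24 p s : pdv p -> (red p (nus s) == 0) = (p%:Z %| mut s)%Z.
Proof.
move=> hp; have [pp pN] := andP hp.
have E : 24%:R * nus s = (mut s)%:~R.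
  by rewrite /nus mulrDr eps24 /mut rmorphB rmorphM /= rmorphB /= -!pmulrn addrC mulrBr.
have -> : (red p (nus s) == 0) = (red p (24%:R * nus s) == 0).
  by rewrite (redM N1 pp pN) mulf_eq0 (red_nat N1 pp pN) (negPf (F24 hp)).
by rewrite E red_int // Fp_int_eq0.
Qed.
Lemma val24_1 s (m : nat) : s%:Z - H%:Z = m%:Z -> val24 1 (mut s) = partition_count m.
Proof.
by move=> E; rewrite /val24 dvd1z divz1 /fsh /mut E subrK dvdz_mulr // mulKz.
Qed.
Lemma val24_1N s : s%:Z - H%:Z < 0 -> val24 1 (mut s) = 0%N.
Proof.
move=> E; rewrite /val24 dvd1z divz1 /fsh /mut subrK dvdz_mulr // mulKz //.
by case: (s%:Z - H%:Z) E.
Qed.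

(** The filters keep only the m congruent to n0 modulo ell and modulo the primes of ps, where p(m)
    is zero by assumption; below s = H there is no coefficient. *)
Lemma X_vanish ps : uniq ps -> all pdv ps ->
  (forall m : nat, (m == n0 %[mod ell])%N -> (forall p, p \in ps -> (m == n0 %[mod p])%N) -> (partition_count m)%:R = 0 :> k) ->
  forall j, nestX M0 ps Psi (j, 1) = 0.
Proof.
move=> up hps hv j; rewrite (@evX M0 ps [::] j Psi (cc [::])) //; last by move=> j' _; apply: (@Psi_pt [::]).
rewrite (@eq_Gf _ _ (fun=> 0)) => [|s]; first by rewrite /Gf gs_eq0 ?rmorph0 ?mulr0 // => i; rewrite mul0r.
rewrite /cc big_nil; case Cl: (cls s); last by rewrite mul0r !mulr0.
have [|np] := boolP (all (fun p => red p (nus s) == red p M0) ps); last first.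
  have [p pps np'] := allPn np.
  by rewrite (big_rem p pps) /= (negPf np') mulr0 !mul0r.
move=> /allP hr; have hr' p : p \in ps -> (p%:Z %| s%:Z - H%:Z - n0%:Z)%Z.
  by move=> pps; rewrite -redM0 ?hr //; apply: (allP hps).
suff -> : (val24 1 (mut s))%:R = 0 :> k by rewrite !mulr0.
case: (leqP H s) => hs; last by rewrite val24_1N //; clear - hs; lia.
rewrite (@val24_1 s (s - H)) ?subzn //.
have Es : s = (s - H + H)%N by rewrite subnK.
apply: hv => [|p pps].
  by move: Cl; rewrite /cls {1}Es eqn_modDr.
have := hr' p pps; rewrite subzn //; move: (s - H)%N => m d.
by move: d; rewrite -eqz_mod_dvd !modz_nat eqz_nat.
Qed.

(** At the point (0, 1) the relation nestZ = 0 forces every coefficient to vanish, because distinct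
    s have distinct exponents. *)
Lemma main_k ps : uniq ps -> all pdv ps ->
  (forall m : nat, (m == n0 %[mod ell])%N -> (forall p, p \in ps -> (m == n0 %[mod p])%N) -> (partition_count m)%:R = 0 :> k) ->
  (forall p, p \in ps -> red p M0 != 0) ->
  forall s, cls s -> (forall p, p \in ps -> (p%:Z %| mut s)%Z) ->
  sm (fun p => aq p / gM M0 p) ps (fun d => (val24 d (mut s))%:R) 1 = 0.
Proof.
move=> up hps hv M00 s Cs hs.
have Z0 : nestZ M0 ps Psi (0, 1) = 0.
  apply: (@nest_main _ _ _ _ T sqf zeta M0 ps (fun f => Psi \o f) (0, 1) up hps _ _ _ _ id) => //.
  - by move=> p pps; rewrite /= mulr0 mulr1.
  - by move=> p f pps rf; apply: scal_comp => //; apply: Psi_scal; apply: (allP hps).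
  - by move=> f rf; apply: nestX_uf => //; [exact: Psi_uf|exact: X_vanish].
  - exact: Rel_id.
have EP : EvP [::] Psi cc by move=> qs j uq hq _ _ fj; apply: Psi_pt.
have EE := EvP_nestZ M0 (isT : all pdv [::]) up hps (fun _ _ => isT) EP.
have E : nestZ M0 ps Psi (0, 1) = W * iota (Gf (foldl (cz M0) cc ps [::]) nus ex 0).
  by apply: (EE [::] 0) => // q _; rewrite mulr0.
have g0 p : p \in ps -> gM M0 p != 0 by move=> pps; apply: gam_neq0; [exact: (allP hps)|exact: M00].
have := @W_Gf0 (foldl (cz M0) cc ps [::]) (etrans (esym E) Z0) s.
rewrite foldl_cz // => [|p pps]; last by apply/eqP; rewrite nus_red24 ?hs //; apply: (allP hps).
rewrite !big_nil Cs !mulr1 => /eqP; rewrite mulf_eq0.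
suff /negPf-> : \prod_(p <- ps) (gM M0 p * p%:R) != 0 by rewrite /= mulf_eq0 (negPf kp0) /= => /eqP.
rewrite prodf_seq_neq0; apply/allP => p pps /=; rewrite mulf_neq0 ?g0 // pk0 //; exact: (allP hps).
Qed.

Lemma M0_24 p : pdv p -> 24%:R * red p M0 = (24 * n0%:Z - 1)%:~R.
Proof.
move=> hp; have [pp pN] := andP hp.
have <- : red p (24%:R * M0) = 24%:R * red p M0 by rewrite (redM N1 pp pN) (red_nat N1 pp pN).
rewrite -red_int //; congr (red p _).
by rewrite /M0 mulrDr eps24 rmorphB rmorphM /= -!pmulrn addrC.
Qed.
Lemma chi_leg p (z : int) : pdv p -> chi k (z%:~R : 'F_p) = (legendre z p)%:~R.
Proof.
move=> hp; have [pp pN] := andP hp; rewrite /chi /legendre Fp_int_eq0 //; case: ifP => [_|nd]; first by rewrite mulr0z.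
have x0 : (z%:~R : 'F_p) != 0 by rewrite Fp_int_eq0 // nd.
have S := sqr_res N1 oddN pp pN (sqf pp pN) x0.
have E : ((z%:~R : 'F_p) ^+ GaussSums.hp p == 1) = [exists x : 'I_p, (p%:Z %| x%:Z ^+ 2 - z)%Z].
  apply/eqP/existsP => [/S[y Ey]|[x Ex]].
    exists (Ordinal (valFp pp y)); rewrite /= -Fp_int_eq0 // rmorphB rmorphXn /= -pmulrn natr_Zp Ey subrr //.
  apply/S; exists (x : nat)%:R; apply/eqP; rewrite -subr_eq0 pmulrn -rmorphXn -rmorphB Fp_int_eq0 //.
by rewrite E; case: ifP => _; rewrite ?mulr1z // mulrNz mulr1z.
Qed.
(** The quotient is 1 over - gp (-1)^b6 gM. Both Gauss sums are characters times one Gauss sum of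
    square chi(-1) p; the choice chi(24 Mn) = -1 removes the sign, and chi(3) = (-1)^b6 produces the
    symbol of -12. *)
Lemma lam_val p : pdv p -> red p M0 != 0 ->
  aq p / gM M0 p = p%:R^-1 * (legendre (-12) p)%:~R * (legendre (24 * n0%:Z - 1) p)%:~R.
Proof.
move=> hp m0; have [pp pN] := andP hp; have [n0' c24] := MnP hp; have cp := sqf pp pN.
have cM := @chiM N p N1 oddN pp pN cp k.
have g1 := gamE N1 oddN pp pN cp (eta p) n0'; have g2 := gamE N1 oddN pp pN cp (eta p) m0.
have gg := gam_sq N1 oddN pp pN cp (etaP hp) (tk2 T).
have sq (x : 'F_p) : x != 0 -> chi k x * chi k x = 1 by exact: chi_sq.
have E12 : chi k ((-12)%:~R : 'F_p) = chi k (-1 : 'F_p) * (-1) ^ (b6 p).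
  have E3' : chi k (3%:R : 'F_p) = (-1) ^ (b6 p).
    have p6 := pdv6 hp; have p3' := p3 hp; have op := dvdn_odd pN oddN.
    have hb : p = (2 * GaussSums.hp p).+1 by rewrite /GaussSums.hp; clear - op p3'; lia.
    have n2 : ~~ (2 %| p)%N by move: p6; rewrite (_ : 6 = 2 * 3)%N // coprimeMr coprime_sym prime_coprime // => /andP[].
    have n3 : ~~ (3 %| p)%N.
      by move: p6; rewrite (_ : 6 = 2 * 3)%N // coprimeMr => /andP[_]; rewrite coprime_sym prime_coprime.
    rewrite /b6; case: ifP => E.
      by rewrite -exprnP; apply: (chi3 pp hb p3'); left; clear - E; lia.
    by rewrite N1opp -exprnP; apply: (chi3 pp hb p3'); right; clear - E n2 n3; lia.
  have -> : ((-12)%:~R : 'F_p) = -1 * (3%:R * (2%:R * 2%:R)).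
    by rewrite -!natrM mulN1r -[(-12)%:~R]/(- (12%:R)).
  rewrite !cM E3' sq ?mulr1 // Fp_nat_eq0 //; apply/negP => /dvdn_leq h.
  by have := p3 hp; rewrite ltnNge (leq_trans (h isT)).
rewrite -!chi_leg // E12 -M0_24 // cM /aq /gM -/(gp p) {1}/gp g1 g2.
have {}c24 : chi k (red p (Mn p)) = - chi k (24%:R : 'F_p).
  have := c24; rewrite cM => /(congr1 (fun z => chi k (24%:R : 'F_p) * z)).
  by rewrite mulrA sq ?F24 // mul1r mulrN1.
have ci (x : 'F_p) : x != 0 -> (chi k x)^-1 = chi k x.
  move=> x0; have := sq x x0 => E; have nz : chi k x != 0 by apply: contra_eq_neq E => ->; rewrite mul0r eq_sym oner_eq0.
  by apply: (mulfI nz); rewrite mulfV // E.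
have bi : ((-1 : k) ^ (b6 p))^-1 = (-1) ^ (b6 p) by rewrite invr_expz N1opp.
rewrite c24 -invfM.
have alg (x g b y : k) : - (- x * g) * b * (y * g) = x * y * b * (g * g) by ring.
rewrite alg gg !invfM !ci ?F24 // ?bi ?oppr_eq0 ?oner_eq0 //.
move: (chi k (24%:R : 'F_p)) (chi k (red p M0)) (chi k (-1 : 'F_p)) ((-1) ^ b6 p) (p%:R^-1) => x y z b q; ring.
Qed.

(** The vanishing is moved by a single Weyl element at a prime outside ps. No sum over t is taken,
    so it concerns the coefficients at mu / p^2 alone. *)
Lemma aux_k p ps : uniq (p :: ps) -> all pdv (p :: ps) ->
  (forall m : nat, (m == n0 %[mod ell])%N -> (forall p, p \in ps -> (m == n0 %[mod p])%N) -> (partition_count m)%:R = 0 :> k) ->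
  forall s, cls s -> (forall q, q \in ps -> (q%:Z %| s%:Z - H%:Z - n0%:Z)%Z) -> (val24 p (mut s))%:R = 0 :> k.
Proof.
move=> /= /andP[np up] /andP[hp hps] hv s Cs hs.
have X0 : nestX M0 ps (Psi \o Sp p) (0, 1) = 0.
  apply: nestX_uf; [exact: Psi_uf|exact: Rl_Sp|exact: X_vanish].
rewrite (@evX M0 ps [:: p] 0 _ (cc [:: p])) //= in X0; last 4 first.
- by rewrite hp.
- by move=> q qps; rewrite inE; apply: contraNneq np => <-.
- by move=> q _; rewrite mulr0.
- by move=> j fj; apply: (@Psi_pt [:: p]) => //=; rewrite hp.
have := W_Gf0 X0 s => /eqP; rewrite /cc Cs mul1r big_seq1 !mulf_eq0 (negPf kp0) invr_eq0 /=.
rewrite (negPf (Cq_neq0 (_ : all pdv [:: p]))) /= ?hp // => /orP[|/eqP //].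
rewrite (negPf (_ : \prod_(q <- ps) _ != 0)) // prodf_seq_neq0; apply/allP => q qps /=.
have hq := allP hps q qps; rewrite redM0 // hs // mulr1; exact: pk0.
Qed.
End Proj.
End Eval.

End Evaluation.

(** * Choice of the field, the roots of unity and the parameters *)

Module Instance.
Import PowerSeries FormalSums Theta TripleProduct ProductFormula TateCurve Hasse TorsionPoints GaloisAction Uniformity TorsionTwist TateTorsion GaussSums EtaQuotients LocalOperators PartitionSeries Evaluation.

Lemma eq_sm (k : comNzRingType) (l l' : nat -> k) ps v d : {in ps, l =1 l'} -> sm l ps v d = sm l' ps v d.
Proof.
elim: ps d => [|p ps IH] d //= h; have h' : {in ps, l =1 l'} by move=> q qp; apply: h; rewrite inE qp orbT.
by rewrite !IH // h // mem_head.
Qed.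

(** By Euler's theorem L divides ell^totient(L) - 1, the order of the multiplicative group of the
    field with ell^totient(L) elements. *)
Lemma field_exists ell L : prime ell -> coprime ell L -> (0 < L)%N ->
  exists (k : fieldType) (g : k), ell \in [pchar k] /\ L.-primitive_root g.
Proof.
move=> pl cl L0; have t0 : (0 < totient L)%N by rewrite totient_gt0.
have [K chK cK] := pPrimePowerField pl t0.
have d : (L %| #|K|.-1)%N.
  have := Euler_exp_totient cl; rewrite -cK => /eqP; have c0 : (0 < #|K|)%N by rewrite cK expn_gt0 prime_gt0.
  by rewrite eqn_mod_dvd // subn1.
have c1 : (0 < #|K|.-1)%N.
  by rewrite -ltnS prednK ?cK ?expn_gt0 ?prime_gt0 // -{1}(expn0 ell) ltn_exp2l // prime_gt1.
have [g gP] : exists g : K, (#|K|.-1).-primitive_root g.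
  have := @has_prim_root _ _ (filter (predC1 0) (enum K)) c1.
  have -> : size (filter (predC1 0) (enum K)) = #|K|.-1.
    rewrite [in RHS](cardD1 0) add1n /= cardE /enum_mem -!filter_predI.
    by congr (size _); apply: eq_filter => x /=; rewrite !inE andbT.
  rewrite filter_uniq ?enum_uniq // leqnn => /(_ _ isT isT) h.
  have /hasP[g _ gP] : has (#|K|.-1).-primitive_root (filter (predC1 0) (enum K)).
    apply: h; apply/allP => x; rewrite mem_filter => /andP[/= x0 _].
    rewrite unity_rootE; apply/eqP/(mulfI x0); rewrite mulr1 -exprS prednK ?expf_card //.
    by rewrite cK expn_gt0 prime_gt0.
  by exists g.
exists K, (g ^+ (#|K|.-1 %/ L)); split=> //.
have := exp_prim_root gP (#|K|.-1 %/ L).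
have E : ((#|K|.-1 %/ L) * L = #|K|.-1)%N by rewrite divnK.
have q0 : (0 < #|K|.-1 %/ L)%N by rewrite divn_gt0 // dvdn_leq.
have /gcdn_idPl -> : (#|K|.-1 %/ L %| #|K|.-1)%N by rewrite -{2}E dvdn_mulr.
by have -> : (#|K|.-1 %/ (#|K|.-1 %/ L) = L)%N by rewrite -{1}E mulKn.
Qed.

Lemma mul_bound (a b c : nat) : (0 < a)%N -> (2 * c <= b)%N -> (8 * a * c <= 4 * a ^ 2 * b)%N.
Proof.
move=> a0 h; apply: (@leq_trans (4 * a ^ 2 * (2 * c))%N); last by rewrite leq_mul2l h orbT.
by rewrite -mulnn; nia.
Qed.

Definition lamk (k : fieldType) (M : int) (p : nat) : k :=
  p%:R^-1 * (legendre (-12) p)%:~R * (legendre M p)%:~R.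

Section Inst.
Variables (ell : nat) (ps : seq nat).
Hypothesis pl : prime ell.
Hypothesis l3 : (3 < ell)%N.
Hypothesis ups : uniq ps.
Hypothesis pps : all prime ps.
Hypothesis cps : all (fun p => coprime p (6 * ell)) ps.
Hypothesis nps : ps != [::].
Notation N := (\prod_(p <- ps) p)%N.

Lemma N_gt1 : (1 < N)%N.
Proof.
case: ps nps pps => // p qs _ /= /andP[pp hqs]; rewrite big_cons.
have : (0 < \prod_(q <- qs) q)%N by elim: qs hqs => [|q qs IH] /=; rewrite ?big_nil // big_cons muln_gt0 => /andP[/prime_gt0-> /IH].
by have := prime_gt1 pp; move: (\prod_(q <- qs) q)%N => m; clear; nia.
Qed.
Lemma N_cop m : (forall p, p \in ps -> coprime p m) -> coprime N m.
Proof.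
elim: ps => [|p qs IH] h; first by rewrite big_nil coprime1n.
rewrite big_cons coprimeMl h ?mem_head // IH // => q qq; apply: h.
by rewrite inE qq orbT.
Qed.
Lemma N_6l : coprime N (6 * ell). Proof. by apply: N_cop => p pp; exact: (allP cps). Qed.
Lemma N_6 : coprime N 6. Proof. by have := N_6l; rewrite coprimeMr => /andP[]. Qed.
Lemma N_l : coprime N ell. Proof. by have := N_6l; rewrite coprimeMr => /andP[]. Qed.
Lemma pN p : p \in ps -> (p %| N)%N.
Proof. by move=> h; rewrite (big_rem p h) dvdn_mulr. Qed.
Lemma N_sqf p : prime p -> (p %| N)%N -> coprime p (N %/ p).
Proof.
move=> pp pN.
have pps' : p \in ps.
  elim: ps pps pN => [|q qs IH] /=; first by rewrite big_nil dvdn1 => _ /eqP E; rewrite E in pp.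
  move=> /andP[hq hqs]; rewrite big_cons Euclid_dvdM // inE dvdn_prime2 // => /orP[->//|/(IH hqs) ->].
  by rewrite orbT.
rewrite (big_rem p pps') /= mulKn ?prime_gt0 //.
apply: cop_prod => //; last by rewrite mem_rem_uniq // inE eqxx.
by apply/allP => q /mem_rem/(allP pps).
Qed.

(** The two uses of the construction: all primes processed, or one auxiliary prime moved by its Weyl
    element. The field depends on ps and ell only; its roots of unity of orders N^2 and ell - 1 are
    powers of one g. *)
Lemma inst : exists k : fieldType, ell \in [pchar k] /\ forall n0 : nat,
  (forall qs, uniq qs -> all (fun p => p \in ps) qs ->
   (forall m : nat, (m == n0 %[mod ell])%N -> (forall p, p \in qs -> (m == n0 %[mod p])%N) -> (ell %| partition_count m)%N) ->
   (qs = ps -> (forall p, p \in ps -> ~~ (p%:Z %| 24 * n0%:Z - 1)%Z) ->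
     forall t : int, (ell%:Z %| t - n0%:Z)%Z -> (forall p, p \in ps -> (p%:Z %| 24 * t - 1)%Z) ->
     sm (lamk k (24 * n0%:Z - 1)) ps (fun d => (val24 d (24 * t - 1))%:R) 1 = 0) /\
   (forall p, ps = p :: qs -> forall t : int, (ell%:Z %| t - n0%:Z)%Z -> (forall q, q \in qs -> (q%:Z %| t - n0%:Z)%Z) ->
     (ell %| val24 p (24 * t - 1))%N)).
Proof.
have N1 := N_gt1; have N0 : (0 < N)%N by apply: ltnW.
have L0 : (0 < N ^ 2 * ell.-1)%N by rewrite muln_gt0 expn_gt0 N0 -ltnS prednK ?prime_gt0 // prime_gt1.
have cL : coprime ell (N ^ 2 * ell.-1).
  by have := N_l; rewrite coprime_sym => c; rewrite coprimeMr coprimeXr // coprimenP ?prime_gt0.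
have [k [g [chl gP]]] := field_exists pl cL L0.
exists k; split=> // n0.
have prim a b : (a * b = N ^ 2 * ell.-1)%N -> (0 < a)%N -> b.-primitive_root (g ^+ a).
  move=> E a0; have := exp_prim_root gP a; rewrite -E.
  by have /gcdn_idPl -> : (a %| a * b)%N by [rewrite dvdn_mulr]; rewrite mulKn.
have xiP := prim ell.-1 (N ^ 2)%N (mulnC _ _) _; have {}xiP : (N ^ 2).-primitive_root (g ^+ ell.-1).
  by apply: xiP; move: L0; rewrite muln_gt0 => /andP[].
have omP : (ell.-1).-primitive_root (g ^+ (N ^ 2)) by apply: prim => //; rewrite expn_gt0 N0.
have kN : (N%:R : k) != 0 by rewrite -(dvdn_pcharf chl) -prime_coprime // coprime_sym N_l.
have [F [iota Fr]] := frac_exists (fps k).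
pose T := TW0 pl l3 chl N1 N_6 kN xiP omP Fr.
have KK0 : KK l3 chl N1 Fr != 0.
  have ks : ksg N F != 0 by apply: contra_eq_neq (ksg_sq N F) => ->; rewrite mul0r eq_sym oner_eq0.
  rewrite /KK !mulf_neq0 ?invr_eq0 ?mulf_neq0 ?expf_neq0 ?EF0 ?XF0 //; exact: TT_neq0.
have E24 : (N %| 24 * E3 N + 1)%N by exact: (E3_24 pl l3 chl N1 N_6 kN xiP omP Fr).
have Eq0 : euler (fpsX (8 * N ^ 2) : fps k) != 0 by rewrite euler_neq0 // qq0 // N0.
have zP := zetaP N1 N_6 xiP.
have iota0 x : iota x = 0 -> x = 0 by move/eqP; rewrite (iota_eq0 Fr) => /eqP.
have YYv j : YY T (j%:R, 1) * iota (euler (fpsC (zeta N (g ^+ ell.-1) ^+ j) * fpsX (8 * N))) =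
   KK l3 chl N1 Fr * tc T (zeta N (g ^+ ell.-1) ^+ (j * E3 N)).
  by rewrite (YY_val pl l3 chl N1 N_6 kN xiP omP Fr j) -[tc T]/(cF iota) rmorphXn.
have tDi x : tD T (iota x) = iota (fderiv x) by exact: DF_iota.
have hpd : all (pdivs N) ps by apply/allP => p pin; rewrite /pdivs (allP pps) ?pN.
have [km kn Ekm _] := egcdnP ell (isT : (0 < 12)%N).
have c12 : coprime 12 ell.
  by rewrite coprime_sym prime_coprime // (_ : 12 = 2 * (2 * 3))%N // !Euclid_dvdM // !dvdn_prime2 //; clear - l3; lia.
rewrite (eqP c12) in Ekm.
have par (t : int) : exists n H Y1 s, [/\ (ell %| N + 12 * n)%N, (hr N * N ^ 2 - Sg N + 4 * N ^ 2 * n = Y1 + 8 * N * H)%N,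
    (N ^ 2 <= H)%N & (s%:Z - H%:Z = t)].
  (* Since 12 km is 1 modulo ell, the first term makes 12 n congruent to - N; the second, a multiple
     of ell, makes n large enough for [Y1] to be a natural number. *)
  pose H := (N ^ 2 + absz t)%N; pose n := (N * km * ell.-1 + ell * (2 * H))%N.
  exists n, H, (hr N * N ^ 2 - Sg N + 4 * N ^ 2 * n - 8 * N * H)%N, (absz (t + H%:Z)); split.
  - have -> : (N + 12 * n = ell * (N * kn * ell.-1 + N + 24 * H))%N.
      by rewrite /n; have := prime_gt0 pl; clear - Ekm; case: ell Ekm => //= l; nia.
    exact: dvdn_mulr.
  - rewrite subnK // (leq_trans _ (leq_addl _ _)) //.
    have : (2 * H <= n)%N by rewrite /n (leq_trans _ (leq_addl _ _)) // leq_pmull // prime_gt0.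
    exact: mul_bound.
  - exact: leq_addr.
  - by rewrite /H; clear; lia.
move=> qs uq hq hv.
have hv' m : (m == n0 %[mod ell])%N -> (forall p, p \in qs -> (m == n0 %[mod p])%N) -> (partition_count m)%:R = 0 :> k.
  by move=> h1 h2; apply/eqP; rewrite -(dvdn_pcharf chl) hv.
have clsE H s t : s%:Z - H%:Z = t -> (ell%:Z %| t - n0%:Z)%Z -> cls ell H n0 s.
  move=> <- d; rewrite /cls -eqz_nat -!modz_nat eqz_mod_dvd PoszD.
  by rewrite (_ : s%:Z - (n0%:Z + H%:Z) = s%:Z - H%:Z - n0%:Z) //; ring.
split=> [E M00|p E] t.
- subst qs => dt hd; have [n [H [Y1 [s [h1 h2 h3 h4]]]]] := par t.
  have [kp kp0 kpE] := KK_val pl l3 chl N1 N_6 kN xiP omP Fr n.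
  have Em : mut H s = 24 * t - 1 by rewrite /mut h4.
  have M00' p : p \in ps -> red p (M0 N (E3 N) n0) != 0.
    move=> pin; apply: contra (M00 p pin) => /eqP r0; rewrite -(Fp_int_eq0 _ (allP hpd p pin)).
    by rewrite -(M0_24 T E24 n0 (allP hpd p pin)) r0 mulr0.
  have := @main_k k F N ell T pl chl N_6 N_l N_sqf _ zP iota iota0 (fun=> erefl) tDi _ _ _ _ KK0 E24 Eq0 YYv n H Y1 kp n0 h1 h2 h3 kp0 kpE ps ups hpd hv' M00' s (clsE _ _ _ h4 dt).
  rewrite Em => /(_ hd) <-; apply: eq_sm => p pin.
  by rewrite (lam_val T pl chl N_6 N_l N_sqf zP KK0 E24 Eq0 (allP hpd p pin) (M00' p pin)).
- move=> dt hd; have [n [H [Y1 [s [h1 h2 h3 h4]]]]] := par t.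
  have [kp kp0 kpE] := KK_val pl l3 chl N1 N_6 kN xiP omP Fr n.
  have Em : mut H s = 24 * t - 1 by rewrite /mut h4.
  rewrite -Em (dvdn_pcharf chl); apply/eqP.
  have up : uniq (p :: qs) by rewrite -E.
  have hp : all (pdivs N) (p :: qs) by apply/allP => q; rewrite -E => /(allP hpd).
  apply: (@aux_k k F N ell T pl chl N_6 N_l N_sqf _ zP iota iota0 (fun=> erefl) tDi _ _ _ _ KK0 E24 Eq0 YYv n H Y1 kp n0 h1 h2 h3 kp0 kpE p qs up hp hv' s (clsE _ _ _ h4 dt)).
  by rewrite h4.
Qed.
End Inst.

End Instance.

(** * Legendre symbols and integral forms of the iterated sums *)

Import ProductFormula GaussSums Evaluation Instance.

Section Legendre.
Variable p : nat.
Hypothesis pp : prime p.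
Hypothesis p2 : (2 < p)%N.
Let p1 := prime_gt1 pp.
Let op : odd p. Proof. by case: (even_prime pp) p2 => [->|]. Qed.
Let cp : coprime p (p %/ p). Proof. by rewrite divnn prime_gt0 // coprimen1. Qed.
Lemma intFp_eq0 (z : int) : ((z%:~R : 'F_p) == 0) = (p%:Z %| z)%Z.
Proof.
case: z => n; first by rewrite -pmulrn Fp_nat_eq0.
by rewrite NegzE mulrNz oppr_eq0 -pmulrn Fp_nat_eq0 // rpredN.
Qed.
Lemma leg_chi (z : int) : legendre z p = chi int (z%:~R : 'F_p).
Proof.
rewrite /chi /legendre intFp_eq0; case: ifP => [//|nd].
have x0 : (z%:~R : 'F_p) != 0 by rewrite intFp_eq0 nd.
have S := sqr_res p1 op pp (dvdnn p) cp x0.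
have -> : ((z%:~R : 'F_p) ^+ hp p == 1) = [exists x : 'I_p, (p%:Z %| x%:Z ^+ 2 - z)%Z].
  apply/eqP/existsP => [/S[y Ey]|[x Ex]].
    by exists (Ordinal (valFp pp y)); rewrite /= -intFp_eq0 rmorphB rmorphXn /= -pmulrn natr_Zp Ey subrr.
  by apply/S; exists (x : nat)%:R; apply/eqP; rewrite -subr_eq0 pmulrn -rmorphXn -rmorphB intFp_eq0.
by [].
Qed.
Lemma leg_mod (a b : int) : (p%:Z %| a - b)%Z -> legendre a p = legendre b p.
Proof. by rewrite !leg_chi -intFp_eq0 rmorphB subr_eq0 => /eqP->. Qed.
Lemma leg_sq (d : nat) (a : int) : coprime d p -> legendre ((d ^ 2)%:Z * a) p = legendre a p.
Proof.
move=> cd; rewrite !leg_chi rmorphM (chiM p1 op pp (dvdnn p) cp) -mulnn PoszM rmorphM (chiM p1 op pp (dvdnn p) cp) /=.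
by rewrite chi_sq ?mul1r // -pmulrn Fp_nat_eq0 // -prime_coprime // coprime_sym.
Qed.
Lemma leg_neq0 (a : int) : (legendre a p == 0) = (p%:Z %| a)%Z.
Proof. by rewrite /legendre; case: ifP => // _; case: ifP. Qed.
(** Equal symbols make a b a square y^2 modulo p, and u = y / a works. *)
Lemma leg_eq (a b : int) : legendre (- a) p = legendre (- b) p -> ~~ (p%:Z %| b)%Z ->
  exists u : nat, coprime u p /\ (p%:Z %| (u ^ 2)%:Z * a - b)%Z.
Proof.
move=> E nb; have na : ~~ (p%:Z %| a)%Z.
  by have := leg_neq0 (- a); rewrite E leg_neq0 !rpredN (negPf nb) => <-.
have a0 : (a%:~R : 'F_p) != 0 by rewrite intFp_eq0.
have b0 : (b%:~R : 'F_p) != 0 by rewrite intFp_eq0.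
have ab0 : (a%:~R * b%:~R : 'F_p) != 0 by rewrite mulf_neq0.
have : chi int (a%:~R * b%:~R : 'F_p) = 1.
  rewrite -[a%:~R * _]mulrNN (chiM p1 op pp (dvdnn p) cp) -!rmorphN -!leg_chi E leg_chi chi_sq //.
  by rewrite rmorphN oppr_eq0.
rewrite /chi (negPf ab0); case: ifP => // /eqP h _.
have [y Ey] := (sqr_res p1 op pp (dvdnn p) cp ab0).2 h.
have y0 : y != 0 by apply: contraNneq ab0 => y0; rewrite -Ey y0 expr0n.
pose u := y / a%:~R; have u0 : u != 0 by rewrite mulf_neq0 // invr_eq0.
exists (u : nat); split.
  by rewrite coprime_sym prime_coprime // -Fp_nat_eq0 // natr_Zp.
have uE : ((u : nat)%:Z)%:~R = u :> 'F_p by rewrite -pmulrn natr_Zp.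
rewrite -intFp_eq0 rmorphB rmorphM -mulnn PoszM rmorphM /= uE subr_eq0; apply/eqP.
by rewrite -expr2 /u expr_div_n Ey expr2 invfM -mulrA; field.
Qed.
End Legendre.

Lemma jacobi_prime z p : prime p -> jacobi z p = legendre z p.
Proof. by move=> pp; rewrite /jacobi primes_prime // big_seq1 logn_prime // eqxx expr1. Qed.

Lemma solve24 (D : nat) (M : int) : coprime 24 D -> (0 < D)%N -> exists n0 : nat, (D%:Z %| 24 * n0%:Z - 1 - M)%Z.
Proof.
move=> c D0; have [km kn E _] := egcdnP D (isT : (0 < 24)%N); rewrite (eqP c) in E.
have D0' : D%:Z != 0 by rewrite eqz_nat -lt0n.
have := modz_ge0 (M + 1) D0'; case Ew: ((M + 1) %% D%:Z)%Z => [w|//] _.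
exists (km * w)%N; apply/dvdzP; exists (kn%:Z * w%:Z - ((M + 1) %/ D%:Z)%Z).
have E2 := divz_eq (M + 1) D%:Z; rewrite Ew in E2.
have E1 : km%:Z * 24 = kn%:Z * D%:Z + 1 by rewrite -!PoszM E PoszD.
have E4 : M = ((M + 1) %/ D%:Z)%Z * D%:Z + w%:Z - 1 by rewrite -E2 addrK.
move: E4; move: ((M + 1) %/ D%:Z)%Z => q ->.
by rewrite PoszM mulrA [24 * _]mulrC E1; ring.
Qed.

(** [sm] cleared of denominators, so that a vanishing over k can be read as a divisibility of
    integers and then used over the algebraic numbers. *)
Fixpoint smi (e : nat -> int) (ps : seq nat) (v : nat -> int) (d : nat) : int :=
  if ps is p :: ps' then p%:Z * smi e ps' v d + e p * smi e ps' v (p * d)%N else v d.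
Lemma smi_sm (K : fieldType) (lam : nat -> K) (e : nat -> int) ps (v : nat -> int) d :
  (forall p, p \in ps -> (p%:R : K) != 0 /\ lam p = (e p)%:~R / p%:R) ->
  (\prod_(p <- ps) p)%N%:R * sm lam ps (fun d => (v d)%:~R) d = (smi e ps v d)%:~R.
Proof.
elim: ps d => [|p ps IH] d h /=; first by rewrite big_nil mul1r.
have [p0 lp] := h p (mem_head _ _).
have h' q : q \in ps -> (q%:R : K) != 0 /\ lam q = (e q)%:~R / q%:R by move=> qq; apply: h; rewrite inE qq orbT.
rewrite rmorphD !rmorphM /= -!IH // big_cons natrM lp -pmulrn.
move: (sm _ _ _ _) (sm _ _ _ _) (\prod_(q <- ps) q)%N%:R => x y z; field.
exact: p0.
Qed.
Lemma eq_smi (P : pred nat) e ps v v' d : (forall d, P d -> v d = v' d) -> P d ->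
  (forall p d, p \in ps -> P d -> P (p * d)%N) -> smi e ps v d = smi e ps v' d.
Proof.
move=> E; elim: ps d => [|p ps IH] d Pd h /=; first exact: E.
have h' q c : q \in ps -> P c -> P (q * c)%N by move=> qq; apply: h; rewrite inE qq orbT.
by rewrite !IH // h // mem_head.
Qed.
Lemma smi0 e ps d : smi e ps (fun=> 0) d = 0.
Proof. by elim: ps d => //= p ps IH d; rewrite !IH !mulr0. Qed.
Lemma smi_top e ps v d : (forall c, (c %| d * \prod_(p <- ps) p)%N -> c != (d * \prod_(p <- ps) p)%N -> v c = 0) ->
  all (fun p => 1 < p)%N ps -> (0 < d)%N ->
  smi e ps v d = \prod_(p <- ps) e p * v (d * \prod_(p <- ps) p)%N.
Proof.
elim: ps d => [|p ps IH] d h; first by rewrite !big_nil muln1 mul1r.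
move=> /= /andP[p1 hps] d0; rewrite big_cons in h *; rewrite big_cons.
have P0 : (0 < \prod_(q <- ps) q)%N.
  by elim: ps hps {IH h} => [|q qs IH] /=; rewrite ?big_nil // big_cons muln_gt0 => /andP[/ltnW-> /IH].
have Ed : (p * d * \prod_(q <- ps) q = d * (p * \prod_(q <- ps) q))%N by rewrite [(p * d)%N]mulnC mulnA.
have lt c : (c %| d * \prod_(q <- ps) q)%N -> v c = 0.
  move=> dc; apply: h; first by apply: dvdn_trans dc _; rewrite mulnCA dvdn_mull.
  have : (c <= d * \prod_(q <- ps) q)%N by apply: dvdn_leq dc; rewrite muln_gt0 d0.
  have : (d * \prod_(q <- ps) q < d * (p * \prod_(q <- ps) q))%N by rewrite ltn_pmul2l // ltn_Pmull.
  by move: (\prod_(q <- ps) q)%N (d * _)%N (d * _)%N; clear => _ x y xy cx; rewrite neq_ltn (leq_ltn_trans cx xy).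
rewrite [X in p%:Z * X](IH d) // => [|c dc _]; last exact: lt.
rewrite (lt _ (dvdnn _)) !mulr0 add0r (IH (p * d)%N) ?muln_gt0 ?d0 ?(ltnW p1) // => [|c]; last first.
  by rewrite Ed; apply: h.
by rewrite Ed mulrA.
Qed.

Lemma sq24 m : coprime m 6 -> exists h, (m ^ 2 = 24 * h + 1)%N.
Proof.
rewrite -coprime_modl -(@modn_dvdm 24) // coprime_modl => c.
have A : all (fun r => coprime r 6 ==> (r ^ 2 %% 24 == 1)%N) (iota 0 24) by [].
have := implyP (allP A (m %% 24)%N _) c; rewrite mem_iota ltn_mod modnXm => /(_ isT)/eqP E.
by exists (m ^ 2 %/ 24)%N; rewrite mulnC [LHS](divn_eq _ 24) E.
Qed.

(** * Transport of the vanishing between residue classes, and the exclusion of delta = 1 *)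

Section Final.
Variables (ell : nat) (ps : seq nat).
Hypothesis pl : prime ell.
Hypothesis l3 : (3 < ell)%N.
Hypothesis ups : uniq ps.
Hypothesis pps : all prime ps.
Hypothesis cps : all (fun p => coprime p (6 * ell)) ps.
Notation N := (\prod_(p <- ps) p)%N.
Let l2 : (2 < ell)%N := ltnW l3.

(** The hypothesis in terms of the class of 24 m - 1, the quantity on which multiplication by
    squares acts. *)
Definition PV (M : int) := forall m : nat, ((ell * N)%:Z %| 24 * m%:Z - 1 - M)%Z -> (ell %| partition_count m)%N.

Lemma N6l : coprime N (6 * ell). Proof. exact: N_6l. Qed.
Lemma N_pos : (0 < N)%N.
Proof.
by elim: ps pps => [|q qs IH] /=; rewrite ?big_nil // big_cons muln_gt0 => /andP[/prime_gt0-> /IH].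
Qed.
Lemma l24 : coprime 24 ell.
Proof.
rewrite coprime_sym prime_coprime // (_ : 24 = 2 * (2 * (2 * 3)))%N // !Euclid_dvdM // !dvdn_prime2 //.
by clear - l3; lia.
Qed.
Lemma c24 m : coprime m 6 -> coprime 24 m.
Proof.
rewrite (_ : 6 = 2 * 3)%N // coprimeMr => /andP[c2 c3].
by rewrite (_ : 24 = 2 * (2 * (2 * 3)))%N // !coprimeMl ![coprime _ m]coprime_sym c2 c3.
Qed.
Lemma N24 : coprime 24 N. Proof. by apply: c24; have := N6l; rewrite coprimeMr => /andP[]. Qed.
Lemma cNl : coprime N ell. Proof. by have := N6l; rewrite coprimeMr => /andP[]. Qed.
Lemma dvd24 (D : nat) x : coprime 24 D -> (D%:Z %| 24 * x)%Z = (D%:Z %| x)%Z.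
Proof. by move=> c; rewrite Gauss_dvdzr // coprimezE coprime_sym. Qed.
Lemma dvdlN x : ((ell * N)%:Z %| x)%Z = (ell%:Z %| x)%Z && (N%:Z %| x)%Z.
Proof. by rewrite PoszM Gauss_dvdz // coprimezE coprime_sym cNl. Qed.
Lemma dvdNall x : (N%:Z %| x)%Z = all (fun p => p%:Z %| x)%Z ps.
Proof. by rewrite dvdzE absz_nat (prod_all _ ups pps). Qed.

Lemma PV_inst M : PV M -> exists n0 : nat, ((ell * N)%:Z %| 24 * n0%:Z - 1 - M)%Z /\
  forall m : nat, (m == n0 %[mod ell])%N -> (forall p, p \in ps -> (m == n0 %[mod p])%N) -> (ell %| partition_count m)%N.
Proof.
move=> pv; have c : coprime 24 (ell * N) by rewrite coprimeMr l24 N24.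
have [|n0 h] := solve24 M c; first by rewrite muln_gt0 N_pos prime_gt0.
exists n0; split=> // m ml mp; apply: pv.
have -> : 24 * m%:Z - 1 - M = 24 * (m%:Z - n0%:Z) + (24 * n0%:Z - 1 - M) by ring.
rewrite rpredD // dvdz_mull // dvdlN dvdNall; apply/andP; split.
  by rewrite -eqz_mod_dvd !modz_nat eqz_nat.
by apply/allP => p pin; rewrite -eqz_mod_dvd !modz_nat eqz_nat mp.
Qed.

(** Uses the auxiliary prime part of [inst], with t chosen so that 24 t - 1 = p^2 (24 m - 1). *)
Lemma PV_prime p M M' : prime p -> p \notin ps -> coprime p (6 * ell) -> PV M ->
  ((ell * N)%:Z %| (p ^ 2)%:Z * M' - M)%Z -> PV M'.
Proof.
move=> pp np cp pv hM m hm; have [n0 [h0 hv]] := PV_inst pv.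
have p6 : coprime p 6 by move: cp; rewrite coprimeMr => /andP[].
have [||||k [_ /(_ n0) H]] := @inst ell (p :: ps) pl l3 _ _ _ _ => //=; try by rewrite ?np ?pp ?cp.
have [|||_ /(_ p erefl) B] := H ps => //; first by apply/allP => q qq; rewrite inE qq orbT.
have [hh Eh] := sq24 p6.
pose t : int := (p ^ 2)%:Z * m%:Z - hh%:Z.
have Et : 24 * t - 1 = (24 * m%:Z - 1) * (p ^ 2)%:Z by rewrite /t Eh PoszD PoszM; ring.
have D : ((ell * N)%:Z %| 24 * (t - n0%:Z))%Z.
  have -> : 24 * (t - n0%:Z) = (p ^ 2)%:Z * (24 * m%:Z - 1 - M') + ((p ^ 2)%:Z * M' - M) - (24 * n0%:Z - 1 - M).
    have -> : 24 * (t - n0%:Z) = (24 * t - 1) - (24 * n0%:Z - 1) by ring.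
    by rewrite Et; ring.
  by rewrite rpredB // rpredD // dvdz_mull.
rewrite dvd24 in D; last by rewrite coprimeMr l24 N24.
move: D; rewrite dvdlN dvdNall => /andP[Dl /allP DN].
have := B t Dl DN; rewrite Et.
have dz : (p ^ 2)%:Z != 0 by rewrite eqz_nat -lt0n expn_gt0 prime_gt0.
by rewrite /val24 dvdz_mull // mulzK // /fsh subrK dvdz_mulr // mulKz.
Qed.

(** Induction over the prime factors of r, since [PV_prime] handles one prime outside ps and prime
    to 6 ell. *)
Lemma PV_mul r : forall M M', coprime r (6 * ell * N) -> (0 < r)%N -> PV M ->
  ((ell * N)%:Z %| (r ^ 2)%:Z * M' - M)%Z -> PV M'.
Proof.
elim/ltn_ind: r => r IH M M' cr r0 pv hM.
have [r1|r1] := leqP r 1.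
  have E : r = 1%N by lia.
  rewrite E mul1r in hM; move=> m hm; apply: pv.
  have -> : 24 * m%:Z - 1 - M = (24 * m%:Z - 1 - M') + (M' - M) by ring.
  exact: rpredD.
pose p := pdiv r; pose r' := (r %/ p)%N; have pp : prime p := pdiv_prime r1.
have Er : r = (r' * p)%N by rewrite divnK // pdiv_dvd.
have r'0 : (0 < r')%N by move: r0; rewrite Er muln_gt0 => /andP[].
move: cr; rewrite Er coprimeMl => /andP[cr' cp].
have [cpl cpN] : coprime p (6 * ell) /\ coprime p N by move: cp; rewrite coprimeMr => /andP[].
have np : p \notin ps by apply/negP => /pN d; move: cpN; rewrite prime_coprime // d.
apply: (IH r' _ ((r' ^ 2)%:Z * M')) => //.
- by rewrite Er ltn_Pmulr // prime_gt1.
- apply: (PV_prime pp np cpl pv); move: hM; rewrite Er expnMn PoszM.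
  by rewrite [(r' ^ 2)%:Z * _]mulrC mulrA.
- by rewrite subrr dvdz0.
Qed.

(** Chinese remainders: r is the ratio u modulo ell and 1 modulo 6 N, so r is prime to 6 ell N and
    multiplying by r^2 changes the class at ell only. *)
Lemma PV_square M mu : PV M -> legendre (- mu) ell = legendre (- M) ell ->
  exists M', [/\ PV M', (ell%:Z %| mu - M')%Z & (N%:Z %| M' - M)%Z].
Proof.
move=> pv E; have [dM|nM] := boolP (ell%:Z %| M)%Z.
  exists M; split; rewrite ?subrr ?dvdz0 // rpredB //.
  by have := leg_neq0 ell (- mu); rewrite E leg_neq0 !rpredN dM => <-.
have [u [cu hu]] := leg_eq pl l2 E nM.
have c6 : coprime ell (6 * N).
  rewrite coprimeMr [coprime ell N]coprime_sym cNl andbT.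
  by have := l24; rewrite coprime_sym (_ : 24 = 6 * 4)%N // coprimeMr => /andP[].
pose r := chinese ell (6 * N) u 1.
have rl : r = u %[mod ell] by exact: chinese_modl.
have r6 : r = 1 %[mod 6 * N] by exact: chinese_modr.
have crl : coprime r ell by rewrite -coprime_modl rl coprime_modl.
have cr6 : coprime r (6 * N) by rewrite -coprime_modl r6 coprime_modl coprime1n.
have cr : coprime r (6 * ell * N) by rewrite -mulnA mulnCA coprimeMr crl.
have r0 : (0 < r)%N.
  by rewrite lt0n; apply/negP => /eqP r0; move: crl; rewrite r0 /coprime gcd0n => /eqP E1; move: pl; rewrite E1.
pose M' := zchinese ell%:Z N%:Z mu M.
have clN : coprimez ell%:Z N%:Z by rewrite coprimezE coprime_sym cNl.
have Ml : (ell%:Z %| M' - mu)%Z by rewrite -eqz_mod_dvd; apply/eqP; exact: zchinese_modl.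
have MN : (N%:Z %| M' - M)%Z by rewrite -eqz_mod_dvd; apply/eqP; exact: zchinese_modr.
exists M'; split=> //; last by rewrite -opprB rpredN.
apply: (PV_mul cr r0 pv); rewrite dvdlN; apply/andP; split.
  have -> : (r ^ 2)%:Z * M' - M = (r ^ 2)%:Z * (M' - mu) + (((r ^ 2)%:Z - (u ^ 2)%:Z) * mu + ((u ^ 2)%:Z * mu - M)) by ring.
  rewrite rpredD ?dvdz_mull // rpredD // dvdz_mulr // -!mulnn !PoszM.
  have -> : r%:Z * r%:Z - u%:Z * u%:Z = (r%:Z - u%:Z) * (r%:Z + u%:Z) by ring.
  by rewrite dvdz_mulr // -eqz_mod_dvd !modz_nat rl.
have -> : (r ^ 2)%:Z * M' - M = (r ^ 2)%:Z * (M' - M) + ((r%:Z - 1) * (r%:Z + 1)) * M by rewrite -mulnn PoszM; ring.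
apply: rpredD; first exact: dvdz_mull.
rewrite -mulrA dvdz_mulr //.
have : ((6 * N)%:Z %| r%:Z - 1)%Z by rewrite -eqz_mod_dvd -[1]/(1%:Z) !modz_nat r6.
by apply: dvdz_trans; rewrite PoszM dvdz_mull.
Qed.

Definition ez (M : int) (p : nat) : int := legendre (-12) p * legendre M p.

(** The class of mu at ell is first reached through [PV_square], which leaves the class modulo N
    untouched. Without primes the claim is the transported hypothesis itself, as the construction
    needs N > 1. *)
Lemma key M mu : PV M -> (forall p, p \in ps -> ~~ (p%:Z %| M)%Z) -> (24 %| mu + 1)%Z -> (N%:Z %| mu)%Z ->
  legendre (- mu) ell = legendre (- M) ell -> (ell%:Z %| smi (ez M) ps (fun d => (val24 d mu)%:Z) 1)%Z.
Proof.
move=> pv nM /dvdzP[t Et] dN E; have Emu : mu = 24 * t - 1 by rewrite mulrC -Et addrK.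
have [M' [pv' hl hN]] := PV_square pv E.
have [n0 [h0 hv]] := PV_inst pv'; move: h0; rewrite dvdlN => /andP[h0l h0N].
have [ps0|psn] := eqVneq ps [::].
  have N1 : N = 1%N by rewrite ps0 big_nil.
  rewrite ps0 /= /val24 exp1n dvd1z divz1 /fsh Emu subrK dvdz_mulr // mulKz //.
  case: t Et Emu => [m|m] _ Emu /=; last by rewrite dvdz0.
  by apply: pv'; rewrite N1 muln1 -Emu.
have [k [chl /(_ n0) H]] := inst pl l3 ups pps cps psn.
have [|A _] := H ps ups _ hv; first by apply/allP.
have dvdp p x : p \in ps -> (N%:Z %| x)%Z -> (p%:Z %| x)%Z by move=> pin; rewrite dvdNall => /allP/(_ p pin).
have M0' p : p \in ps -> (p%:Z %| 24 * n0%:Z - 1 - M)%Z.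
  move=> pin; have -> : 24 * n0%:Z - 1 - M = (24 * n0%:Z - 1 - M') + (M' - M) by ring.
  by rewrite rpredD ?(dvdp p).
have nd p : p \in ps -> ~~ (p%:Z %| 24 * n0%:Z - 1)%Z.
  move=> pin; apply: contra (nM p pin) => d.
  have -> : M = (24 * n0%:Z - 1) - (24 * n0%:Z - 1 - M) by ring.
  by rewrite rpredB ?M0'.
have tl : (ell%:Z %| t - n0%:Z)%Z.
  rewrite -(dvd24 _ l24); have -> : 24 * (t - n0%:Z) = (mu - M') - (24 * n0%:Z - 1 - M') by rewrite Emu; ring.
  by rewrite rpredB.
have := A erefl nd t tl; rewrite -Emu => /(_ (fun p pin => dvdp p mu pin dN)) S0.
have p3 p : p \in ps -> (2 < p)%N.
  move=> pin; have := allP cps p pin; rewrite coprimeMr => /andP[c6 _].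
  by have := prime_gt1 (allP pps p pin); move: c6; case: p pin => [|[|[|p]]].
have := @smi_sm k (lamk k (24 * n0%:Z - 1)) (ez M) ps (fun d => (val24 d mu)%:Z) 1.
rewrite S0 mulr0 => /(_ _)/esym E0.
have {E0}/eqP E0 : (smi (ez M) ps (fun d => (val24 d mu)%:Z) 1)%:~R = 0 :> k.
  apply: E0 => p pin; split.
    rewrite -(dvdn_pcharf chl) -prime_coprime // coprime_sym.
    by have := allP cps p pin; rewrite coprimeMr => /andP[].
  rewrite /lamk /ez rmorphM /= (leg_mod (allP pps p pin) (p3 p pin) (M0' p pin)); ring.
move: E0; move: (smi _ _ _ _) => z; case: z => n; first by rewrite -pmulrn -(dvdn_pcharf chl).
by rewrite NegzE mulrNz oppr_eq0 -pmulrn -(dvdn_pcharf chl) rpredN.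
Qed.

Lemma ez_neq0 M p : p \in ps -> ~~ (p%:Z %| M)%Z -> ez M p != 0.
Proof.
move=> pin nM; have pp := allP pps p pin; have := allP cps p pin; rewrite coprimeMr => /andP[c6 _].
have n12 : ~~ (p %| 12)%N.
  rewrite (_ : 12 = 2 * 6)%N // Euclid_dvdM // negb_or -!prime_coprime // c6 andbT.
  by move: c6; rewrite (_ : 6 = 2 * 3)%N // coprimeMr => /andP[].
by rewrite mulf_neq0 ?leg_neq0 // dvdzE.
Qed.

(** At mu = - N^2 a proper divisor d of N gives an index below -1, so only d = N contributes, with
    the value p(0) = 1 and the coefficient 1 or -1. *)
Lemma delta_neq1 M : PV M -> (forall p, p \in ps -> ~~ (p%:Z %| M)%Z) -> legendre (- M) ell <> 1.
Proof.
move=> pv nM E; pose mu : int := - (N ^ 2)%:Z.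
have N6 : coprime N 6 by have := N6l; rewrite coprimeMr => /andP[].
have [hh Eh] := sq24 N6.
have d24 : (24 %| mu + 1)%Z.
  by rewrite /mu Eh PoszD PoszM opprD addrNK rpredN dvdz_mulr.
have dN : (N%:Z %| mu)%Z by rewrite /mu rpredN -mulnn PoszM dvdz_mulr.
have El : legendre (- mu) ell = legendre (- M) ell.
  rewrite E /mu opprK -[(N ^ 2)%:Z]mulr1 (leg_sq pl l2 _ cNl) (leg_chi pl l2) rmorph1 chi1 //.
have := key pv nM d24 dN El.
have v0 c : (c %| 1 * N)%N -> c != (1 * N)%N -> (val24 c mu)%:Z = 0.
  rewrite mul1n => /dvdnP[q Eq] ne; have c0 : (0 < c)%N by have := N_pos; rewrite Eq muln_gt0 => /andP[].
  have q1 : (1 < q)%N.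
    have := N_pos; rewrite Eq muln_gt0 => /andP[q0 _]; rewrite ltn_neqAle q0 andbT eq_sym.
    by apply: contra ne => /eqP q1; rewrite Eq q1 mul1n.
  have cz : (c ^ 2)%:Z != 0 by rewrite eqz_nat -lt0n expn_gt0 c0.
  have Em : mu = - (q ^ 2)%:Z * (c ^ 2)%:Z by rewrite /mu Eq expnMn PoszM mulNr.
  rewrite /val24 Em dvdz_mull // mulzK // /fsh; case: ifP => // /dvdzP[z Ez].
  rewrite Ez mulzK //; case: z Ez => // z; rewrite -mulnn; clear - q1; nia.
rewrite smi_top //; last by apply: sub_all pps => p /prime_gt1.
have -> : val24 (1 * N) mu = 1%N.
  have nz : (N ^ 2)%:Z != 0 by rewrite eqz_nat -lt0n expn_gt0 N_pos.
  rewrite mul1n /val24 /mu -mulN1r dvdz_mull // mulzK // /fsh addNr dvdz0 div0z /= /partition_count.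
  have -> : [set m : {ffun 'I_0 -> 'I_1} | (\sum_(i < 0) i.+1 * m i)%N == 0%N] = setT.
    by apply/setP => m; rewrite !inE big_ord0.
  by rewrite cardsT card_ffun !card_ord.
rewrite mulr1 dvdzE absz_nat => d.
have e1 : forall qs, {subset qs <= ps} -> absz (\prod_(p <- qs) ez M p) = 1%N.
  elim=> [|p qs IH] h; first by rewrite big_nil.
  rewrite big_cons abszM IH => [|q qq]; last by apply: h; rewrite inE qq orbT.
  have := ez_neq0 (h p (mem_head _ _)) (nM p (h p (mem_head _ _))).
  by rewrite /ez /legendre; do 4! [case: ifP => _ //].
by move: d; rewrite e1 // dvdn1 => /eqP E1; move: pl; rewrite E1.
Qed.
End Final.

(** U multiplies the index by its prime and V divides it, so taking V at the primes of d reads the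
    sequence at P n / d^2, with P the product of all primes. As the primes are distinct, q divides n
    exactly when q^2 divides P n for each q in the list. *)
Lemma ops_sm (lam : nat -> algC) ps (a : nat -> algC) n : uniq ps -> all prime ps ->
  foldl (fun b q => opUV q (lam q) b) a ps n =
  sm lam ps (fun d => if (d ^ 2 %| (\prod_(p <- ps) p) * n)%N then a ((\prod_(p <- ps) p) * n %/ d ^ 2)%N else 0) 1.
Proof.
have sh l qs v q d : sm l qs v (q * d)%N = sm l qs (fun d => v (q * d)%N) d :> algC.
  by elim: qs d => [|p qs IH] d //=; rewrite mulnCA !IH.
have ext l qs (v v' : nat -> algC) d : v =1 v' -> sm l qs v d = sm l qs v' d.
  by move=> E; elim: qs d => [|p qs IH] d /=; rewrite ?E ?IH.
elim/last_ind: ps n => [|ps q IH] n; first by rewrite /= big_nil mul1n exp1n dvd1n divn1.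
rewrite rcons_uniq all_rcons => /andP[nq up] /andP[pq hps].
rewrite foldl_rcons sm_rcons /opUV /opU /opV !IH // -cats1 big_cat big_seq1 /=.
set P := (\prod_(p <- ps) p)%N; rewrite mulnA [(q * 1)%N]mulnC -[(1 * q)%N]/(1 * q)%N [(1 * q)%N]mulnC sh; congr (_ + _ * _).
have cq : ~~ (q %| P)%N by rewrite -prime_coprime // cop_prod.
have q0 := prime_gt0 pq.
case: ifP => [/dvdnP[m ->]|nd].
  rewrite mulnK //; apply: ext => d; rewrite expnMn.
  have -> : (P * q * (m * q) = q ^ 2 * (P * m))%N by rewrite -mulnn; lia.
  by rewrite dvdn_pmul2l ?expn_gt0 ?q0 // divnMl ?expn_gt0 ?q0.
rewrite -[LHS](_ : sm lam ps (fun=> 0) 1 = 0); last first.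
  by elim: (ps) 1%N => //= p qs IHq d; rewrite !IHq mulr0 addr0.
apply: ext => d; case: ifP => // dd; suff : false by [].
have : (q ^ 2 %| P * q * n)%N by apply: dvdn_trans dd; rewrite expnMn dvdn_mulr.
rewrite -mulnn mulnAC dvdn_pmul2r // Euclid_dvdM // nd orbF => d'.
by rewrite d' in cq.
Qed.

Section Oell.
Variable ell : nat.
Notation O := (in_Oell ell).
Lemma OD x y : O x -> O y -> O (x + y).
Proof.
move=> [m [cm hm]] [m' [cm' hm']]; exists (m * m')%N; split; first by rewrite coprimeMl cm.
rewrite natrM mulrDr; apply: rpredD.
  by rewrite mulrAC rpredM // rpred_nat.
by rewrite -mulrA rpredM // rpred_nat.
Qed.
Lemma OM x y : O x -> O y -> O (x * y).
Proof.
move=> [m [cm hm]] [m' [cm' hm']]; exists (m * m')%N; split; first by rewrite coprimeMl cm.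
by rewrite natrM mulrACA rpredM.
Qed.
Lemma O0 : O 0. Proof. by exists 1%N; rewrite coprime1n mulr0 rpred0. Qed.
Lemma ops_O (lam : nat -> algC) ps c n : (forall n, O (c n)) -> (forall q, q \in ps -> O (lam q)) ->
  O (foldl (fun b q => opUV q (lam q) b) c ps n).
Proof.
elim: ps c n => [|q ps IH] c n hc hl //=; apply: IH => [m|p pp]; last by apply: hl; rewrite inE pp orbT.
rewrite /opUV /opU /opV; apply: OD => //; apply: OM; first by apply: hl; rewrite mem_head.
by case: ifP => _; [exact: hc|exact: O0].
Qed.
(** Used to discard the part of the coefficients that is divisible by ell. *)
Lemma ops_lin (lam : nat -> algC) ps (a b c : nat -> algC) x : (forall n, a n = b n + x * c n) ->
  forall n, foldl (fun b q => opUV q (lam q) b) a ps n =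
    foldl (fun b q => opUV q (lam q) b) b ps n + x * foldl (fun b q => opUV q (lam q) b) c ps n.
Proof.
elim: ps a b c => [|q ps IH] a b c h n //=; apply: IH => m; rewrite /opUV /opU /opV h.
by case: ifP => _; rewrite ?h; ring.
Qed.
End Oell.

Lemma prod_primes Q : (0 < Q)%N -> squarefree Q -> (\prod_(p <- primes Q) p)%N = Q.
Proof.
move=> Q0 sq; rewrite [in RHS](prod_prime_decomp Q0) prime_decompE big_map /= !big_seq.
apply: eq_bigr => p; rewrite mem_primes => /and3P[pp _ pQ].
have l1 : (0 < logn p Q)%N by rewrite logn_gt0 mem_primes pp Q0.
have l2 : ~~ (1 < logn p Q)%N by rewrite -pfactor_dvdn // sq.
by have -> : logn p Q = 1%N by clear - l1 l2; lia.
Qed.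

Theorem theorem3p4 (ell Q : nat) (beta0 : int) :
  prime ell -> (5 <= ell)%N ->
  (0 < Q)%N -> squarefree Q -> coprime Q (6 * ell) ->
  gcdz Q%:Z (24 * beta0 - 1) = 1 ->
  (forall n : int, (ell %| p_int (ell%:Z * Q%:Z * n + beta0))%N) ->
  let delta := jacobi (1 - 24 * beta0) ell in
  (delta = 0 \/ delta = -1) /\
  (forall a : nat -> algC, is_f_coeffs ell delta a ->
     forall n : nat, cong_mod ell (apply_ops beta0 Q a n) 0).
Proof.
move=> pl l5 Q0 sq cQ gc hyp delta.
have l3 : (3 < ell)%N by apply: ltnW.
have l2 : (2 < ell)%N by apply: ltnW.
pose ps := primes Q; have ups : uniq ps := primes_uniq Q.
have pps : all prime ps by apply/allP => p; rewrite mem_primes => /andP[].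
have dps p : p \in ps -> (p %| Q)%N by rewrite mem_primes => /and3P[].
have cps : all (fun p => coprime p (6 * ell)) ps by apply/allP => p /dps d; exact: coprime_dvdl d cQ.
have EQ : (\prod_(p <- ps) p)%N = Q by exact: prod_primes.
pose M : int := 24 * beta0 - 1.
have nM p : p \in ps -> ~~ (p%:Z %| M)%Z.
  move=> pin; apply/negP => d; have : (p%:Z %| gcdz Q%:Z M)%Z by rewrite dvdz_gcd d andbT dvdzE !absz_nat dps.
  by rewrite gc dvdzE absz_nat dvdn1 => /eqP E; have := allP pps p pin; rewrite E.
have c24l : coprime 24 (ell * Q).
  by rewrite coprimeMr (l24 pl l3) c24 //; move: cQ; rewrite coprimeMr => /andP[].
have pv : PV ell ps M.
  move=> m; rewrite EQ (_ : 24 * m%:Z - 1 - M = 24 * (m%:Z - beta0)); last by rewrite /M; ring.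
  rewrite dvd24 // => /dvdzP[z Ez]; have := hyp z.
  by rewrite -PoszM mulrC -Ez subrK.
have Ed : delta = legendre (- M) ell by rewrite /delta jacobi_prime // /M opprB.
have d1 := delta_neq1 pl l3 ups pps cps pv nM.
split; first by rewrite Ed; move: d1; rewrite /legendre; case: ifP => _; [left|case: ifP => // _; right].
(* [bn] is the integral model of the coefficients; a differs from it by ell times the ell-integral
   sequence c. *)
move=> a ha n; pose bn y := if jacobi (- y%:Z) ell == delta then p_shift y else 0%N.
have l0 : (ell%:R : algC) != 0 by rewrite pnatr_eq0 -lt0n prime_gt0.
pose c y : algC := (a y - (bn y)%:R) / ell%:R.
have Oc y : in_Oell ell (c y).
  by have [_] := ha y; rewrite /cong_mod /c /bn; case: ifP.
have Ol q : q \in ps -> in_Oell ell (lambda_coef beta0 q).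
  move=> qin; exists q; split; first by have := allP cps q qin; rewrite coprimeMr => /andP[].
  have q0 : (q%:R : algC) != 0 by rewrite pnatr_eq0 -lt0n prime_gt0 // (allP pps).
  by rewrite /lambda_coef !mulrA mulfV // mul1r -rmorphM rpred_int.
have ac y : a y = (bn y)%:R + ell%:R * c y by rewrite /c mulrC mulfVK // addrC subrK.
rewrite /cong_mod subr0 /apply_ops -/ps (ops_lin _ _ ac) mulrDl [ell%:R * _]mulrC mulfK //.
apply: OD; last exact: ops_O.
rewrite ops_sm // EQ; set mu := (Q * n)%N.
pose vz d : int := (if (d ^ 2 %| mu)%N then bn (mu %/ d ^ 2)%N else 0%N)%:Z.
have -> : sm (lambda_coef beta0) ps (fun d => if (d ^ 2 %| mu)%N then (bn (mu %/ d ^ 2)%N)%:R else 0) 1 =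
   sm (lambda_coef beta0) ps (fun d => (vz d)%:~R) 1 :> algC.
  by congr (sm _ _ _ _); apply: funext => d; rewrite /vz -pmulrn; case: ifP.
(* Q is prime to ell and clears the denominators of the operators, which leaves a divisibility
   between integers. *)
exists Q; split; first by move: cQ; rewrite coprimeMr => /andP[].
have := @smi_sm algC (lambda_coef beta0) (ez M) ps vz 1; rewrite EQ mulrA => -> => [|p pin]; last first.
  have pp := allP pps p pin; have q0 : (p%:R : algC) != 0 by rewrite pnatr_eq0 -lt0n prime_gt0.
  by split=> //; rewrite /lambda_coef !jacobi_prime // /ez rmorphM /= -/M; ring.
suff /dvdzP[z ->] : (ell%:Z %| smi (ez M) ps vz 1)%Z by rewrite rmorphM /= -pmulrn mulfK // rpred_int.
pose P d := coprime d (6 * ell).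
have PM p d : p \in ps -> P d -> P (p * d)%N by move=> pin Pd; rewrite /P coprimeMl (allP cps) // andbT.
have P1 : P 1%N by rewrite /P coprime1n.
(* Squares of integers prime to 6 ell change neither the symbol at ell nor the class modulo 24, so
   one case distinction on mu decides all terms at once. *)
have vE d : P d -> (d ^ 2 %| mu)%N -> legendre (- (mu %/ d ^ 2)%N%:Z) ell = legendre (- mu%:Z) ell /\
   (24 %| (mu %/ d ^ 2).+1)%N = (24 %| mu.+1)%N.
  rewrite /P coprimeMr => /andP[d6 dl] dd; have Em := divnK dd; set y := (mu %/ d ^ 2)%N in Em *.
  split.
    rewrite -Em PoszM mulrC -mulrN (leg_sq pl l2) //.
  have [hh Eh] := sq24 d6.
  rewrite -Em Eh (_ : (y * (24 * hh + 1)).+1 = y.+1 + 24 * (y * hh))%N; last by clear; lia.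
  by rewrite dvdn_addl // dvdn_mulr.
have [good|bad] := boolP ((legendre (- mu%:Z) ell == delta) && (24 %| mu.+1)%N); last first.
  rewrite (@eq_smi P _ _ _ (fun=> 0)) ?smi0 ?dvdz0 // => d Pd; rewrite /vz; case: ifP => // dd.
  have [E1 E2] := vE d Pd dd; rewrite /bn jacobi_prime // E1 /p_shift E2.
  by move: bad; case: eqP => //= _; case: ifP.
case/andP: good => /eqP gl g24.
rewrite (@eq_smi P _ _ _ (fun d => (val24 d mu%:Z)%:Z)) //; last first.
  move=> d Pd; rewrite /vz /val24 dvdzE !absz_nat; case: ifP => // dd.
  have [E1 E2] := vE d Pd dd; rewrite /bn jacobi_prime // E1 gl eqxx /p_shift E2 g24 divz_nat /fsh.
  by rewrite -[1]/(1%:Z) -PoszD addn1 dvdzE !absz_nat E2 g24 divz_nat.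
apply: key => //; last by rewrite gl Ed.
  by rewrite -[1]/(1%:Z) -PoszD addn1 dvdzE !absz_nat.
by rewrite EQ /mu PoszM dvdz_mulr.
Qed.
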